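(* The variational problem is well-posed: for every right-hand side $F\in Y^*$ there exists a unique $(\mathbf u,\mathbf s)\in X$ with $$b(\mathbf u,\mathbf s;\mathbf w,\xi)=F(\mathbf w,\xi)\qquad\text{for all }(\mathbf w,\xi)\in Y.$$ The solution is bounded in the sense that $\lVert(\mathbf u,\mathbf s)\rVert_X\le\beta^{-1}\lVert F\rVert_{Y^*}$.
   Context: Setting. $\Omega\subset\mathbb R^d$ is a bounded Lipschitz domain, $\mathcal I=(0,T_{\mathrm{end}})$ with $0<T_{\mathrm{end}}<\infty$, and $Q=\mathcal I\times\Omega$ with coordinates $(t,x)$. $\nabla_x$ and $\mathrm{div}_x$ are the (weak) gradient and divergence in $x$, and $\mathrm{div}(v,\tau)=\partial_t v+\mathrm{div}_x\tau$ for scalar $v$ and $\mathbb R^d$-valued $\tau$. $L^2$ inner products of pairs $\mathbf v=(v,\tau)$ are taken componentwise and summed. Let $U=\{(v,\tau)\in L^2(Q)\times L^2(Q;\mathbb R^d):\nabla_x v\in L^2(Q;\mathbb R^d),\ \mathrm{div}(v,\tau)\in L^2(Q)\}$ with $\lVert(v,\tau)\rVert_U^2=\lVert\nabla_x v\rVert_{L^2(Q)}^2+\lVert(v,\tau)\rVert_{L^2(Q)}^2+\lVert\mathrm{div}(v,\tau)\rVert_{L^2(Q)}^2$. Let $U_0$ be the set of $(v,\tau)\in U$ with $\langle\nabla_x v,\chi\rangle_{L^2(Q)}=-\langle v,\mathrm{div}_x\chi\rangle_{L^2(Q)}$ for all $\chi\in C^\infty(\overline Q;\mathbb R^d)$ (equivalently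 $v\in L^2(\mathcal I;H^1_0(\Omega))$). Every $(v,\tau)\in U_0$ satisfies $v\in L^2(\mathcal I;H_0^1(\Omega))\cap H^1(\mathcal I;H^{-1}(\Omega))\hookrightarrow C(\overline{\mathcal I};L^2(\Omega))$, so $\gamma_0(v,\tau)=v(0,\cdot)\in L^2(\Omega)$ is well defined. Set $A(v,\tau)=(\mathrm{div}(v,\tau),\ \nabla_x v+\tau)$ and $A^*(v,\tau)=(-\mathrm{div}(v,\tau),\ -\nabla_x v+\tau)$. Broken formulation. $\mathcal T$ is a given finite partition of $Q$ into non-overlapping cells $K$ (covering $Q$ up to a null set). $H(A^*,K)=\{(w,\chi)\in L^2(K)\times L^2(K;\mathbb R^d):\mathrm{div}(w,\chi)\in L^2(K),\ \nabla_xw\in L^2(K;\mathbb R^d)\}$, $H(A^*,\mathcal T)=\{\mathbf w\in L^2(Q)\times L^2(Q;\mathbb R^d):\mathbf w|_K\in H(A^*,K)\ \forall K\in\mathcal T\}$, and $A^*_h$ is the element-wise application of $A^*$. $Y=H(A^*,\mathcal T)\times L^2(\Omega)$ is a Hilbert space with inner product $\langle(\mathbf w,\xi),(\tilde{\mathbf w},\tilde\xi)\rangle_Y=\langle\mathbf w,\tilde{\mathbf w}\rangle_{L^2(Q)}+\langle A_h^*\mathbf w,A_h^*\tilde{\mathbf w}\rangle_{L^2(Q)}+\langle\xi,\tilde\xi\rangle_{L^2(\Omega)}$ and induced norm $\lVert\cdot\rVert_Y$. The trace operator $\gamma_A:U_0\to Y^*$ is $\langle\gamma_A\mathbf v,(\mathbf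 w,\xi)\rangle_{\partial\mathcal T}=\langle A\mathbf v,\mathbf w\rangle_{L^2(Q)}-\langle\mathbf v,A_h^*\mathbf w\rangle_{L^2(Q)}+\langle\gamma_0\mathbf v,\xi\rangle_{L^2(\Omega)}$. Set $\Gamma(\partial\mathcal T)=\gamma_AU_0\subset Y^*$; for $\mathbf t\in\Gamma(\partial\mathcal T)$ write $\langle\mathbf t,(\mathbf w,\xi)\rangle_{\partial\mathcal T}=\mathbf t(\mathbf w,\xi)$. Set $X=(L^2(Q)\times L^2(Q;\mathbb R^d))\times\Gamma(\partial\mathcal T)$ and $b(\mathbf v,\mathbf t;\mathbf w,\xi)=\langle\mathbf v,A_h^*\mathbf w\rangle_{L^2(Q)}+\langle\mathbf t,(\mathbf w,\xi)\rangle_{\partial\mathcal T}$. Norm on $X$. Let $T=(T_1,T_2):X\to Y$, $T_1(\mathbf v,\mathbf t)\in H(A^*,\mathcal T)$, be defined by $\langle T(\mathbf v,\mathbf t),(\mathbf w,\xi)\rangle_Y=b(\mathbf v,\mathbf t;\mathbf w,\xi)$ for all $(\mathbf w,\xi)\in Y$, and set $\mathcal E(\mathbf v,\mathbf t)=\mathbf v-A_h^*T_1(\mathbf v,\mathbf t)$, which belongs to $U_0$. Then $\lVert(\mathbf v,\mathbf t)\rVert_X^2=\lVert\mathbf v\rVert_{L^2(Q)}^2+\lVert\mathcal E(\mathbf v,\mathbf t)\rVert_{L^2(Q)}^2+\lVert A\mathcal E(\mathbf v,\mathbf t)\rVert_{L^2(Q)}^2+\lVert\gamma_0\mathcal E(\mathbf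 v,\mathbf t)\rVert_{L^2(\Omega)}^2$. Constants. $c_{\mathbf L}>0$ is a constant with $c_{\mathbf L}\lVert\mathbf v\rVert_{L^2(Q)}^2\le\lVert A\mathbf v\rVert_{L^2(Q)}^2+\lVert\gamma_0\mathbf v\rVert_{L^2(\Omega)}^2$ for all $\mathbf v\in U_0$ (such a constant exists), and $\beta=\dfrac{1+2c_{\mathbf L}-\sqrt{(1+2c_{\mathbf L})^2-4c_{\mathbf L}^2}}{2c_{\mathbf L}}>0$. *)

(* Defs.v *)
From HB Require Import structures.
From mathcomp Require Import all_boot all_order all_algebra.
From mathcomp Require Import all_classical all_reals all_analysis.

Set Implicit Arguments.
Unset Strict Implicit.
Unset Printing Implicit Defensive.

Import Order.TTheory GRing.Theory Num.Theory.
Import numFieldNormedType.Exports.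

Local Open Scope classical_set_scope.
Local Open Scope ring_scope.

Definition rV_display : measure_display.
Proof. exact: default_measure_display. Qed.

(* sigma-algebra on R^d generated by the coordinate maps *)
Section measurable_rV.
Context {R : realType} (d : nat).

Definition rV_coord (i : 'I_d) (x : 'rV[R]_d) : measurableTypeR R := x ord0 i.

Let rV_set0 : g_sigma_preimage rV_coord set0.
Proof. exact: sigma_algebra0. Qed.

Let rV_setC A : g_sigma_preimage rV_coord A -> g_sigma_preimage rV_coord (~` A).
Proof. exact: sigma_algebraC. Qed.

Let rV_bigcup (F : (set 'rV[R]_d)^nat) :
  (forall i, g_sigma_preimage rV_coord (F i)) ->
  g_sigma_preimage rV_coord (\bigcup_i F i).
Proof. exact: sigma_algebra_bigcup. Qed.

HB.instance Definition _ := @isMeasurable.Build rV_display 'rV[R]_d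
  (g_sigma_preimage rV_coord) rV_set0 rV_setC rV_bigcup.

End measurable_rV.

Section lebesgue_rV.
Context {R : realType}.

Lemma measurable_rV_coord d i : measurable_fun [set: 'rV[R]_d] (@rV_coord R d i).
Proof.
move=> _ Y mY; rewrite setTI; apply: sub_sigma_algebra => /=.
rewrite -bigcup_seq/=; exists i => /=; first by rewrite mem_index_enum.
by exists Y => //; rewrite setTI.
Qed.

Lemma measurable_fun_rVP d0 (T : measurableType d0) d (f : T -> 'rV[R]_d) :
  (forall i, measurable_fun [set: T] (rV_coord i \o f)) ->
  measurable_fun [set: T] f.
Proof.
move=> mf _ A mA; rewrite setTI.
have : preimage_set_system [set: T] f (g_sigma_preimage (@rV_coord R d)) (f @^-1` A).
  by exists A => //; rewrite setTI.
rewrite -g_sigma_preimage_comp.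
move: (f @^-1` A); apply: smallest_sub; first exact: sigma_algebra_measurable.
move=> B; rewrite -bigcup_seq/= => -[i _ [C mC <-]].
exact: mf.
Qed.

Definition rV_cons d (p : measurableTypeR R * 'rV[R]_d) : 'rV[R]_d.+1 :=
  \row_i (if unlift ord0 i is Some j then p.2 ord0 j else p.1).

Definition rV_uncons d (x : 'rV[R]_d.+1) : measurableTypeR R * 'rV[R]_d :=
  (x ord0 ord0, \row_i x ord0 (lift ord0 i)).

Lemma rV_consE0 d p : @rV_cons d p ord0 ord0 = p.1.
Proof. by rewrite mxE unlift_none. Qed.

Lemma rV_consE d p i : @rV_cons d p ord0 (lift ord0 i) = p.2 ord0 i.
Proof. by rewrite mxE liftK. Qed.

Lemma rV_uncons_consK d : cancel (@rV_cons d) (@rV_uncons d).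
Proof.
move=> [t x]; rewrite /rV_uncons rV_consE0; congr pair.
by apply/rowP => i; rewrite mxE rV_consE.
Qed.

Lemma measurable_rV_cons d : measurable_fun setT (@rV_cons d).
Proof.
apply: measurable_fun_rVP => i; case: (unliftP ord0 i) => [j|] ->.
- rewrite (_ : _ \o _ = @rV_coord R d j \o snd); last first.
    by apply/funext => p /=; rewrite /rV_coord rV_consE.
  by apply: measurableT_comp => //; exact: measurable_rV_coord.
- rewrite (_ : _ \o _ = fst)//.
  by apply/funext => p /=; rewrite /rV_coord rV_consE0.
Qed.

Lemma measurable_rV_uncons d : measurable_fun setT (@rV_uncons d).
Proof.
apply/measurable_fun_pairP; split; first exact: (measurable_rV_coord ord0).
apply: measurable_fun_rVP => i.
rewrite (_ : _ \o _ = rV_coord (lift ord0 i)); first exact: measurable_rV_coord.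
by apply/funext => x; rewrite /rV_coord /= mxE.
Qed.

HB.instance Definition _ d :=
  @isMeasurableFun.Build _ _ _ _ (@rV_cons d) (@measurable_rV_cons d).

Section step.
Context (d : nat) (m : {sigma_finite_measure set 'rV[R]_d -> \bar R}).

Local Notation mp := (@lebesgue_measure R \x m)%E.

Definition lebesgue_rV_step : set 'rV[R]_d.+1 -> \bar R :=
  pushforward mp (@rV_cons d).

Let step0 : lebesgue_rV_step set0 = 0%E.
Proof. by rewrite /lebesgue_rV_step /pushforward preimage_set0 measure0. Qed.

Let step_ge0 A : (0 <= lebesgue_rV_step A)%E.
Proof. exact: measure_ge0. Qed.

Let step_sigma_additive : semi_sigma_additive lebesgue_rV_step.
Proof.
move=> F mF tF mUF; rewrite /lebesgue_rV_step /pushforward preimage_bigcup.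
have mcons A : measurable A -> measurable (@rV_cons d @^-1` A).
  by move=> mA; rewrite -[X in measurable X]setTI; exact: measurable_rV_cons.
apply: measure_semi_sigma_additive => [n|/=|].
- exact: mcons.
- apply/trivIsetP => i j _ _ ij; rewrite -preimage_setI.
  by move/trivIsetP : tF => /(_ _ _ _ _ ij) ->//; rewrite preimage_set0.
- by rewrite -preimage_bigcup; exact: mcons.
Qed.

HB.instance Definition _ := isMeasure.Build _ _ _ lebesgue_rV_step
  step0 step_ge0 step_sigma_additive.

Let step_sigma_finite : sigma_finite setT lebesgue_rV_step.
Proof.
have /sigma_finiteP[F [TF ndF Foo]] := @sigma_finiteT _ _ _ (@lebesgue_measure R).
have /sigma_finiteP[G [TG ndG Goo]] := sigma_finiteT m.
exists (fun n => @rV_uncons d @^-1` (F n `*` G n)).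
  rewrite -preimage_bigcup -[LHS](preimage_setT (@rV_uncons d)); congr (_ @^-1` _).
  rewrite -setXTT TF TG predeqE => -[x y]; split.
    move=> [/= [n _ Fnx] [k _ Gky]]; exists (maxn n k) => //; split.
    - by move: x Fnx; exact/subsetPset/ndF/leq_maxl.
    - by move: y Gky; exact/subsetPset/ndG/leq_maxr.
  by move=> [n _ []/= ? ?]; split; exists n.
move=> k; have [? ?] := Foo k; have [? ?] := Goo k; split.
  rewrite -[X in measurable X]setTI; apply: measurable_rV_uncons => //.
  exact: measurableX.
rewrite /lebesgue_rV_step /pushforward -comp_preimage.
rewrite (_ : _ \o _ = id) ?preimage_id; last first.
  by apply/funext => p /=; rewrite rV_uncons_consK.
by rewrite product_measure1E// lte_mul_pinfty// ge0_fin_numE.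
Qed.

HB.instance Definition _ := Measure_isSigmaFinite.Build _ _ _ lebesgue_rV_step
  step_sigma_finite.

End step.

(* d-fold product of the Lebesgue measure on R; the measure on R^(d+1) is the
   image of the product measure on R x R^d by rV_cons. *)
Fixpoint lebesgue_rV d : {sigma_finite_measure set 'rV[R]_d -> \bar R} :=
  if d is d'.+1 then lebesgue_rV_step (lebesgue_rV d')
  else \d_(0 : 'rV[R]_0).

Lemma lebesgue_rV_box d (A : 'I_d -> set (measurableTypeR R)) :
  (forall i, measurable (A i)) ->
  lebesgue_rV d [set x : 'rV[R]_d | forall i, A i (x ord0 i)] =
  (\prod_i @lebesgue_measure R (A i))%E.
Proof.
elim: d A => [|d IH] A mA.
  rewrite big_ord0 /= diracE mem_set//= => i; by case: i.
rewrite big_ord_recl /= /lebesgue_rV_step /pushforward.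
rewrite (_ : _ @^-1` _ = A ord0 `*`
    [set x : 'rV[R]_d | forall i, A (lift ord0 i) (x ord0 i)]); last first.
  apply/seteqP; split => [[t x]/= h|[t x]/= [h0 h] i].
    split; first by have := h ord0; rewrite rV_consE0.
    by move=> i; have := h (lift ord0 i); rewrite rV_consE.
  by case: (unliftP ord0 i) => [j|] ->; rewrite ?rV_consE ?rV_consE0.
rewrite product_measure1E//; first by rewrite -IH.
rewrite (_ : [set _ | _] = \bigcap_(i in [set: 'I_d])
    (@rV_coord R d i @^-1` A (lift ord0 i))).
  apply: fin_bigcap_measurable => // i _.
  by rewrite -[X in measurable X]setTI; apply: measurable_rV_coord.
by apply/seteqP; split => [x h i _|x h i]; [exact: h|exact: (h i I)].
Qed.

End lebesgue_rV.

(* A class in L^2(D) is represented by a function on the whole space, of which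
   only the values on D matter; equality of classes is `eqL2`. *)
Section L2.
Context {d : measure_display} {T : measurableType d} {R : realType}.
Variables (mu : {measure set T -> \bar R}) (D : set T).
Implicit Types f g : T -> R.

Definition inL2 f : Prop := f \_ D \in Lfun mu 2%:E.
Definition eqL2 f g : Prop := {ae mu, forall x, D x -> f x = g x}.
Definition ipL2 f g : R := \int[mu]_(x in D) (f x * g x).
Definition normL2 f : R := Num.sqrt (ipL2 f f).

End L2.

Section domains.
Context {R : realType} {d : nat}.

Definition dotv (u v : 'rV[R]_d) : R := \sum_i u ord0 i * v ord0 i.

(* Near each boundary point, Omega is the region above the graph, in the
   direction of some unit vector nu, of a Lipschitz function of the
   orthogonal projection onto the hyperplane nu^\perp. *)
Definition lipschitz_boundary (Omega : set 'rV[R]_d) : Prop :=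
  forall x0, (closure Omega `\` Omega) x0 ->
  exists (nu : 'rV[R]_d) (g : 'rV[R]_d -> R),
    [/\ dotv nu nu = 1, lipschitz g &
        \forall x \near x0, Omega x <-> g (x - dotv x nu *: nu) < dotv x nu].

Definition bounded_lipschitz_domain (Omega : set 'rV[R]_d) : Prop :=
  [/\ open Omega, connected Omega, Omega !=set0, bounded_set Omega &
      lipschitz_boundary Omega].

Definition cylinder (Tend : R) (Omega : set 'rV[R]_d) : set (R * 'rV[R]_d) :=
  [set z | 0 < z.1 < Tend /\ Omega z.2].

(* Lebesgue measures on R^d (space) and on R x R^d (space-time). *)
Definition leb_x : {measure set 'rV[R]_d -> \bar R} := lebesgue_rV d.
Definition leb_tx : {measure set (measurableTypeR R * 'rV[R]_d) -> \bar R} :=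
  (@lebesgue_measure R \x @lebesgue_rV R d)%E.

(* The cells are open; nothing is assumed on their shape. *)
Definition is_mesh (Q : set (R * 'rV[R]_d)) (n : nat)
    (K : 'I_n -> set (R * 'rV[R]_d)) : Prop :=
  [/\ forall i, open (K i), forall i, K i `<=` Q, trivIset setT K &
      leb_tx.-negligible (Q `\` \bigcup_i K i)].

End domains.

Notation sfield R d := (R * 'rV[R]_d -> R).
Notation vfield R d := (R * 'rV[R]_d -> 'rV[R]_d).
(* pairs (v, tau) *)
Notation pfield R d := (sfield R d * vfield R d)%type.
(* carrier of Y: pairs (w, xi) with xi a function of x only *)
Notation ycarrier R d := (pfield R d * ('rV[R]_d -> R))%type.
(* carrier of X: pairs (v, t) with t a functional on Y *)
Notation xcarrier R d := (pfield R d * (ycarrier R d -> R))%type.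

Section weak_derivatives.
Context {R : realType} {d : nat}.
Implicit Types (D : set (R * 'rV[R]_d)) (phi v f : sfield R d)
  (chi g : vfield R d) (w : pfield R d).

Definition vcomp chi (i : 'I_d) : sfield R d := fun z => chi z ord0 i.

Definition dir_t : R * 'rV[R]_d := (1, 0).
Definition dir_x (i : 'I_d) : R * 'rV[R]_d := (0, delta_mx ord0 i).

(* C^oo: all iterated directional derivatives exist and are continuous *)
Definition smooth phi : Prop := forall s : seq (R * 'rV[R]_d),
  let psi : sfield R d := foldr (fun e (h : sfield R d) => 'D_e h) phi s in
  continuous psi /\ forall z e, derivable psi z e.

Definition smooth_vec chi : Prop := forall i, smooth (vcomp chi i).

Definition test_function D phi : Prop :=
  smooth phi /\
  exists C, [/\ compact C, C `<=` D & forall z, ~ C z -> phi z = 0].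

Definition smooth_divx chi : sfield R d :=
  fun z => \sum_i 'D_(dir_x i) (vcomp chi i) z.

Definition inL2v D chi : Prop := forall i, inL2 leb_tx D (vcomp chi i).
Definition inL2p D w : Prop := inL2 leb_tx D w.1 /\ inL2v D w.2.
Definition eqL2p D w w' : Prop :=
  eqL2 leb_tx D w.1 w'.1 /\ forall i, eqL2 leb_tx D (vcomp w.2 i) (vcomp w'.2 i).
Definition ipL2v D chi g : R := \sum_i ipL2 leb_tx D (vcomp chi i) (vcomp g i).
Definition ipL2p D w w' : R := ipL2 leb_tx D w.1 w'.1 + ipL2v D w.2 w'.2.
Definition normL2p D w : R := Num.sqrt (ipL2p D w w).

Definition is_weak_gradx D v g : Prop := forall i phi, test_function D phi ->
  ipL2 leb_tx D v ('D_(dir_x i) phi) = - ipL2 leb_tx D (vcomp g i) phi.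

Definition is_weak_div D w f : Prop := forall phi, test_function D phi ->
  ipL2 leb_tx D w.1 ('D_dir_t phi) +
    \sum_i ipL2 leb_tx D (vcomp w.2 i) ('D_(dir_x i) phi) =
  - ipL2 leb_tx D f phi.

(* The square integrable weak derivatives, chosen among a.e. equal functions. *)
Definition gradx D v : vfield R d :=
  xget ((fun=> 0) : vfield R d) [set g | inL2v D g /\ is_weak_gradx D v g].
Definition wdiv D w : sfield R d :=
  xget ((fun=> 0) : sfield R d) [set f | inL2 leb_tx D f /\ is_weak_div D w f].

(* This is U for D = Q and H(A^*, K) for D = K. *)
Definition inU D w : Prop :=
  [/\ inL2p D w,
      exists g, inL2v D g /\ is_weak_gradx D w.1 g &
      exists f, inL2 leb_tx D f /\ is_weak_div D w f].

Definition opA D w : pfield R d :=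
  (wdiv D w, fun z => gradx D w.1 z + w.2 z).
Definition opAstar D w : pfield R d :=
  (fun z => - wdiv D w z, fun z => - gradx D w.1 z + w.2 z).

(* Here C^oo of the closure of Q means restrictions of smooth functions on
   R x R^d. *)
Definition inU0 (Q : set (R * 'rV[R]_d)) w : Prop :=
  inU Q w /\ forall chi, smooth_vec chi ->
    ipL2v Q (gradx Q w.1) chi = - ipL2 leb_tx Q w.1 (smooth_divx chi).

End weak_derivatives.

Section initial_trace.
Context {R : realType} {d : nat} (Tend : R) (Omega : set 'rV[R]_d).

(* V is the representative of v in C([0, Tend]; L^2(Omega)). *)
Definition continuous_rep (v : sfield R d) (V : R -> 'rV[R]_d -> R) : Prop :=
  [/\ forall t, `[0, Tend]%classic t -> inL2 leb_x Omega (V t),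
      forall t, `[0, Tend]%classic t ->
        (fun s => normL2 leb_x Omega (fun x => V s x - V t x))
          @ within `[0, Tend]%classic (nbhs t) --> (0 : R) &
      {ae @lebesgue_measure R, forall t : R, 0 < t < Tend ->
        eqL2 leb_x Omega (fun x => v (t, x)) (V t)}].

Definition gamma0 (w : pfield R d) : 'rV[R]_d -> R :=
  xget ((fun _ _ => 0) : R -> 'rV[R]_d -> R)
    [set V | continuous_rep w.1 V] 0.

End initial_trace.

Section broken_formulation.
Context {R : realType} {d : nat} (Tend : R) (Omega : set 'rV[R]_d).
Context {n : nat} (K : 'I_n -> set (R * 'rV[R]_d)).
Local Notation Q := (cylinder Tend Omega).
Implicit Types (v w : pfield R d) (y : ycarrier R d) (x : xcarrier R d).

Definition inHAstarT w : Prop := inL2p Q w /\ forall i, inU (K i) w.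

Definition opAstar_h w : pfield R d :=
  (fun z => \sum_(i < n) \1_(K i) z * (opAstar (K i) w).1 z,
   fun z => \sum_(i < n) (\1_(K i) z : R) *: (opAstar (K i) w).2 z).

Definition inY y : Prop := inHAstarT y.1 /\ inL2 leb_x Omega y.2.

Definition ipY y y' : R :=
  ipL2p Q y.1 y'.1 + ipL2p Q (opAstar_h y.1) (opAstar_h y'.1)
  + ipL2 leb_x Omega y.2 y'.2.

Definition normY y : R := Num.sqrt (ipY y y).

(* Elements of the dual of Y are functions on the carrier of which only the
   values on Y matter.  Boundedness makes them compatible with a.e. equality. *)
Definition in_dualY (F : ycarrier R d -> R) : Prop :=
  (forall a y y', inY y -> inY y' -> F (a *: y + y') = a * F y + F y') /\
  exists C : R, forall y, inY y -> `|F y| <= C * normY y.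

Definition eq_dualY (F G : ycarrier R d -> R) : Prop :=
  forall y, inY y -> F y = G y.

Definition norm_dualY (F : ycarrier R d -> R) : R :=
  sup [set `|F y| | y in [set y | inY y /\ normY y <= 1]].

Definition gammaA v : ycarrier R d -> R := fun y =>
  ipL2p Q (opA Q v) y.1 - ipL2p Q v (opAstar_h y.1)
  + ipL2 leb_x Omega (gamma0 Tend Omega v) y.2.

Definition inGamma (t : ycarrier R d -> R) : Prop :=
  exists2 v, inU0 Q v & eq_dualY t (gammaA v).

Definition inX x : Prop := inL2p Q x.1 /\ inGamma x.2.

Definition eqX x x' : Prop := eqL2p Q x.1 x'.1 /\ eq_dualY x.2 x'.2.

Definition form_b x y : R := ipL2p Q x.1 (opAstar_h y.1) + x.2 y.

Definition opT x : ycarrier R d :=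
  xget (((fun=> 0), (fun=> 0)), (fun=> 0))
    [set y | inY y /\ forall y', inY y' -> ipY y y' = form_b x y'].

Definition opE x : pfield R d := x.1 - opAstar_h (opT x).1.

Definition normX x : R :=
  Num.sqrt (normL2p Q x.1 ^+ 2 + normL2p Q (opE x) ^+ 2
    + normL2p Q (opA Q (opE x)) ^+ 2
    + normL2 leb_x Omega (gamma0 Tend Omega (opE x)) ^+ 2).

End broken_formulation.

(* Main.v *)
(* A functional t = gamma_A z with z in U_0 acts on test functions through A z,
   z and gamma_0 z, so that b(u, t; w, xi) = F(w, xi) becomes: with (w0, xi0) the
   Riesz representative of F in Y, A z = w0, gamma_0 z = xi0 and
   u = z + A^*_h w0.  The theorem thus rests on (A, gamma_0) being a bijection
   from U_0 onto L^2(Q)^(1+d) x L^2(Omega), the bound being elementary.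

   Elements of U_0 are limits in the graph norm of sums of fields a(t) m(x) and
   of fields (0, chi) with div_x chi in L^2.  This is tested on the moments of the
   components against cos(j pi t / T) and sin(j pi t / T).  The test requires the
   Green formula <grad v, chi> = - <v, div_x chi> for v vanishing on the lateral
   boundary in the sense of U_0 and every chi with a square integrable divergence.
   Instead of using the regularity of the boundary of Omega, it is deduced from
   the coercivity hypothesis, applied to fields that grow exponentially in time.

   By density, the energy identity
   |v(t)|^2 - |v(s)|^2 = 2 int_s^t <div (v, tau), v> + <tau, grad v>
   extends to U_0; it gives the representative of v that is continuous in time
   and the boundedness of gamma_0.  The coercivity hypothesis makes the range of
   (A, gamma_0) closed, and a pair orthogonal to the range solves the adjoint
   problem with zero final value, so that it vanishes by the energy identity. *)
Require Import Defs.
From HB Require Import structures.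
From mathcomp Require Import all_boot all_order all_algebra.
From mathcomp Require Import all_classical all_reals all_analysis.
From mathcomp Require Import measurable_realfun.
From mathcomp Require Import ring lra.

Set Implicit Arguments.
Unset Strict Implicit.
Unset Printing Implicit Defensive.

Import Order.TTheory GRing.Theory Num.Theory.
Import numFieldNormedType.Exports.

Local Open Scope classical_set_scope.
Local Open Scope ring_scope.

(** * Semi-inner-product spaces *)

(** Two weak forms of vanishing lateral values have to be reconciled. Membership in $U_0$ is a Green
    formula against smooth fields; the energy identity needs it against every square integrable
    field with square integrable divergence. In the Hilbert space of pairs $(v,\nabla_x v)$, the
    defect between the two is a $u$ that vanishes laterally in the sense of $U_0$ and solves
    $\mathrm{div}_x\nabla_x u=\lambda u$, where $\lambda$ is prescribed by scaling the component
    $v$. If $m$ is a time moment of $u$, then $A$ annihilates $(e^{\lambda t}m,-e^{\lambda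
    t}\nabla_x m)$, and coercivity gives $c_{\mathbf L}\int_0^Te^{2\lambda t}dt\,\lVert
    m\rVert^2\le\lVert m\rVert^2$; a large $\lambda$ forces $m=0$.

    Cosines and sines are chosen because $d/dt$ exchanges them and because the sines vanish at both
    ends of the time interval, which test functions of compact support do not reach. Orthogonality
    to the tensor fields then yields two identities whose sum is a sum of four squares.

    The constant is $\beta^{-1}=1+s$ with $c_{\mathbf L}s^2=s+1$: this $s$ is the weight in Young's
    inequality for the mixed term of $\lVert v+A^*_hw_0\rVert^2$. *)

Section semi_inner_product.
Context {R : realType} {V : lmodType R}.
Variables (P : V -> Prop) (ip : V -> V -> R).

(** Classes are represented by functions, so the products are only semi-definite, and they are
    bilinear only on a subset [P] of the ambient module, since integrals of non-integrable products
    take default values. Equality of classes is recovered from a vanishing square. *)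
Record sip_space : Prop := SipSpace {
  sip0 : P 0;
  sipP : forall a u v, P u -> P v -> P (a *: u + v);
  sipC : forall u v, P u -> P v -> ip u v = ip v u;
  sipL : forall a u v w, P u -> P v -> P w ->
    ip (a *: u + v) w = a * ip u w + ip v w;
  sip_ge0 : forall u, P u -> 0 <= ip u u }.

Definition sip_cvg (u : nat -> V) l :=
  (fun n => ip (u n - l) (u n - l)) @ \oo --> (0 : R).

Definition sip_cauchy (u : nat -> V) := forall e : R, 0 < e ->
  exists N, forall m n, (N <= m)%N -> (N <= n)%N ->
    ip (u m - u n) (u m - u n) <= e.

Definition sip_complete := forall u, (forall n, P (u n)) ->
  sip_cauchy u -> exists2 l, P l & sip_cvg u l.

Hypothesis S : sip_space.

Lemma sipD u v : P u -> P v -> P (u + v).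
Proof. by move=> Pu Pv; rewrite -[u]scale1r; exact: sipP. Qed.

Lemma sipZ a u : P u -> P (a *: u).
Proof. by move=> Pu; rewrite -[_ *: _]addr0; apply: sipP => //; exact: sip0. Qed.

Lemma sipN u : P u -> P (- u).
Proof. by move=> Pu; rewrite -scaleN1r; exact: sipZ. Qed.

Lemma sipB u v : P u -> P v -> P (u - v).
Proof. by move=> Pu Pv; apply: sipD => //; exact: sipN. Qed.

Lemma ip0l w : P w -> ip 0 w = 0.
Proof.
move=> Pw; have P0 := sip0 S.
by have := sipL S (-1) P0 P0 Pw; rewrite scaler0 addr0 mulN1r addNr.
Qed.

Lemma ipDl u v w : P u -> P v -> P w -> ip (u + v) w = ip u w + ip v w.
Proof. by move=> Pu Pv Pw; rewrite -[u]scale1r sipL// mul1r scale1r. Qed.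

Lemma ipZl a u w : P u -> P w -> ip (a *: u) w = a * ip u w.
Proof.
by move=> Pu Pw; have := sipL S a Pu (sip0 S) Pw; rewrite ip0l// !addr0.
Qed.

Lemma ipNl u w : P u -> P w -> ip (- u) w = - ip u w.
Proof. by move=> Pu Pw; rewrite -scaleN1r ipZl// mulN1r. Qed.

Lemma ipBl u v w : P u -> P v -> P w -> ip (u - v) w = ip u w - ip v w.
Proof. by move=> Pu Pv Pw; rewrite ipDl//; [rewrite ipNl | exact: sipN]. Qed.

Lemma ipDr u v w : P u -> P v -> P w -> ip w (u + v) = ip w u + ip w v.
Proof.
by move=> Pu Pv Pw; rewrite !(sipC S Pw)// ?ipDl//; exact: sipD.
Qed.

Lemma ipZr a u w : P u -> P w -> ip w (a *: u) = a * ip w u.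
Proof. by move=> Pu Pw; rewrite !(sipC S Pw)// ?ipZl//; exact: sipZ. Qed.

Lemma ipNr u w : P u -> P w -> ip w (- u) = - ip w u.
Proof. by move=> Pu Pw; rewrite -scaleN1r ipZr// mulN1r. Qed.

Lemma ipBr u v w : P u -> P v -> P w -> ip w (u - v) = ip w u - ip w v.
Proof. by move=> Pu Pv Pw; rewrite ipDr//; [rewrite ipNr | exact: sipN]. Qed.

Lemma ip_sqrD u v : P u -> P v ->
  ip (u + v) (u + v) = ip u u + 2 * ip u v + ip v v.
Proof.
move=> Pu Pv; have Puv := sipD Pu Pv.
by rewrite ipDl// !ipDr// (sipC S Pv Pu); ring.
Qed.

Lemma ip_sqrB u v : P u -> P v ->
  ip (u - v) (u - v) = ip u u - 2 * ip u v + ip v v.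
Proof.
move=> Pu Pv; have Nv := sipN Pv.
by rewrite ip_sqrD// ipNr// ipNl// ipNr//; ring.
Qed.

Lemma ip_sqrZ a u : P u -> ip (a *: u) (a *: u) = a ^+ 2 * ip u u.
Proof.
by move=> Pu; have Pa := sipZ a Pu; rewrite ipZl// ipZr//; ring.
Qed.

(** The square of $au-bv$ is a nonnegative quadratic form in $(a,b)$. It is evaluated at $a=\langle
    v,v\rangle$, $b=\langle u,v\rangle$; a null vector $v$ requires another choice. *)
Lemma sip_CS u v : P u -> P v -> (ip u v) ^+ 2 <= ip u u * ip v v.
Proof.
move=> Pu Pv.
have H a b : 0 <= a ^+ 2 * ip u u - 2 * (a * b * ip u v) + b ^+ 2 * ip v v.
  have Pau := sipZ a Pu; have Pbv := sipZ b Pv.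
  have := sip_ge0 S (sipB Pau Pbv).
  by rewrite ip_sqrB// !ip_sqrZ// ipZl// ipZr// mulrA.
have uu := sip_ge0 S Pu; have vv := sip_ge0 S Pv.
have [v0|v0] := eqVneq (ip v v) 0; last first.
  have {v0}vv : 0 < ip v v by rewrite lt_neqAle eq_sym v0.
  rewrite -subr_ge0 -(pmulr_rge0 _ vv).
  by have := H (ip v v) (ip u v); congr (_ <= _); ring.
rewrite v0 mulr0; have [->|p0] := eqVneq (ip u v) 0; first by rewrite expr0n.
(* For a null $v$ and $a=1$ the form is affine in $b$; this value would make it $-1$. *)
have := H 1 ((ip u u + 1) / (2 * ip u v)); rewrite v0.
have -> : 1 * ((ip u u + 1) / (2 * ip u v)) * ip u v = (ip u u + 1) / 2.
  by field.
by move=> ?; lra.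
Qed.

Lemma sip_null u v : P u -> P v -> ip u u = 0 -> ip u v = 0.
Proof.
move=> Pu Pv u0; have := sip_CS Pu Pv; rewrite u0 mul0r => h.
by apply/eqP; rewrite -sqrf_eq0 eq_le h sqr_ge0.
Qed.

Lemma sip_young u v : P u -> P v -> 2 * `|ip u v| <= ip u u + ip v v.
Proof.
move=> Pu Pv; have := sip_ge0 S (sipB Pu Pv); have := sip_ge0 S (sipD Pu Pv).
rewrite ip_sqrD// ip_sqrB//; move: (ip u u) (ip v v) => p q.
by case: (ger0P (ip u v)) => _; lra.
Qed.

Lemma sip_sqrD_le u v : P u -> P v ->
  ip (u + v) (u + v) <= 2 * ip u u + 2 * ip v v.
Proof.
move=> Pu Pv; have := sip_ge0 S (sipB Pu Pv).
by rewrite ip_sqrB// ip_sqrD//; lra.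
Qed.

Lemma sip_cvg_ip u l w : (forall n, P (u n)) -> P l -> P w -> sip_cvg u l ->
  (fun n => ip (u n) w) @ \oo --> ip l w.
Proof.
move=> Pu Pl Pw ul; apply/cvgrPdist_le => e e0.
have := ul => /cvgrPdist_le /(_ (e ^+ 2 / (ip w w + 1))).
have ww := sip_ge0 S Pw.
have w1 : 0 < ip w w + 1 by rewrite ltr_wpDl.
move=> /(_ (divr_gt0 (exprn_gt0 2 e0) w1)); apply: filterS => n.
have Pd := sipB (Pu n) Pl.
rewrite sub0r normrN ger0_norm ?sip_ge0// ler_pdivlMr// => h.
rewrite distrC -ipBl// -(@ler_pXn2r _ 2)// ?nnegrE ?normr_ge0 ?(ltW e0)//.
rewrite real_normK ?num_real//; apply: le_trans (sip_CS Pd Pw) _.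
apply: le_trans h; rewrite ler_wpM2l ?sip_ge0//; lra.
Qed.

Lemma sip_cvg_sqr u l : (forall n, P (u n)) -> P l -> sip_cvg u l ->
  (fun n => ip (u n) (u n)) @ \oo --> ip l l.
Proof.
move=> Pu Pl ul.
have h := sip_cvg_ip Pu Pl Pl ul.
rewrite (_ : (fun n => ip (u n) (u n)) =
  (fun n => ip (u n - l) (u n - l) + 2 * ip (u n) l - ip l l)); last first.
  by apply/funext => n; rewrite ip_sqrB//; ring.
suff : (fun n => ip (u n - l) (u n - l) + 2 * ip (u n) l - ip l l) @ \oo -->
    0 + 2 * ip l l - ip l l.
  by rewrite (_ : 0 + _ - _ = ip l l)//; ring.
by apply: cvgB; [apply: cvgD => //; exact: cvgMl_tmp|exact: cvg_cst].
Qed.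

Section riesz.
Variable F : V -> R.
Hypothesis FL : forall a u v, P u -> P v -> F (a *: u + v) = a * F u + F v.
Variable C : R.
Hypothesis FC : forall u, P u -> F u ^+ 2 <= C * ip u u.
Hypothesis cplt : sip_complete.

Let FD u v : P u -> P v -> F (u + v) = F u + F v.
Proof. by move=> Pu Pv; rewrite -[u]scale1r FL// mul1r scale1r. Qed.
Let F0 : F 0 = 0.
Proof.
have P0 := sip0 S.
by have := FL (-1) P0 P0; rewrite scaler0 addr0 mulN1r addNr.
Qed.
Let FZ a u : P u -> F (a *: u) = a * F u.
Proof. by move=> Pu; have := FL a Pu (sip0 S); rewrite F0 !addr0. Qed.

Let J u := ip u u - 2 * F u.

(* The Riesz representative of F minimizes J; completeness is used along a
   minimizing sequence, which is Cauchy by the parallelogram identity. *)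
Lemma sip_riesz : exists2 l, P l & forall u, P u -> ip l u = F u.
Proof.
(* $2F(u)\le2\sqrt{|C|\langle u,u\rangle}\le\langle u,u\rangle+|C|$, so that [J] is bounded
   below. *)
have JC u : P u -> - `|C| <= J u.
  move=> Pu; have h := FC Pu; have uu := sip_ge0 S Pu; rewrite /J.
  have {}h : F u ^+ 2 <= `|C| * ip u u.
    by apply: le_trans h _; rewrite ler_wpM2r// ler_norm.
  have C0 := normr_ge0 C; set c := `|C| in C0 h *; set q := ip u u in uu h *.
  rewrite -subr_ge0 opprK.
  suff : (2 * F u) ^+ 2 <= (q + c) ^+ 2.
    have qc : 0 <= q + c by exact: addr_ge0.
    move=> h2; suff : 2 * F u <= q + c by lra.
    by have [|/ltW Fu0] := leP (2 * F u) 0; [lra | rewrite -(@ler_pXn2r _ 2)].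
  have := sqr_ge0 (q - c); nra.
pose A := [set J u | u in P].
have A0 : A !=set0 by exists (J 0); exists 0 => //; exact: sip0.
have Alb : has_lbound A by exists (- `|C|) => _ [u Pu <-]; exact: JC.
have mJ u : P u -> inf A <= J u by move=> Pu; apply: ge_inf => //; exists u.
have /choice[u Hu] : forall n : nat, exists u, P u /\ J u < inf A + n.+1%:R^-1.
  move=> n; have n0 : 0 < n.+1%:R^-1 :> R by rewrite invr_gt0.
  have [_ [u Pu <-] h] := inf_adherent n0 (conj A0 Alb).
  by exists u.
have par v w : P v -> P w ->
    ip (v - w) (v - w) <= 2 * (J v - inf A) + 2 * (J w - inf A).
  move=> Pv Pw; have Pvw := sipD Pv Pw.
  have := mJ _ (sipZ (2^-1) Pvw); rewrite /J FZ// ip_sqrZ// ip_sqrD// FD// ip_sqrB//.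
  lra.
have cu : sip_cauchy u.
  move=> e e0; have e4 : 0 < e / 4 by rewrite divr_gt0.
  have [N _ HN] := near_infty_natSinv_lt (PosNum e4).
  exists N => m n /HN/= hm /HN/= hn.
  have [Pm Jm] := Hu m; have [Pn Jn] := Hu n.
  apply: le_trans (par _ _ Pm Pn) _; move: hm hn Jm Jn.
  by move: (m.+1%:R^-1) (n.+1%:R^-1) (J _) (J _) => *; lra.
have [l Pl ul] := cplt (fun n => (Hu n).1) cu.
have Jl : J l <= inf A.
  have Pu n : P (u n) by have [] := Hu n.
  have Fu : (fun n => F (u n)) @ \oo --> F l.
    apply/cvgrPdist_le => e e0.
    have := ul => /cvgrPdist_le /(_ (e ^+ 2 / (`|C| + 1))).
    have C1 : 0 < `|C| + 1 by rewrite ltr_wpDl.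
    move=> /(_ (divr_gt0 (exprn_gt0 2 e0) C1)); apply: filterS => n.
    have Pd := sipB (Pu n) Pl; have dd := sip_ge0 S Pd.
    rewrite sub0r normrN ger0_norm// ler_pdivlMr// => h.
    have -> : F l - F (u n) = - F (u n - l).
      by rewrite FD//; [rewrite -scaleN1r FZ//; ring|exact: sipN].
    rewrite normrN -(@ler_pXn2r _ 2)// ?nnegrE ?normr_ge0 ?(ltW e0)//.
    rewrite real_normK ?num_real//; apply: le_trans (FC Pd) _.
    apply: le_trans h; rewrite mulrC ler_wpM2l//.
    by have := ler_norm C; lra.
  have Ju : (fun n => J (u n)) @ \oo --> J l.
    by apply: cvgB; [exact: sip_cvg_sqr|exact: cvgMl_tmp].
  have iu : (fun n => inf A + n.+1%:R^-1) @ \oo --> inf A + 0.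
    by apply: cvgD; [exact: cvg_cst|exact: cvg_harmonic].
  rewrite -[leRHS]addr0; apply: ler_cvg_to Ju iu _.
  by near=> n; apply/ltW; have [] := Hu n.
exists l => // w Pw.
have H t : 0 <= t ^+ 2 * ip w w + 2 * t * (ip l w - F w).
  have Ptw := sipZ t Pw.
  have := le_trans Jl (mJ _ (sipD Pl Ptw)).
  by rewrite /J ip_sqrD// FD// ip_sqrZ// ipZr// FZ//; lra.
have ww := sip_ge0 S Pw; apply/eqP; rewrite -subr_eq0; apply/eqP.
set p := ip l w - F w in H *; set q := ip w w in ww H.
have q1 : 0 < q + 1 by lra.
(* The minimizer of $t^2q+2tp$ is $-p/q$; the denominator $q+1$ also covers null directions. *)
have := H (- p / (q + 1)).
have -> : (- p / (q + 1)) ^+ 2 * q + 2 * (- p / (q + 1)) * p =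
  - (p ^+ 2) * ((q + 2) / (q + 1) ^+ 2).
  by field; rewrite gt_eqF.
rewrite mulNr oppr_ge0 pmulr_lle0; last first.
  by rewrite divr_gt0 ?exprn_gt0//; lra.
by move=> p0; apply/eqP; rewrite -sqrf_eq0 eq_le p0 sqr_ge0.
Unshelve. all: by end_near. Qed.

End riesz.

End semi_inner_product.

Lemma sip_space_sub {R : realType} {V : lmodType R} (P P' : V -> Prop) ip :
  sip_space P ip -> (forall u, P' u -> P u) -> P' 0 ->
  (forall a u v, P' u -> P' v -> P' (a *: u + v)) -> @sip_space R V P' ip.
Proof.
move=> S sub P0 PL; split=> //.
- by move=> u v /sub Pu /sub Pv; exact: sipC S _ _ Pu Pv.
- by move=> a u v w /sub Pu /sub Pv /sub Pw; exact: sipL S _ _ _ _ Pu Pv Pw.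
- by move=> u /sub Pu; exact: sip_ge0 S _ Pu.
Qed.

(** The projection is the Riesz representative, within the complete subspace, of the functional
    [ip v]. *)
Lemma sip_projection {R : realType} {V : lmodType R} (P P' : V -> Prop) ip v :
  sip_space P ip -> sip_space P' ip -> (forall u, P' u -> P u) ->
  @sip_complete R V P' ip -> P v ->
  exists2 l, P' l & forall u, P' u -> ip (v - l) u = 0.
Proof.
move=> S S' sub cplt Pv.
have [|u Pu|l Pl H] := @sip_riesz _ _ P' ip S' (ip v) _ (ip v v) _ cplt.
- move=> a u w /sub Pu /sub Pw.
  by rewrite (ipDr S)//; [rewrite (ipZr S)|exact: (sipZ S)].
- by apply: (sip_CS S) => //; exact: sub.
- exists l => // u Pu; rewrite (ipBl S) ?H ?subrr//; exact: sub.
Qed.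

(** * Square integrable functions *)

Section L2_space.
Context {d : measure_display} {T : measurableType d} {R : realType}.
Variables (mu : {measure set T -> \bar R}) (D : set T).
Hypothesis mD : measurable D.
Implicit Types f g h : T -> R.

Local Notation L2 := (inL2 mu D).
Local Notation ip := (ipL2 mu D).

Lemma inL2P f : L2 f <->
  measurable_fun D f /\ mu.-integrable D (fun x => (f x ^+ 2)%:E).
Proof.
have mfE : measurable_fun D f <-> measurable_fun setT (f \_ D).
  exact: (measurable_restrictT f mD).
have E : (fun x => (((f \_ D) x) ^+ 2)%:E) =
    (fun x => (f x ^+ 2)%:E) \_ D :> (T -> \bar R).
  by apply/funext => x; rewrite !patchE; case: ifP => //; rewrite expr0n.
split => [fL|[/mfE mf intf]].
  split; first by apply/mfE; move: fL => /andP[/[!inE]].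
  by apply/integrable_mkcond => //; rewrite -E; exact: Lfun2_integrable_sqr.
rewrite /inL2 inE/=; apply/andP; split; rewrite inE//=.
rewrite /finite_norm unlock /Lnorm.
apply: poweR_lty; move: intf => /(integrable_mkcond _ mD); rewrite -E.
move=> /integrableP[_]; apply: le_lt_trans; rewrite le_eqVlt; apply/orP; left.
apply/eqP; apply: eq_integral => x _.
rewrite -[LHS]/((`| (f \_ D) x |%:E) `^ 2)%E poweR_EFin powR_mulrn//.
by rewrite real_normK ?num_real// gee0_abs// lee_fin sqr_ge0.
Qed.

Lemma inL2_measurable f : L2 f -> measurable_fun D f.
Proof. by move=> /inL2P[]. Qed.

Lemma inL2_dominated f g : measurable_fun D f -> L2 g ->
  (forall x, D x -> `|f x| <= `|g x|) -> L2 f.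
Proof.
move=> mf /inL2P[mg ig] fg; apply/inL2P; split => //.
apply: le_integrable ig => //.
  by apply/measurable_EFinP; exact: measurable_funX.
move=> x Dx; rewrite /= lee_fin !ger0_norm ?sqr_ge0//.
by rewrite -[leLHS]real_normK ?num_real// -[leRHS]real_normK ?num_real// lerXn2r// ?nnegrE ?normr_ge0// fg.
Qed.

Lemma inL2M f g : L2 f -> L2 g -> mu.-integrable D (EFin \o (f \* g)).
Proof.
move=> /inL2P[mf if2] /inL2P[mg ig2].
apply: (le_integrable mD _ _ (integrableD mD if2 ig2)).
  by apply/measurable_EFinP; exact: measurable_funM.
move=> x Dx /=; rewrite lee_fin [leRHS]ger0_norm ?addr_ge0 ?sqr_ge0//.
rewrite normrM -[_ ^+ 2 in leRHS]real_normK ?num_real//.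
rewrite -[g x ^+ 2]real_normK ?num_real//.
by have := sqr_ge0 (`|f x| - `|g x|); have := sqr_ge0 (`|f x| + `|g x|); nra.
Qed.

Lemma ipL2_EFin f g : L2 f -> L2 g ->
  (\int[mu]_(x in D) (f x * g x)%:E)%E = (ip f g)%:E.
Proof.
move=> fL gL; rewrite /ipL2 /Rintegral fineK//.
exact: (integrable_fin_num mD (inL2M fL gL)).
Qed.

Lemma inL2_0 : L2 0.
Proof.
apply/inL2P; split; first exact: measurable_cst.
by under eq_fun do rewrite expr0n; exact: integrable0.
Qed.

Lemma inL2_sip : sip_space L2 ip.
Proof.
have two : (1 <= 2%:E :> \bar R)%E by rewrite lee_fin ler1n.
split.
- exact: inL2_0.
- move=> a u v uL vL; rewrite /inL2.
  have -> : (a *: u + v) \_ D = a *: (u \_ D) + v \_ D.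
    apply/funext => x.
    rewrite -[RHS]/(a * (u \_ D) x + (v \_ D) x) !patchE.
    by case: ifP => //; rewrite mulr0 addr0.
  case: (Lfun_submod_closed mu two) => _; apply; [exact: uL | exact: vL].
- by move=> u v _ _; apply: eq_Rintegral => x _; rewrite mulrC.
- move=> a u v w uL vL wL; rewrite /ipL2.
  have uw := inL2M uL wL; have vw := inL2M vL wL.
  rewrite -RintegralZl// -RintegralD//; last exact: (integrableZl mD a uw).
  by apply: eq_Rintegral => x _ /=; rewrite mulrDl mulrA.
- by move=> u _; apply: Rintegral_ge0 => x _; rewrite -expr2 sqr_ge0.
Qed.

Lemma ipL2_eq0 f : L2 f -> ip f f = 0 -> eqL2 mu D f (fun=> 0).
Proof.
move=> fL f0; have mf := inL2_measurable fL.
have : (\int[mu]_(x in D) `|(f x * f x)%:E| = 0)%E.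
  rewrite -[RHS]/(0%:E) -f0 -ipL2_EFin//; apply: eq_integral => x _.
  by rewrite gee0_abs// lee_fin -expr2 sqr_ge0.
move=> /(ae_eq_integral_abs _ mD _).1 h.
have mf2 : measurable_fun D (fun x => (f x * f x)%:E).
  by apply/measurable_EFinP; exact: measurable_funM.
move: h => /(_ mf2); apply: filterS => x /[apply] -[] /eqP.
by rewrite mulf_eq0 orbb => /eqP.
Qed.

Lemma eqL2_ip f g : L2 f -> eqL2 mu D f (fun=> 0) -> L2 g -> ip f g = 0.
Proof.
move=> fL f0 gL; rewrite /ipL2 /Rintegral.
rewrite (@ae_eq_integral _ _ _ mu D (cst 0%E)) ?integral0//.
- by case/integrableP: (inL2M fL gL).
- by move: f0; apply: filterS => x /= fx /fx ->; rewrite mul0r.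
Qed.

Lemma eqL2_ipl f f' g : L2 f -> L2 f' -> eqL2 mu D f f' -> L2 g ->
  ip f g = ip f' g.
Proof.
move=> fL fL' ff gL; apply/eqP; rewrite -subr_eq0 -(ipBl inL2_sip)//.
rewrite eqL2_ip//; first exact: (sipB inL2_sip).
move: ff; apply: filterS => x fx Dx; apply/eqP; rewrite subr_eq0; apply/eqP.
exact: fx.
Qed.

Lemma ip0_eqL2 f g : L2 f -> L2 g -> ip (f - g) (f - g) = 0 -> eqL2 mu D f g.
Proof.
move=> fL gL /(ipL2_eq0 (sipB inL2_sip fL gL)); apply: filterS => x /[apply].
by move=> /eqP; rewrite subr_eq0 => /eqP.
Qed.

Lemma ipL2_dominated (f : T -> R) (phi_ : nat -> T -> R) (phi h : T -> R) :
  L2 f -> L2 h -> (forall n, measurable_fun D (phi_ n)) ->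
  (forall n x, D x -> `|phi_ n x| <= h x) -> measurable_fun D phi ->
  (forall x, D x -> phi_ ^~ x @ \oo --> phi x) ->
  (fun n => ip f (phi_ n)) @ \oo --> ip f phi.
Proof.
move=> fL hL mphi_ phih mphi cphi; have mf := inL2_measurable fL.
have := @dominated_convergence _ _ _ mu D mD
  (fun n x => (f x * phi_ n x)%:E) (fun x => (f x * phi x)%:E)
  (fun x => `|(f x * h x)%:E|%E).
case.
- by move=> n; apply/measurable_EFinP; exact: measurable_funM.
- by apply/measurable_EFinP; exact: measurable_funM.
- by apply: aeW => x Dx; apply: cvg_EFin; [exact: nearW|apply: cvgMl_tmp; exact: cphi].
- by apply: integrable_abse; exact: inL2M.
- apply: aeW => x n Dx; rewrite /= lee_fin !normrM ler_wpM2l//.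
  by apply: le_trans (phih n x Dx) _; exact: ler_norm.
- move=> i0 _ H; rewrite /ipL2 /Rintegral.
  apply: fine_cvg; move: H; rewrite fineK//; exact: (integrable_fin_num mD i0).
Qed.

(** Riesz-Fischer: along a fast subsequence the weighted squares of the increments are summable
    almost everywhere, which gives a pointwise limit, and the Cauchy estimate passes to this
    limit. *)
Lemma inL2_complete : sip_complete L2 ip.
Proof.
move=> u uL cu.
have S := inL2_sip.
have e8 (k : nat) : 0 < (8^-1) ^+ k :> R by rewrite exprn_gt0.
have /choice[N HN] : forall k : nat, exists N, forall m n, (N <= m)%N ->
    (N <= n)%N -> ip (u m - u n) (u m - u n) <= (8^-1) ^+ k.
  by move=> k; exact: cu (e8 k).
(* Summing the thresholds gives indices beyond [N j] for all [j <= k], although [N] need not be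
   monotone. *)
pose s k := (\sum_(j < k.+1) N j)%N.
have sN k : (N k <= s k)%N by rewrite /s big_ord_recr/= leq_addl.
have sN1 k : (N k <= s k.+1)%N.
  by rewrite /s big_ord_recr/= (leq_trans (sN k))// leq_addr.
have sNj k j : (k <= j)%N -> (N k <= s j)%N.
  move=> kj; rewrite /s (bigD1 (Ordinal (kj : (k < j.+1)%N)))//= leq_addr//.
pose f k := u (s k).
have fL k : L2 (f k) by exact: uL.
have mfk k : measurable_fun D (f k) by exact: inL2_measurable.
have dL k : L2 (f k.+1 - f k) by exact: (sipB S).
(* The weight balances two demands: the integrals are at most $4^k8^{-k}=2^{-k}$, hence summable,
   and a finite sum $h(x)$ bounds the increments by $\sqrt{h(x)}\,2^{-k}$. *)
pose t k x : R := (4 ^+ k * (f k.+1 x - f k x) ^+ 2).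
have t0 k x : 0 <= t k x by rewrite mulr_ge0 ?sqr_ge0 ?exprn_ge0.
have mt k : measurable_fun D (t k).
  apply: measurable_funM => //; apply: measurable_funX.
  by apply: measurable_funB.
pose h x := (\sum_(k <oo) (t k x)%:E)%E.
have hint : (\int[mu]_(x in D) h x < +oo)%E.
  rewrite integral_nneseries//; last 2 first.
  - by move=> k; apply/measurable_EFinP.
  - by move=> k x _; rewrite lee_fin.
  apply: (@le_lt_trans _ _ (\sum_(0 <= k <oo) ((2^-1) ^+ k)%:E)%E).
    apply: lee_nneseries => k _.
      by move=> _; apply: integral_ge0 => x _; rewrite lee_fin.
    have -> : (\int[mu]_(x in D) (t k x)%:E =
       (4 ^+ k)%:E * \int[mu]_(x in D) ((f k.+1 - f k) x * (f k.+1 - f k) x)%:E)%E.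
      rewrite -integralZl//; last exact: inL2M.
    rewrite ipL2_EFin// -EFinM lee_fin.
    apply: (@le_trans _ _ (4 ^+ k * (8^-1) ^+ k)).
      by rewrite ler_wpM2l ?exprn_ge0//; apply: HN.
    by rewrite -exprMn (_ : 4 * 8^-1 = 2^-1)//; field.
  apply: le_lt_trans (ltry 2); apply: le_trans (epsilon_trick0 xpredT (ler0n R 2)).
  by apply: lee_nneseries => k _; rewrite lee_fin ?exprn_ge0// exprVn natrX exprS invfM mulrA mulfV ?mul1r.
have mh : measurable_fun D h.
  by apply: ge0_emeasurable_sum => [k x _ _|k _]; [rewrite lee_fin | exact/measurable_EFinP].
have hfin : {ae mu, forall x, D x -> h x \is a fin_num}.
  apply: integrable_ae => //; apply/integrableP; split => //.
  apply: le_lt_trans hint; rewrite le_eqVlt; apply/orP; left; apply/eqP.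
  apply: eq_integral => x _; rewrite gee0_abs//.
  by apply: nneseries_ge0 => k _ _; rewrite lee_fin.
(* The upper limit is measurable on all of [D] and agrees with the limit wherever [h] is finite. *)
pose g x := fine (limn_esup (fun k => (f k x)%:E)).
have fg x : h x \is a fin_num -> f ^~ x @ \oo --> g x.
  move=> hx.
  have tk k : t k x <= fine (h x).
    rewrite -lee_fin fineK//; apply: le_trans (nneseries_lim_ge k.+1 _); last first.
      by move=> i _; rewrite lee_fin.
    rewrite big_nat_recr//= leeDr//; apply: sume_ge0 => i _.
    by rewrite lee_fin.
  have hx0 : 0 <= fine (h x) by exact: le_trans (t0 0%N x) (tk 0%N).
  have cf : cvgn (fun k => f k x).
    have : cvgn (series (fun k => f k.+1 x - f k x)).
      apply: normed_cvg.
      apply: (@series_le_cvg _ _ (geometric (Num.sqrt (fine (h x))) 2^-1)).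
      - by move=> k; exact: normr_ge0.
      - by move=> k; rewrite mulr_ge0 ?sqrtr_ge0 ?exprn_ge0.
      - move=> k /=; rewrite -sqrtr_sqr.
        rewrite -[2^-1 ^+ k]ger0_norm ?exprn_ge0// -sqrtr_sqr -sqrtrM//.
        rewrite ler_sqrt ?mulr_ge0 ?sqr_ge0// -exprM mulnC exprM.
        rewrite -ler_pdivrMr ?exprn_gt0//; apply: le_trans (tk k).
        by rewrite /t mulrC -[in leLHS]exprVn (_ : (2^-1 ^+ 2)^-1 = 4 :> R)//; field.
      - by apply: is_cvg_geometric_series; rewrite ger0_norm// invf_lt1 ?ltr1n.
    have E : series (fun k => f k.+1 x - f k x) = (fun n => f n x - f 0%N x).
      by apply/funext => n; rewrite /series/= telescope_sumr.
    rewrite E => c; have -> : (fun k => f k x) = (fun n => (f n x - f 0%N x) + f 0%N x).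
      by apply/funext => n; rewrite subrK.
    by apply: is_cvgD => //; exact: is_cvg_cst.
  have ecf : (fun k => (f k x)%:E) @ \oo --> (limn (fun k => f k x))%:E.
    by apply: cvg_EFin => //; exact: nearW.
  rewrite /g is_cvg_limn_esupE; last by apply/cvg_ex; eexists; exact: ecf.
  by rewrite (cvg_lim _ ecf).
have mg : measurable_fun D g.
  have m1 : measurable_fun D (fun x => limn_esup (fun k => (f k x)%:E)).
    by apply: measurable_fun_limn_esup => k; apply/measurable_EFinP.
  by apply: (measurableT_comp _ m1); exact: fine_measurable.
(* Fatou's lemma along the subsequence bounds the distance to the limit. *)
have fatou_bound m k : (N k <= m)%N ->
    (\int[mu]_(x in D) ((u m x - g x) ^+ 2)%:E <= ((8^-1) ^+ k)%:E)%E.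
  move=> Nkm.
  have mfm j : measurable_fun D (fun x => ((u m x - f j x) ^+ 2)%:E).
    apply/measurable_EFinP; apply: measurable_funX; apply: measurable_funB => //.
    exact: inL2_measurable.
  have nn j x : D x -> (0 <= ((u m x - f j x) ^+ 2)%:E)%E.
    by move=> _; rewrite lee_fin sqr_ge0.
  have F := fatou mu mD mfm nn.
  apply: (@le_trans _ _ (\int[mu]_(x in D) limn_einf (fun j => ((u m x - f j x) ^+ 2)%:E))%E).
    rewrite (@ge0_ae_eq_integral _ _ _ mu D _
      (fun x => limn_einf (fun j => ((u m x - f j x) ^+ 2)%:E)))//.
    - apply/measurable_EFinP; apply: measurable_funX; apply: measurable_funB => //.
      exact: inL2_measurable.
    - apply: measurableT_comp => //; apply: measurable_fun_limn_esup => j.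
      exact: measurableT_comp.
    - by move=> x _; rewrite lee_fin sqr_ge0.
    - move=> x Dx; rewrite limn_einf_lim; apply: lime_ge.
        exact: is_cvg_einfs.
      apply: nearW => j; apply: le_ereal_inf_tmp => _ [i _ <-]; exact: nn.
    - move: hfin; apply: filterS => x /[apply] /fg gx.
      apply/esym; have cc : (fun j => ((u m x - f j x) ^+ 2)%:E) @ \oo -->
          ((u m x - g x) ^+ 2)%:E.
        apply: cvg_EFin; first exact: nearW.
        have c : (fun j => u m x - f j x) @ \oo --> u m x - g x.
          by apply: cvgB => //; exact: cvg_cst.
        exact: (cvgM c c).
      rewrite is_cvg_limn_einfE; last by apply/cvg_ex; eexists; exact: cc.
      exact: cvg_lim cc.
  apply: le_trans F _; rewrite limn_einf_lim; apply: lime_le.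
    exact: is_cvg_einfs.
  apply: nearW => j; apply: (@le_trans _ _
    (\int[mu]_(x in D) ((u m x - f (maxn j k) x) ^+ 2)%:E)%E).
    by apply: ereal_inf_lbound; exists (maxn j k) => //=; exact: leq_maxl.
  have fL' : L2 (u m - f (maxn j k)) by exact: (sipB S).
  rewrite (_ : (\int[mu]_(x in D) _)%E =
    (ip (u m - f (maxn j k)) (u m - f (maxn j k)))%:E); last first.
    by rewrite -ipL2_EFin//; apply: eq_integral => x _; rewrite expr2.
  by rewrite lee_fin; apply: HN => //; apply: sNj; exact: leq_maxr.
have gL : L2 g.
  have dg : L2 (u (N 0%N) - g).
    apply/inL2P; split.
      by apply: measurable_funB => //; exact: inL2_measurable.
    apply/integrableP; split.
      apply/measurable_EFinP; apply: measurable_funX; apply: measurable_funB => //.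
      exact: inL2_measurable.
    apply: le_lt_trans (le_lt_trans (fatou_bound _ _ (leqnn (N 0%N))) (ltry _)).
    rewrite le_eqVlt; apply/orP; left; apply/eqP; apply: eq_integral => x _.
    by rewrite gee0_abs// lee_fin sqr_ge0.
  by rewrite (_ : g = u (N 0%N) - (u (N 0%N) - g)); [exact: (sipB S)|rewrite subKr].
exists g => //.
have ipk m k : (N k <= m)%N -> ip (u m - g) (u m - g) <= (8^-1) ^+ k.
  move=> /fatou_bound; rewrite -lee_fin -ipL2_EFin; [|exact: (sipB S)..].
  by apply: le_trans; rewrite le_eqVlt; apply/orP; left; apply/eqP; apply: eq_integral => x _; rewrite expr2.
apply/cvgrPdist_le => e e0.
have h8 : `|8^-1 : R| < 1 by rewrite ger0_norm// invf_lt1 ?ltr1n.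
have := cvg_expr h8 => /cvgrPdist_le /(_ e e0) [k _ Hk].
exists (N k) => // m /= Nkm; rewrite sub0r normrN ger0_norm; last first.
  by apply: (sip_ge0 S); exact: (sipB S).
apply: le_trans (ipk _ _ Nkm) _; have := Hk k (leqnn k).
by rewrite /= sub0r normrN; apply: le_trans; rewrite ler_norm.
Qed.

End L2_space.

(** * Square integrable vector fields and pairs *)

Section L2_pairs.
Context {R : realType} {d : nat}.
Variable D : set (measurableTypeR R * 'rV[R]_d).
Hypothesis mD : measurable D.

Local Notation mu := (@leb_tx R d).
Local Notation S := (@inL2_sip _ _ R mu D mD).

Lemma vcompL (a : R) (u v : vfield R d) i :
  vcomp (a *: u + v) i = a *: vcomp u i + vcomp v i.
Proof. by apply/funext => z; rewrite /vcomp mxE mxE. Qed.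

Lemma vcompB (u v : vfield R d) i : vcomp (u - v) i = vcomp u i - vcomp v i.
Proof. by apply/funext => z; rewrite /vcomp mxE mxE. Qed.

Lemma vcomp0 i : vcomp (0 : vfield R d) i = 0.
Proof. by apply/funext => z; rewrite /vcomp mxE. Qed.

Lemma inL2v_sip : sip_space (@inL2v R d D) (@ipL2v R d D).
Proof.
split.
- by move=> i; rewrite vcomp0; exact: (sip0 S).
- by move=> a u v uL vL i; rewrite vcompL; exact: (sipP S).
- by move=> u v uL vL; apply: eq_bigr => i _; exact: (sipC S).
- move=> a u v w uL vL wL; rewrite /ipL2v mulr_sumr -big_split/=.
  by apply: eq_bigr => i _; rewrite vcompL (sipL S).
- by move=> u uL; apply: sumr_ge0 => i _; exact: (sip_ge0 S).
Qed.

Lemma inL2p_sip : sip_space (@inL2p R d D) (@ipL2p R d D).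
Proof.
have Sv := inL2v_sip; split.
- by split; [exact: (sip0 S)|exact: (sip0 Sv)].
- move=> a u v [u1 u2] [v1 v2]; split; first exact: (sipP S).
  exact: (sipP Sv).
- move=> u v [u1 u2] [v1 v2]; rewrite /ipL2p (sipC S)//; congr +%R.
  exact: (sipC Sv).
- move=> a u v w [u1 u2] [v1 v2] [w1 w2]; rewrite /ipL2p (sipL S)//.
  by rewrite [ipL2v D (a *: u + v).2 _](sipL Sv)//; ring.
- by move=> u [u1 u2]; apply: addr_ge0; [exact: (sip_ge0 S)|exact: (sip_ge0 Sv)].
Qed.

Lemma ipL2v_comp_le (w : vfield R d) i : inL2v D w ->
  ipL2 mu D (vcomp w i) (vcomp w i) <= ipL2v D w w.
Proof.
move=> wL; rewrite /ipL2v (bigD1 i)//= lerDl.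
by apply: sumr_ge0 => j _; exact: (sip_ge0 S).
Qed.

Lemma ipL2p_fst_le (w : pfield R d) : inL2p D w ->
  ipL2 mu D w.1 w.1 <= ipL2p D w w.
Proof. by move=> [_ wL]; rewrite /ipL2p lerDl; exact: (sip_ge0 inL2v_sip). Qed.

Lemma ipL2p_snd_le (w : pfield R d) : inL2p D w ->
  ipL2v D w.2 w.2 <= ipL2p D w w.
Proof. by move=> [wL _]; rewrite /ipL2p lerDr; exact: (sip_ge0 S). Qed.

Lemma normL2p_sqr (w : pfield R d) : inL2p D w ->
  normL2p D w ^+ 2 = ipL2p D w w.
Proof. by move=> wL; rewrite sqr_sqrtr//; exact: (sip_ge0 inL2p_sip). Qed.

Lemma cvg_le0 (u v : R^nat) : (forall n, 0 <= u n <= v n) ->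
  v @ \oo --> (0 : R) -> u @ \oo --> (0 : R).
Proof.
move=> uv v0; apply: (@squeeze_cvgr _ _ _ _ (cst 0) v) => //.
  by apply: nearW => n; exact: uv.
exact: cvg_cst.
Qed.

Lemma L2p_cvgP (u : nat -> pfield R d) l : (forall n, inL2p D (u n)) ->
  inL2p D l -> sip_cvg (ipL2p D) u l <->
  sip_cvg (ipL2 mu D) (fun n => (u n).1) l.1 /\
  forall i, sip_cvg (ipL2 mu D) (fun n => vcomp (u n).2 i) (vcomp l.2 i).
Proof.
move=> uL lL.
have dL n : inL2p D (u n - l) by exact: (sipB inL2p_sip).
split=> [ul|[ul1 ul2]].
  split => [|i].
    apply: cvg_le0 ul => n; rewrite (sip_ge0 S) /=; last by case: (dL n).
    exact: ipL2p_fst_le (dL n).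
  apply: cvg_le0 ul => n; rewrite -vcompB.
  rewrite (sip_ge0 S) /=; last by case: (dL n).
  by apply: le_trans (ipL2p_snd_le (dL n)); apply: ipL2v_comp_le; case: (dL n).
rewrite /sip_cvg /ipL2p -[0 in X in _ --> X]addr0; apply: cvgD => //.
have -> : (0 : R) = \sum_(i < d) 0 by rewrite big1.
apply: (@cvg_big _ _ _ _ _ (@add_continuous R)) => i _.
by under eq_fun do rewrite [(_ - _).2]/= vcompB; exact: ul2.
Qed.

Lemma inL2p_complete : sip_complete (@inL2p R d D) (@ipL2p R d D).
Proof.
move=> u uL cu.
have dL m n : inL2p D (u m - u n) by exact: (sipB inL2p_sip).
have [l1 l1L ul1] : exists2 l, inL2 mu D l &
    sip_cvg (ipL2 mu D) (fun n => (u n).1) l.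
  apply: (inL2_complete mD) => [n|e e0]; first by case: (uL n).
  have [N HN] := cu e e0; exists N => m n Nm Nn.
  exact: le_trans (ipL2p_fst_le (dL m n)) (HN m n Nm Nn).
have /choice[l2 Hl2] : forall i, exists l, inL2 mu D l /\
    sip_cvg (ipL2 mu D) (fun n => vcomp (u n).2 i) l.
  move=> i; have [||l lL ul] := @inL2_complete _ _ _ mu D mD (fun n => vcomp (u n).2 i).
  - by move=> n; case: (uL n).
  - move=> e e0; have [N HN] := cu e e0; exists N => m n Nm Nn.
    apply: le_trans (HN m n Nm Nn); apply: le_trans (ipL2p_snd_le (dL m n)).
    by rewrite -vcompB; apply: ipL2v_comp_le; case: (dL m n).
  - by exists l.
have E i : vcomp (fun z => \row_j l2 j z) i = l2 i.
  by apply/funext => z; rewrite /vcomp mxE.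
have lL : inL2p D (l1, fun z => \row_j l2 j z).
  by split => // i; rewrite E; case: (Hl2 i).
exists (l1, fun z => \row_j l2 j z) => //; apply/L2p_cvgP => //.
by split => // i; rewrite E; case: (Hl2 i).
Qed.

Lemma eqL2p_ip0 (u v : pfield R d) : inL2p D u -> inL2p D v ->
  ipL2p D (u - v) (u - v) = 0 -> eqL2p D u v.
Proof.
move=> uL vL h; have dL := sipB inL2p_sip uL vL.
have h1 : ipL2 mu D (u.1 - v.1) (u.1 - v.1) <= 0.
  by have := ipL2p_fst_le dL; rewrite h.
have h2 i : ipL2 mu D (vcomp (u - v).2 i) (vcomp (u - v).2 i) <= 0.
  by rewrite -h; apply: le_trans (ipL2p_snd_le dL); apply: ipL2v_comp_le; case: dL.
have [u1 u2] := uL; have [v1 v2] := vL.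
split.
  apply: (ip0_eqL2 mD) => //; apply/eqP; rewrite eq_le h1 (sip_ge0 S)//.
  exact: (sipB S).
move=> i; apply: (ip0_eqL2 mD) => //; apply/eqP; rewrite eq_le.
rewrite (sip_ge0 S) ?andbT; last exact: (sipB S).
by have := h2 i; rewrite vcompB.
Qed.

Lemma eqL2p_ipl (u u' v : pfield R d) : inL2p D u -> inL2p D u' ->
  inL2p D v -> eqL2p D u u' -> ipL2p D u v = ipL2p D u' v.
Proof.
move=> [u1 u2] [v1 v2] [w1 w2] [e1 e2]; congr +%R; first exact: eqL2_ipl.
by apply: eq_bigr => i _; exact: eqL2_ipl.
Qed.

Lemma eqL2p_ipr (u v v' : pfield R d) : inL2p D u -> inL2p D v ->
  inL2p D v' -> eqL2p D v v' -> ipL2p D u v = ipL2p D u v'.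
Proof.
by move=> uL vL vL' vv; rewrite !(sipC inL2p_sip uL)//; exact: eqL2p_ipl.
Qed.

End L2_pairs.

(** * Smooth cutoff functions *)

Section elementary_functions.
Context {R : realType}.
Implicit Types (f g : R -> R) (x y : R).

(* The derivatives of the flat function exp(-1/y) are combinations of these. *)
Definition flat (k : nat) y : R :=
  if 0 < y then y^-1 ^+ k * expR (- y^-1) else 0.

Lemma flat_ge0 k y : 0 <= flat k y.
Proof.
rewrite /flat; case: ifP => // y0.
by rewrite mulr_ge0 ?expR_ge0// exprn_ge0// invr_ge0 ltW.
Qed.

Lemma flat_gt0 k y : 0 < y -> 0 < flat k y.
Proof.
by move=> y0; rewrite /flat y0 mulr_gt0 ?expR_gt0// exprn_gt0// invr_gt0.
Qed.

Lemma flat_le0 k y : y <= 0 -> flat k y = 0.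
Proof. by rewrite /flat leNgt; case: ifP. Qed.

(** $e^s\ge s^{k+2}/(k+2)!$ at $s=1/y$. A bound of order $y^2$ makes the difference quotient at $0$
    tend to $0$. *)
Lemma flat_le k y : flat k y <= k.+2`!%:R * y ^+ 2.
Proof.
have [y0|y0] := leP y 0.
  by rewrite flat_le0// mulr_ge0 ?sqr_ge0.
rewrite /flat y0 expRN; have iy : 0 <= y^-1 by rewrite invr_ge0 ltW.
have := expR_ge1Dxn k.+1 iy; set s := y^-1 in iy * => h.
have fk : 0 < k.+2`!%:R :> R by rewrite ltr0n fact_gt0.
rewrite ler_pdivrMr ?expR_gt0//.
apply: (@le_trans _ _ (k.+2`!%:R * y ^+ 2 * (s ^+ k.+2 / k.+2`!%:R))).
  rewrite [k.+2`!%:R * _]mulrC -mulrA [_%:R * _]mulrC divfK ?gt_eqF//.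
  have E (a b : R) : a ^+ 2 * b ^+ k.+2 = (a * b) ^+ 2 * b ^+ k.
    by rewrite !exprS; ring.
  by rewrite E /s divff ?gt_eqF// expr1n mul1r.
apply: ler_wpM2l; first by apply: mulr_ge0; [exact: ltW|exact: sqr_ge0].
by apply: le_trans h; rewrite lerDr.
Qed.

Lemma flat_derive k y :
  is_derive y 1 (flat k) (- k%:R * flat k.+1 y + flat k.+2 y).
Proof.
have [y0|y0|->] := ltgtP y 0.
- rewrite !flat_le0 ?(ltW y0)// mulr0 addr0.
  apply: (@near_eq_is_derive _ _ _ (cst 0)) => //.
  near=> z; rewrite /= flat_le0//; apply/ltW; near: z; exact: lt_nbhsl.
- rewrite /flat y0.
  apply: (@near_eq_is_derive _ _ _ (fun y => y^-1 ^+ k * expR (- y^-1))).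
    by near=> z; rewrite ifT//; near: z; exact: lt_nbhsr.
  have yn0 : y != 0 by rewrite gt_eqF.
  have fctX (g : R -> R) j z : (g ^+ j) z = g z ^+ j.
    by elim: j => [|j IH]; rewrite ?expr0// !exprS -IH.
  have dV : is_derive y 1 (fun y : R => y^-1) (- y ^- 2).
    apply: DeriveDef; first exact: derivableV.
    by rewrite deriveV// derive_id /GRing.scale/= mulr1.
  have dX := @is_deriveX _ _ _ k _ _ _ dV.
  have dN := @is_deriveN _ _ _ _ _ _ _ dV.
  have dE : is_derive y 1 (expR \o (fun y : R => - y^-1)) (expR (- y^-1) * y ^- 2).
    have := @is_derive1_comp _ expR (fun y => - y^-1) y _ _ (is_derive_expR _) dN.
    by rewrite opprK.
  have := is_deriveM dX dE.
  rewrite [X in is_derive _ _ X _](_ : _ = (fun y => y^-1 ^+ k * expR (- y^-1))); last first.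
    by apply/funext => z; rewrite -[LHS]/(((fun y : R => y^-1) ^+ k) z * expR (- z^-1)) fctX.
  move/is_derive_eq; apply; rewrite /GRing.scale/= fctX.
  rewrite -exprVn; set s := y^-1; set E := expR _.
  case: k {dX} => [|k]; first by rewrite /= !exprS expr0; ring.
  rewrite /= !exprS expr0; set n := k.+1%:R; move: n (s ^+ k) => n p; ring.
- rewrite !flat_le0// mulr0 addr0.
  have C0 : 0 <= k.+2`!%:R :> R by [].
  have H : (fun h : R => h^-1 *: ((flat k \o shift 0) (h *: 1) - flat k 0)) @ 0^' --> (0 : R).
    apply/cvgrPdist_le => e e0.
    have C1 : 0 < k.+2`!%:R + 1 :> R by rewrite ltr_wpDl.
    near=> h; rewrite sub0r normrN /= addr0 (flat_le0 k (lexx 0)) subr0 [h%:A]mulr1 normrZ.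
    have h0 : h != 0 by near: h; exact: nbhs_dnbhs_neq.
    rewrite [`|flat _ _|]ger0_norm ?flat_ge0//.
    apply: (@le_trans _ _ (k.+2`!%:R * `|h|)).
      rewrite normfV ler_pdivrMl ?normr_gt0//.
      apply: le_trans (flat_le _ _) _.
      by rewrite [leRHS]mulrCA -expr2 real_normK ?num_real.
    apply: (@le_trans _ _ ((k.+2`!%:R + 1) * `|h|)).
      by rewrite ler_wpM2r// lerDl.
    rewrite -ler_pdivlMl// mulrC; near: h; apply: dnbhs0_le.
    by rewrite divr_gt0.
  apply: DeriveDef; first by apply/cvg_ex; exists 0.
  exact: cvg_lim H.
Unshelve. all: by end_near. Qed.

(** A class closed under differentiation: membership gives continuity and derivatives of all orders
    at once. It contains the smooth time weights used below, namely cutoffs, exponentials, affine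
    functions, cosines and sines. *)
Inductive elementary : (R -> R) -> Prop :=
| elem_flat k : elementary (flat k)
| elem_cst c : elementary (fun=> c)
| elem_id : elementary id
| elem_add f g : elementary f -> elementary g -> elementary (fun y => f y + g y)
| elem_mul f g : elementary f -> elementary g -> elementary (fun y => f y * g y)
| elem_affine f a b : elementary f -> elementary (fun y => f (a * y + b))
| elem_inv f : elementary f -> (forall y, 0 < f y) ->
    elementary (fun y => (f y)^-1)
| elem_exp : elementary expR
| elem_cos : elementary cos
| elem_sin : elementary sin.

Lemma is_derive_affine (f : R -> R) (a b y df : R) :
  is_derive (a * y + b) 1 f df -> is_derive y 1 (fun y => f (a * y + b)) (a * df).
Proof.
move=> H; have dl : is_derive y 1 (fun y : R => a * y + b) a.
  have := @is_deriveD _ _ _ _ _ y 1 _ _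
    (@is_deriveZ _ _ _ id a y 1 _ (is_derive_id _ _)) (is_derive_cst b _ _).
  by rewrite addr0 [_ *: _]mulr1.
by have := @is_derive1_comp _ f _ y _ _ H dl; rewrite mulrC.
Qed.

Lemma elementary_derive f : elementary f ->
  exists2 f', elementary f' & forall y, is_derive y 1 f (f' y).
Proof.
elim=> {f} [k|c||f g ef [f' ef' df] eg [g' eg' dg]|
  f g ef [f' ef' df] eg [g' eg' dg]|f a b ef [f' ef' df]|f ef [f' ef' df] f0|||].
- exists (fun y => (- k%:R) * flat k.+1 y + flat k.+2 y) => [|y].
    apply: elem_add; last exact: elem_flat.
    by apply: elem_mul; [exact: elem_cst|exact: elem_flat].
  exact: flat_derive.
- by exists (fun=> 0); [exact: elem_cst|move=> y; exact: is_derive_cst].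
- by exists (fun=> 1); [exact: elem_cst|move=> y; exact: is_derive_id].
- exists (fun y => f' y + g' y); first exact: elem_add.
  by move=> y; exact: is_deriveD.
- exists (fun y => f y * g' y + g y * f' y).
    by apply: elem_add; exact: elem_mul.
  by move=> y; exact: is_deriveM.
- exists (fun y => a * f' (a * y + b)).
    by apply: elem_mul; [exact: elem_cst|exact: elem_affine].
  by move=> y; exact: is_derive_affine.
- exists (fun y => - 1 * (f y)^-1 * (f y)^-1 * f' y).
    apply: elem_mul => //; apply: elem_mul; last exact: elem_inv.
    by apply: elem_mul; [exact: elem_cst|exact: elem_inv].
  move=> y; have fy : f y != 0 by rewrite gt_eqF.
  apply: DeriveDef; first by apply: derivableV => //; case: (df y).
  rewrite deriveV//.
  have [_ ->] := df y; rewrite /GRing.scale/= expr2 invfM; ring.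
- by exists expR; [exact: elem_exp|move=> y; exact: is_derive_expR].
- exists (fun y => - 1 * sin y); first by apply: elem_mul; [exact: elem_cst|exact: elem_sin].
  by move=> y; rewrite mulN1r; exact: is_derive_cos.
- by exists cos; [exact: elem_cos|move=> y; exact: is_derive_sin].
Qed.

Lemma is_derive_continuous f f' : (forall y, is_derive y 1 f (f' y)) ->
  continuous f.
Proof.
by move=> df y; apply/differentiable_continuous/derivable1_diffP; case: (df y).
Qed.

Lemma elementary_continuous f : elementary f -> continuous f.
Proof. by move=> /elementary_derive[f' _ /is_derive_continuous]. Qed.

Let S y := flat 0 y + flat 0 (- 1 * y + 1).

Let S_gt0 y : 0 < S y.
Proof.
rewrite /S; have [y0|y0] := leP y 0; last first.
  by rewrite ltr_pwDl ?flat_gt0 ?flat_ge0.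
by rewrite ltr_wpDl ?flat_ge0// flat_gt0//; lra.
Qed.

(** The usual smooth transition from $0$ to $1$; the denominator is positive because $y$ and $1-y$
    are never both nonpositive. *)
Definition step y : R := flat 0 y * (S y)^-1.
(** The quotient rule after cancellation: each term keeps a factor at $y$ and one at $1-y$, so that
    the derivative visibly vanishes outside $]0,1[$. *)
Definition step' y : R :=
  (flat 2 y * flat 0 (- 1 * y + 1) + flat 0 y * flat 2 (- 1 * y + 1)) *
  ((S y)^-1 * (S y)^-1).

Let elemS : elementary S.
Proof.
by apply: elem_add; [exact: elem_flat|apply: elem_affine; exact: elem_flat].
Qed.

Lemma elementary_step : elementary step.
Proof. by apply: elem_mul; [exact: elem_flat|exact: elem_inv]. Qed.

Lemma elementary_step' : elementary step'.
Proof.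
apply: elem_mul; last by apply: elem_mul; exact: elem_inv.
apply: elem_add; apply: elem_mul; do ?[exact: elem_flat];
  by apply: elem_affine; exact: elem_flat.
Qed.

Lemma step_derive y : is_derive y 1 step (step' y).
Proof.
have d0 (z : R) : is_derive z 1 (flat 0) (flat 2 z).
  by have := flat_derive 0 z; rewrite oppr0 mul0r add0r.
have d1 := is_derive_affine (d0 (- 1 * y + 1)).
have dS : is_derive y 1 S (flat 2 y + -1 * flat 2 (- 1 * y + 1)).
  exact: is_deriveD.
have Sy := S_gt0 y.
have dV : is_derive y 1 (fun y => (S y)^-1)
    (- (S y) ^- 2 * (flat 2 y + -1 * flat 2 (- 1 * y + 1))).
  apply: DeriveDef; first by apply: derivableV; [rewrite gt_eqF|case: dS].
  by rewrite deriveV ?gt_eqF//; case: dS => _ ->.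
have := is_deriveM (d0 y) dV; move/is_derive_eq; apply.
rewrite /GRing.scale/= /step' /S; field.
by rewrite -/(S y) gt_eqF.
Qed.

Lemma step_ge0 y : 0 <= step y.
Proof. by rewrite mulr_ge0 ?flat_ge0// invr_ge0 ltW. Qed.

Lemma step_le1 y : step y <= 1.
Proof. by rewrite /step ler_pdivrMr// mul1r lerDl flat_ge0. Qed.

Lemma step_le0 y : y <= 0 -> step y = 0.
Proof. by move=> y0; rewrite /step flat_le0// mul0r. Qed.

Lemma step_ge1 y : 1 <= y -> step y = 1.
Proof.
move=> y1; rewrite /step /S [flat 0 (_ + _)]flat_le0 ?addr0; last lra.
by rewrite divff// gt_eqF// flat_gt0//; lra.
Qed.

Lemma step'_out y : y <= 0 \/ 1 <= y -> step' y = 0.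
Proof.
move=> [y0|y1]; rewrite /step'; first by rewrite !(flat_le0 _ y0) !mul0r addr0 mul0r.
have y1' : - 1 * y + 1 <= 0 by lra.
by rewrite !(flat_le0 _ y1') !mulr0 addr0 mul0r.
Qed.

Lemma bounded_of_continuous_support f (a b : R) : continuous f ->
  (forall y, y <= a \/ b <= y -> f y = 0) -> exists M, forall y, `|f y| <= M.
Proof.
move=> cf f0.
have : compact (f @` `[a, b]).
  apply: continuous_compact; last exact: segment_compact.
  exact: continuous_subspaceT.
move=> /compact_bounded [M [_ HM]].
exists (Num.max 0 (M + 1)) => y.
have [ya|ya] := leP y a; first by rewrite f0 ?normr0 ?le_max ?lexx//; left.
have [yb|yb] := leP b y; first by rewrite f0 ?normr0 ?le_max ?lexx//; right.
rewrite le_max; apply/orP; right; apply: (HM (M + 1)); first by rewrite ltrDl.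
by exists y => //=; rewrite in_itv/= !ltW.
Qed.

(** For [k > 0] this is $1$ on $[a+1/k,b-1/k]$ and $0$ outside $]a,b[$. Both arguments are in the
    form that [elem_affine] accepts. *)
Definition cutoff (a b : R) (k : nat) y : R :=
  step (k%:R * y + - (k%:R * a)) * step (- k%:R * y + k%:R * b).

Lemma elementary_cutoff a b k : elementary (cutoff a b k).
Proof. by apply: elem_mul; apply: elem_affine; exact: elementary_step. Qed.

Lemma cutoff_ge0 a b k y : 0 <= cutoff a b k y.
Proof. by rewrite mulr_ge0 ?step_ge0. Qed.

Lemma cutoff_le1 a b k y : cutoff a b k y <= 1.
Proof.
by rewrite -[1]mulr1 ler_pM ?step_ge0 ?step_le1.
Qed.

Lemma cutoff_out a b k y : y <= a \/ b <= y -> cutoff a b k y = 0.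
Proof.
move=> [ya|yb]; rewrite /cutoff.
  by rewrite step_le0 ?mul0r// -mulrBr mulr_ge0_le0// subr_le0.
by rewrite [X in _ * X]step_le0 ?mulr0// mulNr addrC -mulrBr mulr_ge0_le0// subr_le0.
Qed.

Lemma cutoff_cvg a b y : (fun k => cutoff a b k y) @ \oo --> (\1_(`]a, b[%classic : set R) y : R).
Proof.
rewrite indicE; case: (boolP (y \in _)) => [|/negP yab].
  rewrite inE/= in_itv/= => /andP[ay yb]; rewrite /=.
  apply: cvg_near_cst; near=> k; rewrite /cutoff !step_ge1 ?mulr1//.
    rewrite mulNr addrC -mulrBr -ler_pdivrMr ?subr_gt0// mul1r.
    by near: k; exact: nbhs_infty_ger.
  rewrite -mulrBr -ler_pdivrMr ?subr_gt0// mul1r.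
  by near: k; exact: nbhs_infty_ger.
apply: cvg_near_cst; apply: nearW => k; rewrite cutoff_out//=.
have [ya|ya] := leP y a; first by left.
have [yb|yb] := leP b y; first by right.
by exfalso; apply: yab; rewrite inE/= in_itv/= ya yb.
Unshelve. all: by end_near. Qed.

End elementary_functions.

(** * Smooth functions on space-time *)

Section smooth_functions.
Context {R : realType} {d : nat}.
Local Notation E := (R * 'rV[R]_d)%type.
Implicit Types (f g phi : sfield R d) (z e : E).

Lemma is_derive_line f z e (s df : R) :
  is_derive s 1 (fun h : R => f (h *: e + z)) df <->
  is_derive (s *: e + z) e f df.
Proof.
have H : (fun h : R => h^-1 *: (((fun h : R => f (h *: e + z)) \o shift s) (h *: 1)
      - f (s *: e + z))) =
    (fun h : R => h^-1 *: ((f \o shift (s *: e + z)) (h *: e) - f (s *: e + z))).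
  by apply/funext => h /=; rewrite [h%:A]mulr1 scalerDl addrA.
by split=> -[h1 h2]; split; move: h1 h2; rewrite /derivable /derive H.
Qed.

Lemma is_derive_line0 f z e (df : R) :
  is_derive (0 : R) 1 (fun h : R => f (h *: e + z)) df <-> is_derive z e f df.
Proof. by have := is_derive_line f z e 0 df; rewrite scale0r add0r. Qed.

(** Smoothness by exhibiting a stable class: this avoids all formulas for iterated derivatives. *)
Lemma smooth_coind (C : sfield R d -> Prop) :
  (forall f, C f -> continuous f) ->
  (forall f z e, C f -> derivable f z e) ->
  (forall f e, C f -> C ('D_e f)) ->
  forall f, C f -> smooth f.
Proof.
move=> Cc Cd CD f Cf s.
suff H : C (foldr (fun e (h : sfield R d) => 'D_e h) f s).
  by split=> [|z e]; [exact: Cc|exact: Cd].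
by elim: s => [//|e s IH] /=; exact: CD.
Qed.

Lemma smooth_continuous f : smooth f -> continuous f.
Proof. by move=> /(_ [::])[]. Qed.

Lemma smooth_derivable f z e : smooth f -> derivable f z e.
Proof. by move=> /(_ [::])[]. Qed.

Lemma smooth_derive f e : smooth f -> smooth ('D_e f).
Proof.
by move=> sf s; have := sf (rcons s e); rewrite foldr_rcons.
Qed.

Lemma derive_mulE f g z e : derivable f z e -> derivable g z e ->
  'D_e (fun z => f z * g z) z = f z * 'D_e g z + g z * 'D_e f z.
Proof. by move=> df dg; exact: (deriveM df dg). Qed.

Lemma derive_addE f g z e : derivable f z e -> derivable g z e ->
  'D_e (fun z => f z + g z) z = 'D_e f z + 'D_e g z.
Proof. by move=> df dg; exact: (deriveD df dg). Qed.

(** The derivative of a product is a sum of products, so that sums and products have to be treated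
    together to obtain a class stable under derivation. *)
Inductive smooth_alg : sfield R d -> Prop :=
| smooth_alg_base f : smooth f -> smooth_alg f
| smooth_alg_add f g : smooth_alg f -> smooth_alg g ->
    smooth_alg (fun z => f z + g z)
| smooth_alg_mul f g : smooth_alg f -> smooth_alg g ->
    smooth_alg (fun z => f z * g z).

Lemma smooth_alg_smooth f : smooth_alg f -> smooth f.
Proof.
have dC g z e : smooth_alg g -> derivable g z e.
  elim=> {g} [g sg|g h _ dg _ dh|g h _ dg _ dh]; first exact: smooth_derivable.
  - exact: (derivableD dg dh).
  - exact: (derivableM dg dh).
apply: smooth_coind => {f} [f| |f e]; last 2 first.
- by move=> *; exact: dC.
- elim=> {f} [f sf|f g af Df ag Dg|f g af Df ag Dg].
  + by apply: smooth_alg_base; exact: smooth_derive.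
  + rewrite (_ : 'D_e _ = fun z => 'D_e f z + 'D_e g z); last first.
      by apply/funext => z; rewrite derive_addE//; exact: dC.
    exact: smooth_alg_add.
  + rewrite (_ : 'D_e _ = fun z => f z * 'D_e g z + g z * 'D_e f z); last first.
      by apply/funext => z; rewrite derive_mulE//; exact: dC.
    by apply: smooth_alg_add; exact: smooth_alg_mul.
- elim=> {f} [f sf|f g _ cf _ cg|f g _ cf _ cg] z; first exact: smooth_continuous.
  + by apply: cvgD; [exact: cf|exact: cg].
  + by apply: cvgM; [exact: cf|exact: cg].
Qed.

Lemma smoothD f g : smooth f -> smooth g -> smooth (fun z => f z + g z).
Proof.
by move=> sf sg; apply: smooth_alg_smooth; apply: smooth_alg_add;
  exact: smooth_alg_base.
Qed.

Lemma smoothM f g : smooth f -> smooth g -> smooth (fun z => f z * g z).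
Proof.
by move=> sf sg; apply: smooth_alg_smooth; apply: smooth_alg_mul;
  exact: smooth_alg_base.
Qed.

Lemma derive_elem_affine (g g' : R -> R) (l : E -> R) (l' : E -> R) z e :
  (forall y : R, is_derive y 1 g (g' y)) ->
  (forall (h : R) e z, l (h *: e + z) = l' e * h + l z) ->
  is_derive z e (fun z => g (l z)) (l' e * g' (l z)).
Proof.
move=> dg Hl; apply/is_derive_line0.
under eq_fun do rewrite Hl.
by apply: is_derive_affine; rewrite mulr0 add0r.
Qed.

Lemma smooth_elem (g : R -> R) (l : E -> R) (l' : E -> R) :
  elementary g -> continuous l ->
  (forall (h : R) e z, l (h *: e + z) = l' e * h + l z) ->
  smooth (fun z => g (l z)).
Proof.
move=> eg cl Hl.
apply: (@smooth_coind (fun f => exists2 g, elementary g & f = (fun z => g (l z)))).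
- move=> _ [h eh ->] z; apply: continuous_comp; first exact: cl.
  exact: elementary_continuous.
- move=> _ z e [h /elementary_derive[h' _ dh] ->].
  by have [] := derive_elem_affine z e dh Hl.
- move=> _ e [h /elementary_derive[h' eh' dh] ->].
  exists (fun y => l' e * h' y).
    by apply: elem_mul => //; exact: elem_cst.
  by apply/funext => z; have [_ ->] := derive_elem_affine z e dh Hl.
- by exists g.
Qed.

Lemma fst_affine (h : R) e z : (h *: e + z).1 = e.1 * h + z.1.
Proof. by rewrite /= mulrC. Qed.

Lemma coord_affine i (h : R) e z :
  (h *: e + z).2 ord0 i = e.2 ord0 i * h + z.2 ord0 i.
Proof. by rewrite /= !mxE mulrC. Qed.

Lemma coord_continuous i : continuous (fun z : E => z.2 ord0 i).
Proof.
move=> z; apply: (@continuous_comp _ _ _ snd (fun x : 'rV[R]_d => x ord0 i)).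
  exact: cvg_snd.
exact: coord_continuous.
Qed.

Lemma smooth_fst (g : R -> R) : elementary g -> smooth (fun z : E => g z.1).
Proof.
move=> eg; apply: (@smooth_elem g fst fst) => //; last exact: fst_affine.
by move=> z; exact: cvg_fst.
Qed.

Lemma smooth_coord (g : R -> R) i : elementary g ->
  smooth (fun z : E => g (z.2 ord0 i)).
Proof.
move=> eg; apply: (@smooth_elem g _ (fun z => z.2 ord0 i)) => //.
  exact: coord_continuous.
exact: coord_affine.
Qed.

Lemma derive_fst_t (g g' : R -> R) z : (forall y : R, is_derive y 1 g (g' y)) ->
  'D_dir_t (fun z : E => g z.1) z = g' z.1.
Proof.
move=> dg.
by have [_ ->] := derive_elem_affine z dir_t dg fst_affine; rewrite /= mul1r.
Qed.

Lemma derive_fst_x (g : R -> R) i z : 'D_(dir_x i) (fun z : E => g z.1) z = 0.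
Proof.
have [//] : is_derive z (dir_x i) (fun z : E => g z.1) 0.
apply/is_derive_line0; under eq_fun do rewrite fst_affine mul0r add0r.
exact: is_derive_cst.
Qed.

Lemma smooth_cst (c : R) : smooth (fun _ : E => c).
Proof. exact: (smooth_fst (elem_cst c)). Qed.

Lemma smoothZ (c : R) f : smooth f -> smooth (fun z => c * f z).
Proof. by apply: smoothM; exact: smooth_cst. Qed.

Lemma smooth_prod (I : Type) (r : seq I) (F : I -> sfield R d) :
  (forall i, smooth (F i)) -> smooth (fun z => \prod_(i <- r) F i z).
Proof.
move=> sF; elim: r => [|i r IH].
  rewrite (_ : (fun _ => _) = fun=> 1); first exact: smooth_cst.
  by apply/funext => z; rewrite big_nil.
rewrite (_ : (fun _ => _) = fun z => F i z * \prod_(j <- r) F j z).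
  exact: (smoothM (sF i) IH).
by apply/funext => z; rewrite big_cons.
Qed.

Lemma smooth_sum (I : Type) (r : seq I) (F : I -> sfield R d) :
  (forall i, smooth (F i)) -> smooth (fun z => \sum_(i <- r) F i z).
Proof.
move=> sF; elim: r => [|i r IH].
  rewrite (_ : (fun _ => _) = fun=> 0); first exact: smooth_cst.
  by apply/funext => z; rewrite big_nil.
rewrite (_ : (fun _ => _) = fun z => F i z + \sum_(j <- r) F j z).
  exact: (smoothD (sF i) IH).
by apply/funext => z; rewrite big_cons.
Qed.

Lemma is_derive_frozen f (t : R) e z df :
  is_derive (t, z.2) (0, e.2) f df -> is_derive z e (fun z : E => f (t, z.2)) df.
Proof.
have H : (fun h : R => h^-1 *: ((f \o shift (t, z.2)) (h *: (0, e.2)) - f (t, z.2))) =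
    (fun h : R => h^-1 *: (((fun z : E => f (t, z.2)) \o shift z) (h *: e) - f (t, z.2))).
  apply/funext => h /=; congr (_ *: (f _ - _)).
  by apply/pair_equal_spec; split => //=; rewrite scaler0 add0r.
by move=> [h1 h2]; split; move: h1 h2; rewrite /derivable /derive H.
Qed.

Lemma smooth_frozen f (t : R) : smooth f -> smooth (fun z : E => f (t, z.2)).
Proof.
move=> sf.
apply: (@smooth_coind (fun f => exists2 g, smooth g & f = (fun z => g (t, z.2)))).
- move=> _ [g sg ->] z.
  apply: (@continuous_comp _ _ _ (fun z : E => (t, z.2)) g).
    have c1 : (fun=> t) @ z --> t by exact: cvg_cst.
    have c2 : (fun z0 : E => z0.2) @ z --> z.2 by exact: cvg_snd.
    exact: cvg_pair c1 c2.
  exact: smooth_continuous.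
- move=> _ z e [g sg ->].
  by have [] := is_derive_frozen (derivableP (smooth_derivable (z := (t, z.2)) (e := (0, e.2)) sg)).
- move=> _ e [g sg ->]; exists ('D_(0, e.2) g); first exact: smooth_derive.
  apply/funext => z.
  by have [_ ->] := is_derive_frozen (derivableP (smooth_derivable (z := (t, z.2)) (e := (0, e.2)) sg)).
- by exists f.
Qed.

Lemma derive_zero_out f (C : set E) e z : closed C ->
  (forall z, ~ C z -> f z = 0) -> ~ C z -> 'D_e f z = 0.
Proof.
move=> cC f0 Cz; rewrite (@near_eq_derive _ _ _ f (cst 0)).
  by rewrite derive_cst.
have oC : open (~` C) by exact: closed_openC.
have : \near z, (~` C) z by exact: open_nbhs_nbhs.
by apply: filterS => y; exact: f0.
Qed.

Lemma E_hausdorff : hausdorff_space E.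
Proof. exact: norm_hausdorff. Qed.

Lemma test_function_derive (D : set E) f e : test_function D f ->
  test_function D ('D_e f).
Proof.
move=> [sf [C [cC CD f0]]]; split; first exact: smooth_derive.
exists C; split => // z Cz; apply: (derive_zero_out _ _ f0 Cz).
exact: compact_closed E_hausdorff cC.
Qed.

Lemma test_functionMr (D : set E) f g : smooth f -> test_function D g ->
  test_function D (fun z => f z * g z).
Proof.
move=> sf [sg [C [cC CD g0]]]; split; first exact: smoothM.
by exists C; split => // z Cz; rewrite g0// mulr0.
Qed.

Lemma test_function_out (D : set E) f z : test_function D f -> ~ D z -> f z = 0.
Proof. by move=> [_ [C [_ CD f0]]] Dz; apply: f0; exact: contra_not (CD z) Dz. Qed.

Definition box_cutoff (a0 b0 : R) (a b : 'I_d -> R) (k : nat) : sfield R d :=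
  fun z => cutoff a0 b0 k z.1 * \prod_i cutoff (a i) (b i) k (z.2 ord0 i).

Lemma smooth_box_cutoff a0 b0 a b k : smooth (box_cutoff a0 b0 a b k).
Proof.
apply: smoothM; first exact: (smooth_fst (elementary_cutoff _ _ _)).
by apply: smooth_prod => i; exact: (smooth_coord _ (elementary_cutoff _ _ _)).
Qed.

Lemma box_cutoff_ge0 a0 b0 a b k z : 0 <= box_cutoff a0 b0 a b k z.
Proof.
apply: mulr_ge0; first exact: cutoff_ge0.
by apply: prodr_ge0 => i _; exact: cutoff_ge0.
Qed.

Lemma box_cutoff_le1 a0 b0 a b k z : box_cutoff a0 b0 a b k z <= 1.
Proof.
rewrite -[1]mulr1; apply: ler_pM; rewrite ?cutoff_ge0 ?cutoff_le1//.
  by apply: prodr_ge0 => i _; exact: cutoff_ge0.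
by apply: prodr_ile1 => i _; rewrite cutoff_ge0 cutoff_le1.
Qed.

Definition box (a0 b0 : R) (a b : 'I_d -> R) : set E :=
  [set z : E | a0 < z.1 < b0 /\ forall i, a i < z.2 ord0 i < b i].

Definition cbox (a0 b0 : R) (a b : 'I_d -> R) : set E :=
  [set z : E | a0 <= z.1 <= b0 /\ forall i, a i <= z.2 ord0 i <= b i].

Lemma cbox_compact a0 b0 a b : compact (cbox a0 b0 a b).
Proof.
have := compact_setX (@segment_compact _ a0 b0)
  (@rV_compact _ _ _ (fun i => @segment_compact R (a i) (b i))).
by congr compact; apply/seteqP; split=> -[t x] /=; rewrite in_itv/= => -[t1 x1];
  split => // i; have := x1 i; rewrite in_itv.
Qed.

Lemma box_cutoff_out a0 b0 a b k z : ~ box a0 b0 a b z ->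
  box_cutoff a0 b0 a b k z = 0.
Proof.
have out (u v y : R) : ~ u < y < v -> y <= u \/ v <= y.
  move=> h; have [yu|uy] := leP y u; first by left.
  by have [vy|yv] := leP v y; [right|exfalso; apply: h; rewrite uy yv].
move=> nb; rewrite /box_cutoff.
have [z1|z1] := pselect (a0 < z.1 < b0); last first.
  by rewrite cutoff_out ?mul0r//; exact: out.
have : ~ forall i, a i < z.2 ord0 i < b i by move=> h; exact: nb.
move=> /existsNP[i hi]; rewrite (bigD1 i)//= [X in _ * (X * _)]cutoff_out ?mul0r ?mulr0//.
exact: out.
Qed.

Lemma test_box_cutoff (D : set E) a0 b0 a b k : cbox a0 b0 a b `<=` D ->
  test_function D (box_cutoff a0 b0 a b k).
Proof.
move=> BD; split; first exact: smooth_box_cutoff.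
exists (cbox a0 b0 a b); split => //; first exact: cbox_compact.
move=> z nz; apply: box_cutoff_out => -[z1 z2]; apply: nz; split => /=.
  by move: z1 => /andP[/ltW -> /ltW ->].
by move=> i; move: (z2 i) => /andP[/ltW -> /ltW ->].
Qed.

Lemma box_cutoff_cvg a0 b0 a b z :
  (fun k => box_cutoff a0 b0 a b k z) @ \oo --> (\1_(box a0 b0 a b) z : R).
Proof.
have -> : (\1_(box a0 b0 a b) z : R) =
    \1_(`]a0, b0[%classic : set R) z.1 *
    \prod_i \1_(`](a i), (b i)[%classic : set R) (z.2 ord0 i).
  have itvE (u v y : R) : \1_(`]u, v[%classic : set R) y = (u < y < v)%R%:R :> R.
    by rewrite indicE; congr ((nat_of_bool _)%:R); apply/idP/idP; rewrite inE/= in_itv.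
  rewrite itvE; under eq_bigr do rewrite itvE.
  rewrite indicE; have [zb|zb] := pselect (box a0 b0 a b z).
    by rewrite mem_set//; move: zb => [-> h]; rewrite big1 ?mulr1// => i _; rewrite h.
  rewrite memNset//=; apply/esym/eqP; rewrite mulf_eq0.
  have [z1|z1] := boolP (a0 < z.1 < b0); last by rewrite eqxx.
  have : ~ forall i, a i < z.2 ord0 i < b i by move=> h; exact: zb.
  move=> /existsNP[i /negP/negbTE hi].
  by apply/orP; right; rewrite (bigD1 i)//= hi mul0r.
apply: cvgM; first exact: cutoff_cvg.
apply: (@cvg_big _ _ _ _ _ (@mul_continuous R)) => i _.
exact: cutoff_cvg.
Qed.

End smooth_functions.

(** * Integration by parts in space-time *)

Section borel_sets.
Context {R : realType} {d : nat}.
Local Notation E := (R * 'rV[R]_d)%type.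
Local Notation ME := (measurableTypeR R * 'rV[R]_d)%type.

Lemma measurable_coord_E i :
  measurable_fun setT (fun z : ME => z.2 ord0 i : measurableTypeR R).
Proof.
by apply: (measurableT_comp (measurable_rV_coord i)); exact: measurable_snd.
Qed.

Lemma measurable_box (a0 b0 : R) (a b : 'I_d -> R) :
  measurable (box a0 b0 a b : set ME).
Proof.
have -> : (box a0 b0 a b : set ME) =
    ((fun z : ME => z.1) @^-1` `]a0, b0[%classic) `&`
    \bigcap_(i in [set: 'I_d])
      ((fun z : ME => z.2 ord0 i) @^-1` `](a i), (b i)[%classic).
  apply/seteqP; split=> z /= [z1 z2]; split; rewrite ?in_itv//=.
    by move=> i _; rewrite /= in_itv/= z2.
  by move=> i; have := z2 i I; rewrite /= in_itv.
apply: measurableI.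
  by rewrite -[X in measurable X]setTI; exact: measurable_fst.
apply: fin_bigcap_measurable => // i _.
by rewrite -[X in measurable X]setTI; exact: measurable_coord_E.
Qed.

(** The family consists of the boxes with rational center and half-width $1/(n+1)$ whose closure
    lies in $U$. It makes open sets measurable for the product sigma-algebra, and closed boxes
    inside $U$ make the box cutoffs test functions on $U$. *)
Lemma open_cover_boxes (U : set E) : open U ->
  exists (a0 b0 : nat -> R) (a b : nat -> 'I_d -> R),
    (forall n, cbox (a0 n) (b0 n) (a n) (b n) `<=` U) /\
    (forall z, U z -> exists n, box (a0 n) (b0 n) (a n) (b n) z).
Proof.
move=> oU; pose I := (rat * 'rV[rat]_d * nat)%type.
pose l0 (i : I) : R := ratr i.1.1 - i.2.+1%:R^-1.
pose r0 (i : I) : R := ratr i.1.1 + i.2.+1%:R^-1.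
pose l (i : I) j : R := ratr (i.1.2 ord0 j) - i.2.+1%:R^-1.
pose r (i : I) j : R := ratr (i.1.2 ord0 j) + i.2.+1%:R^-1.
pose good (i : I) := `[< cbox (l0 i) (r0 i) (l i) (r i) `<=` U >].
pose sel (T : Type) (f : I -> T) (x : T) (n : nat) : T :=
  if (unpickle n : option I) is Some i then if good i then f i else x else x.
(* Integers that code no admissible box are sent to the time interval $[1,0]$, hence to an empty
   box. *)
exists (sel _ l0 1), (sel _ r0 0), (sel _ l (fun=> 0)), (sel _ r (fun=> 0)); split.
  move=> n; rewrite /sel; case: unpickle => [i|]; last first.
    by move=> z [/= /andP[h1 h2]]; exfalso; lra.
  case: ifP => [/asboolP//|_ z [/= /andP[h1 h2]]]; exfalso; lra.
move=> z Uz.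
have /nbhs_ballP[e /= e0 zeU] : nbhs z U by exact: open_nbhs_nbhs.
have e2 : 0 < e / 2 by rewrite divr_gt0.
have [n _ Hn] := near_infty_natSinv_lt (PosNum e2).
have {Hn} := Hn n (leqnn n); rewrite /=; set s : R := n.+1%:R^-1 => ne.
have s0 : 0 < s by rewrite invr_gt0.
have Q (y : R) : exists q : rat, ratr q - s < y < ratr q + s.
  have [|q] := @rat_in_itvoo R (y - s) (y + s); first by lra.
  by rewrite in_itv/= => /andP[? ?]; exists q; apply/andP; split; lra.
have [q0 hq0] := Q z.1; have /choice[q hq] := fun j => Q (z.2 ord0 j).
pose i : I := (q0, \row_j q j, n).
have gi : good i.
  apply/asboolP => y [/= y1 y2]; apply: zeU.
  have near_e (u v c : R) : c - s < u < c + s -> c - s <= v <= c + s -> `|u - v| < e.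
    move: ne; rewrite ltr_norml => ne /andP[? ?] /andP[? ?].
    by apply/andP; split; lra.
  split; first exact: near_e hq0 y1.
  split => // k j; rewrite !ord1; apply: near_e (hq j) _.
  by have := y2 j; rewrite /l /r mxE.
exists (pickle i); rewrite /sel pickleK gi; split => //= j.
by rewrite /l /r mxE; exact: hq.
Qed.

Lemma open_measurable_E (U : set E) : open U -> measurable (U : set ME).
Proof.
move=> /open_cover_boxes [a0 [b0 [a [b [H1 H2]]]]].
have -> : (U : set ME) = \bigcup_n box (a0 n) (b0 n) (a n) (b n).
  apply/seteqP; split=> [z /H2[n zn]|z [n _ [z1 z2]]]; first by exists n.
  apply: (H1 n); split; first by move: z1 => /andP[/ltW -> /ltW ->].
  by move=> i; move: (z2 i) => /andP[/ltW -> /ltW ->].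
by apply: bigcupT_measurable => n; exact: measurable_box.
Qed.

Lemma continuous_measurable_E (f : E -> R) : continuous f ->
  measurable_fun setT (f : ME -> measurableTypeR R).
Proof.
move=> cf mD; apply: (measurability _ (RGenInftyO.measurableE R)) => //.
move=> _ [_ [x ->] <-]; rewrite setTI; apply: open_measurable_E.
by move/continuousP : cf; apply; exact: interval_open.
Qed.

Lemma smooth_measurable (f : sfield R d) : smooth f ->
  measurable_fun setT (f : ME -> measurableTypeR R).
Proof. by move=> /smooth_continuous; exact: continuous_measurable_E. Qed.

Definition boxes : set (set ME) :=
  [set B | exists a0 b0 a b, B = box a0 b0 a b].

Lemma boxes_setI_closed : setI_closed boxes.
Proof.
move=> _ _ [a0 [b0 [a [b ->]]]] [a0' [b0' [a' [b' ->]]]].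
exists (Num.max a0 a0'), (Num.min b0 b0'), (fun i => Num.max (a i) (a' i)),
  (fun i => Num.min (b i) (b' i)).
apply/seteqP; split=> z /=; rewrite /box/=.
  move=> [[z1 z2] [z1' z2']]; split.
    by rewrite gt_max lt_min; move: z1 z1' => /andP[-> ->] /andP[-> ->].
  move=> i; rewrite gt_max lt_min.
  by move: (z2 i) (z2' i) => /andP[-> ->] /andP[-> ->].
rewrite gt_max lt_min => -[/andP[/andP[-> ->] /andP[-> ->]] H].
by split; split => // i; move: (H i); rewrite gt_max lt_min
  => /andP[/andP[h1 h2] /andP[h3 h4]]; apply/andP.
Qed.

Lemma cover_box (z : E) : exists n : nat, forall m, (n <= m)%N ->
  box (- m%:R) m%:R (fun=> - m%:R) (fun=> m%:R) z.
Proof.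
pose M := `|z.1| + \sum_i `|z.2 ord0 i|.
have S0 : 0 <= \sum_i `|z.2 ord0 i| by apply: sumr_ge0.
exists (Num.bound M) => m Mm.
have {}Mm : M < m%:R.
  by apply: (lt_le_trans (archi_boundP _)); rewrite ?ler_nat// addr_ge0.
split; first by rewrite -ltr_norml (le_lt_trans _ Mm)// lerDl.
move=> i; rewrite -ltr_norml (le_lt_trans _ Mm)// /M (bigD1 i)//= addrCA lerDl.
by rewrite addr_ge0// sumr_ge0.
Qed.

(** Boxes form a generating system stable under intersection, as the Dynkin argument requires. A
    condition on one coordinate is a countable union of boxes whose other sides are $]-n,n[$. *)
Lemma measurable_boxes : @measurable _ ME = <<s boxes >>.
Proof.
apply/seteqP; split; last first.
  apply: smallest_sub; first exact: sigma_algebra_measurable.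
  by move=> _ [a0 [b0 [a [b ->]]]]; exact: measurable_box.
have sB : sigma_algebra setT (<<s boxes >>) by exact: smallest_sigma_algebra.
have bigcupB (F : (set ME)^nat) : (forall n, <<s boxes >> (F n)) ->
    <<s boxes >> (\bigcup_n F n) by case: sB => _ _; exact.
have coordB (f : ME -> measurableTypeR R) :
    (forall x y, exists F : (set ME)^nat, (forall n, boxes (F n)) /\
      f @^-1` `]x, y[%classic = \bigcup_n F n) ->
    forall A, measurable A -> <<s boxes >> (f @^-1` A).
  move=> Hf A; rewrite (RGenOpens.measurableE R) => mA.
  have sf := sigma_algebra_image f sB.
  have : <<s @RGenOpens.G R >> `<=` image_set_system setT f (<<s boxes >>).
    apply: smallest_sub => // _ [x [y ->]].
    have [F [FB Fxy]] := Hf x y.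
    rewrite /image_set_system /= setTI Fxy; apply: bigcupB => n.
    exact: sub_sigma_algebra.
  by move=> /(_ _ mA); rewrite /image_set_system /= setTI.
apply: smallest_sub => // _ [[A mA <-]|[A mA <-]]; rewrite setTI.
  apply: coordB mA => x y.
  exists (fun n => box x y (fun=> - n%:R) (fun=> n%:R)); split.
    by move=> n; exists x, y, (fun=> - n%:R), (fun=> n%:R).
  apply/seteqP; split=> [z|z [n _ [h _]]]; rewrite /= in_itv//=.
  by move=> zxy; have [n /(_ n (leqnn n)) [_ hn]] := cover_box z; exists n.
have coord2 i B : measurable B -> <<s boxes >> ((fun z : ME => z.2 ord0 i) @^-1` B).
  apply: coordB => x y.
  exists (fun n => box (- n%:R) n%:R (fun j => if j == i then x else - n%:R)
    (fun j => if j == i then y else n%:R)); split.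
    by move=> n; do 4 eexists; reflexivity.
  apply/seteqP; split=> [z|z [n _ [_ h]]]; rewrite /= in_itv//=; last first.
    by have := h i; rewrite eqxx.
  move=> zxy; have [n /(_ n (leqnn n)) [h1 h2]] := cover_box z; exists n => //.
  by split => // j; case: eqP => [->|].
have sf := sigma_algebra_image (snd : ME -> 'rV[R]_d) sB.
have : g_sigma_preimage (@rV_coord R d) `<=`
    image_set_system setT (snd : ME -> 'rV[R]_d) (<<s boxes >>).
  apply: smallest_sub => // B; rewrite -bigcup_seq/= => -[i _ [C mC <-]].
  by rewrite /image_set_system /= setTI setTI; exact: coord2.
by move=> /(_ _ mA); rewrite /image_set_system /= setTI.
Qed.

End borel_sets.

(** The push-forward is bundled as a measure, the form in which the uniqueness theorems for Lebesgue
    and product measures apply to it. *)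
Lemma pushforward_measure_eq {d1 d2} {T1 : measurableType d1}
    {T2 : measurableType d2} {R : realType} (m : {measure set T1 -> \bar R})
    (f : T1 -> T2) : measurable_fun setT f ->
  exists m' : {measure set T2 -> \bar R}, forall A, m' A = m (f @^-1` A).
Proof.
by move=> mf; unshelve eexists (pushforward m f).
Qed.

Lemma integral_invariant {d} {T : measurableType d} {R : realType}
    (m : {measure set T -> \bar R}) (s : T -> T) : measurable_fun setT s ->
  (forall A, measurable A -> m (s @^-1` A) = m A) ->
  forall f : T -> R, m.-integrable setT (EFin \o f) ->
  m.-integrable setT (EFin \o (f \o s)) /\
  \int[m]_z f (s z) = \int[m]_z f z.
Proof.
move=> ms sm f intf; have [m' Hm'] := pushforward_measure_eq m ms.
have Hm A : measurable A -> A `<=` setT -> m A = pushforward m s A.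
  by move=> mA _; rewrite /pushforward sm.
have /integrableP[mf fi] := intf.
have mEf : measurable_fun setT (EFin \o (f \o s)) by exact: (measurableT_comp mf ms).
have int_s : m.-integrable setT (EFin \o (f \o s)).
  apply/integrableP; split => //; move: fi; congr (_ < _)%E.
  have -> : (\int[m]_x `|(EFin \o f) x| =
      \int[pushforward m s]_x `|(EFin \o f) x|)%E.
    exact: eq_measure_integral.
  rewrite ge0_integral_pushforward ?preimage_setT//.
  exact: measurableT_comp mf.
split=> //; rewrite /Rintegral; congr fine.
have -> : (\int[m]_x (f x)%:E = \int[pushforward m s]_x (f x)%:E)%E.
  exact: eq_measure_integral.
by rewrite integral_pushforward ?preimage_setT.
Qed.

(** * Translation invariance of the Lebesgue measures *)

Section translation.
Context {R : realType}.

Lemma lebesgue_prodE {d2} {T : measurableType d2}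
    (m : {sigma_finite_measure set T -> \bar R})
    (X : set (measurableTypeR R)) (Y : set T) : measurable X -> measurable Y ->
  (@lebesgue_measure R \x m)%E (X `*` Y) = (lebesgue_measure X * m Y)%E.
Proof. by move=> mX mY; exact: product_measure1E. Qed.

Lemma lebesgue_translate (c : R) (A : set (measurableTypeR R)) : measurable A ->
  lebesgue_measure ((fun x : R => x + c) @^-1` A) = lebesgue_measure A.
Proof.
move=> mA; have mf : measurable_fun setT
    (fun x : measurableTypeR R => x + c : measurableTypeR R).
  exact: measurable_funD.
have [m' Hm'] := pushforward_measure_eq (@lebesgue_measure R) mf.
rewrite -Hm'; apply/esym; apply: lebesgue_measure_unique mA => X.
case=> -[a b] _ <-; rewrite Hm' /=.
have -> : (fun x : R => x + c) @^-1` `]a, b] = `](a - c), (b - c)]%classic.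
  by apply/seteqP; split => x; rewrite /= !in_itv/= => /andP[h1 h2];
    apply/andP; split; lra.
rewrite !lebesgue_measure_itv/= !lte_fin.
rewrite ltrD2r; case: ifP => // _; rewrite -!EFinB; congr EFin; ring.
Qed.

Lemma measurable_translate_rV d (c : 'rV[R]_d) :
  measurable_fun setT (fun x : 'rV[R]_d => x + c).
Proof.
apply: measurable_fun_rVP => i.
rewrite (_ : _ \o _ = fun x : 'rV[R]_d => rV_coord i x + c ord0 i); last first.
  by apply/funext => x; rewrite /rV_coord /= mxE.
by apply: measurable_funD => //; exact: measurable_rV_coord.
Qed.

(** Both measures agree on rectangles. The second factor carries an arbitrary invariant map [s], so
    that the lemma serves the induction on the dimension as well as space-time. *)
Lemma product_translate {d2} {T : measurableType d2}
    (m : {sigma_finite_measure set T -> \bar R}) (s : T -> T) (c : R) :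
  measurable_fun setT s -> (forall A, measurable A -> m (s @^-1` A) = m A) ->
  forall A : set (measurableTypeR R * T), measurable A ->
  (@lebesgue_measure R \x m)%E ((fun p => (p.1 + c, s p.2)) @^-1` A) =
  (@lebesgue_measure R \x m)%E A.
Proof.
move=> ms sm A mA.
have mf : measurable_fun setT (fun p : measurableTypeR R * T =>
    (p.1 + c, s p.2) : measurableTypeR R * T).
  apply/measurable_fun_pairP; split.
    by apply: measurable_funD => //; exact: measurable_fst.
  by apply: (measurableT_comp ms); exact: measurable_snd.
have [m' Hm'] := pushforward_measure_eq (@lebesgue_measure R \x m)%E mf.
rewrite -Hm'; apply/esym; apply: product_measure_unique mA => X Y mX mY.
rewrite Hm'.
have -> : (fun p : measurableTypeR R * T => (p.1 + c, s p.2)) @^-1` (X `*` Y) =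
    ((fun x : R => x + c) @^-1` X) `*` (s @^-1` Y) by [].
have ms' : measurable (s @^-1` Y).
  by rewrite -[X in measurable X]setTI; exact: ms.
have mc : measurable ((fun x : R => x + c) @^-1` X : set (measurableTypeR R)).
  have mc : measurable_fun setT
    (fun x : measurableTypeR R => x + c : measurableTypeR R).
    exact: measurable_funD.
  by rewrite -[X in measurable X]setTI; exact: mc.
apply: (etrans (lebesgue_prodE m mc ms')).
by rewrite sm// lebesgue_translate.
Qed.

Lemma lebesgue_rV_translate d (c : 'rV[R]_d) (A : set 'rV[R]_d) : measurable A ->
  lebesgue_rV d ((fun x => x + c) @^-1` A) = lebesgue_rV d A.
Proof.
elim: d c A => [|d IH] c A mA.
  by congr (lebesgue_rV 0 _); apply/seteqP; split=> x /=;
    by rewrite (_ : x + c = x)//; apply/rowP => -[].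
pose c' : 'rV[R]_d := \row_i c ord0 (lift ord0 i).
rewrite /= /lebesgue_rV_step /pushforward.
have -> : @rV_cons R d @^-1` ((fun x => x + c) @^-1` A) =
    (fun p => (p.1 + c ord0 ord0, p.2 + c')) @^-1` (@rV_cons R d @^-1` A).
  apply/seteqP; split => -[t x] /=; rewrite (_ : rV_cons (t, x) + c =
    rV_cons (t + c ord0 ord0, x + c'))//; apply/rowP => i; rewrite mxE;
  by case: (unliftP ord0 i) => [j|] ->; rewrite ?rV_consE ?rV_consE0 ?mxE.
have mcA : measurable (@rV_cons R d @^-1` A).
  by rewrite -[X in measurable X]setTI; exact: measurable_rV_cons.
exact: (product_translate (c ord0 ord0) (measurable_translate_rV c') (IH c') mcA).
Qed.

Context {d : nat}.
Local Notation E := (R * 'rV[R]_d)%type.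
Local Notation ME := (measurableTypeR R * 'rV[R]_d)%type.
Local Notation mu := (@leb_tx R d).

Lemma leb_tx_translate (c : E) (A : set ME) : measurable A ->
  mu ((fun z : E => z + c) @^-1` A) = mu A.
Proof.
move=> mA.
exact: (product_translate c.1 (measurable_translate_rV c.2)
  (@lebesgue_rV_translate d c.2) mA).
Qed.

Lemma measurable_translate_E (c : E) :
  measurable_fun setT (fun z : ME => z + c : ME).
Proof.
apply/measurable_fun_pairP; split.
  have : measurable_fun setT (fun z : ME => z.1 + c.1 : measurableTypeR R).
    by apply: measurable_funD => //; exact: measurable_fst.
  exact.
have : measurable_fun setT (fun z : ME => z.2 + c.2 : 'rV[R]_d).
  apply: (measurableT_comp (measurable_translate_rV c.2)); exact: measurable_snd.
exact.
Qed.

Lemma integral_translate (f : ME -> R) (c : E) :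
  mu.-integrable setT (EFin \o f) ->
  mu.-integrable setT (EFin \o (fun z : ME => f (z + c))) /\
  \int[mu]_z f (z + c) = \int[mu]_z f z.
Proof.
exact: (integral_invariant (measurable_translate_E c) (leb_tx_translate c)).
Qed.

Lemma measurable_rV_box (A : 'I_d -> set (measurableTypeR R)) :
  (forall i, measurable (A i)) ->
  measurable [set x : 'rV[R]_d | forall i, A i (x ord0 i)].
Proof.
move=> mA; rewrite (_ : mkset _ = \bigcap_(i in [set: 'I_d])
    (@rV_coord R d i @^-1` A i)); last first.
  by apply/seteqP; split => [x h i _|x h i]; [exact: h|exact: (h i I)].
apply: fin_bigcap_measurable => // i _.
by rewrite -[X in measurable X]setTI; exact: measurable_rV_coord.
Qed.

Lemma leb_x_box_lty (a b : 'I_d -> R) :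
  (leb_x [set x : 'rV[R]_d | forall i, (a i < x ord0 i < b i)%R] < +oo)%E.
Proof.
rewrite (_ : mkset _ =
  [set x : 'rV[R]_d | forall i, `](a i), (b i)[%classic (x ord0 i)]); last first.
  by apply/seteqP; split => x h i; move: (h i); rewrite /= in_itv.
set B := mkset _; suff : (lebesgue_rV d B < +oo)%E by [].
have mi i : measurable (`](a i), (b i)[%classic : set (measurableTypeR R)) by [].
rewrite (lebesgue_rV_box mi).
apply: (@proj2 (0%E <= _)%E); apply: (big_ind (fun x : \bar R => (0 <= x)%E /\ (x < +oo)%E)).
- by split; rewrite ?lee_fin ?ltry.
- move=> x y [x0 xoo] [y0 yoo]; split; first exact: mule_ge0.
  by rewrite lte_mul_pinfty// ge0_fin_numE.
- move=> i _; split; first exact: measure_ge0.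
  by rewrite lebesgue_measure_itv/=; case: ifP; rewrite -?EFinB ?ltry.
Qed.

Lemma leb_tx_box_lty (a0 b0 : R) (a b : 'I_d -> R) :
  (mu (box a0 b0 a b) < +oo)%E.
Proof.
rewrite (_ : box a0 b0 a b = `]a0, b0[%classic `*`
    [set x : 'rV[R]_d | forall i, a i < x ord0 i < b i]); last first.
  by apply/seteqP; split => z [/= z1 z2]; split => //=; move: z1; rewrite in_itv.
have mB : measurable [set x : 'rV[R]_d | forall i, (a i < x ord0 i < b i)%R].
  have := @measurable_rV_box (fun i => `](a i), (b i)[%classic) (fun i => measurable_itv _).
  by congr measurable; apply/seteqP; split => x h i; move: (h i); rewrite /= in_itv.
have mI : measurable (`]a0, b0[%classic : set (measurableTypeR R)) by [].
apply: (eq_ind_r (fun x => (x < +oo)%E) _ (lebesgue_prodE (lebesgue_rV d) mI mB)).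
apply: lte_mul_pinfty => //; last exact: leb_x_box_lty.
by rewrite lebesgue_measure_itv/=; case: ifP.
Qed.

End translation.

Lemma Rintegral_dominated {d} {T : measurableType d} {R : realType}
    (mu : {measure set T -> \bar R}) (D : set T) (f_ : nat -> T -> R)
    (f g : T -> R) : measurable D ->
  (forall n, measurable_fun D (f_ n)) -> measurable_fun D f ->
  (forall x, D x -> (fun n => f_ n x) @ \oo --> f x) ->
  mu.-integrable D (EFin \o g) ->
  (forall n x, D x -> `|f_ n x| <= g x) ->
  (fun n => \int[mu]_(x in D) f_ n x) @ \oo --> \int[mu]_(x in D) f x.
Proof.
move=> mD mf_ mf f_f ig f_g.
have [|||||i0 _ H] := @dominated_convergence _ _ _ mu D mD
    (fun n x => (f_ n x)%:E) (fun x => (f x)%:E) (EFin \o g).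
- by move=> n; exact/measurable_EFinP.
- exact/measurable_EFinP.
- by apply: aeW => x Dx; apply: cvg_EFin; [exact: nearW|exact: f_f].
- exact: ig.
- by apply: aeW => x n Dx; rewrite /= lee_fin f_g.
- rewrite /Rintegral; apply: fine_cvg; move: H; rewrite fineK//.
  exact: (integrable_fin_num mD i0).
Qed.

Lemma ipL2_dominated_cst {d} {T : measurableType d} {R : realType}
    (mu : {measure set T -> \bar R}) (D : set T) (f : T -> R)
    (phi_ : nat -> T -> R) (phi h : T -> R) (c : R) : measurable D ->
  inL2 mu D f -> inL2 mu D h -> (forall n, measurable_fun D (phi_ n)) ->
  (forall n x, D x -> `|phi_ n x| <= h x) -> measurable_fun D phi ->
  (forall x, D x -> phi_ ^~ x @ \oo --> phi x) ->
  (forall n, ipL2 mu D f (phi_ n) = c) -> ipL2 mu D f phi = c.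
Proof.
move=> mD fL hL mphi_ phih mphi cphi H.
have /cvg_lim <- // := ipL2_dominated mD fL hL mphi_ phih mphi cphi.
by under eq_fun do rewrite H; rewrite lim_cst.
Qed.

Section integration_by_parts.
Context {R : realType} {d : nat}.
Local Notation E := (R * 'rV[R]_d)%type.
Local Notation ME := (measurableTypeR R * 'rV[R]_d)%type.
Local Notation mu := (@leb_tx R d).
Implicit Types (z e : E) (N : R) (D : set E).

Definition cube N : set E := cbox (- N) N (fun=> - N) (fun=> N).

Lemma cubeP N z : cube N z <-> `|z.1| <= N /\ forall i, `|z.2 ord0 i| <= N.
Proof.
by split=> -[z1 z2]; split=> [|i]; move: z1 z2; rewrite ler_norml// => z1 z2;
  have := z2 i; rewrite ler_norml.
Qed.

Lemma sub_cube N N' : N <= N' -> cube N `<=` cube N'.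
Proof.
move=> NN z /cubeP[z1 z2]; apply/cubeP.
by split=> [|i]; apply: le_trans NN; [exact: z1|exact: z2].
Qed.

Lemma cube_compact N : compact (cube N).
Proof. exact: cbox_compact. Qed.

Lemma cube_closed N : closed (cube N).
Proof. by apply: (compact_closed (@E_hausdorff R d)); exact: cube_compact. Qed.

Lemma measurable_cube N : measurable (cube N : set ME).
Proof.
rewrite -[X in measurable X]setCK; apply: measurableC.
by apply: open_measurable_E; apply: closed_openC; exact: cube_closed.
Qed.

Lemma coord_norm_le (x : 'rV[R]_d) i : `|x ord0 i| <= `|x|.
Proof.
rewrite [leRHS]mx_normrE.
by apply: (@le_bigmax _ _ _ 0 (fun i : 'I_1 * 'I_d => `|x i.1 i.2|) (ord0, i)).
Qed.

Lemma compact_sub_cube (K : set E) : compact K -> exists N, K `<=` cube N.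
Proof.
move=> /compact_bounded [M [_ HM]]; exists (M + 1) => z Kz.
have {HM}zM : `|z| <= M + 1 by apply: (HM (M + 1)); rewrite ?ltrDl.
have zE : `|z| = Num.max `|z.1| `|z.2| by [].
move: zM; rewrite zE ge_max => /andP[z1 z2]; apply/cubeP; split => // i.
exact: le_trans (coord_norm_le _ _) z2.
Qed.

Lemma bounded_coord (A : set 'rV[R]_d) : bounded_set A ->
  exists N, 0 <= N /\ forall x i, A x -> `|x ord0 i| <= N.
Proof.
move=> [M [_ HM]]; exists (Num.max 0 (M + 1)); rewrite le_max lexx; split => // x i Ax.
rewrite le_max; apply/orP; right; apply: le_trans (coord_norm_le _ _) _.
by apply: (HM (M + 1)); rewrite ?ltrDl.
Qed.

Lemma leb_cube_lty N : (mu (cube N) < +oo)%E.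
Proof.
apply: le_lt_trans (leb_tx_box_lty (- (N + 1)) (N + 1) (fun=> - (N + 1)) (fun=> N + 1)).
apply: le_measure; rewrite ?inE; [exact: measurable_cube|exact: measurable_box|].
by move=> z /cubeP[z1 z2]; split=> [|i]; rewrite -ltr_norml (le_lt_trans _ (_ : N < N + 1))// ltrDl.
Qed.

Lemma continuous_bounded_cube (f : E -> R) N : continuous f ->
  exists M : R, 0 <= M /\ forall z, cube N z -> `|f z| <= M.
Proof.
move=> cf; have : compact (f @` cube N).
  by apply: continuous_compact; [exact: continuous_subspaceT|exact: cube_compact].
move=> /compact_bounded [M [_ HM]].
exists (Num.max 0 (M + 1)); rewrite le_max lexx; split => // z Nz.
rewrite le_max; apply/orP; right; apply: (HM (M + 1)); first by rewrite ltrDl.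
by exists z.
Qed.

(* The integrals of the difference quotients vanish by translation
   invariance, and they converge to the integral of the derivative. *)
Lemma integral_derive0 (G : E -> R) e N M M' :
  measurable_fun setT (G : ME -> R) -> (forall z, derivable G z e) ->
  measurable_fun setT ('D_e G : ME -> R) ->
  (forall z, `|G z| <= M') -> (forall z, `|'D_e G z| <= M) ->
  (forall z, ~ cube N z -> G z = 0) -> \int[mu]_z 'D_e G z = 0.
Proof.
move=> mG dG mDG GM' DGM G0.
(* The step lengths [c n] are at most $1$, so this cube contains the supports of all difference
   quotients. *)
pose N' : R := `|N| + `|e.1| + \sum_i `|e.2 ord0 i|.
have S0 : 0 <= \sum_i `|e.2 ord0 i| by apply: sumr_ge0.
have iG : mu.-integrable setT (EFin \o (G : ME -> R)).
  have -> : EFin \o G = (EFin \o G) \_ (cube N) :> (ME -> \bar R).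
    apply/funext => z; rewrite patchE; case: ifPn => //.
    by rewrite notin_setE => /G0 /= ->.
  apply/(integrable_mkcond _ (measurable_cube N)).
  apply: measurable_bounded_integrable.
  - exact: measurable_cube.
  - exact: leb_cube_lty.
  - exact: measurable_funS mG.
  - by exists M'; split; rewrite ?num_real// => y My z _; exact: le_trans (GM' z) (ltW My).
pose c (n : nat) : R := n.+1%:R^-1.
have c0 n : 0 < c n by rewrite invr_gt0.
have c1 n : c n <= 1 by rewrite invf_le1 ?ler1n.
pose q n (z : ME) : R := (c n)^-1 * (G (z + c n *: e) - G z).
have q0 n : \int[mu]_z q n z = 0.
  have [iGc Gc] := integral_translate (c n *: e) iG.
  rewrite /q RintegralZl//; last by apply: (integrableB _ iGc iG).
  by rewrite RintegralB// Gc subrr mulr0.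
have qout n z : ~ cube N' z -> q n z = 0.
  move=> nz; rewrite /q !G0 ?subrr ?mulr0//.
    move=> hz; apply: nz; apply: sub_cube hz.
    by rewrite /N' (le_trans (ler_norm N))// -addrA lerDl addr_ge0.
  move=> /cubeP[h1 h2]; apply: nz; apply/cubeP.
  have ce (u : R) : `|c n * u| <= `|u|.
    by rewrite normrM ger0_norm ?(ltW (c0 n))// ler_piMl.
  have tri (u v : R) : `|u| <= `|u + v| + `|v|.
    by rewrite -{1}[u](addrK v) -[in leRHS](normrN v) ler_normD.
  split.
    apply: le_trans (tri _ (c n * e.1)) _.
    apply: (@le_trans _ _ (`|N| + `|e.1|)); last by rewrite /N' lerDl.
    by rewrite lerD//; exact: le_trans h1 (ler_norm _).
  move=> i; apply: le_trans (tri _ (c n * e.2 ord0 i)) _.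
  apply: (@le_trans _ _ (`|N| + `|e.2 ord0 i|)).
    rewrite lerD//; apply: le_trans (ler_norm _).
    by have := h2 i; rewrite /= !mxE.
  rewrite /N' -addrA lerD2l (bigD1 i)//= addrCA lerDl addr_ge0//.
  by rewrite sumr_ge0.
(* The mean value theorem along the segment from [z] to [z + c n *: e] gives a bound uniform in [n],
   hence a dominating function. *)
have qM n z : `|q n z| <= M.
  have Hd (s : R) : is_derive s 1 (fun h : R => G (h *: e + z)) ('D_e G (s *: e + z)).
    by apply/is_derive_line; exact: derivableP.
  have ch : {within `[0, c n], continuous (fun h : R => G (h *: e + z))}.
    by apply: continuous_subspaceT => s; exact: is_derive_continuous Hd s.
  have [s _] := MVT_segment (ltW (c0 n)) (fun s _ => Hd s) ch.
  rewrite scale0r add0r subr0 => H.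
  rewrite /q (addrC z) H mulrC mulfK; first exact: DGM.
  by rewrite gt_eqF.
have M0 : 0 <= M by exact: le_trans (normr_ge0 _) (DGM 0).
have mq n : measurable_fun setT (q n).
  apply: measurable_funM => //; apply: measurable_funB => //.
  exact: (measurableT_comp mG (measurable_translate_E (c n *: e))).
have qD z : (fun n => q n z) @ \oo --> 'D_e G z.
  have : (fun h => h^-1 *: ((G \o shift z) (h *: e) - G z)) @ 0^' --> 'D_e G z.
    exact: dG.
  have cc : c @ \oo --> (0 : R)^'.
    move=> A [r r0 HA]; have := @cvg_harmonic R => /cvgrPdist_lt /(_ r r0).
    apply: filterS => n; rewrite sub0r normrN => hn; apply: HA => /=.
      by rewrite sub0r normrN.
    by rewrite gt_eqF// c0.
  move=> /(cvg_comp _ _ cc) H.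
  rewrite (_ : (fun n => q n z) =
    (fun h => h^-1 *: ((G \o shift z) (h *: e) - G z)) \o c); first exact: H.
  by apply/funext => n; rewrite /q /= (addrC z).
have mN' := measurable_cube N'.
pose g (z : ME) : R := M * \1_(cube N' : set ME) z.
have ig : mu.-integrable setT (EFin \o g).
  have -> : EFin \o g = (cst M%:E) \_ (cube N').
    apply/funext => z; rewrite /g /= patchE indicE.
    by case: ifPn => hz; rewrite ?(negbTE hz) ?hz ?mulr1 ?mulr0.
  apply/(integrable_mkcond _ mN').
  apply: measurable_bounded_integrable => //; first exact: leb_cube_lty.
  exact: bounded_cst.
have qg n z : `|q n z| <= g z.
  rewrite /g /= indicE; case: (boolP (z \in _)) => hz; first by rewrite mulr1.
  by rewrite qout ?normr0 ?mulr0//; move: hz; rewrite notin_setE.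
have H := Rintegral_dominated measurableT mq mDG (fun z _ => qD z) ig
  (fun n z _ => qg n z).
rewrite -(cvg_lim _ H)//; under eq_fun do rewrite q0.
by rewrite lim_cst.
Qed.

Lemma integral_derive_test (psi : sfield R d) e (K : set E) : smooth psi ->
  compact K -> (forall z, ~ K z -> psi z = 0) -> \int[mu]_z 'D_e psi z = 0.
Proof.
move=> sp cK p0; have [N KN] := compact_sub_cube cK.
have [M [M0 HM]] := continuous_bounded_cube N (smooth_continuous (smooth_derive e sp)).
have [M' [M0' HM']] := continuous_bounded_cube N (smooth_continuous sp).
have out z : ~ cube N z -> psi z = 0 by move=> nz; apply: p0; exact: contra_not (KN z) nz.
apply: (@integral_derive0 _ _ N M M') => //.
- exact: smooth_measurable.
- by move=> z; exact: smooth_derivable.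
- exact: smooth_measurable (smooth_derive e sp).
- move=> z; have [/HM'//|nz] := pselect (cube N z).
  by rewrite out ?normr0.
- move=> z; have [/HM//|nz] := pselect (cube N z).
  by rewrite (derive_zero_out _ (@cube_closed N) out nz) normr0.
Qed.

Lemma measurable_cylinder (T : R) (Omega : set 'rV[R]_d) :
  measurable (Omega : set 'rV[R]_d) -> measurable (cylinder T Omega : set ME).
Proof.
move=> mO; rewrite (_ : (cylinder T Omega : set ME) = `]0, T[%classic `*` Omega).
  exact: measurableX.
by apply/seteqP; split => z /= [h1 h2]; split => //; move: h1; rewrite in_itv.
Qed.

Lemma Rintegral_setT_restrict (D : set ME) (f : ME -> R) :
  (forall z, ~ D z -> f z = 0) -> \int[mu]_z f z = \int[mu]_(z in D) f z.
Proof.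
move=> f0; rewrite [RHS]Rintegral_mkcond; apply: eq_Rintegral => z _.
by rewrite patchE; case: ifPn => //; rewrite notin_setE => /f0.
Qed.

Lemma inL2_bounded (D : set ME) (f : sfield R d) N M : measurable D ->
  D `<=` cube N -> measurable_fun D (f : ME -> R) ->
  (forall z, D z -> `|f z| <= M) -> inL2 mu D f.
Proof.
move=> mD DN mf fM; apply/inL2P => //; split => //.
apply: (measurable_bounded_integrable mD).
- apply: le_lt_trans (leb_cube_lty N).
  by apply: le_measure; rewrite ?inE//; exact: measurable_cube.
- exact: measurable_funX.
- exists (M ^+ 2); split; rewrite ?num_real// => y My z Dz.
  rewrite /= normrX (le_trans _ (ltW My))//.
  by rewrite lerXn2r ?nnegrE ?normr_ge0// ?fM// (le_trans (normr_ge0 _) (fM z Dz)).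
Qed.

Lemma smooth_inL2 (D : set ME) (f : sfield R d) N : measurable D ->
  D `<=` cube N -> smooth f -> inL2 mu D f.
Proof.
move=> mD DN sf.
have [M [M0 HM]] := continuous_bounded_cube N (smooth_continuous sf).
apply: (inL2_bounded mD DN (M := M)); last by move=> z /DN; exact: HM.
exact: measurable_funS (smooth_measurable sf).
Qed.

Lemma ipL2_derive_test (D : set ME) N (chi phi : sfield R d) e : measurable D ->
  D `<=` cube N -> smooth chi -> test_function D phi ->
  ipL2 mu D chi ('D_e phi) = - ipL2 mu D ('D_e chi) phi.
Proof.
move=> mD DN sc tp; have sp := tp.1; have := tp => -[_ [C [cC CD p0]]].
have p0' z : ~ C z -> chi z * phi z = 0 by move=> nz; rewrite p0 ?mulr0.
have := integral_derive_test e (smoothM sc sp) cC p0'.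
rewrite (_ : 'D_e _ = fun z => chi z * 'D_e phi z + 'D_e chi z * phi z); last first.
  apply/funext => z; rewrite derive_mulE; [|exact: smooth_derivable..].
  by rewrite [phi z * _]mulrC.
have tp' := test_function_derive e tp.
rewrite (Rintegral_setT_restrict (D := D)); last first.
  by move=> z nz; rewrite (test_function_out tp nz) (test_function_out tp' nz) !mulr0 addr0.
rewrite RintegralD//; last 2 first.
- exact: (inL2M mD (smooth_inL2 mD DN sc) (smooth_inL2 mD DN (smooth_derive e sp))).
- exact: (inL2M mD (smooth_inL2 mD DN (smooth_derive e sc)) (smooth_inL2 mD DN sp)).
by move=> /eqP; rewrite addr_eq0 => /eqP.
Qed.

(** The support is compact in $x$ only, with no restriction in $t$: this is what remains of a test
    function once its time is frozen. *)
Definition lateral (Omega : set 'rV[R]_d) (phi : sfield R d) : Prop :=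
  smooth phi /\ exists C, [/\ compact C, C `<=` Omega & forall z, ~ C z.2 -> phi z = 0].

Lemma test_lateral (T : R) (Omega : set 'rV[R]_d) phi :
  test_function (cylinder T Omega) phi -> lateral Omega phi.
Proof.
move=> [sp [C [cC CQ p0]]]; split => //.
exists (snd @` C); split.
- apply: (@continuous_compact _ _ snd) => //; apply: continuous_subspaceT => z.
  exact: cvg_snd.
- by move=> _ [z Cz <-]; case: (CQ z Cz).
- by move=> z nz; apply: p0 => Cz; apply: nz; exists z.
Qed.

Lemma lateral_frozen (Omega : set 'rV[R]_d) phi t : lateral Omega phi ->
  lateral Omega (fun z : E => phi (t, z.2)).
Proof.
move=> [sp [C [cC CO p0]]]; split; first exact: smooth_frozen.
by exists C; split => // z nz; exact: p0.
Qed.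

Lemma lateralMr (Omega : set 'rV[R]_d) f phi : smooth f -> lateral Omega phi ->
  lateral Omega (fun z => f z * phi z).
Proof.
move=> sf [sp [C [cC CO p0]]]; split; first exact: smoothM.
by exists C; split => // z nz; rewrite p0 ?mulr0.
Qed.

Lemma lateral_out (Omega : set 'rV[R]_d) phi z : lateral Omega phi ->
  ~ Omega z.2 -> phi z = 0.
Proof. by move=> [_ [C [_ CO p0]]] nz; apply: p0; exact: contra_not (CO _) nz. Qed.

Lemma lateral_derive (Omega : set 'rV[R]_d) phi e : lateral Omega phi ->
  lateral Omega ('D_e phi).
Proof.
move=> [sp [C [cC CO p0]]]; split; first exact: smooth_derive.
exists C; split => // z nz; apply: (@derive_zero_out _ _ phi (snd @^-1` C)) => //.
have clC : closed C by apply: compact_closed cC; exact: norm_hausdorff.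
by apply: (@closed_comp _ _ snd) => // x _; exact: cvg_snd.
Qed.

Lemma cylinder_sub_cube (T : R) (Omega : set 'rV[R]_d) : bounded_set Omega ->
  exists N, cylinder T Omega `<=` cube N.
Proof.
move=> /bounded_coord[N [N0 HN]]; exists (`|T| + N) => z [/andP[z0 zT] Oz].
apply/cubeP; split => [|i]; last by apply: le_trans (HN _ i Oz) _; rewrite lerDr.
rewrite ger0_norm ?(ltW z0)// (le_trans (ltW zT))// (le_trans (ler_norm T))//.
by rewrite lerDl.
Qed.

(** The product is cut off in time by the indicator of $]0,T[$. It becomes discontinuous, but the
    indicator is constant along the direction $x_i$, and [integral_derive0] asks only for a bounded
    measurable function that is derivable in that direction. *)
Lemma ipL2_derive_lateral (T : R) (Omega : set 'rV[R]_d) (chi phi : sfield R d) i :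
  measurable Omega -> bounded_set Omega -> smooth chi -> lateral Omega phi ->
  ipL2 mu (cylinder T Omega) chi ('D_(dir_x i) phi) =
  - ipL2 mu (cylinder T Omega) ('D_(dir_x i) chi) phi.
Proof.
move=> mO bO sc lp; have [sp _] := lp; set e := dir_x i.
have mQ := measurable_cylinder T mO; have [N QN] := cylinder_sub_cube T bO.
have spsi := smoothM sc sp; set psi := fun z => chi z * phi z in spsi.
pose G (z : ME) : R := \1_(`]0, T[%classic : set R) z.1 * psi z.
have dG z : is_derive (z : E) e (G : E -> R) (\1_(`]0, T[%classic : set R) z.1 * 'D_e psi z).
  apply/is_derive_line0.
  rewrite (_ : (fun h => _) = (fun h : R => \1_(`]0, T[%classic : set R) z.1 *
    psi (h *: e + z))); last first.
    by apply/funext => h; rewrite /G (_ : (h *: e + z).1 = z.1)//= scaler0 add0r.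
  have := (is_derive_line0 psi z e _).2 (derivableP (smooth_derivable (z:=z) (e:=e) spsi)).
  by move=> H; exact: (is_deriveZ (\1_(`]0, T[%classic : set R) z.1) H).
have lpsi : lateral Omega psi by exact: lateralMr.
have outG z : ~ cube N z -> G z = 0.
  move=> nz; rewrite /G indicE.
  case: (boolP (_ \in _)) => h; last by rewrite mul0r.
  rewrite mul1r (lateral_out lpsi)// => Oz; apply: nz; apply: QN; split => //.
  by move: h; rewrite inE/= in_itv.
have outDG z : ~ cube N z -> \1_(`]0, T[%classic : set R) z.1 * 'D_e psi z = 0.
  move=> nz; rewrite indicE.
  case: (boolP (_ \in _)) => h; last by rewrite mul0r.
  rewrite mul1r (lateral_out (lateral_derive e lpsi))// => Oz; apply: nz; apply: QN; split => //.
  by move: h; rewrite inE/= in_itv.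
have ind1 (t : R) : `|\1_(`]0, T[%classic : set R) t : R| <= 1.
  by rewrite indicE; case: (_ \in _); rewrite ?normr1 ?normr0.
have mind : measurable_fun setT (fun z : ME => \1_(`]0, T[%classic : set R) z.1 : R).
  have m1 : measurable_fun setT (\1_(`]0, T[%classic) : measurableTypeR R -> R).
    exact: measurable_indic.
  by apply: (measurableT_comp m1); exact: measurable_fst.
have [M [M0 HM]] := continuous_bounded_cube N (smooth_continuous (smooth_derive e spsi)).
have [M' [M0' HM']] := continuous_bounded_cube N (smooth_continuous spsi).
have DGE : 'D_e (G : E -> R) = fun z => \1_(`]0, T[%classic : set R) z.1 * 'D_e psi z.
  by apply/funext => z; have [_ ->] := dG z.
have DGz z : 'D_e (G : E -> R) z = \1_(`]0, T[%classic : set R) z.1 * 'D_e psi z.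
  by have [_ ->] := dG z.
have := @integral_derive0 G e N M M'; rewrite DGE.
have bnd (u v w : R) : `|u| <= 1 -> `|v| <= w -> `|u * v| <= w.
  by move=> u1 vw; rewrite normrM (le_trans _ vw)// ler_piMl.
move=> /(_ _ _ _ _ _ outG) H.
have {H} : \int[mu]_z (\1_(`]0, T[%classic : set R) z.1 * 'D_e psi z) = 0.
  apply: H.
  - by apply: measurable_funM => //; exact: smooth_measurable.
  - by move=> z; have [] := dG z.
  - by apply: measurable_funM => //; exact: (smooth_measurable (smooth_derive e spsi)).
  - move=> z; have [/HM'|nz] := pselect (cube N z); first exact: bnd.
    by rewrite outG ?normr0.
  - move=> z; rewrite ?DGz; have [/HM|nz] := pselect (cube N z); first exact: bnd.
    by rewrite outDG ?normr0.
rewrite (Rintegral_setT_restrict (D := cylinder T Omega)); last first.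
  move=> z nz; rewrite indicE.
  case: (boolP (_ \in _)) => h; last by rewrite mul0r.
  rewrite mul1r (lateral_out (lateral_derive e lpsi))// => Oz; apply: nz; split => //.
  by move: h; rewrite inE/= in_itv.
rewrite (@eq_Rintegral _ _ _ mu _ (fun z => chi z * 'D_e phi z + 'D_e chi z * phi z)); last first.
  move=> z; rewrite inE => -[z1 _]; rewrite indicE mem_set/= ?in_itv// mul1r.
  by rewrite derive_mulE; [rewrite [phi z * _]mulrC|exact: smooth_derivable..].
rewrite RintegralD//; last 2 first.
- exact: (inL2M mQ (smooth_inL2 mQ QN sc) (smooth_inL2 mQ QN (smooth_derive e sp))).
- exact: (inL2M mQ (smooth_inL2 mQ QN (smooth_derive e sc)) (smooth_inL2 mQ QN sp)).
by move=> /eqP; rewrite addr_eq0 => /eqP.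
Qed.

Lemma measurable_cbox_sub (D : set E) a0 b0 a b : cbox a0 b0 a b `<=` D ->
  forall a0' b0' a' b', exists a0'' b0'' a'' b'',
  cbox a0'' b0'' a'' b'' `<=` D /\
  (box a0'' b0'' a'' b'' : set E) = box a0 b0 a b `&` box a0' b0' a' b'.
Proof.
move=> BD a0' b0' a' b'.
exists (Num.max a0 a0'), (Num.min b0 b0'), (fun i => Num.max (a i) (a' i)),
  (fun i => Num.min (b i) (b' i)); split.
  move=> z [/= z1 z2]; apply: BD; split.
    by move: z1; rewrite ge_max le_min => /andP[/andP[-> _] /andP[-> _]].
  by move=> i; move: (z2 i); rewrite ge_max le_min => /andP[/andP[-> _] /andP[-> _]].
apply/seteqP; split=> z /=; rewrite /box/=; last first.
  move=> [[z1 z2] [z1' z2']]; split.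
    by rewrite gt_max lt_min; move: z1 z1' => /andP[-> ->] /andP[-> ->].
  move=> i; rewrite gt_max lt_min.
  by move: (z2 i) (z2' i) => /andP[-> ->] /andP[-> ->].
rewrite gt_max lt_min => -[/andP[/andP[-> ->] /andP[-> ->]] H].
by split; split => // i; move: (H i); rewrite gt_max lt_min
  => /andP[/andP[h1 h2] /andP[h3 h4]]; apply/andP.
Qed.

Lemma ae_bigcup (D : set ME) (f : ME -> R) (B : nat -> set ME) :
  D `<=` \bigcup_n B n ->
  (forall n, {ae mu, forall z, D z -> f z * \1_(B n) z = 0}) ->
  {ae mu, forall z, D z -> f z = 0}.
Proof.
move=> DB H; have /ae_foralln := H; apply: filterS => z hz Dz.
have [n _ Bz] := DB z Dz; have := hz n Dz.
by rewrite indicE mem_set// mulr1.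
Qed.

(* The sets on which g has zero mean form a Dynkin system. *)
Lemma box_total (D : set E) (g : sfield R d) N : open D ->
  D `<=` cube N -> inL2 mu D g ->
  (forall a0 b0 a b, cbox a0 b0 a b `<=` D ->
    ipL2 mu D g (\1_(box a0 b0 a b)) = 0) ->
  eqL2 mu D g (fun=> 0).
Proof.
move=> oD DN gL boxE; have mD := open_measurable_E oD.
have [a0 [b0 [a [b [Bsub Bcov]]]]] := open_cover_boxes oD.
pose B n : set ME := box (a0 n) (b0 n) (a n) (b n).
have mB n : measurable (B n) by exact: measurable_box.
apply: (@ae_bigcup D g B) => [z /Bcov [n zn]|n]; first by exists n.
have ind1 (A : set ME) z : `|\1_A z : R| <= 1.
  by rewrite indicE; case: (_ \in _); rewrite ?normr1 ?normr0.
have indL2 (A : set ME) : measurable A -> inL2 mu D (\1_A : ME -> R).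
  by move=> mA; apply: (inL2_bounded mD DN (M := 1)).
have oneL2 : inL2 mu D (fun=> 1 : R).
  by apply: (inL2_bounded mD DN (M := 1)) => // z _; rewrite normr1.
have indI (A C : set ME) z : \1_(A `&` C) z = \1_A z * \1_C z :> R.
  by rewrite !indicE in_setI -mulnb natrM.
pose P (A : set ME) := ipL2 mu D g (\1_(B n `&` A)) = 0.
have S := inL2_sip mu mD.
have mI A : measurable A -> inL2 mu D (\1_(B n `&` A) : ME -> R).
  by move=> mA; apply: indL2; exact: measurableI.
have Pall A : measurable A -> P A.
  move=> mA; have mA' : <<s boxes >> A by rewrite -measurable_boxes.
  move: mA'; apply: (dynkin_induction (measurable_boxes)).
  - exact: boxes_setI_closed.
  - by rewrite /P setIT; exact: boxE.
  - move=> _ [a0' [b0' [a' [b' ->]]]]; rewrite /P.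
    have [a0'' [b0'' [a'' [b'' [sub <-]]]]] :=
      measurable_cbox_sub (@Bsub n) a0' b0' a' b'.
    exact: boxE.
  - move=> X mX PX; rewrite /P.
    have -> : (\1_(B n `&` ~` X) : ME -> R) = \1_(B n) - \1_(B n `&` X).
      apply/funext => z; rewrite -[RHS]/(\1_(B n) z - \1_(B n `&` X) z) !(indI (B n)).
      rewrite ![\1_(~` X) z]indicE ![\1_X z]indicE in_setC.
      by case: (_ \in X); rewrite /= ?mulr1 ?mulr0 ?subrr ?subr0.
    rewrite (ipBr S)//; [|exact: indL2|exact: mI].
    by rewrite boxE// PX subr0.
  - move=> F mF tF PF; rewrite /P.
    have fin k : ipL2 mu D g (\1_(B n `&` \big[setU/set0]_(i < k) F i)) = 0.
      elim: k => [|k IH].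
        by rewrite big_ord0 setI0 indic0 (sipC S)//; [exact: (ip0l S)|exact: (sip0 S)].
      have mU : measurable (\big[setU/set0]_(i < k) F i).
        by apply: bigsetU_measurable.
      rewrite big_ord_recr/=; set U := \big[setU/set0]_(i < k) F i in mU IH *.
      have -> : (\1_(B n `&` (U `|` F k)) : ME -> R) =
          (\1_(B n `&` U) : ME -> R) + \1_(B n `&` F k).
        apply/funext => z.
        rewrite -[RHS]/(\1_(B n `&` U) z + \1_(B n `&` F k) z) !(indI (B n)) -mulrDr.
        congr (_ * _); rewrite !indicE in_setU.
        have [Uz|] := boolP (z \in U); last by rewrite add0r.
        have [Fz|] := boolP (z \in F k); last by rewrite addr0.
        move: Uz Fz; rewrite !inE /U -bigcup_mkord => -[i /= ik Fi] Fk.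
        have /trivIsetP/(_ i k I I) := tF; rewrite ltn_eqF// => /(_ isT) h.
        by have : (F i `&` F k) z by []; rewrite h.
      rewrite (ipDr S)//; [|exact: mI|exact: mI].
      by rewrite IH PF addr0.
    have mUF : measurable (\bigcup_k F k) by exact: bigcupT_measurable.
    apply: (@ipL2_dominated_cst _ _ _ mu D g
      (fun k => \1_(B n `&` \big[setU/set0]_(i < k) F i))
      (\1_(B n `&` \bigcup_k F k)) (fun=> 1) 0 mD gL oneL2 _ _ _ _ fin).
    + move=> k; apply: measurable_indic; apply: measurableI => //.
      exact: bigsetU_measurable.
    + by move=> k z _; exact: ind1.
    + by apply: measurable_indic; exact: measurableI.
    + move=> z _; have [[k _ Fkz]|nz] := pselect ((\bigcup_k F k) z).
        apply: cvg_near_cst; exists k.+1 => // m /= km; rewrite !(indI (B n)); congr (_ * _).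
        rewrite !indicE !mem_set//; first by exists k.
        by rewrite -bigcup_mkord; exists k.
      apply: cvg_near_cst; apply: nearW => m; rewrite !(indI (B n)); congr (_ * _).
      rewrite !indicE !memNset//; rewrite -bigcup_mkord => -[k _ Fk].
      by apply: nz; exists k.
have mg := inL2_measurable mD gL.
(* Zero mean on the part of [B n] where $g\ge0$ and on its complement makes the integral of $|g|$
   over [B n] vanish. *)
pose A : set ME := D `&` g @^-1` `[0, +oo[%classic.
have mA : measurable A by apply: mg => //; exact: measurable_itv.
have e1 : P A by exact: Pall.
have e2 : P (~` A) by apply: Pall; exact: measurableC.
pose h z : R := g z * \1_(B n) z.
have mh : measurable_fun D (h : ME -> R).
  apply: (measurable_funM (f := g : ME -> R) mg).
  exact: (measurable_indic (mB n)).
have habs z : D z -> `|h z| = g z * \1_(B n `&` A) z - g z * \1_(B n `&` ~` A) z.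
  move=> Dz; rewrite !(indI (B n)) /h normrM [`|\1_(B n) z|]ger0_norm; last first.
    by rewrite indicE.
  have [g0|g0] := leP 0 (g z).
    have Az : A z by split => //=; rewrite in_itv/= g0.
    by rewrite ger0_norm// !indicE in_setC (mem_set Az)/= mulr1 !mulr0 subr0.
  have Az : ~ A z by move=> [_]; rewrite /= in_itv/= andbT leNgt g0.
  by rewrite ltr0_norm// !indicE in_setC (memNset Az)/= mulr1 !mulr0 sub0r mulNr.
have ih : mu.-integrable D (EFin \o (fun z => `|h z|)).
  have := integrableB mD (inL2M mD gL (mI _ mA))
    (inL2M mD gL (mI _ (measurableC mA))).
  apply: eq_integrable => // z; rewrite inE => Dz /=.
  by rewrite habs// EFinB.
have : (\int[mu]_(z in D) `|(h z)%:E| = 0)%E.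
  rewrite -[LHS]fineK; last exact: (integrable_fin_num mD ih).
  congr EFin; rewrite -[LHS]/(\int[mu]_(z in D) `|h z|).
  rewrite (@eq_Rintegral _ _ _ mu D (fun z => g z * \1_(B n `&` A) z - g z * \1_(B n `&` ~` A) z)).
    rewrite (RintegralB mD (inL2M mD gL (mI _ mA))
      (inL2M mD gL (mI _ (measurableC mA)))).
    by rewrite -[X in X - _]/(ipL2 mu D g _) e1 -[X in _ - X]/(ipL2 mu D g _) e2 subrr.
  by move=> z; rewrite inE => Dz; rewrite habs.
move=> /(ae_eq_integral_abs _ mD _).1 hae.
have mEh : measurable_fun D (EFin \o h) by exact/measurable_EFinP.
by move: (hae mEh); apply: filterS => z /[apply] -[].
Qed.

(** Indicators of boxes are bounded limits of box cutoffs. Testing with box cutoffs only pays off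
    later: they are products of a function of $t$ and a function of $x$. *)
Lemma test_function_total (D : set E) (g : sfield R d) N : open D ->
  D `<=` cube N -> inL2 mu D g ->
  (forall a0 b0 a b k, cbox a0 b0 a b `<=` D ->
    ipL2 mu D g (box_cutoff a0 b0 a b k) = 0) ->
  eqL2 mu D g (fun=> 0).
Proof.
move=> oD DN gL H; have mD := open_measurable_E oD.
have oneL2 : inL2 mu D (fun=> 1 : R).
  by apply: (inL2_bounded mD DN (M := 1)) => // z _; rewrite normr1.
apply: (box_total oD DN gL) => a0' b0' a' b' BD.
apply: (@ipL2_dominated_cst _ _ _ mu D g (box_cutoff a0' b0' a' b')
  (\1_(box a0' b0' a' b')) (fun=> 1) 0 mD gL oneL2).
- by move=> k; apply: measurable_funS (smooth_measurable (smooth_box_cutoff _ _ _ _ k)).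
- by move=> k z _; rewrite ger0_norm ?box_cutoff_ge0// box_cutoff_le1.
- by apply: measurable_indic; exact: measurable_box.
- by move=> z _; exact: box_cutoff_cvg.
- by move=> k; exact: H.
Qed.

End integration_by_parts.

(** * Weak derivatives *)

Section weak_derivative_graph.
Context {R : realType} {d : nat}.
Local Notation E := (R * 'rV[R]_d)%type.
Local Notation ME := (measurableTypeR R * 'rV[R]_d)%type.
Local Notation mu := (@leb_tx R d).
Variables (D : set E) (N : R).
Hypotheses (oD : open D) (DN : D `<=` cube N).

Let mD : measurable (D : set ME) := open_measurable_E oD.
Let S := @inL2_sip _ _ R mu (D : set ME) mD.
Let Sv := @inL2v_sip R d D mD.
Let Sp := @inL2p_sip R d D mD.

Local Notation L2 := (inL2 mu D).
Local Notation ip := (ipL2 mu D).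

Lemma smooth_L2 (f : sfield R d) : smooth f -> L2 f.
Proof. exact: smooth_inL2 mD DN. Qed.

Lemma test_L2 (phi : sfield R d) e : test_function D phi ->
  L2 phi /\ L2 ('D_e phi).
Proof.
by move=> [sp _]; split; [exact: (smooth_L2 sp)|exact: (smooth_L2 (smooth_derive e sp))].
Qed.

Lemma smooth_vec_L2 (chi : vfield R d) : smooth_vec chi -> inL2v D chi.
Proof. by move=> sc i; exact: (smooth_L2 (sc i)). Qed.

Lemma smooth_divx_smooth (chi : vfield R d) : smooth_vec chi -> smooth (smooth_divx chi).
Proof.
by move=> sc; apply: smooth_sum => i; apply: smooth_derive; exact: sc.
Qed.

Lemma test_orthogonal (f : sfield R d) : L2 f ->
  (forall phi, test_function D phi -> ip f phi = 0) -> eqL2 mu D f (fun=> 0).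
Proof.
move=> fL H; apply: test_function_total DN fL _ => // a0 b0 a b k BD.
by apply: H; exact: test_box_cutoff.
Qed.

Lemma test_separates (f g : sfield R d) : L2 f -> L2 g ->
  (forall phi, test_function D phi -> ip f phi = ip g phi) -> eqL2 mu D f g.
Proof.
move=> fL gL H; apply: (ip0_eqL2 mD fL gL); apply: (eqL2_ip mD) => //.
- exact: (sipB S).
- apply: test_orthogonal; first exact: (sipB S).
  move=> phi tp; have [pL _] := test_L2 0 tp.
  by rewrite (ipBl S)// H// subrr.
- exact: (sipB S).
Qed.

(** [gradx] and [wdiv] are choices, hence linear only up to null sets. With the derivatives [g] and
    [f] as witnesses the graph is linear and closed; the chosen functions are compared with the
    witnesses afterwards. *)
Definition wgraph (w : pfield R d) (g : vfield R d) (f : sfield R d) : Prop :=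
  [/\ inL2p D w, inL2v D g, is_weak_gradx D w.1 g, L2 f & is_weak_div D w f].

Lemma weak_gradx_unique v g g' : inL2v D g -> inL2v D g' ->
  is_weak_gradx D v g -> is_weak_gradx D v g' ->
  forall i, eqL2 mu D (vcomp g i) (vcomp g' i).
Proof.
move=> gL gL' Hg Hg' i; apply: test_separates => // phi tp.
by apply: oppr_inj; rewrite -Hg// -Hg'.
Qed.

Lemma weak_div_unique w f f' : L2 f -> L2 f' ->
  is_weak_div D w f -> is_weak_div D w f' -> eqL2 mu D f f'.
Proof.
move=> fL fL' Hf Hf'; apply: test_separates => // phi tp.
by apply: oppr_inj; rewrite -Hf// -Hf'.
Qed.

Lemma inU_wgraph w : inU D w -> wgraph w (gradx D w.1) (wdiv D w).
Proof.
move=> [wL [g Hg] [f Hf]].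
have [h1 h2] : [set g | inL2v D g /\ is_weak_gradx D w.1 g] (gradx D w.1).
  by apply: xgetPex; exists g.
have [h3 h4] : [set f | L2 f /\ is_weak_div D w f] (wdiv D w).
  by apply: xgetPex; exists f.
by split.
Qed.

Lemma wgraph_inU w g f : wgraph w g f -> inU D w.
Proof. by move=> [wL gL Hg fL Hf]; split => //; [exists g|exists f]. Qed.

Lemma wgraph_gradx w g f : wgraph w g f ->
  forall i, eqL2 mu D (vcomp (gradx D w.1) i) (vcomp g i).
Proof.
move=> wg; have [wL gL Hg _ _] := wg.
have [_ gL' Hg' _ _] := inU_wgraph (wgraph_inU wg).
exact: weak_gradx_unique gL' gL Hg' Hg.
Qed.

Lemma wgraph_wdiv w g f : wgraph w g f -> eqL2 mu D (wdiv D w) f.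
Proof.
move=> wg; have [_ _ _ fL Hf] := wg.
have [_ _ _ fL' Hf'] := inU_wgraph (wgraph_inU wg).
exact: weak_div_unique fL' fL Hf' Hf.
Qed.

Definition Apair (w : pfield R d) (g : vfield R d) (f : sfield R d) : pfield R d :=
  (f, g + w.2).
Definition Astarpair (w : pfield R d) (g : vfield R d) (f : sfield R d) : pfield R d :=
  (- f, - g + w.2).

Lemma Apair_L2 w g f : wgraph w g f -> inL2p D (Apair w g f).
Proof. by move=> [[_ wL] gL _ fL _]; split => //; exact: (sipD Sv). Qed.

Lemma Astarpair_L2 w g f : wgraph w g f -> inL2p D (Astarpair w g f).
Proof.
move=> [[_ wL] gL _ fL _]; split; first exact: (sipN S).
by apply: (sipD Sv) => //; exact: (sipN Sv).
Qed.

Lemma opA_L2 w : inU D w -> inL2p D (opA D w).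
Proof. by move=> /inU_wgraph /Apair_L2. Qed.

Lemma opAstar_L2 w : inU D w -> inL2p D (opAstar D w).
Proof. by move=> /inU_wgraph /Astarpair_L2. Qed.

Lemma opA_wgraph w g f : wgraph w g f -> eqL2p D (opA D w) (Apair w g f).
Proof.
move=> wg; split; first exact: wgraph_wdiv wg.
move=> i; have := wgraph_gradx wg i; apply: filterS => z /[apply].
by rewrite /vcomp /= !mxE => ->.
Qed.

Lemma opAstar_wgraph w g f : wgraph w g f -> eqL2p D (opAstar D w) (Astarpair w g f).
Proof.
move=> wg; split.
  by have := wgraph_wdiv wg; apply: filterS => z /[apply] /= ->.
move=> i; have := wgraph_gradx wg i; apply: filterS => z /[apply].
by rewrite /vcomp /= !mxE => ->.
Qed.

Lemma weak_gradxL a v v' g g' : L2 v -> L2 v' -> inL2v D g -> inL2v D g' ->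
  is_weak_gradx D v g -> is_weak_gradx D v' g' ->
  is_weak_gradx D (a *: v + v') (a *: g + g').
Proof.
move=> vL vL' gL gL' Hg Hg' i phi tp; have [pL dL] := test_L2 (dir_x i) tp.
by rewrite vcompL !(sipL S)// Hg// Hg'//; ring.
Qed.

Lemma wgraphL a w g f w' g' f' : wgraph w g f -> wgraph w' g' f' ->
  wgraph (a *: w + w') (a *: g + g') (a *: f + f').
Proof.
move=> [wL gL Hg fL Hf] [wL' gL' Hg' fL' Hf']; split.
- exact: (sipP Sp).
- exact: (sipP Sv).
- by case: wL => ? ?; case: wL' => ? ?; exact: weak_gradxL.
- exact: (sipP S).
- move=> phi tp; have [pL tL] := test_L2 dir_t tp.
  have [w1 w2] := wL; have [w1' w2'] := wL'.
  have fE : ip f phi = - (ip w.1 ('D_dir_t phi) +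
      \sum_i ip (vcomp w.2 i) ('D_(dir_x i) phi)) by rewrite Hf ?opprK.
  have fE' : ip f' phi = - (ip w'.1 ('D_dir_t phi) +
      \sum_i ip (vcomp w'.2 i) ('D_(dir_x i) phi)) by rewrite Hf' ?opprK.
  rewrite (sipL S a fL fL' pL) fE fE' [ip (a *: w + w').1 _](sipL S a w1 w1' tL).
  rewrite (eq_bigr (fun i => a * ip (vcomp w.2 i) ('D_(dir_x i) phi) +
    ip (vcomp w'.2 i) ('D_(dir_x i) phi))).
    by rewrite big_split/= -mulr_sumr; ring.
  move=> i _; have [_ dL] := test_L2 (dir_x i) tp.
  by rewrite vcompL (sipL S a (w2 i) (w2' i) dL).
Qed.

Lemma wgraph0 : wgraph 0 0 0.
Proof.
have z0 (phi : sfield R d) : L2 phi -> ip 0 phi = 0 by move=> ?; exact: (ip0l S).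
split; [exact: (sip0 Sp)|exact: (sip0 Sv)| |exact: (sip0 S)|].
  move=> i phi tp; have [pL dL] := test_L2 (dir_x i) tp.
  by rewrite vcomp0 !z0// oppr0.
move=> phi tp; have [pL tL] := test_L2 dir_t tp.
rewrite !z0// oppr0 add0r big1// => i _.
by have [_ dL] := test_L2 (dir_x i) tp; rewrite vcomp0 z0.
Qed.

(** Weak derivatives form a closed operator: each defining identity involves fixed test functions
    and passes to the limit. *)
Lemma wgraph_cvg (w_ : nat -> pfield R d) (g_ : nat -> vfield R d)
    (f_ : nat -> sfield R d) w g f :
  (forall n, wgraph (w_ n) (g_ n) (f_ n)) ->
  inL2p D w -> inL2v D g -> L2 f ->
  sip_cvg (ipL2p D) w_ w ->
  (forall i, sip_cvg ip (fun n => vcomp (g_ n) i) (vcomp g i)) ->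
  sip_cvg ip f_ f -> wgraph w g f.
Proof.
move=> wg wL gL fL cw cg cf.
have wLn n : inL2p D (w_ n) by case: (wg n).
have [cw1 cw2] := (L2p_cvgP mD wLn wL).1 cw.
have [w1 w2] := wL.
have lim_eq (u v : R^nat) (a b : R) : (forall n, u n = v n) -> u @ \oo --> a ->
    v @ \oo --> b -> a = b.
  move=> uv ua vb; apply: (cvg_unique _ ua) => //.
  by rewrite (_ : u = v)//; exact/funext.
split => //.
- move=> i phi tp; have [pL dL] := test_L2 (dir_x i) tp.
  apply: (lim_eq (fun n => ip (w_ n).1 ('D_(dir_x i) phi))
    (fun n => - ip (vcomp (g_ n) i) phi)).
  + by move=> n; case: (wg n) => _ _ H _ _; exact: H.
  + by apply: (sip_cvg_ip S) => // n; case: (wLn n).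
  + by apply: cvgN; apply: (sip_cvg_ip S) => // n; case: (wg n).
- move=> phi tp; have [pL tL] := test_L2 dir_t tp.
  apply: (lim_eq (fun n => ip (w_ n).1 ('D_dir_t phi) +
      \sum_i ip (vcomp (w_ n).2 i) ('D_(dir_x i) phi))
    (fun n => - ip (f_ n) phi)).
  + by move=> n; case: (wg n) => _ _ _ _; exact.
  + apply: cvgD; first by apply: (sip_cvg_ip S) => // n; case: (wLn n).
    apply: (@cvg_big _ _ _ _ _ (@add_continuous R)) => i _.
    have [_ dL] := test_L2 (dir_x i) tp.
    by apply: (sip_cvg_ip S) => // n; case: (wLn n).
  + by apply: cvgN; apply: (sip_cvg_ip S) => // n; case: (wg n).
Qed.

Lemma wgraph_ae w w' g f : wgraph w g f -> inL2p D w' -> eqL2p D w w' ->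
  wgraph w' g f.
Proof.
move=> [wL gL Hg fL Hf] wL' [e1 e2]; have [w1 w2] := wL; have [w1' w2'] := wL'.
split => //.
- move=> i phi tp; have [pL dL] := test_L2 (dir_x i) tp.
  by rewrite -(eqL2_ipl mD w1 w1' e1 dL) Hg.
- move=> phi tp; have [pL tL] := test_L2 dir_t tp.
  rewrite -Hf// -(eqL2_ipl mD w1 w1' e1 tL); congr +%R.
  apply: eq_bigr => i _; have [_ dL] := test_L2 (dir_x i) tp.
  by rewrite (eqL2_ipl mD (w2 i) (w2' i) (e2 i) dL).
Qed.

Lemma smooth_wgraph (phi : sfield R d) (chi : vfield R d) : smooth phi ->
  smooth_vec chi ->
  wgraph (phi, chi) (fun z => \row_i 'D_(dir_x i) phi z)
    (fun z => 'D_dir_t phi z + smooth_divx chi z).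
Proof.
move=> sp sc.
have E i : vcomp (fun z => \row_i 'D_(dir_x i) phi z) i = 'D_(dir_x i) phi.
  by apply/funext => z; rewrite /vcomp mxE.
have sd := smooth_divx_smooth sc.
split.
- by split; [exact: (smooth_L2 sp)|exact: (smooth_vec_L2 sc)].
- by move=> i; rewrite E; apply: smooth_L2; exact: smooth_derive.
- by move=> i psi tp; rewrite E; exact: ipL2_derive_test DN sp tp.
- exact: (smooth_L2 (smoothD (smooth_derive dir_t sp) sd)).
- move=> psi tp; have [pL tL] := test_L2 dir_t tp.
  rewrite [LHS]/= (ipL2_derive_test dir_t mD DN sp tp).
  rewrite (eq_bigr (fun i => - ip ('D_(dir_x i) (vcomp chi i)) psi)); last first.
    by move=> i _; exact: ipL2_derive_test DN (sc i) tp.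
  rewrite sumrN -opprD; congr (- _).
  rewrite [RHS](ipDl S)//; [|exact: (smooth_L2 (smooth_derive _ sp))|exact: (smooth_L2 sd)].
  congr +%R; rewrite /smooth_divx.
  have : forall r : seq 'I_d,
      ip (fun z => \sum_(i <- r) 'D_(dir_x i) (vcomp chi i) z) psi =
      \sum_(i <- r) ip ('D_(dir_x i) (vcomp chi i)) psi.
    elim=> [|i r IH].
      rewrite big_nil (_ : (fun z => _) = 0); first exact: (ip0l S).
      by apply/funext => z; rewrite big_nil.
    rewrite big_cons -IH -(ipDl S)//.
    + by congr (ip _ psi); apply/funext => z; rewrite big_cons.
    + by apply: smooth_L2; apply: smooth_derive; exact: sc.
    + by apply: smooth_L2; apply: smooth_sum => j; apply: smooth_derive; exact: sc.
  by move=> ->.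
Qed.

End weak_derivative_graph.

(** * Moments in time *)

Section fubini_real.
Context {d1 d2} {T1 : measurableType d1} {T2 : measurableType d2} {R : realType}.
Variables (m1 : {sigma_finite_measure set T1 -> \bar R})
  (m2 : {sigma_finite_measure set T2 -> \bar R}).

Lemma abse_fine_le (x : \bar R) : (`|(fine x)%:E| <= `|x|)%E.
Proof. by case: x => [r| |] //=; rewrite normr0 leey. Qed.

(** Fubini's theorem produces extended real inner integrals, finite almost everywhere; this passes
    to real integrals. *)
Lemma integrable_fine {d} {T : measurableType d} (m : {measure set T -> \bar R})
    (F : T -> \bar R) : m.-integrable setT F ->
  m.-integrable setT (EFin \o (fun x => fine (F x))) /\
  (\int[m]_x (fine (F x))%:E = \int[m]_x F x)%E.
Proof.
move=> iF; have mF := measurable_int m iF.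
have mfF : measurable_fun setT (EFin \o (fun x => fine (F x))).
  by apply/measurable_EFinP; apply: (measurableT_comp _ mF); exact: fine_measurable.
split; first by apply: le_integrable iF => // x _; exact: abse_fine_le.
apply: ae_eq_integral => //; have := integrable_ae measurableT iF.
by apply: filterS => x /[apply] Fx; rewrite fineK.
Qed.

Lemma Rfubini1 (g : T1 * T2 -> R) : (m1 \x m2)%E.-integrable setT (EFin \o g) ->
  m1.-integrable setT (EFin \o (fun x => \int[m2]_y g (x, y))) /\
  \int[(m1 \x m2)%E]_z g z = \int[m1]_x \int[m2]_y g (x, y).
Proof.
move=> ig; have iF := integrable_fubini_F ig.
have [iF' EF] := integrable_fine iF; split; first exact: iF'.
by rewrite /Rintegral; congr fine; rewrite -integral12_prod_meas1.
Qed.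

Lemma integrable_fubini_G (g : T1 * T2 -> R) :
  (m1 \x m2)%E.-integrable setT (EFin \o g) ->
  m2.-integrable setT (fun y => \int[m1]_x (g (x, y))%:E)%E.
Proof.
move=> ig.
apply/integrableP; split; first exact: measurable_fubini_G ig.
apply: le_lt_trans ((integrable21ltyP m1 m2 (measurable_int _ ig)).1 ig).
apply: ge0_le_integral => //.
- by apply: measurableT_comp => //; exact: measurable_fubini_G ig.
- apply: (@measurable_fun_fubini_tonelli_G _ _ _ _ _ m1 (fun z => `|(g z)%:E|%E)) => //.
  by apply: measurableT_comp => //; exact: (measurable_int _ ig).
- move=> y _; apply: le_abse_integral => //.
  have mg := measurable_int _ ig.
  exact: (measurableT_comp mg (measurable_pair2 y)).
Qed.

Lemma Rfubini2 (g : T1 * T2 -> R) : (m1 \x m2)%E.-integrable setT (EFin \o g) ->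
  m2.-integrable setT (EFin \o (fun y => \int[m1]_x g (x, y))) /\
  \int[(m1 \x m2)%E]_z g z = \int[m2]_y \int[m1]_x g (x, y).
Proof.
move=> ig; have iG := integrable_fubini_G ig.
have [iG' EG] := integrable_fine iG; split; first exact: iG'.
by rewrite /Rintegral; congr fine; rewrite -integral21_prod_meas1.
Qed.

Lemma measurable_param_integral2 (H : T1 * T2 -> R) : measurable_fun setT H ->
  measurable_fun setT (fun y => \int[m1]_x H (x, y)).
Proof.
move=> mH; have mEH : measurable_fun setT (EFin \o H) by exact/measurable_EFinP.
have mI : measurable_fun setT (fun y => (\int[m1]_x (H (x, y))%:E)%E).
  under eq_fun do rewrite integralE.
  apply: emeasurable_funB.
    have := @measurable_fun_fubini_tonelli_G _ _ _ _ _ m1 _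
      (measurable_funepos mEH) (fun z => funepos_ge0 (EFin \o H) z).
    by congr measurable_fun; apply/funext => y; apply: eq_integral => x _; rewrite !funeposE.
  have := @measurable_fun_fubini_tonelli_G _ _ _ _ _ m1 _
    (measurable_funeneg mEH) (fun z => funeneg_ge0 (EFin \o H) z).
  by congr measurable_fun; apply/funext => y; apply: eq_integral => x _; rewrite !funenegE.
by apply: (measurableT_comp _ mI); exact: fine_measurable.
Qed.

End fubini_real.

(** * Fubini on rectangles, and moments in the first variable *)

Section rectangle.
Context {d1 d2} {T1 : measurableType d1} {T2 : measurableType d2} {R : realType}.
Variables (m1 : {sigma_finite_measure set T1 -> \bar R})
  (m2 : {sigma_finite_measure set T2 -> \bar R}).
Local Notation mu := (m1 \x m2)%E.
Variables (A : set T1) (B : set T2).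
Hypotheses (mA : measurable A) (mB : measurable B).
Local Notation AB := (A `*` B).
Implicit Types (F f g h : T1 * T2 -> R).

Let mAB : measurable AB. Proof. exact: measurableX. Qed.

Lemma rect_restrict1 h r x :
  (h \_ AB) (r, x) = ((fun r => ((fun x => h (r, x)) \_ B) x) \_ A) r.
Proof.
rewrite !patchE; have [hr|hr] := boolP (r \in A); last first.
  by rewrite memNset// => -[h1 /= Ox]; move: hr; rewrite notin_setE.
have [hx|hx] := boolP (x \in B).
  by rewrite mem_set//; move: hr hx; rewrite !inE.
by rewrite memNset// => -[_ /= Ox]; move: hx; rewrite notin_setE.
Qed.

Lemma rect_restrict2 h r x :
  (h \_ AB) (r, x) = ((fun x => ((fun r => h (r, x)) \_ A) r) \_ B) x.
Proof. by rewrite rect_restrict1 !patchE; do ?case: ifP. Qed.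

Lemma rect_fubini1 F : mu.-integrable AB (EFin \o F) ->
  m1.-integrable A (EFin \o (fun r => \int[m2]_(x in B) F (r, x))) /\
  \int[mu]_(z in AB) F z = \int[m1]_(r in A) \int[m2]_(x in B) F (r, x).
Proof.
move=> /(integrable_mkcond _ mAB) iF.
have iF' : mu.-integrable setT (EFin \o (F \_ AB)).
  by move: iF; congr (mu.-integrable _ _); rewrite restrict_EFin.
have [i1 E1] := Rfubini1 iF'.
have EE : (fun r => \int[m2]_x (F \_ AB) (r, x)) =
    (fun r => \int[m2]_(x in B) F (r, x)) \_ A.
  apply/funext => r; rewrite patchE; case: ifPn => hr.
    rewrite [RHS]Rintegral_mkcond; apply: eq_Rintegral => x _.
    by rewrite rect_restrict1 patchE hr.
  rewrite (@eq_Rintegral _ _ _ m2 _ (cst 0)) ?Rintegral_cst ?mul0r// => x _.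
  by rewrite rect_restrict1 patchE (negbTE hr).
split.
  apply/(integrable_mkcond _ mA).
  by move: i1; congr (m1.-integrable _ _); rewrite EE restrict_EFin.
by rewrite Rintegral_mkcond E1 EE -Rintegral_mkcond.
Qed.

Lemma rect_fubini2 F : mu.-integrable AB (EFin \o F) ->
  m2.-integrable B (EFin \o (fun x => \int[m1]_(r in A) F (r, x))) /\
  \int[mu]_(z in AB) F z = \int[m2]_(x in B) \int[m1]_(r in A) F (r, x).
Proof.
move=> /(integrable_mkcond _ mAB) iF.
have iF' : mu.-integrable setT (EFin \o (F \_ AB)).
  by move: iF; congr (mu.-integrable _ _); rewrite restrict_EFin.
have [i1 E1] := Rfubini2 iF'.
have EE : (fun x => \int[m1]_r (F \_ AB) (r, x)) =
    (fun x => \int[m1]_(r in A) F (r, x)) \_ B.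
  apply/funext => x; rewrite patchE; case: ifPn => hx.
    rewrite [RHS]Rintegral_mkcond; apply: eq_Rintegral => r _.
    by rewrite rect_restrict2 patchE hx.
  rewrite (@eq_Rintegral _ _ _ m1 _ (cst 0)) ?Rintegral_cst ?mul0r// => r _.
  by rewrite rect_restrict2 patchE (negbTE hx).
split.
  apply/(integrable_mkcond _ mB).
  by move: i1; congr (m2.-integrable _ _); rewrite EE restrict_EFin.
by rewrite Rintegral_mkcond E1 EE -Rintegral_mkcond.
Qed.

Lemma ae_rect1 F : mu.-integrable AB (EFin \o F) ->
  {ae m1, forall r, A r -> m2.-integrable B (EFin \o (fun x => F (r, x)))}.
Proof.
move=> /(integrable_mkcond _ mAB) iF.
have := ae_integrable1 iF; apply: filterS => r /= H hr.
apply/(integrable_mkcond _ mB); move: H; congr (m2.-integrable _ _).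
rewrite !restrict_EFin; apply/funext => x /=.
by rewrite rect_restrict1 patchE mem_set.
Qed.

Lemma slice_measurable1 F r : measurable_fun AB F -> A r ->
  measurable_fun B (fun x => F (r, x)).
Proof.
move=> /(measurable_restrictT _ mAB) mF hr.
apply/(measurable_restrictT _ mB).
have := measurableT_comp mF (measurable_pair1 r).
apply: eq_measurable_fun => x _ /=.
by rewrite rect_restrict1 patchE mem_set.
Qed.

Lemma slice_measurable2 F x : measurable_fun AB F -> B x ->
  measurable_fun A (fun r => F (r, x)).
Proof.
move=> /(measurable_restrictT _ mAB) mF hx.
apply/(measurable_restrictT _ mA).
have := measurableT_comp mF (measurable_pair2 x).
apply: eq_measurable_fun => r _ /=.
by rewrite rect_restrict2 patchE mem_set.
Qed.

Lemma ae_slice_L2 f : inL2 mu AB f ->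
  {ae m1, forall r, A r -> inL2 m2 B (fun x => f (r, x))}.
Proof.
move=> /(inL2P _ mAB)[mf if2].
have := ae_rect1 (F := fun z => f z ^+ 2) if2.
apply: filterS => r H hr; apply/inL2P => //; split; last exact: H.
exact: slice_measurable1.
Qed.

Hypothesis Afin : (m1 A < +oo)%E.

Definition moment (b : T1 -> R) f (x : T2) : R := \int[m1]_(r in A) (b r * f (r, x)).

Lemma inL2_bounded_weight (b : T1 -> R) (M : R) : measurable_fun setT b ->
  (forall r, A r -> `|b r| <= M) ->
  inL2 m1 A b /\ ipL2 m1 A b b <= M ^+ 2 * fine (m1 A).
Proof.
move=> /(measurable_funS measurableT (@subsetT _ A)) mb bM.
have ic (c : R) : m1.-integrable A (EFin \o (fun=> c)).
  apply: (measurable_bounded_integrable mA Afin); first exact: measurable_cst.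
  by exists `|c|; split; [exact: num_real|move=> y cy r _; exact: ltW].
have b2 r : A r -> b r * b r <= M ^+ 2.
  move=> /bM h; rewrite -expr2 -[b r ^+ 2]ger0_norm ?sqr_ge0// normrX.
  by rewrite lerXn2r ?nnegrE// (le_trans _ h).
have bL : inL2 m1 A b.
  apply/inL2P => //; split => //; apply: le_integrable (ic (M ^+ 2)) => //.
    by apply/measurable_EFinP; exact: measurable_funX.
  by move=> r /b2 h; rewrite /= lee_fin ger0_norm ?sqr_ge0// ger0_norm ?sqr_ge0// expr2.
split => //; rewrite -Rintegral_cst//; apply: le_Rintegral => //.
exact: (inL2M mA bL bL).
Qed.

Lemma measurable_moment (b : T1 -> R) f : measurable_fun setT b -> measurable_fun AB f ->
  measurable_fun B (moment b f).
Proof.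
move=> mb mf.
have mH : measurable_fun AB (fun z => b z.1 * f z).
  apply: measurable_funM => //.
  apply: (measurable_funS measurableT) => //.
  exact: (measurableT_comp mb measurable_fst).
have := measurable_param_integral2 m1 ((measurable_restrictT _ mAB).1 mH).
move=> /(measurable_funS measurableT (@subsetT _ B)).
apply: eq_measurable_fun => x xB; rewrite /moment [RHS]Rintegral_mkcond.
by apply: eq_Rintegral => r _; rewrite rect_restrict2 patchE xB.
Qed.

(** Cauchy-Schwarz for every $x$, in extended reals because the square may fail to be integrable on
    exceptional slices. The added $1$ keeps the constant positive, so that its product with
    $+\infty$ is $+\infty$. *)
Lemma moment_CS (b : T1 -> R) f (M : R) x : measurable_fun setT b ->
  (forall r, A r -> `|b r| <= M) -> measurable_fun AB f -> B x ->
  (((moment b f x) ^+ 2)%:E <=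
    (M ^+ 2 * fine (m1 A) + 1)%:E * \int[m1]_(r in A) (f (r, x) ^+ 2)%:E)%E.
Proof.
move=> mb bM mf Bx; set C := M ^+ 2 * _ + 1.
have C0 : 0 < C by rewrite ltr_wpDl// mulr_ge0 ?sqr_ge0// fine_ge0.
have I0 : (0 <= \int[m1]_(r in A) (f (r, x) ^+ 2)%:E)%E.
  by apply: integral_ge0 => r _; rewrite lee_fin sqr_ge0.
have [Ioo|Ioo] := eqVneq (\int[m1]_(r in A) (f (r, x) ^+ 2)%:E)%E +oo%E.
  by rewrite Ioo gt0_muley ?lte_fin// leey.
have mfx := slice_measurable2 mf Bx.
have fL : inL2 m1 A (fun r => f (r, x)).
  apply/inL2P => //; split => //; apply/integrableP; split.
    by apply/measurable_EFinP; exact: measurable_funX.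
  under eq_integral do rewrite /= ger0_norm ?sqr_ge0//.
  by rewrite ltey.
have [bL bb] := inL2_bounded_weight mb bM.
have E : (\int[m1]_(r in A) (f (r, x) ^+ 2)%:E)%E =
    (ipL2 m1 A (fun r => f (r, x)) (fun r => f (r, x)))%:E.
  by rewrite -(ipL2_EFin mA)//; apply: eq_integral => r _; rewrite expr2.
rewrite E -EFinM lee_fin.
apply: le_trans (sip_CS (inL2_sip m1 mA) bL fL) _.
apply: ler_wpM2r; first exact: (sip_ge0 (inL2_sip m1 mA) fL).
by apply: le_trans bb _; rewrite lerDl.
Qed.

Lemma inL2_moment (b : T1 -> R) f (M : R) : measurable_fun setT b ->
  (forall r, A r -> `|b r| <= M) -> inL2 mu AB f -> inL2 m2 B (moment b f).
Proof.
move=> mb bM /(inL2P _ mAB)[mf if2].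
have mm := measurable_moment mb mf.
apply/inL2P => //; split => //.
have := if2 => /(integrable_mkcond _ mAB).
rewrite (_ : _ \_ AB = EFin \o ((fun z => f z ^+ 2) \_ AB)); last by rewrite restrict_EFin.
move=> /integrable_fubini_G iG.
have iG' := integrableS measurableT mB (@subsetT _ B) iG.
have := @integrableZl _ _ _ _ _ mB (M ^+ 2 * fine (m1 A) + 1) _ iG'.
apply: le_integrable => //.
  by apply/measurable_EFinP; exact: measurable_funX.
move=> x Bx; rewrite gee0_abs ?lee_fin ?sqr_ge0//.
apply: le_trans (moment_CS mb bM mf Bx) _.
apply: le_trans (lee_abs _).
rewrite le_eqVlt; apply/orP; left; apply/eqP.
congr (_ * _)%E; rewrite integral_mkcond; apply: eq_integral => r _ /=.
by rewrite restrict_EFin /= rect_restrict2 patchE mem_set.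
Qed.

Lemma ae_rect2 F : mu.-integrable AB (EFin \o F) ->
  {ae m2, forall x, B x -> m1.-integrable A (EFin \o (fun r => F (r, x)))}.
Proof.
move=> /(integrable_mkcond _ mAB) iF.
have := ae_integrable2 iF; apply: filterS => x /= H hx.
apply/(integrable_mkcond _ mA); move: H; congr (m1.-integrable _ _).
rewrite !restrict_EFin; apply/funext => r /=.
by rewrite rect_restrict2 patchE mem_set.
Qed.

Lemma inL2_snd (m : T2 -> R) : inL2 m2 B m -> inL2 mu AB (fun z => m z.2).
Proof.
move=> /(inL2P _ mB)[mm im].
have mmz : measurable_fun AB (fun z => m z.2).
  move=> _ Y mY; rewrite (_ : _ `&` _ = A `*` (B `&` m @^-1` Y)); last first.
    by apply/seteqP; split => z /=; rewrite /setX/=; tauto.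
  by apply: measurableX => //; exact: mm.
apply/inL2P => //; split => //; apply/(integrable_mkcond _ mAB).
have m2z : measurable_fun AB (fun z => (m z.2 ^+ 2)%:E).
  by apply/measurable_EFinP; exact: measurable_funX.
apply/(integrable12ltyP m1 m2 ((measurable_restrictT _ mAB).1 m2z)).
rewrite (_ : (\int[m1]_x _)%E = (\int[m1]_(x in A) \int[m2]_(y in B) (m y ^+ 2)%:E)%E).
  rewrite integral_cst//; move: im => /(integrable_fin_num mB) im.
  by rewrite -[X in (X * _)%E](fineK im) lte_mul_pinfty ?lee_fin// ?fine_ge0// integral_ge0// => y _; rewrite lee_fin sqr_ge0.
rewrite [RHS]integral_mkcond; apply: eq_integral => r _.
rewrite patchE; case: ifPn => hr.
  rewrite [RHS]integral_mkcond; apply: eq_integral => x _.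
  rewrite !restrict_EFin /= rect_restrict1 patchE hr.
  by rewrite ger0_norm// patchE; case: ifP => // _; rewrite sqr_ge0.
rewrite integral0_eq// => x _.
by rewrite !restrict_EFin /= rect_restrict1 patchE (negbTE hr) normr0.
Qed.

Lemma inL2_weightM (b : T1 -> R) f (M : R) : measurable_fun setT b ->
  (forall r, A r -> `|b r| <= M) -> inL2 mu AB f ->
  inL2 mu AB (fun z => b z.1 * f z).
Proof.
move=> mb bM fL; have S := inL2_sip mu mAB.
apply: (@inL2_dominated _ _ _ mu _ mAB _ (M *: f)).
- apply: measurable_funM; last exact: (inL2_measurable mAB fL).
  apply: (measurable_funS measurableT) => //.
  exact: (measurableT_comp mb measurable_fst).
- exact: (sipZ S).
- move=> z [Az _]; rewrite -[(M *: f) z]/(M * f z) !normrM ler_wpM2r//.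
  by apply: le_trans (ler_norm M); exact: bM.
Qed.

Lemma ae_slice_L2_2 f : inL2 mu AB f ->
  {ae m2, forall x, B x -> inL2 m1 A (fun r => f (r, x))}.
Proof.
move=> /(inL2P _ mAB)[mf if2].
have := ae_rect2 (F := fun z => f z ^+ 2) if2.
apply: filterS => x H hx; apply/inL2P => //; split; last exact: H.
exact: slice_measurable2.
Qed.

(** Taking the moment against [b] is the adjoint of multiplying a function of the second variable by
    [b]. *)
Lemma tensor_moment (b : T1 -> R) (m : T2 -> R) f (M : R) : measurable_fun setT b ->
  (forall r, A r -> `|b r| <= M) -> inL2 m2 B m -> inL2 mu AB f ->
  ipL2 mu AB (fun z => b z.1 * m z.2) f = ipL2 m2 B m (moment b f).
Proof.
move=> mb bM mL fL; have tL := inL2_weightM mb bM (inL2_snd mL).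
have momL := inL2_moment mb bM fL.
have [i1] := rect_fubini2 (inL2M mAB tL fL).
rewrite /ipL2 => ->; rewrite /Rintegral; congr fine.
apply: ae_eq_integral => //.
- by case/integrableP: i1.
- by case/integrableP: (inL2M mB mL momL).
have [bL _] := inL2_bounded_weight mb bM.
have := ae_slice_L2_2 fL; apply: filterS => x H Bx; congr EFin.
rewrite -[RHS]/(m x * \int[m1]_(r in A) (b r * f (r, x))).
rewrite -[LHS]/(\int[m1]_(r in A) (b r * m x * f (r, x))).
rewrite -RintegralZl//; last exact: (inL2M mA bL (H Bx)).
by apply: eq_Rintegral => r _; rewrite [b r * _]mulrC mulrA.
Qed.

Lemma tensor_slice (b : T1 -> R) (m : T2 -> R) f (M : R) : measurable_fun setT b ->
  (forall r, A r -> `|b r| <= M) -> inL2 m2 B m -> inL2 mu AB f ->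
  (forall r, A r -> inL2 m2 B (fun x => f (r, x))) ->
  m1.-integrable A (EFin \o (fun r => b r * ipL2 m2 B m (fun x => f (r, x)))) /\
  ipL2 mu AB (fun z => b z.1 * m z.2) f =
  \int[m1]_(r in A) (b r * ipL2 m2 B m (fun x => f (r, x))).
Proof.
move=> mb bM mL fL fsL; have tL := inL2_weightM mb bM (inL2_snd mL).
have E r : A r -> \int[m2]_(x in B) (b r * m x * f (r, x)) =
    b r * ipL2 m2 B m (fun x => f (r, x)).
  move=> /fsL hr; rewrite -RintegralZl//; last exact: (inL2M mB mL hr).
  by apply: eq_Rintegral => x _; rewrite mulrA.
have [i1 e1] := rect_fubini1 (inL2M mAB tL fL); split.
  apply: eq_integrable i1 => // r; rewrite inE => Ar /=.
  by congr EFin; exact: E.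
by rewrite {1}/ipL2 e1; apply: eq_Rintegral => r; rewrite inE => /E.
Qed.

End rectangle.

Section time_weights.
Context {R : realType} {d : nat}.
Local Notation E := (R * 'rV[R]_d)%type.
Local Notation ME := (measurableTypeR R * 'rV[R]_d)%type.
Local Notation mu := (@leb_tx R d).
Local Notation mx := (@leb_x R d).
Local Notation lam := (@lebesgue_measure R).
Variables (T : R) (Om : set 'rV[R]_d).
Hypotheses (T0 : 0 < T) (oO : open Om) (bO : bounded_set Om).
Local Notation Q := (cylinder T Om).
Local Notation L2 := (inL2 mu (Q : set ME)).
Local Notation ip := (ipL2 mu (Q : set ME)).
Local Notation L2x := (inL2 mx Om).
Local Notation ipx := (ipL2 mx Om).

Definition time_interval : set (measurableTypeR R) := [set t | 0 < t < T].
Local Notation I := time_interval.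

Lemma open_measurable_x : measurable (Om : set 'rV[R]_d).
Proof.
have oO' : open (snd @^-1` Om : set E).
  by apply: open_comp => // z _; exact: cvg_snd.
have := measurable_pair1 (0 : measurableTypeR R) (T2 := 'rV[R]_d).
move=> /(_ measurableT _ (open_measurable_E oO')); rewrite setTI.
exact.
Qed.

Lemma cylinder_open : open (Q : set E).
Proof.
rewrite (_ : (Q : set E) = fst @^-1` `]0, T[%classic `&` snd @^-1` Om); last first.
  by apply/seteqP; split => z /=; rewrite in_itv.
apply: openI; apply: open_comp => //; first by move=> z _; exact: cvg_fst.
by move=> z _; exact: cvg_snd.
Qed.

Lemma measurable_Q : measurable (Q : set ME).
Proof. exact: open_measurable_E cylinder_open. Qed.

Lemma measurable_time_interval : measurable I.
Proof.
rewrite (_ : I = `]0, T[%classic); first exact: measurable_itv.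
by apply/seteqP; split=> r /=; rewrite in_itv.
Qed.

Lemma time_interval_lebesgue : lam I = T%:E.
Proof.
rewrite (_ : I = `]0, T[%classic); last first.
  by apply/seteqP; split=> r /=; rewrite in_itv.
by rewrite lebesgue_measure_itv/= lte_fin T0 oppr0 adde0.
Qed.

Lemma time_interval_lty : (lam I < +oo)%E.
Proof. by rewrite time_interval_lebesgue ltry. Qed.

(** Wider than the elementary functions: indicators of time intervals are needed as well. *)
Definition weight (b : R -> R) := measurable_fun setT (b : measurableTypeR R -> R) /\
  exists M : R, forall r, I r -> `|b r| <= M.

Lemma weight_elem b : elementary b -> weight b.
Proof.
move=> /elementary_continuous cb; split; first exact: continuous_measurable_fun.
have : compact (b @` `[0, T]).
  apply: continuous_compact; last exact: segment_compact.
  exact: continuous_subspaceT.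
move=> /compact_bounded [M [_ HM]]; exists (M + 1) => r /andP[r0 rT].
by apply: (HM (M + 1)); rewrite ?ltrDl//; exists r => //=; rewrite in_itv/= !ltW.
Qed.

Lemma weightM b b' : weight b -> weight b' -> weight (fun t => b t * b' t).
Proof.
move=> [mb [M bM]] [mb' [M' bM']]; split; first exact: measurable_funM.
exists (M * M') => r Ir; rewrite normrM; apply: ler_pM => //; [exact: bM|exact: bM'].
Qed.

Lemma weight_indic (A : set (measurableTypeR R)) : measurable A -> weight (\1_A : R -> R).
Proof.
move=> mA; split; first exact: measurable_indic.
by exists 1 => r _; rewrite indicE; case: (_ \in _); rewrite ?normr1 ?normr0.
Qed.

Definition mom (b : R -> R) (f : sfield R d) (x : 'rV[R]_d) : R :=
  \int[lam]_(r in I) (b r * f (r, x)).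

Lemma weight_L2 b f : weight b -> L2 f -> L2 (fun z => b z.1 * f z).
Proof.
move=> [mb [M bM]] fL.
exact: (@inL2_weightM _ _ _ _ R lam (lebesgue_rV d) I Om measurable_time_interval open_measurable_x b f M mb bM fL).
Qed.

Lemma snd_L2 m : L2x m -> L2 (fun z => m z.2).
Proof.
exact: (@inL2_snd _ _ _ _ R lam (lebesgue_rV d) I Om measurable_time_interval open_measurable_x time_interval_lty m).
Qed.

Lemma tensor_L2 b m : weight b -> L2x m -> L2 (fun z => b z.1 * m z.2).
Proof. by move=> wb /snd_L2; exact: weight_L2. Qed.

Lemma mom_L2 b f : weight b -> L2 f -> L2x (mom b f).
Proof.
move=> [mb [M bM]] fL.
exact: (@inL2_moment _ _ _ _ R lam (lebesgue_rV d) I Om measurable_time_interval open_measurable_x time_interval_lty b f M mb bM fL).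
Qed.

Lemma tensor_mom b m f : weight b -> L2x m -> L2 f ->
  ip (fun z => b z.1 * m z.2) f = ipx m (mom b f).
Proof.
move=> [mb [M bM]] mL fL.
exact: (@tensor_moment _ _ _ _ R lam (lebesgue_rV d) I Om measurable_time_interval open_measurable_x time_interval_lty b m f M mb bM mL fL).
Qed.

Lemma tensor_tensor b b' m m' : weight b -> weight b' -> L2x m -> L2x m' ->
  ip (fun z => b z.1 * m z.2) (fun z => b' z.1 * m' z.2) =
  (\int[lam]_(r in I) (b r * b' r)) * ipx m m'.
Proof.
move=> wb wb' mL mL'; rewrite tensor_mom//; last exact: tensor_L2.
rewrite -(ipZr (inL2_sip mx open_measurable_x))//; apply: eq_Rintegral => x _.
congr (_ * _); rewrite /mom -[RHS]/(_ * m' x) mulrC -RintegralZl//.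
- by apply: eq_Rintegral => r _; rewrite [RHS]mulrC mulrA.
- exact: measurable_time_interval.
have [mb [M bM]] := wb; have [mb' [M' bM']] := wb'.
have [bL _] := inL2_bounded_weight measurable_time_interval time_interval_lty mb bM.
have [bL' _] := inL2_bounded_weight measurable_time_interval time_interval_lty mb' bM'.
exact: (inL2M measurable_time_interval bL bL').
Qed.

Lemma smooth_slice_L2 phi r : smooth phi -> I r -> L2x (fun x => phi (r, x)).
Proof.
move=> sp Ir; have [N QN] := cylinder_sub_cube T bO.
have [M [M0 HM]] := continuous_bounded_cube N (smooth_continuous sp).
have mf : measurable_fun Om (fun x => phi (r, x)).
  apply: (measurable_funS measurableT) => //.
  exact: (measurableT_comp (smooth_measurable sp) (measurable_pair1 (r : measurableTypeR R))).
have Of : (mx Om < +oo)%E.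
  have [K [K0 HK]] := bounded_coord bO.
  have := leb_x_box_lty (fun _ : 'I_d => - (K + 1)) (fun=> K + 1).
  set B := mkset _ => Blt; apply: le_lt_trans Blt.
  have mB : measurable B.
    have := measurable_rV_box (fun _ : 'I_d => measurable_itv `](- (K + 1) : R), (K + 1)[).
    by congr measurable; apply/seteqP; split => x h i; move: (h i); rewrite /= in_itv.
  apply: le_measure; rewrite ?inE; [exact: open_measurable_x|exact: mB|].
  move=> x Ox i; rewrite -ltr_norml (le_lt_trans (HK x i Ox))// ltrDl//.
have mO := open_measurable_x.
apply/inL2P => //; split => //.
apply: (measurable_bounded_integrable mO Of); first exact: measurable_funX.
exists (M ^+ 2); split; first exact: num_real.
move=> y My x Ox; apply: le_trans (ltW My); rewrite normrX.
by rewrite lerXn2r ?nnegrE// HM//; apply: QN.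
Qed.

Lemma tensor_smooth_fubini b m phi : weight b -> L2x m -> smooth phi ->
  lam.-integrable I (EFin \o (fun r => b r * ipx m (fun x => phi (r, x)))) /\
  ip (fun z => b z.1 * m z.2) phi =
  \int[lam]_(r in I) (b r * ipx m (fun x => phi (r, x))).
Proof.
move=> [mb [M bM]] mL sp; have [N QN] := cylinder_sub_cube T bO.
have fL := smooth_inL2 measurable_Q QN sp.
exact: (@tensor_slice _ _ _ _ R lam (lebesgue_rV d) I Om measurable_time_interval open_measurable_x time_interval_lty b m phi M mb bM mL fL (fun r => smooth_slice_L2 sp)).
Qed.

Lemma tensor_smooth_integrable b m phi : weight b -> L2x m -> smooth phi ->
  lam.-integrable I (EFin \o (fun r => b r * ipx m (fun x => phi (r, x)))).
Proof. by move=> wb mL sp; case: (tensor_smooth_fubini wb mL sp). Qed.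

Lemma tensor_smooth b m phi : weight b -> L2x m -> smooth phi ->
  ip (fun z => b z.1 * m z.2) phi =
  \int[lam]_(r in I) (b r * ipx m (fun x => phi (r, x))).
Proof. by move=> wb mL sp; case: (tensor_smooth_fubini wb mL sp). Qed.

End time_weights.

(** * Continuous representatives and their initial value *)

Section initial_values.
Context {R : realType} {d : nat}.
Local Notation E := (R * 'rV[R]_d)%type.
Local Notation mx := (@leb_x R d).
Local Notation lam := (@lebesgue_measure R).
Variables (T : R) (Om : set 'rV[R]_d).
Hypotheses (T0 : 0 < T) (oO : open Om) (bO : bounded_set Om).
Local Notation L2x := (inL2 mx Om).
Local Notation ipx := (ipL2 mx Om).

Let mO := open_measurable_x oO.
Let Sx := @inL2_sip _ _ R mx Om mO.

Lemma ae_exists (P : R -> Prop) (a b : R) : a < b ->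
  {ae lam, forall t : R, a < t < b -> P t} -> exists2 t, a < t < b & P t.
Proof.
move=> ab; move=> [N [mN N0 NP]]; apply: contrapT => nP.
have sub : `]a, b[%classic `<=` N.
  move=> t /=; rewrite in_itv/= => tab; apply: NP => /= /(_ tab) Pt.
  by apply: nP; exists t.
have : (lam `]a, b[%classic <= lam N)%E.
  by apply: le_measure => //; rewrite inE//; exact: measurable_itv.
by rewrite N0 lebesgue_measure_itv/= lte_fin ab -EFinB lee_fin subr_le0 leNgt ab.
Qed.

Lemma normL2x_small (f : 'rV[R]_d -> R) e : L2x f -> 0 <= e ->
  normL2 mx Om f <= e -> ipx f f <= e ^+ 2.
Proof.
move=> fL e0; rewrite /normL2 => h; rewrite -[leLHS]sqr_sqrtr ?(sip_ge0 Sx)//.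
by rewrite lerXn2r ?nnegrE ?sqrtr_ge0.
Qed.

Lemma continuous_rep_near v V e : continuous_rep T Om v V -> 0 < e ->
  exists2 del, 0 < del & forall t : R, 0 <= t <= T -> t < del ->
    ipx (V t - V 0) (V t - V 0) <= e.
Proof.
move=> [VL Vc _] e0.
have z0 : `[0, T]%classic (0 : R) by rewrite /= in_itv/= lexx ltW.
have := Vc 0 z0 => /cvgrPdist_le /(_ (Num.sqrt e)); rewrite sqrtr_gt0 => /(_ e0).
rewrite near_withinE => /nbhs_ballP[del /= del0 H]; exists del => // t tT tdel.
have t1 : `[0, T]%classic t by rewrite /= in_itv/=.
have : ball (0 : R) del t by rewrite /ball/= sub0r normrN ger0_norm//; case/andP: tT.
move=> /H /(_ t1); rewrite sub0r normrN ger0_norm ?sqrtr_ge0// => h.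
rewrite -[leRHS]sqr_sqrtr ?(ltW e0)//.
exact: (normL2x_small (sipB Sx (VL _ t1) (VL _ z0)) (sqrtr_ge0 _) h).
Qed.

(** The two representatives agree at almost every time, hence at some time so close to $0$ that both
    are near their initial values. *)
Lemma continuous_rep_unique v V V' : continuous_rep T Om v V ->
  continuous_rep T Om v V' -> ipx (V 0 - V' 0) (V 0 - V' 0) = 0.
Proof.
move=> HV HV'; have [VL _ aeV] := HV; have [VL' _ aeV'] := HV'.
have z0 : `[0, T]%classic (0 : R) by rewrite /= in_itv/= lexx ltW.
have BL : L2x (V 0 - V' 0) by exact: (sipB Sx (VL _ z0) (VL' _ z0)).
apply/eqP; rewrite eq_le (sip_ge0 Sx BL) andbT; apply/ler_addgt0Pl => e e0.
have e4 : 0 < e / 4 by rewrite divr_gt0.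
have [d1 d10 H1] := continuous_rep_near HV e4.
have [d2 d20 H2] := continuous_rep_near HV' e4.
pose dl := Num.min T (Num.min d1 d2).
have dl0 : 0 < dl by rewrite !lt_min T0 d10.
have [t /andP[t0]] : exists2 t, 0 < t < dl & eqL2 mx Om (V t) (V' t).
  apply: ae_exists => //.
  apply: (@filterS2 _ _ (ae_filter_ringOfSetsType lam) _ _ _ _ aeV aeV').
  move=> t h h' /andP[t0].
  rewrite !lt_min => /and3P[tT _ _].
  have tT' : 0 < t < T by rewrite t0.
  by apply: filterS2 (h tT') (h' tT') => x hx hx' Ox; rewrite -hx// -hx'.
rewrite !lt_min => /and3P[tT td1 td2] eqt.
have tI : `[0, T]%classic t by rewrite /= in_itv/= !ltW.
have tI' : 0 <= t <= T by rewrite !ltW.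
have /(_ tI' td1) h1 := H1 t; have /(_ tI' td2) h2 := H2 t.
have a1 := VL _ z0; have a2 := VL' _ z0; have a3 := VL _ tI; have a4 := VL' _ tI.
have P1 := sipB Sx a3 a1; have P2 := sipB Sx a4 a2.
have := sip_sqrD_le Sx (sipN Sx P1) P2.
rewrite (ipNl Sx P1 (sipN Sx P1)) (ipNr Sx P1 P1) opprK.
have -> : ipx (- (V t - V 0) + (V' t - V' 0)) (- (V t - V 0) + (V' t - V' 0)) =
    ipx (V 0 - V' 0) (V 0 - V' 0).
  have e1 : eqL2 mx Om (- (V t - V 0) + (V' t - V' 0)) (V 0 - V' 0).
    apply: filterS eqt => x /[apply] h.
    rewrite -[LHS]/(- (V t x - V 0 x) + (V' t x - V' 0 x)) h.
    by rewrite -[RHS]/(V 0 x - V' 0 x); ring.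
  have L1 := sipD Sx (sipN Sx P1) P2.
  rewrite (eqL2_ipl mO L1 BL e1)// (sipC Sx BL)//.
  by rewrite (eqL2_ipl mO L1 BL e1).
move=> h; lra.
Qed.

(** [gamma0] is read off a chosen representative; by uniqueness any representative at hand computes
    it. *)
Lemma gamma0_rep w V : continuous_rep T Om w.1 V ->
  L2x (gamma0 T Om w) /\ eqL2 mx Om (gamma0 T Om w) (V 0).
Proof.
move=> HV; rewrite /gamma0; set G := xget _ _.
have HG : continuous_rep T Om w.1 G.
  by have := @xgetPex _ (fun _ _ => 0) [set V | continuous_rep T Om w.1 V]; apply; exists V.
have z0 : `[0, T]%classic (0 : R) by rewrite /= in_itv/= lexx ltW.
have GL : L2x (G 0) by have [h _ _] := HG; exact: h.
have VL : L2x (V 0) by have [h _ _] := HV; exact: h.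
by split => //; apply: (ip0_eqL2 mO) => //; exact: continuous_rep_unique HG HV.
Qed.

Lemma tensor_rep a m : elementary a -> L2x m ->
  continuous_rep T Om (fun z : E => a z.1 * m z.2) (fun t x => a t * m x).
Proof.
move=> ea mL; split.
- by move=> t _; exact: (sipZ Sx (a t) mL).
- move=> t _.
  have E1 s : normL2 mx Om (fun x => a s * m x - a t * m x) = `|a s - a t| * normL2 mx Om m.
    rewrite /normL2 -sqrtr_sqr -sqrtrM ?sqr_ge0//; congr Num.sqrt.
    rewrite -(ip_sqrZ Sx)//; congr ipx; apply/funext => x;
      by rewrite -[RHS]/((a s - a t) * m x) mulrBl.
  under eq_fun do rewrite E1.
  set c := normL2 mx Om m.
  have H : (fun s => `|a s - a t| * c) @ t --> `|a t - a t| * c.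
    apply: cvgMl; apply: cvg_norm.
    by apply: cvgB; [exact: elementary_continuous|exact: cvg_cst].
  by move: H; rewrite subrr normr0 mul0r => /cvg_within_filter; exact.
- by apply: aeW => t tT; apply: aeW.
Qed.

End initial_values.

(** * Tensor fields on the cylinder *)

Section orthogonal.
Context {R : realType} {V : lmodType R}.
Variables (P : V -> Prop) (ip : V -> V -> R) (Th : V -> Prop).
Hypotheses (S : sip_space P ip) (cP : sip_complete P ip)
  (ThP : forall th, Th th -> P th).

(** Spaces defined by Green formulas or weak derivatives are orthogonal complements of sets of test
    vectors, which makes them complete. *)
Definition sip_orth u := P u /\ forall th, Th th -> ip u th = 0.

Lemma sip_orth_space : sip_space sip_orth ip.
Proof.
apply: (sip_space_sub S); first by move=> u [].
  by split; [exact: (sip0 S)|move=> th /ThP; exact: (ip0l S)].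
move=> a u v [Pu Hu] [Pv Hv]; split; first exact: (sipP S).
by move=> th tP; rewrite (sipL S)//; [rewrite Hu// Hv// mulr0 addr0|exact: ThP].
Qed.

Lemma sip_orth_complete : sip_complete sip_orth ip.
Proof.
move=> u Pu cu; have Pu' n : P (u n) by case: (Pu n).
have [l Pl ul] := cP Pu' cu; exists l => //; split => // th tP.
have := sip_cvg_ip S Pu' Pl (ThP tP) ul.
rewrite (_ : (fun n => ip (u n) th) = fun=> 0); last first.
  by apply/funext => n; case: (Pu n) => _ ->.
by move=> /(cvg_lim (@Rhausdorff R)) <-; exact: lim_cst.
Qed.

End orthogonal.

Section zero_trace.
Context {R : realType} {d : nat}.
Local Notation E := (R * 'rV[R]_d)%type.
Local Notation ME := (measurableTypeR R * 'rV[R]_d)%type.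
Local Notation mu := (@leb_tx R d).
Local Notation mx := (@leb_x R d).
Local Notation lam := (@lebesgue_measure R).
Variables (T : R) (Om : set 'rV[R]_d).
Hypotheses (T0 : 0 < T) (oO : open Om) (bO : bounded_set Om).
Local Notation Q := (cylinder T Om).
Local Notation L2 := (inL2 mu (Q : set ME)).
Local Notation ip := (ipL2 mu (Q : set ME)).
Local Notation L2x := (inL2 mx Om).
Local Notation ipx := (ipL2 mx Om).
Local Notation I := (time_interval T).

Let mO := open_measurable_x oO.
Let Sx := @inL2_sip _ _ R mx Om mO.
Let oQ : open (Q : set E) := @cylinder_open R d T Om oO.
Let mQ : measurable (Q : set ME) := @measurable_Q R d T Om oO.
Let S := @inL2_sip _ _ R mu (Q : set ME) mQ.
Let mI := measurable_time_interval T.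
Let wL2 b f : weight T b -> L2 f -> L2 (fun z => b z.1 * f z). Proof. exact: weight_L2. Qed.
Let tL2 b m : weight T b -> L2x m -> L2 (fun z => b z.1 * m z.2). Proof. exact: tensor_L2. Qed.

Lemma cylinder_cube : exists N, (Q : set E) `<=` cube N.
Proof. exact: cylinder_sub_cube. Qed.

Let sL2 (f : sfield R d) : smooth f -> L2 f.
Proof. by have [N QN] := cylinder_cube; exact: (smooth_L2 oQ QN). Qed.

Lemma interval_FTC (F f : R -> R) (s t : R) : s < t ->
  (forall y : R, is_derive y 1 F (f y)) -> continuous f ->
  \int[lam]_(r in [set r : measurableTypeR R | s < r < t]) f r = F t - F s.
Proof.
move=> st dF cf; have cF := is_derive_continuous dF.
have H : (\int[lam]_(x in `[s, t]) (f x)%:E = (F t)%:E - (F s)%:E)%E.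
  apply: continuous_FTC2 => //; first exact: continuous_subspaceT.
    split; first by move=> y _; case: (dF y).
      by apply: cvg_at_right_filter; exact: cF.
    by apply: cvg_at_left_filter; exact: cF.
  by move=> y _; rewrite derive1E; case: (dF y).
rewrite (_ : mkset _ = `]s, t[%classic); last first.
  by apply/seteqP; split=> r /=; rewrite in_itv.
rewrite /Rintegral -(@integral_itv_bndoo _ s t _ true false).
  by rewrite H -EFinB.
by apply: measurable_funTS; apply/measurable_EFinP; exact: continuous_measurable_fun.
Qed.

Lemma test_cutoff a0 b0 k psi : 0 < a0 -> b0 < T -> lateral Om psi ->
  test_function Q (fun z : E => cutoff a0 b0 k z.1 * psi z).
Proof.
move=> a00 b0T [sp [C [cC CO p0]]]; split.
  by apply: smoothM => //; exact: smooth_fst (elementary_cutoff _ _ _).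
exists (`[a0, b0]%classic `*` C); split.
- by apply: compact_setX => //; exact: segment_compact.
- move=> z [/=]; rewrite in_itv/= => /andP[h1 h2] Cz; split; last exact: CO.
  by rewrite (lt_le_trans a00 h1) (le_lt_trans h2 b0T).
- move=> z nz; have [Cz|nC] := pselect (C z.2); last by rewrite p0 ?mulr0.
  rewrite cutoff_out ?mul0r//.
  have [ha|ha] := leP z.1 a0; first by left.
  have [hb|hb] := leP b0 z.1; first by right.
  by exfalso; apply: nz; split => //=; rewrite in_itv/= !ltW.
Qed.

(** Since [m] is only square integrable, the identity is moved to moments: for each $x$ it is the
    fundamental theorem of calculus for $a(t)\varphi(t,x)$, which vanishes at both ends. *)
Lemma tensor_derive_t a a' m phi : elementary a -> elementary a' ->
  (forall y : R, is_derive y 1 a (a' y)) -> L2x m -> test_function Q phi ->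
  ip (fun z => a z.1 * m z.2) ('D_dir_t phi) = - ip (fun z => a' z.1 * m z.2) phi.
Proof.
move=> ea ea' da mL tp; have sp := tp.1.
have dL := sL2 (smooth_derive dir_t sp).
rewrite !tensor_mom//; do ?[exact: weight_elem|exact: sL2].
rewrite -(ipNr Sx)//; last by apply: mom_L2 => //; [exact: weight_elem|exact: sL2].
apply: eq_Rintegral => x _; congr (_ * _).
rewrite -[RHS]/(- mom T a' phi x) /mom.
have slc f : smooth f -> continuous (fun r : R => f (r, x)).
  move=> sf r; apply: (@continuous_comp _ _ _ (fun r : R => (r, x)) f).
    have c1 : id @ r --> r by exact: cvg_id.
    have c2 : (fun=> x) @ r --> x by exact: cvg_cst.
    exact: cvg_pair c1 c2.
  exact: smooth_continuous.
have dslc (r : R) : is_derive r 1 (fun r : R => phi (r, x)) ('D_dir_t phi (r, x)).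
  have E1 (h : R) : (h, x) = h *: (1, 0) + (0, x) :> E.
    by apply/pair_equal_spec; split => /=; rewrite ?scaler0 ?add0r// addr0 [_ *: _]mulr1.
  under eq_fun do rewrite E1.
  rewrite [X in 'D_dir_t phi X]E1; apply/is_derive_line.
  exact/derivableP/smooth_derivable.
have dF (r : R) : is_derive r 1 (fun r : R => a r * phi (r, x))
    (a r * 'D_dir_t phi (r, x) + phi (r, x) * a' r).
  exact: (is_deriveM (da r) (dslc r)).
have ca := elementary_continuous ea; have ca' := elementary_continuous ea'.
have sdp := slc _ (smooth_derive dir_t sp).
have cM (f g : R -> R) : continuous f -> continuous g -> continuous (fun r => f r * g r).
  by move=> cf cg r; exact: (cvgM (cf r) (cg r)).
have cint (f : R -> R) : continuous f -> lam.-integrable I (EFin \o f).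
  move=> cf; apply: (@integrableS _ _ _ lam `[0, T]%classic) => //.
    by move=> r /andP[r0 rT]; rewrite /= in_itv/= !ltW.
  apply: continuous_compact_integrable; first exact: segment_compact.
  exact: continuous_subspaceT.
have := interval_FTC T0 dF; rewrite -/I.
have out r : r <= 0 \/ T <= r -> phi (r, x) = 0.
  move=> h; apply: (test_function_out tp) => -[/= /andP[h1 h2] _].
  by case: h; rewrite leNgt ?h1 ?h2.
rewrite !out ?lexx ?mulr0 ?subr0; [|by left|by right].
rewrite RintegralD//; [|exact: cint (cM _ _ ca sdp)|exact: cint (cM _ _ (slc _ sp) ca')].
move=> H; apply/eqP; rewrite -addr_eq0; apply/eqP; rewrite -[RHS]H.
  by congr (_ + _); apply: eq_Rintegral => r _; rewrite mulrC.
by move=> r; apply: cvgD; [exact: (cM _ _ ca sdp r)|exact: (cM _ _ (slc _ sp) ca' r)].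
Qed.

(** The test functions are smooth without any condition on their support, so that the formula also
    encodes zero lateral values. Only $x$-derivatives occur, so nothing is imposed at the ends of
    the time interval. *)
Record grad0 (v : sfield R d) (g : vfield R d) : Prop := Grad0 {
  grad0_L2 : L2 v;
  grad0_L2v : inL2v Q g;
  grad0_ibp : forall i phi, smooth phi ->
    ip v ('D_(dir_x i) phi) = - ip (vcomp g i) phi }.

Definition tensorv (a : R -> R) (p : 'I_d -> 'rV[R]_d -> R) : vfield R d :=
  fun z => \row_i (a z.1 * p i z.2).
Definition weightv (a : R -> R) (g : vfield R d) : vfield R d :=
  fun z => a z.1 *: g z.
Definition momv (b : R -> R) (g : vfield R d) (i : 'I_d) := mom T b (vcomp g i).

Lemma vcomp_tensorv a p i : vcomp (tensorv a p) i = fun z => a z.1 * p i z.2.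
Proof. by apply/funext => z; rewrite /vcomp mxE. Qed.

Lemma vcomp_weightv a g i : vcomp (weightv a g) i = fun z => a z.1 * vcomp g i z.
Proof. by apply/funext => z; rewrite /vcomp mxE. Qed.

(** The condition $m\in H^1_0(\Omega)$ with gradient [p], in the form of [grad0]; the test functions
    are time slices of smooth functions on space-time. *)
Record spatial (m : 'rV[R]_d -> R) (p : 'I_d -> 'rV[R]_d -> R) : Prop := Spatial {
  spatial_L2 : L2x m;
  spatial_L2v : forall i, L2x (p i);
  spatial_ibp : forall i phi r, smooth phi -> I r ->
    ipx m (fun x => 'D_(dir_x i) phi (r, x)) = - ipx (p i) (fun x => phi (r, x)) }.

Lemma grad0_weak v g : grad0 v g -> is_weak_gradx Q v g.
Proof. by move=> [_ _ H] i phi [sp _]; exact: H. Qed.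

Lemma grad0_weight a v g : elementary a -> grad0 v g ->
  grad0 (fun z => a z.1 * v z) (weightv a g).
Proof.
move=> ea [vL gL H]; have wa := weight_elem T ea.
have sa : smooth (fun z : E => a z.1) by exact: smooth_fst.
split; first exact: wL2.
  by move=> i; rewrite vcomp_weightv; exact: wL2.
move=> i phi sp; have := H i _ (smoothM sa sp).
have E1 : 'D_(dir_x i) (fun z : E => a z.1 * phi z) = fun z => a z.1 * 'D_(dir_x i) phi z.
  apply/funext => z; rewrite derive_mulE; [|exact: smooth_derivable..].
  by rewrite derive_fst_x mulr0 addr0.
rewrite E1 vcomp_weightv => h.
rewrite [LHS](_ : _ = ip v (fun z => a z.1 * 'D_(dir_x i) phi z)); last first.
  by apply: eq_Rintegral => z _; rewrite mulrCA mulrA.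
rewrite h; congr (- _); apply: eq_Rintegral => z _.
by rewrite mulrCA mulrA.
Qed.

Lemma grad0_tensor a m p : elementary a -> spatial m p ->
  grad0 (fun z => a z.1 * m z.2) (tensorv a p).
Proof.
move=> ea [mL pL H]; have wa := weight_elem T ea; split; first exact: tL2.
  by move=> i; rewrite vcomp_tensorv; exact: tL2.
move=> i phi sp; rewrite vcomp_tensorv !tensor_smooth//; last exact: smooth_derive.
rewrite (_ : \int[lam]_(r in I) _ = \int[lam]_(r in I) (-1 * (a r * ipx (p i) (fun x => phi (r, x))))).
  rewrite RintegralZl ?mulN1r//; exact: tensor_smooth_integrable.
by apply: eq_Rintegral => r; rewrite inE => Ir; rewrite H// mulrN mulN1r.
Qed.

Lemma derive_frozen_x i phi r z : smooth phi ->
  'D_(dir_x i) (fun z : E => phi (r, z.2)) z = 'D_(dir_x i) phi (r, z.2).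
Proof.
move=> sp; have ds := derivableP (smooth_derivable (z := (r, z.2)) (e := dir_x i) sp).
by have [_ ->] := @is_derive_frozen _ _ phi r (dir_x i) z _ ds.
Qed.

(** Test [grad0] with $b(t)\varphi(r,x)$: the weight commutes with the $x$-derivatives. *)
Lemma spatial_mom b v g : elementary b -> grad0 v g -> spatial (mom T b v) (momv b g).
Proof.
move=> eb [vL gL H]; have wb := weight_elem T eb.
split; [exact: mom_L2|by move=> i; exact: mom_L2|].
move=> i phi r sp Ir; have sb : smooth (fun z : E => b z.1) by exact: smooth_fst.
have sf := smooth_frozen r sp; have pL := smooth_slice_L2 oO bO sp Ir.
have dL := smooth_slice_L2 oO bO (smooth_derive (dir_x i) sp) Ir.
rewrite (sipC Sx (mom_L2 T0 oO wb vL) dL) (sipC Sx (mom_L2 T0 oO wb (gL i)) pL).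
rewrite -!tensor_mom//.
have := H i _ (smoothM sb sf).
have E1 : 'D_(dir_x i) (fun z : E => b z.1 * phi (r, z.2)) = fun z => b z.1 * 'D_(dir_x i) phi (r, z.2).
  apply/funext => z; rewrite derive_mulE; [|exact: smooth_derivable..].
  rewrite derive_fst_x mulr0 addr0; congr (_ * _).
  exact: derive_frozen_x.
rewrite E1 (sipC S vL) 1?(sipC S (gL i))//; [exact: (tL2 wb pL)|exact: (tL2 wb dL)].
Qed.

End zero_trace.

(** * Duality on the fields vanishing on the lateral boundary *)

Section zero_trace_duality.
Context {R : realType} {d : nat}.
Local Notation E := (R * 'rV[R]_d)%type.
Local Notation ME := (measurableTypeR R * 'rV[R]_d)%type.
Local Notation mu := (@leb_tx R d).
Local Notation mx := (@leb_x R d).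
Local Notation lam := (@lebesgue_measure R).
Variables (T : R) (Om : set 'rV[R]_d).
Hypotheses (T0 : 0 < T) (oO : open Om) (bO : bounded_set Om).
Local Notation Q := (cylinder T Om).
Local Notation L2 := (inL2 mu (Q : set ME)).
Local Notation ip := (ipL2 mu (Q : set ME)).
Local Notation L2x := (inL2 mx Om).
Local Notation ipx := (ipL2 mx Om).
Local Notation I := (time_interval T).

Let mO := open_measurable_x oO.
Let Sx := @inL2_sip _ _ R mx Om mO.
Let oQ : open (Q : set E) := @cylinder_open R d T Om oO.
Let mQ : measurable (Q : set ME) := @measurable_Q R d T Om oO.
Let S := @inL2_sip _ _ R mu (Q : set ME) mQ.
Let Sv := @inL2v_sip R d Q mQ.
Let Sp := @inL2p_sip R d Q mQ.
Let mI := measurable_time_interval T.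
Let tL2 b m : weight T b -> L2x m -> L2 (fun z => b z.1 * m z.2).
Proof. exact: tensor_L2. Qed.
Let sL2 (f : sfield R d) : smooth f -> L2 f.
Proof. by have [N QN] := cylinder_cube T bO; exact: (smooth_L2 oQ QN). Qed.

Definition is_weak_divx (chi : vfield R d) (q : sfield R d) := forall phi,
  test_function Q phi ->
  \sum_i ip (vcomp chi i) ('D_(dir_x i) phi) = - ip q phi.

Record spatial_divx (p : 'I_d -> 'rV[R]_d -> R) (q : 'rV[R]_d -> R) : Prop :=
  SpatialDivx {
  spatial_divx_L2v : forall i, L2x (p i);
  spatial_divx_L2 : L2x q;
  spatial_divx_ibp : forall phi r, test_function Q phi -> I r ->
    \sum_i ipx (p i) (fun x => 'D_(dir_x i) phi (r, x)) =
    - ipx q (fun x => phi (r, x)) }.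

Lemma Rintegral_sum {d0} {T1 : measurableType d0} (m : {measure set T1 -> \bar R})
    (A : set T1) (F : 'I_d -> T1 -> R) : measurable A ->
  (forall i, m.-integrable A (EFin \o F i)) ->
  \sum_i \int[m]_(x in A) F i x = \int[m]_(x in A) \sum_i F i x.
Proof.
move=> mA iF; suff [] : m.-integrable A (EFin \o (fun x => \sum_i F i x)) /\
    \sum_i \int[m]_(x in A) F i x = \int[m]_(x in A) \sum_i F i x by [].
elim: (index_enum _) => [|i s [IH1 IH2]].
  split; last by rewrite big_nil -[LHS](mul0r (fine (m A))) -Rintegral_cst//;
    apply: eq_Rintegral => x _; rewrite big_nil.
  rewrite (_ : _ \o _ = cst 0%E); first exact: integrable0.
  by apply/funext => x; rewrite /= big_nil.
have E : (fun x => \sum_(j <- i :: s) F j x) = fun x => F i x + \sum_(j <- s) F j x.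
  by apply/funext => x; rewrite big_cons.
rewrite E; split; first exact: (integrableD mA (iF i) IH1).
by rewrite big_cons IH2 RintegralD.
Qed.

Lemma ipL2_sumr (f : sfield R d) (g : 'I_d -> sfield R d) : L2 f ->
  (forall i, L2 (g i)) -> ip f (fun z => \sum_i g i z) = \sum_i ip f (g i).
Proof.
move=> fL gL; have H i : mu.-integrable Q (EFin \o (fun z => f z * g i z)).
  exact: (inL2M mQ fL (gL i)).
rewrite -[RHS]/(\sum_i \int[mu]_(z in Q) (f z * g i z)).
rewrite (Rintegral_sum mQ H).
by apply: eq_Rintegral => z _; rewrite mulr_sumr.
Qed.

Lemma divx_tensor a p q : elementary a -> spatial_divx p q ->
  is_weak_divx (tensorv a p) (fun z => a z.1 * q z.2).
Proof.
move=> ea [pL qL H] phi tp; have sp := tp.1; have wa := weight_elem T ea.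
have E1 i : ip (vcomp (tensorv a p) i) ('D_(dir_x i) phi) =
    \int[lam]_(r in I) (a r * ipx (p i) (fun x => 'D_(dir_x i) phi (r, x))).
  by rewrite vcomp_tensorv tensor_smooth//; exact: smooth_derive.
rewrite (eq_bigr _ (fun i _ => E1 i)) Rintegral_sum//; last first.
  by move=> i; exact: (tensor_smooth_integrable T0 oO bO wa (pL i) (smooth_derive (dir_x i) sp)).
rewrite tensor_smooth// -mulN1r -RintegralZl//; last exact: tensor_smooth_integrable.
by apply: eq_Rintegral => r; rewrite inE => Ir; rewrite -mulr_sumr H// mulrN mulN1r.
Qed.

(** In contrast to [spatial_mom], the weight must have compact support in $]0,T[$, because a weak
    divergence is tested only with functions of compact support in the cylinder. *)
Lemma spatial_divx_mom a0 b0 k h q : 0 < a0 -> b0 < T -> inL2v Q h -> L2 q ->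
  is_weak_divx h q ->
  spatial_divx (momv T (cutoff a0 b0 k) h) (mom T (cutoff a0 b0 k) q).
Proof.
move=> a00 b0T hL qL H; set b := cutoff a0 b0 k.
have eb : elementary b by exact: elementary_cutoff.
have wb := weight_elem T eb; split.
- by move=> i; exact: mom_L2.
- exact: mom_L2.
move=> phi r tp Ir; have sp := tp.1; have sf := smooth_frozen r sp.
have lf := lateral_frozen r (test_lateral tp).
have sb : smooth (fun z : E => b z.1) by exact: smooth_fst.
have pL := smooth_slice_L2 oO bO sp Ir.
rewrite (sipC Sx (mom_L2 T0 oO wb qL) pL) -tensor_mom// (sipC S (tL2 wb pL) qL).
rewrite -(H _ (test_cutoff k a00 b0T lf)); apply: eq_bigr => i _.
have dL := smooth_slice_L2 oO bO (smooth_derive (dir_x i) sp) Ir.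
rewrite (sipC Sx (mom_L2 T0 oO wb (hL i)) dL) -tensor_mom//.
rewrite (sipC S (tL2 wb dL) (hL i)); congr (ip _ _); apply/funext => z.
rewrite derive_mulE; [|exact: (smooth_derivable sb)|exact: (smooth_derivable sf)].
by rewrite derive_fst_x mulr0 addr0 derive_frozen_x.
Qed.

Lemma weak_div_tensor a a' m chi q : elementary a -> elementary a' ->
  (forall y : R, is_derive y 1 a (a' y)) -> L2x m -> L2 q -> is_weak_divx chi q ->
  is_weak_div Q (fun z => a z.1 * m z.2, chi) ((fun z => a' z.1 * m z.2) + q).
Proof.
move=> ea ea' da mL qL H phi tp; have pL := sL2 tp.1.
rewrite (tensor_derive_t T0 oO bO ea ea' da mL tp) H// (ipDl S)//; last first.
  exact: tL2 (weight_elem T ea') mL.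
by rewrite opprD.
Qed.

(** $U_0$ with the derivatives as witnesses; [graph0_inU0] and [inU0_graph0] are the translation. *)
Definition graph0 w g f := wgraph Q w g f /\ grad0 T Om w.1 g.

Lemma graph0_tensor a a' m p chi q : elementary a -> elementary a' ->
  (forall y : R, is_derive y 1 a (a' y)) -> spatial T Om m p ->
  inL2v Q chi -> L2 q -> is_weak_divx chi q ->
  graph0 (fun z => a z.1 * m z.2, chi) (tensorv a p) ((fun z => a' z.1 * m z.2) + q).
Proof.
move=> ea ea' da sm cL qL H; have G := grad0_tensor T0 oO bO ea sm.
split => //; have mL := spatial_L2 sm; split.
- by split => //; exact: grad0_L2 G.
- exact: grad0_L2v G.
- exact: grad0_weak.
- by apply: (sipD S) => //; exact: tL2 (weight_elem T ea') mL.
- exact: weak_div_tensor.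
Qed.

Lemma graph0_inU0 w g f : graph0 w g f -> inU0 Q w.
Proof.
move=> [wg G]; split; first exact: wgraph_inU wg.
have [N QN] := cylinder_cube T bO.
have gE := wgraph_gradx oQ QN wg; have gL := grad0_L2v G.
have gL' : inL2v Q (gradx Q w.1).
  by have [_ h _ _ _] := inU_wgraph (wgraph_inU wg).
move=> chi sc; have cL i : L2 (vcomp chi i) by exact: sL2 (sc i).
have dL i : L2 ('D_(dir_x i) (vcomp chi i)) by exact: sL2 (smooth_derive _ (sc i)).
have w1L := grad0_L2 G.
rewrite /ipL2v /smooth_divx ipL2_sumr// -sumrN; apply: eq_bigr => i _.
by rewrite (eqL2_ipl mQ (gL' i) (gL i) (gE i) (cL i)) (grad0_ibp G)// opprK.
Qed.

Lemma inU0_graph0 w : inU0 Q w -> graph0 w (gradx Q w.1) (wdiv Q w).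
Proof.
move=> [wU H]; have wg := inU_wgraph wU; split => //.
have [[w1L _] gL _ _ _] := wg; split => // i phi sp.
pose chi : vfield R d := fun z => phi z *: delta_mx ord0 i.
have E j : vcomp chi j = if j == i then phi else fun=> 0.
  by apply/funext => z; rewrite /vcomp /chi !mxE eqxx/= eq_sym; case: ifP; rewrite ?mulr1 ?mulr0.
have sc : smooth_vec chi.
  move=> j; rewrite E; case: ifP => _; [exact: sp|exact: (smooth_cst 0)].
have := H chi sc; rewrite /ipL2v (bigD1 i)//= big1 ?addr0; last first.
  by move=> j ji; rewrite E (negbTE ji) (sipC S (gL j) (sip0 S)); exact: (ip0l S (gL j)).
rewrite E eqxx => ->; rewrite opprK; congr (ip _ _); apply/funext => z.
rewrite /smooth_divx (bigD1 i)//= big1 ?addr0; first by rewrite E eqxx.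
by move=> j ji; rewrite E (negbTE ji); exact: derive_cst.
Qed.

Section coercive.
Variable cL : R.
Hypotheses (cL0 : 0 < cL)
  (hcoer : forall v : pfield R d, inU0 Q v ->
      cL * normL2p Q v ^+ 2 <=
        normL2p Q (opA Q v) ^+ 2 + normL2 mx Om (gamma0 T Om v) ^+ 2).

Lemma graph0_coercive w g f V : graph0 w g f -> continuous_rep T Om w.1 V ->
  cL * ipL2p Q w w <=
  ipL2p Q (Apair w g f) (Apair w g f) + ipx (V 0) (V 0).
Proof.
move=> G HV; have [wg _] := G; have := hcoer (graph0_inU0 G).
have [N QN] := cylinder_cube T bO.
have wL : inL2p Q w by case: wg.
have AL := opA_L2 oQ (wgraph_inU wg); have AL' := Apair_L2 oQ wg.
have AE := opA_wgraph oQ QN wg.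
have [gL gE] := gamma0_rep T0 oO HV.
have VL : L2x (V 0).
  by have [h _ _] := HV; apply: h; rewrite /= in_itv/= lexx ltW.
rewrite (normL2p_sqr mQ wL) (normL2p_sqr mQ AL).
rewrite (eqL2p_ipl mQ AL AL' AL AE) (eqL2p_ipr mQ AL' AL AL' AE).
rewrite /normL2 sqr_sqrtr ?(sip_ge0 Sx gL)//.
by rewrite (eqL2_ipl mO gL VL gE gL) (sipC Sx VL gL) (eqL2_ipl mO gL VL gE VL).
Qed.

Lemma mom_Z b c f : weight T b -> L2 f ->
  eqL2 mx Om (mom T b (c *: f)) (c *: mom T b f).
Proof.
move=> wb fL; have cfL := sipZ S c fL.
have m1 := mom_L2 T0 oO wb cfL; have m2 := mom_L2 T0 oO wb fL.
have m3 := sipZ Sx c m2; have mD := sipB Sx m1 m3.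
apply: (ip0_eqL2 mO m1 m3); set D := _ - _ in mD *.
transitivity (ipx D (mom T b (c *: f)) - c * ipx D (mom T b f)).
  by rewrite -(ipZr Sx c m2 mD); exact: (ipBr Sx m1 m3 mD).
rewrite -!(tensor_mom T0 oO wb mD)// (ipZr S c fL); first by rewrite subrr.
exact: tL2.
Qed.

(** Integrate $e^{2\lambda r}\ge1+2\lambda r$. Linear growth in $\lambda$ is enough. *)
Lemma exp_square_integral (la : R) : 0 <= la ->
  T + la * T ^+ 2 <= \int[lam]_(r in I) (expR (la * r) * expR (la * r)).
Proof.
move=> la0.
pose F (r : R) := r + la * (r * r).
have dF (y : R) : is_derive y 1 F (1 + la * (y * 1 + y * 1)).
  exact: is_deriveD.
have eF : elementary (fun y : R => 1 + la * (y * 1 + y * 1)).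
  apply: elem_add; first exact: elem_cst.
  apply: elem_mul; first exact: elem_cst.
  by apply: elem_add; apply: elem_mul; do ?[exact: elem_id|exact: elem_cst].
have eE : elementary (fun r => expR (la * r) * expR (la * r)).
  have e1 : elementary (fun r => expR (la * r)).
    by have := elem_affine la 0 elem_exp; under eq_fun do rewrite addr0.
  exact: elem_mul.
have := interval_FTC T0 dF (elementary_continuous eF).
rewrite [F 0]/F mul0r mulr0 addr0 subr0 [F T]/F -expr2 => <-.
have ei f : elementary f -> lam.-integrable I (EFin \o f).
  move=> ef; have [mf [M fM]] := weight_elem T ef.
  apply: (measurable_bounded_integrable mI (time_interval_lty T0)).
    exact: (measurable_funS measurableT (@subsetT _ I) mf).
  by exists M; split; [exact: num_real|move=> y My r Ir; apply: le_trans (ltW My); exact: fM].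
apply: le_Rintegral => //; [exact: ei|exact: ei|].
move=> r /andP[r0 _]; rewrite -expRD; apply: le_trans (expR_ge1Dx _).
by rewrite mulr1 mulrDr.
Qed.

(** With $p$ the moment of $h$, the field $(e^{\lambda t}m,-e^{\lambda t}p)$ has initial value $m$,
    and $A$ annihilates it because $p=\nabla_x m$ and $\mathrm{div}_xp=\lambda m$. Coercivity then
    reads $c_{\mathbf L}(T+\lambda T^2)\lVert m\rVert^2\le\lVert m\rVert^2$, and $c_{\mathbf
    L}\lambda T^2\ge1$ leaves $c_{\mathbf L}T\lVert m\rVert^2\le0$. *)
Lemma moment_null (la : R) u h a0 b0 k : 0 <= la -> 1 <= cL * (la * T ^+ 2) ->
  grad0 T Om u h -> is_weak_divx h (la *: u) -> 0 < a0 -> b0 < T ->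
  ipx (mom T (cutoff a0 b0 k) u) (mom T (cutoff a0 b0 k) u) = 0.
Proof.
move=> la0 la1 G H a00 b0T; have [uL hL _] := G.
set b := cutoff a0 b0 k; have eb : elementary b by exact: elementary_cutoff.
have wb := weight_elem T eb.
set m := mom T b u; have sm : spatial T Om m (momv T b h) by exact: spatial_mom.
have sq := spatial_divx_mom k a00 b0T hL (sipZ S la uL) H.
set q := mom T _ _ in sq; set p := momv _ _ _ in sq sm.
pose a (r : R) := expR (la * r); pose na (r : R) := -1 * a r.
have ea : elementary a.
  by have := elem_affine la 0 elem_exp; under eq_fun do rewrite addr0.
have ena : elementary na by apply: elem_mul => //; exact: elem_cst.
have wa := weight_elem T ea; have wna := weight_elem T ena.
pose a' (r : R) := la * a r.
have ea' : elementary a' by apply: elem_mul => //; exact: elem_cst.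
have da (y : R) : is_derive y 1 a (a' y).
  rewrite /a (_ : (fun r => expR (la * r)) = (fun r => expR (la * r + 0))); last first.
    by apply/funext => r; rewrite addr0.
  by rewrite /a' /a -[la * y]addr0; apply: is_derive_affine; exact: is_derive_expR.
have [qL pL mL] : [/\ L2x q, forall i, L2x (p i) & L2x m].
  by split; [case: sq|case: sq|case: sm].
have cL' : inL2v Q (tensorv na p) by move=> i; rewrite vcomp_tensorv; exact: tL2.
have := graph0_tensor ea ea' da sm cL' (tL2 wna qL) (divx_tensor ena sq).
set w : pfield R d := (_, _); set f := _ + _ => Gw.
have := graph0_coercive Gw (tensor_rep T oO ea mL).
have -> : (fun x => a 0 * m x) = m.
  by apply/funext => x; rewrite /a mulr0 expR0 mul1r.
have f0 : ip f f = 0.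
  have DL := sipB Sx (sipZ Sx la mL) qL; set D := _ - _ in DL.
  have -> : f = fun z => a z.1 * D z.2.
    apply/funext => z; rewrite -[LHS]/(la * a z.1 * m z.2 + -1 * a z.1 * q z.2).
    by rewrite -[D z.2]/(la * m z.2 - q z.2); ring.
  rewrite tensor_tensor//; suff -> : ipx D D = 0 by rewrite mulr0.
  apply: (eqL2_ip mO DL _ DL).
  apply: filterS (mom_Z la wb uL) => x /[apply] qE.
  by rewrite -[LHS]/((la *: m) x - q x) -qE subrr.
have A0 : ipL2p Q (Apair w (tensorv a p) f) (Apair w (tensorv a p) f) = 0.
  rewrite /ipL2p /Apair /= f0 add0r (_ : _ + _ = 0); last first.
    by apply/funext => z; apply/rowP => i; rewrite !mxE /na; ring.
  exact: (ip0l Sv (sip0 Sv)).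
rewrite A0 add0r => h1; have wL : inL2p Q w by case: Gw => -[].
have h2 := ipL2p_fst_le mQ wL.
have := h2; rewrite [X in X <= _](_ : _ = ip (fun z => a z.1 * m z.2) (fun z => a z.1 * m z.2))//.
rewrite tensor_tensor// => h3.
have h4 := exp_square_integral la0.
have m0 := sip_ge0 Sx mL; apply/eqP; rewrite eq_le m0 andbT.
move: h1 h3 h4 la1; set W := ipL2p _ _ _; set J := \int[lam]_(r in I) _.
rewrite -/(a _) -/J => h1 h3 h4 la1.
have h5 : cL * ((T + la * T ^+ 2) * ipx m m) <= ipx m m.
  apply: le_trans h1; rewrite ler_pM2l//; apply: le_trans h3.
  by rewrite ler_wpM2r.
have h6 : 0 <= (cL * (la * T ^+ 2) - 1) * ipx m m by rewrite mulr_ge0// subr_ge0.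
have h7 : 0 < cL * T by rewrite mulr_gt0.
rewrite -(ler_pM2l h7) mulr0; move: h5 h6; move: (ipx m m) (la * T ^+ 2) => x y; lra.
Qed.

(** A box cutoff inside the cylinder is a time cutoff times a function of $x$, so its product with
    $u$ is a pairing with a moment that vanishes by [moment_null]. *)
Lemma residual_null (la : R) u h : 0 <= la -> 1 <= cL * (la * T ^+ 2) ->
  grad0 T Om u h -> is_weak_divx h (la *: u) ->
  eqL2 mu Q u (fun=> 0) /\ forall i, eqL2 mu Q (vcomp h i) (fun=> 0).
Proof.
move=> la0 la1 G H; have [N QN] := cylinder_cube T bO; have [uL hL Hu] := G.
have u0 : eqL2 mu Q u (fun=> 0).
  apply: (test_function_total oQ QN uL) => a0 b0 a b k cQ.
  have bL : L2 (box_cutoff a0 b0 a b k) by exact: sL2 (smooth_box_cutoff _ _ _ _ _).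
  have [|ne] := pselect (forall z, ~ box a0 b0 a b z).
    move=> out; rewrite (_ : box_cutoff _ _ _ _ _ = 0).
      by rewrite (sipC S uL (sip0 S)); exact: (ip0l S uL).
    by apply/funext => z; exact: box_cutoff_out.
  have [z [z1 z2]] : exists z, box a0 b0 a b z by apply: contrapT => /forallNP.
  have z2' i : a i <= z.2 ord0 i <= b i by move: (z2 i) => /andP[/ltW -> /ltW ->].
  have ab : a0 <= b0 by case/andP: z1 => ? ?; apply: ltW; apply: lt_trans; eassumption.
  have [/andP[a00 _] _] : (Q : set E) (a0, z.2) by apply: cQ; split => //=; rewrite lexx.
  have [/andP[_ b0T] _] : (Q : set E) (b0, z.2) by apply: cQ; split => //=; rewrite lexx ab.
  pose psi (x : 'rV[R]_d) := \prod_i cutoff (a i) (b i) k (x ord0 i).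
  have eb : elementary (cutoff a0 b0 k) by exact: elementary_cutoff.
  have wb := weight_elem T eb.
  have pL : L2x psi.
    have sp : smooth (fun z : E => \prod_i cutoff (a i) (b i) k (z.2 ord0 i)).
      by apply: smooth_prod => i; exact: (smooth_coord _ (elementary_cutoff _ _ _)).
    have h1 : 0 < T / 2 by rewrite divr_gt0.
    have h2 : T / 2 < T by rewrite ltr_pdivrMr// ltr_pMr// ltr1n.
    have IT : I (T / 2) by apply/andP; split.
    exact: (smooth_slice_L2 oO bO sp IT).
  rewrite (sipC S uL bL) [LHS](tensor_mom T0 oO wb pL uL).
  rewrite (sipC Sx pL (mom_L2 T0 oO wb uL)).
  apply: (sip_null Sx (mom_L2 T0 oO wb uL) pL).
  exact: moment_null la0 la1 G H a00 b0T.
split => // i; apply: (test_orthogonal oQ QN (hL i)) => phi tp.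
by rewrite -[LHS]opprK -Hu ?(eqL2_ip mQ uL u0) ?oppr0//; [exact: sL2 (smooth_derive _ tp.1)|exact: tp.1].
Qed.

(* If [v] were orthogonal to the fields satisfying the duality relation, then
   z = (e^(lt) m, - e^(lt) p), with m, p the moments of v and its gradient,
   would satisfy A z = 0 and be large compared with its initial value m when
   l is large. *)
Lemma grad0_duality v g chi q : grad0 T Om v g -> inL2v Q chi -> L2 q ->
  is_weak_divx chi q -> ipL2v Q chi g = - ip q v.
Proof.
move=> G cL' qL H.
(* The pair $(v,g)$ is stored with its scalar component divided by [mm]. The residual $u$ then
   solves $\mathrm{div}_x\nabla_xu=\mathtt{mm}^{-2}u$, and
   $\mathtt{mm}^{-2}=(1+\mathtt{la})^2\ge\mathtt{la}$ is large enough for [residual_null]. *)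
pose la : R := (cL * T ^+ 2)^-1 + 1; pose mm : R := (1 + la)^-1.
have [N QN] := cylinder_cube T bO.
pose ei (i : 'I_d) (phi : sfield R d) : vfield R d := fun z => phi z *: delta_mx ord0 i.
have eiE i phi j : vcomp (ei i phi) j = if j == i then phi else 0.
  by apply/funext => z; rewrite /vcomp /ei !mxE eqxx/= eq_sym; case: ifP; rewrite ?mulr1 ?mulr0.
have eiL i phi : L2 phi -> inL2v Q (ei i phi).
  by move=> pL j; rewrite eiE; case: ifP => // _; exact: (sip0 S).
have eiP i phi (h : vfield R d) : inL2v Q h -> ipL2v Q h (ei i phi) = ip (vcomp h i) phi.
  move=> hL; rewrite /ipL2v (bigD1 i)//= eiE eqxx big1 ?addr0// => j ji.
  by rewrite eiE (negbTE ji) (sipC S (hL j) (sip0 S)); exact: (ip0l S (hL j)).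
(* Orthogonality to [Th0] is [grad0] for the rescaled pair; [Th1] adds the duality with every field
   that has a square integrable divergence. *)
pose Th0 (th : pfield R d) := exists i phi, smooth phi /\
  th = (mm *: 'D_(dir_x i) phi, ei i phi).
pose Th1 (th : pfield R d) := Th0 th \/ exists chi q,
  [/\ inL2v Q chi, L2 q, is_weak_divx chi q & th = (mm *: q, chi)].
have cLT : 0 < cL * T ^+ 2 by rewrite mulr_gt0// exprn_gt0.
have la0 : 0 < la by rewrite ltr_wpDl// invr_ge0 ltW.
have mm0 : mm != 0 by rewrite invr_eq0 gt_eqF// ltr_pwDl// ltW.
have Th0L th : Th0 th -> inL2p Q th.
  move=> [i [phi [sp ->]]]; split => /=; last by apply: eiL; exact: sL2.
  by apply: (sipZ S); exact: sL2 (smooth_derive _ sp).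
have Th1L th : Th1 th -> inL2p Q th.
  move=> [/Th0L//|[chi' [q' [cL'' qL' _ ->]]]]; split => //=; exact: (sipZ S).
have orth0 w : sip_orth (inL2p Q) (ipL2p Q) Th0 w -> grad0 T Om (mm *: w.1) w.2.
  move=> [[w1 w2] H0]; split => //; first exact: (sipZ S).
  move=> i phi sp; have pL := sL2 sp; have dL := sL2 (smooth_derive (dir_x i) sp).
  have : ipL2p Q w (mm *: 'D_(dir_x i) phi, ei i phi) = 0 by apply: H0; exists i, phi.
  rewrite /ipL2p /= eiP// (ipZr S _ dL w1) (ipZl S _ w1 dL) => /eqP.
  by rewrite addr_eq0 => /eqP.
pose w0 : pfield R d := (mm^-1 *: v, g).
have [vL gL Hv] := G.
have w0L : inL2p Q w0 by split => //=; exact: (sipZ S).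
have S1 := sip_orth_space Sp Th1L.
have [l [lL Hl] Hr] := sip_projection Sp S1 (fun u (h : sip_orth _ _ _ u) => proj1 h)
  (sip_orth_complete Sp (inL2p_complete mQ) Th1L) w0L.
set r := w0 - l in Hr; have rL : inL2p Q r by exact: (sipB Sp).
have w0Th th : Th0 th -> ipL2p Q w0 th = 0.
  move=> [i [phi [sp ->]]]; have pL := sL2 sp; have dL := sL2 (smooth_derive (dir_x i) sp).
  rewrite /ipL2p /= eiP// (ipZr S _ dL (sipZ S _ vL)) (ipZl S _ vL dL) mulrA divff// mul1r.
  by rewrite Hv// addNr.
have Gr : grad0 T Om (mm *: r.1) r.2.
  apply: orth0; split => // th tP; rewrite (ipBl Sp w0L lL (Th0L _ tP)).
  by rewrite w0Th// Hl ?subr0//; left.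
(* For a test function $\varphi$ the pair $(\mathtt{mm}^{-1}\varphi,\nabla_x\varphi)$ satisfies all
   relations of [Th1], so the residual of the projection is orthogonal to it. *)
have Dr : is_weak_divx r.2 (mm^-1 ^+ 2 *: (mm *: r.1)).
  move=> phi tp; have sp := tp.1; have pL := sL2 sp.
  pose gphi : vfield R d := fun z => \row_i 'D_(dir_x i) phi z.
  have gE i : vcomp gphi i = 'D_(dir_x i) phi by apply/funext => z; rewrite /vcomp mxE.
  have dL i := sL2 (smooth_derive (dir_x i) sp).
  have gpL : inL2v Q gphi by move=> i; rewrite gE.
  have pp : inL2p Q (mm^-1 *: phi, gphi) by split => //=; exact: (sipZ S).
  have := Hr (mm^-1 *: phi, gphi); rewrite /ipL2p /= => H1.
  have {}H1 : ip r.1 (mm^-1 *: phi) + ipL2v Q r.2 gphi = 0.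
    apply: H1; split => // th [[i [psi [spsi ->]]]|[chi' [q' [cL'' qL' H' ->]]]].
      have psL := sL2 spsi; have dpL := sL2 (smooth_derive (dir_x i) spsi).
      rewrite /ipL2p /= eiP// gE (ipZr S _ dpL (sipZ S _ pL)) (ipZl S _ pL dpL) mulrA divff// mul1r.
      by rewrite (sipC S (dL i) psL) (ipL2_derive_test _ mQ QN spsi tp) (sipC S pL dpL) subrr.
    rewrite /ipL2p /= (ipZr S _ qL' (sipZ S _ pL)) (ipZl S _ pL qL') mulrA divff// mul1r.
    rewrite (sipC Sv gpL cL'') /ipL2v (eq_bigr (fun i => ip (vcomp chi' i) ('D_(dir_x i) phi))).
      by rewrite H'// (sipC S pL qL') subrr.
    by move=> i _; rewrite gE.
  rewrite (eq_bigr (fun i => ip (vcomp r.2 i) (vcomp gphi i))); last by move=> i _; rewrite gE.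
  have [r1 r2] := rL; rewrite (ipZr S _ pL r1) in H1.
  rewrite (ipZl S _ (sipZ S _ r1) pL) (ipZl S _ r1 pL).
  rewrite (_ : _ ^+ 2 * _ = mm^-1 * ip r.1 phi); last by rewrite expr2 -mulrA [_^-1 * (mm * _)]mulrA mulVf// mul1r.
  by apply/eqP; rewrite -addr_eq0 addrC H1.
have la1 : 1 <= cL * (mm^-1 ^+ 2 * T ^+ 2).
  rewrite mulrCA -ler_pdivrMr// mul1r invrK.
  have h1 : (cL * T ^+ 2)^-1 <= la by rewrite lerDl.
  apply: le_trans h1 _.
  have h2 (x : R) : 0 < x -> x <= (1 + x) ^+ 2 by move=> x0; nra.
  exact: h2.
have [r1 r2] := residual_null (sqr_ge0 _) la1 Gr Dr.
have r1' : eqL2 mu Q r.1 (fun=> 0).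
  apply: filterS r1 => z /[apply] /eqP.
  by rewrite mulf_eq0 (negbTE mm0)/= => /eqP.
have : ipL2p Q w0 (mm *: q, chi) = 0.
  have tP : Th1 (mm *: q, chi) by right; exists chi, q.
  rewrite -[LHS](subrK (ipL2p Q l (mm *: q, chi))) -(ipBl Sp w0L lL (Th1L _ tP)) Hl// addr0.
  have [rL1 rL2] := rL; rewrite /ipL2p (eqL2_ip mQ rL1 r1')/= ?add0r; last exact: (sipZ S).
  by rewrite /ipL2v big1// => i _; exact: (eqL2_ip mQ (rL2 i) (r2 i) (cL' i)).
rewrite /ipL2p /= (ipZr S _ qL (sipZ S _ vL)) (ipZl S _ vL qL) mulrA divff// mul1r => /eqP.
by rewrite addrC addr_eq0 (sipC Sv cL' gL) (sipC S qL vL) => /eqP.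
Qed.

End coercive.

End zero_trace_duality.

(** * Density of the tensor fields *)

Section bernoulli_sequence.
Context {R : realType}.

(** With $w=\sqrt z$, the product $(n+1)w^n$ is at most the geometric sum $\sum_{i\le n}w^i$, and a
    factor $w^n$ is left over. *)
Lemma geometric_linear_cvg0 (z : R) : 0 <= z < 1 -> (fun n => n.+1%:R * z ^+ n) @ \oo --> (0 : R).
Proof.
move=> /andP[z0 z1]; set w := Num.sqrt z.
have w0 : 0 <= w by exact: sqrtr_ge0.
have w1 : w < 1 by rewrite -[1]sqrtr1 ltr_sqrt.
have zE : z = w * w by rewrite -expr2 sqr_sqrtr.
have H n : n.+1%:R * w ^+ n <= (1 - w)^-1.
  rewrite -[leRHS]mul1r ler_pdivlMr ?subr_gt0//.
  have : n.+1%:R * w ^+ n <= \sum_(i < n.+1) w ^+ i.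
    rewrite mulr_natl -[X in _ *+ X]card_ord -sumr_const; apply: ler_sum => i _.
    by apply: ler_wiXn2l => //; [exact: ltW|rewrite -ltnS].
  move=> h; apply: le_trans (ler_wpM2r _ h) _; first by rewrite subr_ge0 ltW.
  by rewrite mulrC -opprB mulNr -subrX1 opprB lerBlDr lerDl exprn_ge0.
apply: (@cvg_le0 _ _ (fun n => (1 - w)^-1 * w ^+ n)).
  move=> n; rewrite mulr_ge0 ?exprn_ge0//= zE exprMn mulrA.
  by apply: ler_wpM2r; [exact: exprn_ge0|exact: H].
rewrite -[X in _ --> X](mulr0 ((1 - w)^-1)); apply: cvgMr.
by apply: cvg_expr; rewrite ger0_norm.
Qed.

(* Composing with an affine function of cos(pi t / T), which is monotone on [0, T],
   turns the limit of these polynomials into the indicator of a time interval. *)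
Definition bern (n : nat) (y : R) : R := (1 - y ^+ n) ^+ (n.+1 * 2 ^ n).

Lemma bern_bound n y : 0 <= y <= 1 -> 0 <= bern n y <= 1.
Proof.
move=> /andP[y0 y1]; have h : 0 <= 1 - y ^+ n <= 1.
  by rewrite subr_ge0 exprn_ile1// lerBlDr lerDl exprn_ge0.
by case/andP: h => h1 h2; rewrite exprn_ge0// exprn_ile1.
Qed.

(** Below $1/2$, Bernoulli's inequality gives $1-\mathtt{bern}\le(n+1)(2y)^n$; from $1/2$ on,
    $\mathtt{bern}\le\exp(-(n+1)(2y)^n)$. The factor $n+1$ in the exponent settles the value at
    $1/2$ itself. *)
Lemma bern_cvg y : 0 <= y <= 1 -> bern ^~ y @ \oo --> (if y < 1 / 2 then 1 else 0 : R).
Proof.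
move=> /andP[y0 y1]; case: ifPn => [y2|]; last rewrite -leNgt => y2.
  have y3 : 0 <= 2 * y < 1 by apply/andP; split; lra.
  apply/cvgrPdist_le => e e0.
  have := geometric_linear_cvg0 y3 => /cvgrPdist_le /(_ e e0).
  apply: filterS => n; rewrite sub0r normrN ger0_norm; last first.
    by rewrite mulr_ge0// exprn_ge0//; case/andP: y3.
  have /andP[b0 b1] : 0 <= bern n y <= 1 by apply: bern_bound; rewrite y0.
  rewrite ger0_norm ?subr_ge0// => h; apply: le_trans h.
  rewrite lerBlDr -lerBlDl /bern.
  have yn : y ^+ n <= 1 by rewrite exprn_ile1.
  have B k (x : R) : 0 <= x <= 1 -> 1 - k%:R * x <= (1 - x) ^+ k.
    move=> /andP[x0 x1]; elim: k => [|k IH]; first by rewrite mul0r subr0 expr0.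
    rewrite exprS; apply: (@le_trans _ _ ((1 - x) * (1 - k%:R * x))).
      have kx : 0 <= k%:R * x * x by rewrite !mulr_ge0.
      by rewrite -natr1; move: kx; move: (k%:R : R) => kk; nra.
    by apply: ler_wpM2l => //; rewrite subr_ge0.
  apply: le_trans (B _ (y ^+ n) _); last by rewrite exprn_ge0.
  by rewrite natrM natrX exprMn mulrA.
apply: (@cvg_le0 _ _ (fun n => n.+1%:R^-1)); last exact: cvg_harmonic.
move=> n; have /andP[b0 b1] : 0 <= bern n y <= 1 by apply: bern_bound; rewrite y0.
rewrite b0/=; have yn0 : 0 <= y ^+ n by rewrite exprn_ge0.
have yn : y ^+ n <= 1 by rewrite exprn_ile1.
have h1 : bern n y <= expR (- (n.+1%:R * (2 * y) ^+ n)).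
  have -> : - (n.+1%:R * (2 * y) ^+ n) = (n.+1 * 2 ^ n)%:R * - y ^+ n.
    by rewrite natrM natrX exprMn; ring.
  rewrite mulrC expRM_natr /bern lerXn2r ?nnegrE ?expR_ge0 ?subr_ge0//.
  exact: expR_ge1Dx.
apply: le_trans h1 _; rewrite expRN lef_pV2 ?posrE ?expR_gt0 ?ltr0n//.
apply: le_trans (expR_ge1Dx _); apply: (@le_trans _ _ (n.+1%:R * (2 * y) ^+ n)).
  by rewrite ler_peMr// exprn_ege1//; lra.
by rewrite lerDr.
Qed.

End bernoulli_sequence.

(** * Completeness of the cosines in time *)

Section cosine_total.
Context {R : realType} {d : nat}.
Local Notation E := (R * 'rV[R]_d)%type.
Local Notation ME := (measurableTypeR R * 'rV[R]_d)%type.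
Local Notation mu := (@leb_tx R d).
Local Notation mx := (@leb_x R d).
Variables (T : R) (Om : set 'rV[R]_d).
Hypotheses (T0 : 0 < T) (oO : open Om) (bO : bounded_set Om).
Local Notation Q := (cylinder T Om).
Local Notation L2 := (inL2 mu (Q : set ME)).
Local Notation ip := (ipL2 mu (Q : set ME)).
Local Notation L2x := (inL2 mx Om).
Local Notation ipx := (ipL2 mx Om).
Local Notation I := (time_interval T).

Let mO := open_measurable_x oO.
Let Sx := @inL2_sip _ _ R mx Om mO.
Let oQ : open (Q : set E) := @cylinder_open R d T Om oO.
Let mQ : measurable (Q : set ME) := @measurable_Q R d T Om oO.
Let S := @inL2_sip _ _ R mu (Q : set ME) mQ.

Definition freq (j : nat) : R := j%:R * (pi / T).
Definition cosm (j : nat) (t : R) : R := cos (freq j * t).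
Definition sinm (j : nat) (t : R) : R := sin (freq j * t).

Lemma elementary_cosm j : elementary (cosm j).
Proof. by have := elem_affine (freq j) 0 elem_cos; under eq_fun do rewrite addr0. Qed.

Lemma elementary_sinm j : elementary (sinm j).
Proof. by have := elem_affine (freq j) 0 elem_sin; under eq_fun do rewrite addr0. Qed.

Lemma cosm_mul j t : cosm 1 t * cosm j.+1 t = 2^-1 * cosm j.+2 t + 2^-1 * cosm j t.
Proof.
rewrite /cosm; set a := freq 1 * t.
have -> : freq j.+2 * t = freq j.+1 * t + a.
  by rewrite /a /freq -[j.+2%:R]natr1 mul1r; ring.
have -> : freq j * t = freq j.+1 * t - a.
  by rewrite /a /freq -[j.+1%:R]natr1 mul1r; ring.
by rewrite !cosD cosN sinN; field.
Qed.

Lemma cosm1_mono s t : 0 <= s <= T -> 0 <= t <= T -> (cosm 1 t < cosm 1 s) = (s < t).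
Proof.
move=> /andP[s0 sT] /andP[t0 tT]; rewrite /cosm /freq mul1r.
have p0 : 0 < pi / T by rewrite divr_gt0// pi_gt0.
have H r : 0 <= r -> r <= T -> pi / T * r \in `[0, pi].
  move=> r0 rT; rewrite in_itv/= mulr_ge0 ?(ltW p0)//=.
  by rewrite mulrAC -mulrA ler_piMr ?pi_ge0// ler_pdivrMr// mul1r.
by rewrite ltr_cos ?H// ltr_pM2l.
Qed.

Section fixed.
Variables (m : 'rV[R]_d -> R) (f : sfield R d).
Hypotheses (mL : L2x m) (fL : L2 f)
  (f0 : forall j, ip (fun z => cosm j z.1 * m z.2) f = 0).

(** Asking for all cosines at once makes the condition stable under multiplication by $\cos(\pi
    t/T)$, by the product formula for cosines. *)
Definition cos_annihilated (a : R -> R) := weight T a /\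
  forall j, ip (fun z => a z.1 * cosm j z.1 * m z.2) f = 0.

Let tL2 b : weight T b -> L2 (fun z => b z.1 * m z.2).
Proof. by move=> wb; exact: tensor_L2. Qed.

Lemma cos_annihilated1 : cos_annihilated (fun=> 1).
Proof.
split; first exact: (weight_elem T (elem_cst 1)).
by move=> j; rewrite -[RHS](f0 j); congr (ip _ f); apply/funext => z; rewrite mul1r.
Qed.

Lemma cos_annihilatedP c a b : cos_annihilated a -> cos_annihilated b ->
  cos_annihilated (fun t => c * a t + b t).
Proof.
move=> [wa Ha] [wb Hb]; have wc j := weight_elem T (elementary_cosm j).
have wcst := weight_elem T (elem_cst c).
have wD g h : weight T g -> weight T h -> weight T (fun t => g t + h t).
  move=> [mg [M gM]] [mh [M' hM']]; split; first exact: measurable_funD.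
  by exists (M + M') => r Ir; apply: le_trans (ler_normD _ _) _; rewrite lerD ?gM ?hM'.
split; first by apply: wD => //; exact: weightM.
move=> j; have aL := tL2 (weightM wa (wc j)); have bL := tL2 (weightM wb (wc j)).
transitivity (ip (c *: (fun z => a z.1 * cosm j z.1 * m z.2) +
    (fun z => b z.1 * cosm j z.1 * m z.2)) f).
  congr (ip _ f); apply/funext => z.
  by rewrite -[RHS]/(c * (a z.1 * cosm j z.1 * m z.2) + b z.1 * cosm j z.1 * m z.2); ring.
by rewrite (sipL S) ?Ha ?Hb ?mulr0 ?addr0.
Qed.

Lemma cos_annihilated_cos a : cos_annihilated a ->
  cos_annihilated (fun t => cosm 1 t * a t).
Proof.
move=> [wa Ha]; have wc j := weight_elem T (elementary_cosm j).
split; first exact: weightM.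
move=> [|j].
  rewrite -[RHS](Ha 1%N); congr (ip _ f); apply/funext => z.
  by rewrite {2}/cosm /freq !mul0r cos0; ring.
have aL j := tL2 (weightM wa (wc j)).
transitivity (ip (2^-1 *: (fun z => a z.1 * cosm j.+2 z.1 * m z.2) +
    2^-1 *: (fun z => a z.1 * cosm j z.1 * m z.2)) f).
  congr (ip _ f); apply/funext => z; rewrite [cosm 1 _ * _ * _]mulrAC cosm_mul.
  rewrite -[RHS]/(2^-1 * (a z.1 * cosm j.+2 z.1 * m z.2) + 2^-1 * (a z.1 * cosm j z.1 * m z.2)); ring.
have Z := sipZ S 2^-1 (aL j).
by rewrite (sipL S _ (aL _) Z fL) (ipZl S _ (aL j) fL) !Ha !mulr0 addr0.
Qed.

(** Multipliers form an algebra that is closed under bounded pointwise limits and contains the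
    polynomials in $\cos(\pi t/T)$; no uniform approximation is involved. *)
Definition cos_multiplier (p : R -> R) :=
  forall a, cos_annihilated a -> cos_annihilated (fun t => p t * a t).

Lemma cos_multiplier_affine al be : cos_multiplier (fun t => al + be * cosm 1 t).
Proof.
move=> a Ha; have z : cos_annihilated (fun=> 0).
  have := cos_annihilatedP (-1) Ha Ha.
  by rewrite (_ : (fun t => _) = fun=> 0)//; apply/funext => t; rewrite mulN1r addNr.
have := cos_annihilatedP be (cos_annihilated_cos Ha) (cos_annihilatedP al Ha z).
by rewrite (_ : (fun t => _) = (fun t => (al + be * cosm 1 t) * a t))//; apply/funext => t; ring.
Qed.

Lemma cos_multiplierM p q : cos_multiplier p -> cos_multiplier q ->
  cos_multiplier (fun t => p t * q t).
Proof.
move=> Hp Hq a /Hq /Hp.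
by rewrite (_ : (fun t => _) = (fun t => p t * q t * a t))//; apply/funext => t; rewrite mulrA.
Qed.

Lemma cos_multiplierX p k : cos_multiplier p -> cos_multiplier (fun t => p t ^+ k).
Proof.
move=> Hp; elim: k => [|k IH].
  by move=> a; rewrite (_ : (fun t => _ * a t) = a)//; apply/funext => t; rewrite expr0 mul1r.
by under eq_fun do rewrite exprS; exact: cos_multiplierM.
Qed.

Lemma cos_multiplier_bern p n : cos_multiplier p -> cos_multiplier (fun t => bern n (p t)).
Proof.
move=> Hp; apply: (@cos_multiplierX (fun t => 1 - p t ^+ n)) => a Ha.
have := cos_annihilatedP (-1) (cos_multiplierX n Hp Ha) Ha.
by rewrite (_ : (fun t => _) = (fun t => (1 - p t ^+ n) * a t))//; apply/funext => t; ring.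
Qed.

Lemma cos_multiplier_lim (p_ : nat -> R -> R) p : (forall n, cos_multiplier (p_ n)) ->
  (forall n, weight T (p_ n)) -> weight T p ->
  (forall n t, I t -> `|p_ n t| <= 1) -> (forall t, I t -> p_ ^~ t @ \oo --> p t) ->
  cos_multiplier p.
Proof.
move=> Hp wp_ wp p1 pc a Ha; have [wa Ha2] := Ha; split; first exact: weightM.
move=> j; have wc := weight_elem T (elementary_cosm j).
have wac := weightM wa wc; have amL := tL2 wac.
have pL q : weight T q -> L2 (fun z => q z.1 * (a z.1 * cosm j z.1 * m z.2)).
  by move=> wq; apply: (weight_L2 oO wq).
transitivity (ip f (fun z => p z.1 * (a z.1 * cosm j z.1 * m z.2))).
  rewrite (sipC S fL (pL _ wp)); congr (ip _ f); apply/funext => z; ring.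
have hL : L2 (fun z => `|a z.1 * cosm j z.1 * m z.2|).
  apply: (inL2_dominated mQ _ amL).
    by apply: measurableT_comp => //; exact: (inL2_measurable mQ amL).
  by move=> z _; rewrite normr_id.
apply: (@ipL2_dominated_cst _ _ _ mu Q f
  (fun n z => p_ n z.1 * (a z.1 * cosm j z.1 * m z.2)) _ _ 0 mQ fL hL).
- by move=> n; exact: (inL2_measurable mQ (pL _ (wp_ n))).
- by move=> n z [Iz _]; rewrite normrM ler_piMl// p1.
- exact: (inL2_measurable mQ (pL _ wp)).
- by move=> z [Iz _]; apply: cvgMl; exact: pc.
- move=> n; have [_ /(_ j) h] := Hp n _ Ha.
  by rewrite (sipC S fL (pL _ (wp_ n))) -[RHS]h; congr (ip _ f); apply/funext => z; ring.
Qed.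

Lemma cos_multiplier_half al be (A : set (measurableTypeR R)) : measurable A ->
  (forall t, I t -> 0 <= al + be * cosm 1 t <= 1) ->
  (forall t, I t -> (al + be * cosm 1 t < 1 / 2) = (t \in A)) ->
  cos_multiplier (\1_A : R -> R).
Proof.
move=> mA H01 HA.
have el g k : elementary g -> elementary (fun t => g t ^+ k).
  move=> eg; elim: k => [|k IH]; first by under eq_fun do rewrite expr0; exact: elem_cst.
  by under eq_fun do rewrite exprS; exact: elem_mul.
have eN g : elementary g -> elementary (fun t => 1 - g t).
  move=> eg; under eq_fun do rewrite -mulN1r.
  by apply: elem_add; [exact: elem_cst|apply: elem_mul => //; exact: elem_cst].
have ey : elementary (fun t => al + be * cosm 1 t).
  apply: elem_add; first exact: elem_cst.
  by apply: elem_mul; [exact: elem_cst|exact: elementary_cosm].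
apply: (@cos_multiplier_lim (fun n t => bern n (al + be * cosm 1 t))).
- by move=> n; apply: cos_multiplier_bern; exact: cos_multiplier_affine.
- by move=> n; apply: weight_elem; apply: (el); apply: eN; exact: el.
- exact: weight_indic.
- by move=> n t /H01 /(bern_bound n) /andP[h1 h2]; rewrite ger0_norm.
- move=> t It; have := bern_cvg (H01 t It); rewrite (HA t It) indicE.
  by case: (t \in A).
Qed.

Lemma cos_multiplier_interval s t : 0 <= s -> t <= T ->
  cos_multiplier (\1_[set r : measurableTypeR R | s < r < t] : R -> R).
Proof.
move=> s0 tT; have [ts|st] := leP t s.
  move=> a Ha; rewrite (_ : (fun r => _) = fun r => (-1) * a r + a r).
    exact: cos_annihilatedP.
  apply/funext => r; rewrite mulN1r addNr indicE memNset ?mul0r// => -/= /andP[sr rt].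
  by have := lt_trans sr rt; rewrite ltNge ts.
have mA (i : interval R) : measurable ([set` i] : set (measurableTypeR R)) by exact: measurable_itv.
have cos1 r : -1 <= cosm 1 r <= 1 by rewrite cos_geN1 cos_le1.
have sT : s <= T by apply: ltW; exact: lt_le_trans st tT.
have t0 : 0 <= t by apply: ltW; exact: le_lt_trans s0 st.
have h1 : cos_multiplier (\1_`]s, +oo[%classic : R -> R).
  (* The function $\frac12+\frac14(\cos(\pi r/T)-\cos(\pi s/T))$ has values in $[0,1]$ and is below
     $\frac12$ exactly for $r>s$. *)
  apply: (@cos_multiplier_half (1 / 2 - 1 / 4 * cosm 1 s) (1 / 4)) => // r Ir.
    have /andP[u1 u2] := cos1 r; have /andP[u3 u4] := cos1 s; apply/andP; split; lra.
  have -> : (r \in `]s, +oo[%classic) = (s < r).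
    by rewrite mem_setE in_itv/= andbT.
  rewrite -cosm1_mono ?s0//; last by case/andP: Ir => /ltW -> /ltW ->.
  by apply/idP/idP => h; lra.
have h2 : cos_multiplier (\1_`]-oo, t[%classic : R -> R).
  apply: (@cos_multiplier_half (1 / 2 + 1 / 4 * cosm 1 t) (- (1 / 4))) => // r Ir.
    have /andP[u1 u2] := cos1 r; have /andP[u3 u4] := cos1 t; apply/andP; split; lra.
  have -> : (r \in `]-oo, t[%classic) = (r < t).
    by rewrite mem_setE in_itv/=.
  have Ir' : 0 <= r <= T by case/andP: Ir => /ltW -> /ltW ->.
  rewrite -(cosm1_mono Ir') ?t0//.
  by apply/idP/idP => h; lra.
have := cos_multiplierM h1 h2.
rewrite (_ : (fun r => _) = \1_[set r : measurableTypeR R | s < r < t])//.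
apply/funext => r; rewrite !indicE !mem_setE !in_itv/= andbT -natrM mulnb.
by congr (nat_of_bool _)%:R; apply/idP/idP; rewrite inE.
Qed.

End fixed.

Lemma cosine_total f : L2 f ->
  (forall j, ipx (mom T (cosm j) f) (mom T (cosm j) f) = 0) ->
  eqL2 mu Q f (fun=> 0).
Proof.
move=> fL H; have [N QN] := cylinder_cube T bO.
apply: (box_total oQ QN fL) => a0 b0 a b cQ.
have [out|ne] := pselect (forall z, ~ box a0 b0 a b z).
  rewrite (_ : \1_ _ = 0); first by rewrite (sipC S fL (sip0 S)); exact: (ip0l S fL).
  by apply/funext => z; rewrite indicE memNset.
have [z [z1 z2]] : exists z, box a0 b0 a b z by apply: contrapT => /forallNP.
have z2' i : a i <= z.2 ord0 i <= b i by move: (z2 i) => /andP[/ltW -> /ltW ->].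
have ab : a0 <= b0 by case/andP: z1 => ? ?; apply: ltW; apply: lt_trans; eassumption.
have [/andP[a00 _] _] : (Q : set E) (a0, z.2) by apply: cQ; split => //=; rewrite lexx.
have [/andP[_ b0T] _] : (Q : set E) (b0, z.2) by apply: cQ; split => //=; rewrite lexx ab.
pose B : set 'rV[R]_d := [set x | forall i, a i < x ord0 i < b i].
pose m : 'rV[R]_d -> R := \1_B.
have mB : measurable B.
  have := measurable_rV_box (fun i : 'I_d => measurable_itv `](a i), (b i)[).
  by congr measurable; apply/seteqP; split => x h i; move: (h i); rewrite /= in_itv.
have mL : L2x m.
  have h1 : 0 < T / 2 by rewrite divr_gt0.
  have h2 : T / 2 < T by rewrite ltr_pdivrMr// ltr_pMr// ltr1n.
  have IT : I (T / 2) by apply/andP; split.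
  apply: (inL2_dominated mO _ (smooth_slice_L2 oO bO (smooth_cst 1) IT)).
    exact: (measurable_funS measurableT (@subsetT _ _) (measurable_indic mB)).
  by move=> x _; rewrite /m indicE normr1; case: (_ \in _); rewrite ?normr1 ?normr0.
have f0 j : ip (fun z => cosm j z.1 * m z.2) f = 0.
  have wc := weight_elem T (elementary_cosm j).
  rewrite (tensor_mom T0 oO wc mL fL) (sipC Sx mL (mom_L2 T0 oO wc fL)).
  exact: (sip_null Sx (mom_L2 T0 oO wc fL) mL).
have [wi /(_ 0%N) h] := cos_multiplier_interval mL fL (ltW a00) (ltW b0T) (cos_annihilated1 f0).
have wA : weight T (\1_[set r : measurableTypeR R | a0 < r < b0] : R -> R).
  apply: weight_indic; rewrite (_ : mkset _ = `]a0, b0[%classic); first exact: measurable_itv.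
  by apply/seteqP; split=> r /=; rewrite in_itv.
have bE : (\1_(box a0 b0 a b) : E -> R) =
    fun z => \1_[set r : measurableTypeR R | a0 < r < b0] z.1 * m z.2.
  apply/funext => y; rewrite /m !indicE -natrM mulnb; congr (nat_of_bool _)%:R.
  by apply/idP/andP; rewrite !inE.
rewrite bE (sipC S fL (tensor_L2 T0 oO wA mL)) -[RHS]h; congr (ip _ f).
by apply/funext => y; rewrite /cosm /freq !mul0r cos0 !mulr1.
Qed.

End cosine_total.

Section density.
Context {R : realType} {d : nat}.
Local Notation E := (R * 'rV[R]_d)%type.
Local Notation ME := (measurableTypeR R * 'rV[R]_d)%type.
Local Notation mu := (@leb_tx R d).
Variables (T : R) (Om : set 'rV[R]_d).
Hypotheses (T0 : 0 < T) (oO : open Om) (bO : bounded_set Om).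
Local Notation Q := (cylinder T Om).
Local Notation L2 := (inL2 mu (Q : set ME)).
Local Notation ip := (ipL2 mu (Q : set ME)).
Local Notation I := (time_interval T).

Let mO := open_measurable_x oO.
Let oQ : open (Q : set E) := @cylinder_open R d T Om oO.
Let mQ : measurable (Q : set ME) := @measurable_Q R d T Om oO.
Let S := @inL2_sip _ _ R mu (Q : set ME) mQ.
Let mI := measurable_time_interval T.
Let wL2 b f : weight T b -> L2 f -> L2 (fun z => b z.1 * f z).
Proof. exact: weight_L2. Qed.
Let sL2 (f : sfield R d) : smooth f -> L2 f.
Proof. by have [N QN] := cylinder_cube T bO; exact: (smooth_L2 oQ QN). Qed.

Lemma derive_frozen_t phi r z : smooth phi ->
  'D_dir_t (fun z : E => phi (r, z.2)) z = 0.
Proof.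
move=> sp; have ds := derivableP (smooth_derivable (z := (r, z.2)) (e := (0, 0)) sp).
have [_ ->] := @is_derive_frozen _ _ phi r dir_t z _ ds.
exact: derive0.
Qed.

Lemma vanishing_bound a a' : elementary a -> elementary a' ->
  (forall y : R, is_derive y 1 a (a' y)) -> a 0 = 0 -> a T = 0 ->
  exists2 L : R, 0 <= L & forall t, I t -> `|a t| <= L * t /\ `|a t| <= L * (T - t).
Proof.
move=> ea ea' da a0 aT; have [_ [L aL]] := weight_elem T ea'.
have H (s t : R) : 0 <= s -> s < t -> t <= T -> `|a t - a s| <= L * (t - s).
  move=> s0 st tT; have [|c cst ->] := @MVT R a a' s t st.
    by apply: continuous_subspaceT; exact: elementary_continuous.
  rewrite normrM [`|t - s|]ger0_norm ?subr_ge0 ?(ltW st)// ler_wpM2r ?subr_ge0 ?(ltW st)//.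
  apply: aL; move: cst; rewrite in_itv/= => /andP[c1 c2]; apply/andP; split.
    exact: le_lt_trans s0 c1.
  exact: lt_le_trans c2 tT.
exists L => [|t /andP[t0 tT]].
  have h1 : 0 < T / 2 by rewrite divr_gt0.
  have h2 : T / 2 < T by rewrite ltr_pdivrMr// ltr_pMr// ltr1n.
  have IT : I (T / 2) by apply/andP; split.
  exact: le_trans (normr_ge0 _) (aL _ IT).
split; first by have := H 0 t (lexx 0) t0 (ltW tT); rewrite a0 !subr0.
by have := H t T (ltW t0) tT (lexx T); rewrite aT sub0r normrN.
Qed.

(** Vanishes within $1/(k+1)$ of the ends of $[0,T]$ and equals $1$ beyond $2/(k+1)$ from them. *)
Definition inner (k : nat) : R -> R := cutoff k.+1%:R^-1 (T - k.+1%:R^-1) k.+1.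
Definition inner' (k : nat) (y : R) : R :=
  k.+1%:R * (step' (k.+1%:R * y - 1) * step (- k.+1%:R * y + (k.+1%:R * T - 1)) -
  step (k.+1%:R * y - 1) * step' (- k.+1%:R * y + (k.+1%:R * T - 1))).

Lemma innerE k y : inner k y = step (k.+1%:R * y - 1) * step (- k.+1%:R * y + (k.+1%:R * T - 1)).
Proof. by rewrite /inner /cutoff mulrBr mulfV. Qed.

Lemma inner_derive k (y : R) : is_derive y 1 (inner k) (inner' k y).
Proof.
have -> : inner k = fun y => step (k.+1%:R * y - 1) * step (- k.+1%:R * y + (k.+1%:R * T - 1)).
  by apply/funext => z; exact: innerE.
have d1 := is_derive_affine (step_derive (k.+1%:R * y + -1)).
have d2 := is_derive_affine (step_derive (- k.+1%:R * y + (k.+1%:R * T - 1))).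
have := is_deriveM d1 d2; move/is_derive_eq; apply.
by rewrite /inner' /GRing.scale/=; ring.
Qed.

Lemma inner_near t : I t -> \forall k \near \oo,
  1 <= k.+1%:R * t - 1 /\ 1 <= - k.+1%:R * t + (k.+1%:R * T - 1).
Proof.
move=> /andP[t0 tT].
have H (c : R) : 0 < c -> \forall k \near \oo, 2 <= k.+1%:R * c.
  move=> c0; near=> k; rewrite -ler_pdivrMr//; apply: (@le_trans _ _ k%:R).
    by near: k; exact: nbhs_infty_ger.
  by rewrite ler_nat.
have tT' : 0 < T - t by rewrite subr_gt0.
apply: filterS2 (H t t0) (H _ tT') => k.
rewrite mulrBr mulNr; move: (k.+1%:R * t) (k.+1%:R * T) => x y h1 h2.
split; lra.
Unshelve. all: by end_near. Qed.

Lemma inner_cvg t : I t -> (fun k => inner k t) @ \oo --> (1 : R).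
Proof.
move=> /inner_near H; apply: cvg_near_cst; apply: filterS H => k [h1 h2].
by rewrite innerE !step_ge1// mulr1.
Qed.

Lemma inner'_cvg t : I t -> (fun k => inner' k t) @ \oo --> (0 : R).
Proof.
move=> /inner_near H; apply: cvg_near_cst; apply: filterS H => k [h1 h2].
by rewrite /inner' (step'_out (or_intror h1)) (step'_out (or_intror h2)) mul0r mulr0 subrr mulr0.
Qed.

(** The derivative, of size $k+1$, lives only within $2/(k+1)$ of the ends, where [a] is at most
    $2L/(k+1)$. *)
Lemma inner'_bound a (L : R) : 0 <= L ->
  (forall t, I t -> `|a t| <= L * t /\ `|a t| <= L * (T - t)) ->
  exists M : R, forall k t, I t -> `|inner' k t * a t| <= M.
Proof.
move=> L0 aL.
have [M0 HM] := bounded_of_continuous_support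
  (elementary_continuous (@elementary_step' R)) (@step'_out R).
have M00 : 0 <= M0 by apply: le_trans (HM 0); exact: normr_ge0.
have key (n c y al : R) : 0 <= n -> 0 <= c -> y = n * c - 1 -> `|al| <= L * c ->
    n * `|step' y| * `|al| <= M0 * (2 * L).
  move=> n0 c0 yE alc; have [y1|y1] := leP 1 y.
    by rewrite (step'_out (or_intror y1)) normr0 mulr0 mul0r !mulr_ge0.
  have nc : n * `|al| <= 2 * L.
    apply: (@le_trans _ _ (n * (L * c))); first exact: ler_wpM2l.
    by rewrite mulrCA mulrC ler_wpM2r//; move: y1; rewrite yE; lra.
  rewrite mulrAC mulrC; apply: ler_pM => //; exact: mulr_ge0.
exists (M0 * (2 * L) + M0 * (2 * L)) => k t It; have [h1 h2] := aL t It.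
case/andP: It => t0 tT.
have aux (n s1 s2 al : R) : 0 <= n -> 0 <= s2 <= 1 ->
    `|n * (s1 * s2) * al| <= n * `|s1| * `|al|.
  move=> n0 /andP[s20 s21]; rewrite !normrM (ger0_norm n0) (ger0_norm s20).
  by rewrite ler_wpM2r// ler_wpM2l// ler_piMr.
have st (y : R) : 0 <= step y <= 1 by rewrite step_ge0 step_le1.
rewrite /inner' mulrBr mulrBl.
apply: le_trans (ler_normB _ _) _; apply: lerD.
  set s1 := step' _; set s2 := step _.
  have A := aux k.+1%:R s1 s2 (a t) (ler0n R _) (st _).
  apply: le_trans A _.
  exact: (key _ t _ _ (ler0n _ _) (ltW t0) (erefl _) h1).
rewrite [step _ * _]mulrC.
have tT' : 0 <= T - t by rewrite subr_ge0 ltW.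
apply: le_trans (aux _ _ _ _ (ler0n _ _) (st _)) (key _ (T - t) _ _ (ler0n _ _) tT' _ h2).
by ring.
Qed.

(** The divergence equation holds for test functions without compact support in time, provided that
    the weight vanishes at both ends. Insert [inner k] and let [k] grow: the term with [inner'] is
    bounded and tends to $0$ pointwise. *)
Lemma weak_div_vanishing a a' w f psi r : elementary a -> elementary a' ->
  (forall y : R, is_derive y 1 a (a' y)) -> a 0 = 0 -> a T = 0 ->
  inL2p Q w -> L2 f -> is_weak_div Q w f -> test_function Q psi -> I r ->
  ip w.1 (fun z => a' z.1 * psi (r, z.2)) +
  \sum_i ip (vcomp w.2 i) (fun z => a z.1 * 'D_(dir_x i) psi (r, z.2)) =
  - ip f (fun z => a z.1 * psi (r, z.2)).
Proof.
move=> ea ea' da a0 aT [w1L w2L] fL Hdiv tp Ir; have sp := tp.1.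
have [L L0 aL] := vanishing_bound ea ea' da a0 aT.
have [M HM] := inner'_bound L0 aL.
have [N QN] := cylinder_cube T bO.
have sf := smooth_frozen r sp.
have lf := lateral_frozen r (test_lateral tp).
have [P [P0 HP]] := continuous_bounded_cube N (smooth_continuous sf).
have cstL (c : R) : L2 (fun=> c) by exact: sL2 (smooth_cst c).
have ei k : elementary (inner k) by exact: elementary_cutoff.
have sa : smooth (fun z : E => a z.1) by exact: smooth_fst.
have si k : smooth (fun z : E => inner k z.1) by exact: smooth_fst.
pose phi k (z : E) := a z.1 * (inner k z.1 * psi (r, z.2)).
have tphi k : test_function Q (phi k).
  apply: (test_functionMr sa); apply: (@test_cutoff _ _ T Om) => //.
  by rewrite gtrBl invr_gt0.
have Dt k : 'D_dir_t (phi k) = fun z => (inner' k z.1 * a z.1 + inner k z.1 * a' z.1) * psi (r, z.2).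
  apply/funext => z; rewrite /phi derive_mulE; [|exact: (smooth_derivable sa)|]; last first.
    exact: (smooth_derivable (smoothM (si k) sf)).
  rewrite derive_mulE; [|exact: (smooth_derivable (si k))|exact: (smooth_derivable sf)].
  rewrite derive_frozen_t// (derive_fst_t _ da) (derive_fst_t _ (inner_derive k)).
  ring.
have Dx k i : 'D_(dir_x i) (phi k) = fun z => inner k z.1 * (a z.1 * 'D_(dir_x i) psi (r, z.2)).
  apply/funext => z; rewrite /phi derive_mulE; [|exact: (smooth_derivable sa)|]; last first.
    exact: (smooth_derivable (smoothM (si k) sf)).
  rewrite derive_mulE; [|exact: (smooth_derivable (si k))|exact: (smooth_derivable sf)].
  by rewrite derive_frozen_x// !derive_fst_x; ring.
have inner01 k t : `|inner k t| <= 1.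
  by rewrite ger0_norm ?cutoff_ge0// cutoff_le1.
have lim_inner (F g : sfield R d) : L2 F -> L2 g ->
    (fun k => ip F (fun z => inner k z.1 * g z)) @ \oo --> ip F g.
  move=> FL gL; have gL' : L2 (fun z => `|g z|).
    apply: (inL2_dominated mQ _ gL); last by move=> z _; rewrite normr_id.
    by apply: measurableT_comp => //; exact: (inL2_measurable mQ gL).
  apply: (ipL2_dominated mQ FL gL').
  - move=> k; exact: (inL2_measurable mQ (wL2 (weight_elem T (ei k)) gL)).
  - by move=> k z _; rewrite normrM ler_piMl.
  - exact: (inL2_measurable mQ gL).
  - move=> z [Iz _]; rewrite -[X in _ --> X]mul1r; apply: cvgMl; exact: inner_cvg.
have slc (g : sfield R d) : smooth g -> L2 (fun z => g (r, z.2)).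
  by move=> sg; exact: sL2 (smooth_frozen r sg).
have pL := slc _ sp; have wa := weight_elem T ea; have wa' := weight_elem T ea'.
have dL i : L2 (fun z => a z.1 * 'D_(dir_x i) psi (r, z.2)).
  by apply: (wL2 wa); exact: (slc _ (smooth_derive (dir_x i) sp)).
have apL : L2 (fun z => a z.1 * psi (r, z.2)) by exact: (wL2 wa).
have a'pL : L2 (fun z => a' z.1 * psi (r, z.2)) by exact: (wL2 wa').
have wi' k : weight T (inner' k).
  have [g eg dg] := elementary_derive (ei k).
  rewrite (_ : inner' k = g); first exact: weight_elem.
  by apply/funext => y; have [_ <-] := inner_derive k y; have [_ ->] := dg y.
have i'L k : L2 (fun z => inner' k z.1 * a z.1 * psi (r, z.2)).
  exact: (wL2 (weightM (wi' k) wa)).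
have lim0 : (fun k => ip w.1 (fun z => inner' k z.1 * a z.1 * psi (r, z.2))) @ \oo --> (0 : R).
  rewrite -[X in _ --> X](_ : ip w.1 (fun=> 0) = 0); last first.
    by rewrite (sipC S w1L (sip0 S)); exact: (ip0l S w1L).
  apply: (ipL2_dominated mQ w1L (cstL (M * P))).
  - by move=> k; exact: (inL2_measurable mQ (i'L k)).
  - move=> k z Qz; have [Iz Oz] := Qz; rewrite normrM ler_pM//; first exact: HM.
    by apply: HP; apply: QN; split.
  - exact: measurable_cst.
  - move=> z [Iz _]; rewrite -[X in _ --> X](mul0r (psi (r, z.2))).
    apply: cvgMl; rewrite -[X in _ --> X](mul0r (a z.1)).
    by apply: cvgMl; exact: inner'_cvg.
have H k : ip w.1 (fun z => inner' k z.1 * a z.1 * psi (r, z.2)) +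
    ip w.1 (fun z => inner k z.1 * (a' z.1 * psi (r, z.2))) +
    \sum_i ip (vcomp w.2 i) (fun z => inner k z.1 * (a z.1 * 'D_(dir_x i) psi (r, z.2))) =
    - ip f (fun z => inner k z.1 * (a z.1 * psi (r, z.2))).
  have := Hdiv _ (tphi k); rewrite Dt => Hk.
  rewrite -(ipDr S (i'L k) (wL2 (weight_elem T (ei k)) a'pL) w1L).
  rewrite [X in _ = - ip f X](_ : _ = phi k); last by apply/funext => z; rewrite /phi mulrCA.
  rewrite -Hk; congr (_ + _).
    congr (ip _ _); apply/funext => z.
    by rewrite [RHS]mulrDl -[inner k z.1 * _ * _]mulrA.
  by apply: eq_bigr => i _; rewrite Dx.
have limL : (fun k => ip w.1 (fun z => inner' k z.1 * a z.1 * psi (r, z.2)) +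
    ip w.1 (fun z => inner k z.1 * (a' z.1 * psi (r, z.2))) +
    \sum_i ip (vcomp w.2 i) (fun z => inner k z.1 * (a z.1 * 'D_(dir_x i) psi (r, z.2))))
    @ \oo --> 0 + ip w.1 (fun z => a' z.1 * psi (r, z.2)) +
  \sum_i ip (vcomp w.2 i) (fun z => a z.1 * 'D_(dir_x i) psi (r, z.2)).
  apply: cvgD; first by apply: cvgD => //; exact: lim_inner.
  apply: (@cvg_big _ _ _ _ _ (@add_continuous R)) => i _.
  by apply: lim_inner => //; exact: w2L.
have limR : (fun k => - ip f (fun z => inner k z.1 * (a z.1 * psi (r, z.2)))) @ \oo -->
    - ip f (fun z => a z.1 * psi (r, z.2)) by apply: cvgN; exact: lim_inner.
move: limL; rewrite (funext H) add0r => limL.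
by rewrite -(cvg_lim (@Rhausdorff R) limL) (cvg_lim (@Rhausdorff R) limR).
Qed.

End density.

(** * Products and closures of semi-inner-product spaces *)

Section sip_constructions.
Context {R : realType}.

Lemma sip_prod_space {V W : lmodType R} (P : V -> Prop) (P' : W -> Prop) ip ip' :
  sip_space P ip -> sip_space P' ip' ->
  @sip_space R (V * W)%type (fun u => P u.1 /\ P' u.2)
    (fun u v => ip u.1 v.1 + ip' u.2 v.2).
Proof.
move=> S S'; split.
- by split; [exact: (sip0 S)|exact: (sip0 S')].
- by move=> a u v [h1 h2] [h3 h4]; split; [exact: (sipP S)|exact: (sipP S')].
- by move=> u v [h1 h2] [h3 h4]; congr (_ + _); [exact: (sipC S)|exact: (sipC S')].
- move=> a u v w [h1 h2] [h3 h4] [h5 h6] /=; rewrite (sipL S)// (sipL S')//; ring.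
- by move=> u [h1 h2]; rewrite addr_ge0 ?(sip_ge0 S h1) ?(sip_ge0 S' h2).
Qed.

Lemma sip_prod_complete {V W : lmodType R} (P : V -> Prop) (P' : W -> Prop) ip ip' :
  sip_space P ip -> sip_space P' ip' -> sip_complete P ip -> sip_complete P' ip' ->
  @sip_complete R (V * W)%type (fun u => P u.1 /\ P' u.2)
    (fun u v => ip u.1 v.1 + ip' u.2 v.2).
Proof.
move=> S S' c c' u uP cu.
have uP1 n : P (u n).1 by case: (uP n).
have uP2 n : P' (u n).2 by case: (uP n).
have [l lP ul] : exists2 l, P l & sip_cvg ip (fun n => (u n).1) l.
  apply: c => // e e0; have [N HN] := cu e e0; exists N => m n Nm Nn.
  by apply: le_trans (HN m n Nm Nn); rewrite lerDl; exact: (sip_ge0 S' (sipB S' (uP2 _) (uP2 _))).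
have [l' lP' ul'] : exists2 l, P' l & sip_cvg ip' (fun n => (u n).2) l.
  apply: c' => // e e0; have [N HN] := cu e e0; exists N => m n Nm Nn.
  by apply: le_trans (HN m n Nm Nn); rewrite lerDr; exact: (sip_ge0 S (sipB S (uP1 _) (uP1 _))).
exists (l, l') => //; rewrite /sip_cvg -[X in _ --> X]addr0.
exact: cvgD ul ul'.
Qed.

Section closure.
Context {V : lmodType R}.
Variables (P N : V -> Prop) (ip : V -> V -> R).
Hypotheses (S : sip_space P ip) (cP : sip_complete P ip)
  (NP : forall u, N u -> P u) (N0 : N 0)
  (NL : forall a u v, N u -> N v -> N (a *: u + v)).

Definition sip_closure u := P u /\ forall e, 0 < e -> exists2 v, N v & ip (u - v) (u - v) <= e.

Lemma sip_closure_space : sip_space sip_closure ip.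
Proof.
apply: (sip_space_sub S); first by move=> u [].
  split; first exact: (sip0 S).
  by move=> e e0; exists 0 => //; rewrite subr0 (ip0l S (sip0 S)) ltW.
move=> a u v [uP Hu] [vP Hv]; split; first exact: (sipP S).
move=> e e0; have a0 : 0 < a ^+ 2 + 1 by rewrite ltr_wpDl ?sqr_ge0.
have e4 : 0 < e / 4 / (a ^+ 2 + 1) by rewrite !divr_gt0.
have e4' : 0 < e / 4 by rewrite divr_gt0.
have [u' Nu hu] := Hu _ e4; have [v' Nv hv] := Hv _ e4'.
exists (a *: u' + v'); first exact: NL.
have uu := sipB S uP (NP Nu); have vv := sipB S vP (NP Nv).
have -> : a *: u + v - (a *: u' + v') = a *: (u - u') + (v - v').
  by rewrite scalerBr opprD addrACA.
apply: le_trans (sip_sqrD_le S (sipZ S a uu) vv) _.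
rewrite (ip_sqrZ S a uu).
have : a ^+ 2 * ip (u - u') (u - u') <= e / 4.
  apply: (@le_trans _ _ ((a ^+ 2 + 1) * ip (u - u') (u - u'))).
    by rewrite ler_wpM2r ?(sip_ge0 S uu)// lerDl.
  by rewrite mulrC -ler_pdivlMr.
lra.
Qed.

Lemma sip_closure_complete : sip_complete sip_closure ip.
Proof.
move=> u uC cu; have uP n : P (u n) by case: (uC n).
have [l lP ul] := cP uP cu; exists l => //; split => // e e0.
have e4 : 0 < e / 4 by rewrite divr_gt0.
move/cvgrPdist_le : ul => /(_ _ e4) [M _ HM].
have h1 := HM M (leqnn M); have [_ /(_ _ e4) [v Nv hv]] := uC M.
exists v => //; have uvP := sipB S (uP M) (NP Nv); have luP := sipB S lP (uP M).
have -> : l - v = (l - u M) + (u M - v) by rewrite addrA subrK.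
apply: le_trans (sip_sqrD_le S luP uvP) _.
move: h1; rewrite sub0r normrN ger0_norm ?(sip_ge0 S (sipB S (uP M) lP))//.
rewrite -[l - u M]opprB (ipNl S _ (sipN S _)) ?(ipNr S) ?opprK//; try exact: (sipB S).
by move=> h1; lra.
Qed.

(** The residual of the projection onto the closure is orthogonal to [N], hence null. *)
Lemma sip_dense : (forall r, P r -> (forall v, N v -> ip r v = 0) -> ip r r = 0) ->
  forall u, P u -> forall e, 0 < e -> exists2 v, N v & ip (u - v) (u - v) <= e.
Proof.
move=> H u uP e e0.
have [l [lP lC] Hl] := sip_projection S sip_closure_space
  (fun u (h : sip_closure u) => proj1 h) sip_closure_complete uP.
have rP := sipB S uP lP.
have r0 : ip (u - l) (u - l) = 0.
  apply: H => // v Nv; apply: Hl; split; first exact: NP.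
  by move=> e' e0'; exists v => //; rewrite subrr (ip0l S (sip0 S)) ltW.
have e2 : 0 < e / 2 by rewrite divr_gt0.
have [v Nv hv] := lC _ e2; exists v => //; have lvP := sipB S lP (NP Nv).
have -> : u - v = (u - l) + (l - v) by rewrite addrA subrK.
by apply: le_trans (sip_sqrD_le S rP lvP) _; rewrite r0; lra.
Qed.

End closure.

End sip_constructions.

(** * Density in the graph norm *)

Section nice_elements.
Context {R : realType} {d : nat}.
Local Notation E := (R * 'rV[R]_d)%type.
Local Notation ME := (measurableTypeR R * 'rV[R]_d)%type.
Local Notation mu := (@leb_tx R d).
Local Notation mx := (@leb_x R d).
Local Notation lam := (@lebesgue_measure R).
Variables (T : R) (Om : set 'rV[R]_d).
Hypotheses (T0 : 0 < T) (oO : open Om) (bO : bounded_set Om).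
Local Notation Q := (cylinder T Om).
Local Notation L2 := (inL2 mu (Q : set ME)).
Local Notation ip := (ipL2 mu (Q : set ME)).
Local Notation L2x := (inL2 mx Om).
Local Notation ipx := (ipL2 mx Om).
Local Notation I := (time_interval T).

Let mO := open_measurable_x oO.
Let Sx := @inL2_sip _ _ R mx Om mO.
Let oQ : open (Q : set E) := @cylinder_open R d T Om oO.
Let mQ : measurable (Q : set ME) := @measurable_Q R d T Om oO.
Let S := @inL2_sip _ _ R mu (Q : set ME) mQ.
Let Sv := @inL2v_sip R d Q mQ.
Let Sp := @inL2p_sip R d Q mQ.
Let mI := measurable_time_interval T.
Let tL2 b m : weight T b -> L2x m -> L2 (fun z => b z.1 * m z.2).
Proof. exact: tensor_L2. Qed.
Let sL2 (f : sfield R d) : smooth f -> L2 f.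
Proof. by have [N QN] := cylinder_cube T bO; exact: (smooth_L2 oQ QN). Qed.

Local Notation gtriple := (pfield R d * vfield R d * sfield R d)%type.
Variable cL : R.
Hypotheses (cL0 : 0 < cL)
  (hcoer : forall v : pfield R d, inU0 Q v ->
      cL * normL2p Q v ^+ 2 <=
        normL2p Q (opA Q v) ^+ 2 + normL2 mx Om (gamma0 T Om v) ^+ 2).

(* A triple z = ((w, g), f) records a field w together with g = grad_x w.1 and
   f = div w. *)
Definition L2graph (z : gtriple) := (inL2p Q z.1.1 /\ inL2v Q z.1.2) /\ L2 z.2.
Definition ipgraph (z z' : gtriple) : R :=
  ipL2p Q z.1.1 z'.1.1 + ipL2v Q z.1.2 z'.1.2 + ip z.2 z'.2.
Definition ingraph0 (z : gtriple) := graph0 T Om z.1.1 z.1.2 z.2.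

Lemma L2graph_space : sip_space L2graph ipgraph.
Proof. exact: (sip_prod_space (sip_prod_space Sp Sv) S). Qed.

Lemma inL2v_complete : sip_complete (@inL2v R d Q) (@ipL2v R d Q).
Proof.
move=> u uL cu; have [|e e0|l [l1 l2] ul] := @inL2p_complete R d Q mQ (fun n => (0, u n)).
- by move=> n; split; [exact: (sip0 S)|exact: uL].
- have [M HM] := cu e e0; exists M => m n Mm Mn; have := HM m n Mm Mn.
  by rewrite [X in _ -> X <= _]/ipL2p /= subr0 (ip0l S (sip0 S)) add0r.
exists l.2 => //; apply: cvg_le0 ul => n; have dL := sipB Sv (uL n) l2.
rewrite (sip_ge0 Sv dL)/=; apply: (ipL2p_snd_le mQ (w := (0, u n) - l)).
by split => //; exact: (sipB S (sip0 S) l1).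
Qed.

Lemma L2graph_complete : sip_complete L2graph ipgraph.
Proof.
apply: (sip_prod_complete (sip_prod_space Sp Sv) S).
  exact: (sip_prod_complete Sp Sv (inL2p_complete mQ) inL2v_complete).
exact: inL2_complete.
Qed.

Definition unitv (i : 'I_d) (phi : sfield R d) : vfield R d :=
  fun z => phi z *: delta_mx ord0 i.

Lemma vcomp_unitv i phi j : vcomp (unitv i phi) j = if j == i then phi else 0.
Proof.
apply/funext => z; rewrite /vcomp /unitv !mxE eqxx/= eq_sym.
by case: ifP; rewrite ?mulr1 ?mulr0.
Qed.

Lemma unitv_L2 i phi : L2 phi -> inL2v Q (unitv i phi).
Proof. by move=> pL j; rewrite vcomp_unitv; case: ifP => // _; exact: (sip0 S). Qed.

Lemma ip_unitv i phi (h : vfield R d) : inL2v Q h ->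
  ipL2v Q h (unitv i phi) = ip (vcomp h i) phi.
Proof.
move=> hL; rewrite /ipL2v (bigD1 i)//= vcomp_unitv eqxx big1 ?addr0// => j ji.
by rewrite vcomp_unitv (negbTE ji) (sipC S (hL j) (sip0 S)); exact: (ip0l S (hL j)).
Qed.

Definition gradv (phi : sfield R d) : vfield R d := fun z => \row_i 'D_(dir_x i) phi z.

Lemma vcomp_gradv phi i : vcomp (gradv phi) i = 'D_(dir_x i) phi.
Proof. by apply/funext => z; rewrite /vcomp mxE. Qed.

Lemma gradv_L2 phi : smooth phi -> inL2v Q (gradv phi).
Proof. by move=> sp i; rewrite vcomp_gradv; exact: sL2 (smooth_derive _ sp). Qed.

Lemma ip_gradv (h : vfield R d) phi :
  ipL2v Q h (gradv phi) = \sum_i ip (vcomp h i) ('D_(dir_x i) phi).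
Proof. by apply: eq_bigr => i _; rewrite vcomp_gradv. Qed.

(** Orthogonality to the first kind is the Green formula of [grad0], to the second the weak
    divergence; this presents $U_0$ as a closed subspace. *)
Definition graph0_test (th : gtriple) :=
  (exists i phi, smooth phi /\ th = (('D_(dir_x i) phi, 0), unitv i phi, 0)) \/
  (exists phi, test_function Q phi /\ th = (('D_dir_t phi, gradv phi), 0, phi)).

Lemma graph0_test_L2 th : graph0_test th -> L2graph th.
Proof.
move=> [[i [phi [sp ->]]]|[phi [[sp _] ->]]]; split => /=; do ?split => /=.
- exact: sL2 (smooth_derive _ sp).
- exact: (sip0 Sv).
- exact: unitv_L2 (sL2 sp).
- exact: (sip0 S).
- exact: sL2 (smooth_derive _ sp).
- exact: gradv_L2.
- exact: (sip0 Sv).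
- exact: sL2.
Qed.

Lemma ingraph0P z : ingraph0 z <-> sip_orth L2graph ipgraph graph0_test z.
Proof.
case: z => -[w g] f; have ip0r h : L2 h -> ip h 0 = 0.
  by move=> hL; rewrite (sipC S hL (sip0 S)); exact: (ip0l S hL).
have ipv0r h : inL2v Q h -> ipL2v Q h 0 = 0.
  by move=> hL; rewrite (sipC Sv hL (sip0 Sv)); exact: (ip0l Sv hL).
split.
  move=> [[wL gL _ fL H] [_ _ G]]; split; first by [].
  have [w1L w2L] := wL.
  move=> th [[i [phi [sp ->]]]|[phi [tp ->]]]; rewrite /ipgraph /ipL2p /=.
    by rewrite ipv0r// ip0r// ip_unitv// !addr0 G// addNr.
  by rewrite ipv0r// ip_gradv addr0 H// addNr.
move=> [[[wL gL] fL] H]; have [w1L w2L] := wL.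
have G : grad0 T Om w.1 g.
  split => // i phi sp; have := H (('D_(dir_x i) phi, 0), unitv i phi, 0).
  rewrite /ipgraph /ipL2p /= ipv0r// ip0r// ip_unitv// !addr0 => h.
  by apply/eqP; rewrite -addr_eq0 h//; left; exists i, phi.
split => //; split => //; first exact: grad0_weak G.
move=> phi tp; have := H (('D_dir_t phi, gradv phi), 0, phi).
rewrite /ipgraph /ipL2p /= ipv0r// ip_gradv addr0 => h.
by apply/eqP; rewrite -addr_eq0 h//; right; exists phi.
Qed.

Lemma ingraph0_space : sip_space ingraph0 ipgraph.
Proof.
rewrite (_ : ingraph0 = sip_orth L2graph ipgraph graph0_test); last first.
  by apply/funext => z; apply/propext; exact: ingraph0P.
exact: sip_orth_space L2graph_space graph0_test_L2.
Qed.

Lemma ingraph0_complete : sip_complete ingraph0 ipgraph.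
Proof.
rewrite (_ : ingraph0 = sip_orth L2graph ipgraph graph0_test); last first.
  by apply/funext => z; apply/propext; exact: ingraph0P.
exact: sip_orth_complete L2graph_space L2graph_complete graph0_test_L2.
Qed.

(** [V] gives the slice of the scalar component at every time, so that values at a fixed time make
    sense before any trace is available. *)
Inductive nice : gtriple -> (R -> 'rV[R]_d -> R) -> Prop :=
| nice_tensor a a' m p : elementary a -> elementary a' ->
    (forall y : R, is_derive y 1 a (a' y)) -> spatial T Om m p ->
    nice ((fun z => a z.1 * m z.2, 0), tensorv a p, fun z => a' z.1 * m z.2)
      (fun t x => a t * m x)
| nice_flux chi q : inL2v Q chi -> L2 q -> is_weak_divx T Om chi q ->
    nice ((0, chi), 0, q) 0
| nice_comb (c : R) z V z' V' : nice z V -> nice z' V' ->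
    nice (c *: z + z') (c *: V + V').

Lemma nice_ingraph0 z V : nice z V -> ingraph0 z.
Proof.
elim=> {z V} [a a' m p ea ea' da sm|chi q chL qL H|c z V z' V' _ Hz _ Hz'].
- have := graph0_tensor T0 oO bO ea ea' da sm (sip0 Sv) (sip0 S).
  rewrite /ingraph0 /= addr0; apply=> phi tp; have sp := tp.1.
  rewrite -ip_gradv (ip0l Sv (gradv_L2 sp)) (ip0l S (sL2 sp)) oppr0//.
- split; last first.
    split; [exact: (sip0 S)|exact: (sip0 Sv)|].
    move=> i phi sp; rewrite vcomp0 !(ip0l S) ?oppr0//; [exact: sL2|].
    exact: sL2 (smooth_derive _ sp).
  split => //; [by split => //; exact: (sip0 S)|exact: (sip0 Sv)| |].
    move=> i phi [sp _]; rewrite vcomp0 !(ip0l S) ?oppr0//; [exact: sL2|].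
    exact: sL2 (smooth_derive _ sp).
  move=> phi tp; rewrite /= (ip0l S (sL2 (smooth_derive _ tp.1))) add0r.
  exact: H.
- exact: (sipP ingraph0_space).
Qed.

Lemma cosm_derive j (y : R) : is_derive y 1 (cosm T j) (- freq T j * sinm T j y).
Proof.
have d1 : is_derive (freq T j * y + 0) 1 cos (- sin (freq T j * y + 0)) by exact: is_derive_cos.
have := is_derive_affine d1; rewrite addr0 mulrN -mulNr.
by rewrite (_ : (fun y => cos _) = cosm T j)//; apply/funext => z; rewrite addr0.
Qed.

Lemma sinm_derive j (y : R) : is_derive y 1 (sinm T j) (freq T j * cosm T j y).
Proof.
have d1 : is_derive (freq T j * y + 0) 1 sin (cos (freq T j * y + 0)) by exact: is_derive_sin.
have := is_derive_affine d1; rewrite addr0.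
by rewrite (_ : (fun y => sin _) = sinm T j)//; apply/funext => z; rewrite addr0.
Qed.

Lemma sinm_end j : sinm T j T = 0.
Proof.
rewrite /sinm /freq -mulrA divfK ?gt_eqF//.
elim: j => [|j IH]; first by rewrite mul0r sin0.
by rewrite -natr1 mulrDl mul1r sinDpi IH oppr0.
Qed.

Lemma sinm_start j : sinm T j 0 = 0.
Proof. by rewrite /sinm mulr0 sin0. Qed.

Lemma ip_tensor_one m m' : L2x m -> L2x m' ->
  ip (fun z => 1 * m z.2) (fun z => 1 * m' z.2) = T * ipx m m'.
Proof.
move=> mL mL'; have w1 := weight_elem T (elem_cst (1 : R)).
rewrite (tensor_tensor T0 oO w1 w1 mL mL'); congr (_ * _).
rewrite (@eq_Rintegral _ _ _ lam I (fun=> 1)) ?Rintegral_cst ?mul1r//=.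
by rewrite (time_interval_lebesgue T0).
Qed.

(** Let $\nu$ be the frequency, $m,p$ the cosine moments of $v,g$ and $F,P$ the sine moments of
    $f,\tau$. The hypothesis at $\cos(\nu t)\,m$ gives $\lVert m\rVert^2+\lVert p\rVert^2=\nu\langle
    m,F\rangle$. The divergence equation against $\sin(\nu t)$ gives $\mathrm{div}_xP=F+\nu m$, and
    $P=\nabla_xF$, so duality gives $\lVert P\rVert^2+\lVert F\rVert^2=-\nu\langle m,F\rangle$. The
    sum is a vanishing sum of four squares. *)
Lemma mom_null_graph v g tau f :
  ingraph0 ((v, tau), g, f) -> grad0 T Om f tau ->
  (forall a a' m p, elementary a -> elementary a' ->
    (forall y : R, is_derive y 1 a (a' y)) -> spatial T Om m p ->
    ip v (fun z => a z.1 * m z.2) + ipL2v Q g (tensorv a p) +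
    ip f (fun z => a' z.1 * m z.2) = 0) ->
  forall j, ipx (mom T (cosm T j) v) (mom T (cosm T j) v) = 0.
Proof.
move=> rG Gf key j; have [[[vL tL] gL Hg fL Hdiv] Gv] := rG; rewrite /= in vL tL gL Hg fL Hdiv Gv.
have ec := elementary_cosm T j; have es := elementary_sinm T j.
have wc := weight_elem T ec; have ws := weight_elem T es.
have e1 := elem_cst (1 : R).
set mu' := freq T j.
have ens : elementary (fun t => - mu' * sinm T j t) by apply: elem_mul => //; exact: elem_cst.
have emc : elementary (fun t => mu' * cosm T j t) by apply: elem_mul => //; exact: elem_cst.
set m := mom T (cosm T j) v; set F := mom T (sinm T j) f.
have sm : spatial T Om m (momv T (cosm T j) g) := spatial_mom T0 oO bO ec Gv.
have sF : spatial T Om F (momv T (sinm T j) tau) := spatial_mom T0 oO bO es Gf.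
set p := momv T (cosm T j) g in sm; set P := momv T (sinm T j) tau in sF.
have mL := spatial_L2 sm; have pL := spatial_L2v sm.
have FL := spatial_L2 sF; have PL := spatial_L2v sF.
have k1 := key _ _ _ _ ec ens (@cosm_derive j) sm.
have {k1} : ipx m m + \sum_i ipx (p i) (p i) - mu' * ipx m F = 0.
  rewrite -[RHS]k1; congr (_ + _ + _).
  - by rewrite (sipC S vL (tL2 wc mL)) tensor_mom.
  - apply: eq_bigr => i _; rewrite vcomp_tensorv (sipC S (gL i) (tL2 wc (pL i))).
    by rewrite tensor_mom.
  - rewrite -mulNr -(tensor_mom T0 oO ws mL fL) -(ipZl S _ (tL2 ws mL) fL).
    rewrite (sipC S (sipZ S _ (tL2 ws mL)) fL); congr (ip f _); apply/funext => z.
    by rewrite -[LHS]/(- mu' * (sinm T j z.1 * m z.2)) mulrA.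
have qL : L2x (F + mu' *: m) by apply: (sipD Sx FL); exact: (sipZ Sx).
(* The sine vanishes at both ends, so the divergence equation may be tested with $\sin(\nu
   t)\varphi(r,x)$; the term $\nu m$ comes from its time derivative. *)
have sd : spatial_divx T Om P (F + mu' *: m).
  split => // phi r tp Ir; have sp := tp.1.
  have phL := smooth_slice_L2 oO bO sp Ir.
  have dL i := smooth_slice_L2 oO bO (smooth_derive (dir_x i) sp) Ir.
  have := weak_div_vanishing T0 oO bO es emc (@sinm_derive j) (sinm_start j) (sinm_end j)
    (conj vL tL : inL2p Q (v, tau)) fL Hdiv tp Ir => /=.
  rewrite (eq_bigr (fun i => ipx (P i) (fun x => 'D_(dir_x i) phi (r, x)))); last first.
    move=> i _; rewrite (sipC S (tL i) (tL2 ws (dL i))) (tensor_mom T0 oO ws (dL i) (tL i)).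
    by rewrite (sipC Sx (dL i) (PL i)).
  rewrite (sipC S fL (tL2 ws phL)) (tensor_mom T0 oO ws phL fL).
  rewrite (ipDl Sx FL (sipZ Sx _ mL) phL) (ipZl Sx _ mL phL) opprD -/F (sipC Sx FL phL) => <-.
  rewrite addrAC -[LHS]add0r; congr (_ + _); apply/esym/eqP; rewrite subr_eq0; apply/eqP.
  rewrite (sipC Sx mL phL) -(tensor_mom T0 oO wc phL vL) -(ipZl S _ (tL2 wc phL) vL).
  rewrite (sipC S (sipZ S _ (tL2 wc phL)) vL); congr (ip v _); apply/funext => z.
  by rewrite -[RHS]/(mu' * (cosm T j z.1 * phi (r, z.2))) mulrA.
have w1 := weight_elem T e1.
have PL1 : inL2v Q (tensorv (fun=> 1) P) by move=> i; rewrite vcomp_tensorv; exact: (tL2 w1 (PL i)).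
(* Duality on $\Omega$ is obtained from duality on the cylinder for fields that are constant in
   time; each pairing acquires a factor $T$. *)
have := grad0_duality T0 oO bO cL0 hcoer (grad0_tensor T0 oO bO e1 sF) PL1
  (tL2 w1 qL) (divx_tensor T0 oO bO e1 sd).
rewrite (ip_tensor_one qL FL) /ipL2v (eq_bigr (fun i => T * ipx (P i) (P i))); last first.
  by move=> i _; rewrite vcomp_tensorv ip_tensor_one.
have Tn0 : T != 0 by rewrite gt_eqF.
rewrite -mulr_sumr -mulrN => /(mulfI Tn0).
rewrite (ipDl Sx FL (sipZ Sx _ mL) FL) (ipZl Sx _ mL FL).
have pp : 0 <= \sum_i ipx (p i) (p i) by apply: sumr_ge0 => i _; exact: (sip_ge0 Sx).
have PP : 0 <= \sum_i ipx (P i) (P i) by apply: sumr_ge0 => i _; exact: (sip_ge0 Sx).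
have FF := sip_ge0 Sx FL; have mm := sip_ge0 Sx mL.
move: pp PP FF mm; move: (ipx F F) (ipx m m) (\sum_i ipx (p i) (p i))
  (\sum_i ipx (P i) (P i)) (mu' * ipx m F) => x1 x2 x3 x4 x5.
by move=> h1 h2 h3 h4 h5 h6; apply/eqP; rewrite eq_le; apply/andP; split; lra.
Qed.

(** An element orthogonal to all nice ones has $v=0$ by its cosine moments. Then $g=0$ and
    $\mathrm{div}_x\tau=f$, so that what remains is itself a flux, orthogonal to itself. *)
Lemma nice_dense z : ingraph0 z -> forall e, 0 < e ->
  exists z' V', nice z' V' /\ ipgraph (z - z') (z - z') <= e.
Proof.
pose N z := exists V, nice z V.
have dv0 : is_weak_divx T Om 0 0.
  move=> phi [sp _]; rewrite -ip_gradv (ip0l Sv (gradv_L2 sp)).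
  by rewrite (ip0l S (sL2 sp)) oppr0.
have NG u : N u -> ingraph0 u by move=> [V]; exact: nice_ingraph0.
have N0 : N 0 by exists 0; exact: nice_flux (sip0 Sv) (sip0 S) dv0.
have NL a u v : N u -> N v -> N (a *: u + v).
  by move=> [V hV] [V' hV']; exists (a *: V + V'); exact: nice_comb.
move=> zG e e0; suff H r : ingraph0 r -> (forall v, N v -> ipgraph r v = 0) -> ipgraph r r = 0.
  have [v [V hV] hv] := sip_dense ingraph0_space ingraph0_complete NG N0 NL H zG e0.
  by exists v, V.
move=> {z zG e e0}; case: r => -[[v tau] g] f rG rN.
have [[[vL tL] gL Hg fL Hdiv] G] := rG; rewrite /= in vL tL gL Hg fL Hdiv G.
have ipv0r h : inL2v Q h -> ipL2v Q h 0 = 0.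
  by move=> hL; rewrite (sipC Sv hL (sip0 Sv)); exact: (ip0l Sv hL).
have ip0r h : L2 h -> ip h 0 = 0.
  by move=> hL; rewrite (sipC S hL (sip0 S)); exact: (ip0l S hL).
have [Nc QN] := cylinder_cube T bO.
(* A field $\varphi e_i$ with smooth $\varphi$ has divergence $\partial_i\varphi$; orthogonality to
   these fluxes is the Green formula for $f$ and $\tau$. *)
have Gf : grad0 T Om f tau.
  split => // i phi sp.
  have uL := unitv_L2 i (sL2 sp); have dL := sL2 (smooth_derive (dir_x i) sp).
  have du : is_weak_divx T Om (unitv i phi) ('D_(dir_x i) phi).
    move=> psi tp; rewrite -ip_gradv (sipC Sv uL (gradv_L2 tp.1)) ip_unitv; last exact: gradv_L2 tp.1.
    rewrite vcomp_gradv (sipC S (sL2 (smooth_derive _ tp.1)) (sL2 sp)).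
    exact: ipL2_derive_test mQ QN sp tp.
  have := rN _ (ex_intro _ _ (nice_flux uL dL du)).
  rewrite /ipgraph /ipL2p /= ip0r// ipv0r// add0r addr0 ip_unitv// addrC => /eqP.
  by rewrite addr_eq0 => /eqP.
have key a a' m p : elementary a -> elementary a' ->
    (forall y : R, is_derive y 1 a (a' y)) -> spatial T Om m p ->
    ip v (fun z => a z.1 * m z.2) + ipL2v Q g (tensorv a p) +
    ip f (fun z => a' z.1 * m z.2) = 0.
  move=> ea ea' da sm; have := rN _ (ex_intro _ _ (nice_tensor ea ea' da sm)).
  by rewrite /ipgraph /ipL2p /= ipv0r// addr0.
have v0 := cosine_total T0 oO bO vL (mom_null_graph rG Gf key).
have g0 i : eqL2 mu Q (vcomp g i) (fun=> 0).
  apply: (test_orthogonal oQ QN (gL i)) => phi tp.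
  by rewrite -[LHS]opprK -Hg// (eqL2_ip mQ vL v0) ?oppr0//; exact: sL2 (smooth_derive _ tp.1).
have dt : is_weak_divx T Om tau f.
  move=> phi tp; have := Hdiv phi tp.
  by rewrite /= (eqL2_ip mQ vL v0) ?add0r//; exact: sL2 (smooth_derive _ tp.1).
have := rN _ (ex_intro _ _ (nice_flux tL fL dt)).
rewrite /ipgraph /ipL2p /= ip0r// ipv0r// add0r addr0 => <-.
rewrite (eqL2_ip mQ vL v0 vL) add0r /ipL2v; congr (_ + _).
rewrite [X in _ + X]big1 ?addr0// => i _.
exact: (eqL2_ip mQ (gL i) (g0 i) (gL i)).
Qed.

End nice_elements.

(** * Energy identity and initial trace *)

Section energy.
Context {R : realType} {d : nat}.
Local Notation E := (R * 'rV[R]_d)%type.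
Local Notation ME := (measurableTypeR R * 'rV[R]_d)%type.
Local Notation mu := (@leb_tx R d).
Local Notation mx := (@leb_x R d).
Local Notation lam := (@lebesgue_measure R).
Variables (T : R) (Om : set 'rV[R]_d).
Hypotheses (T0 : 0 < T) (oO : open Om) (bO : bounded_set Om).
Local Notation Q := (cylinder T Om).
Local Notation L2 := (inL2 mu (Q : set ME)).
Local Notation ip := (ipL2 mu (Q : set ME)).
Local Notation L2x := (inL2 mx Om).
Local Notation ipx := (ipL2 mx Om).
Local Notation I := (time_interval T).

Let mO := open_measurable_x oO.
Let Sx := @inL2_sip _ _ R mx Om mO.
Let oQ : open (Q : set E) := @cylinder_open R d T Om oO.
Let mQ : measurable (Q : set ME) := @measurable_Q R d T Om oO.
Let S := @inL2_sip _ _ R mu (Q : set ME) mQ.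
Let Sv := @inL2v_sip R d Q mQ.
Let mI := measurable_time_interval T.
Let wL2 b f : weight T b -> L2 f -> L2 (fun z => b z.1 * f z).
Proof. exact: weight_L2. Qed.
Let tL2 b m : weight T b -> L2x m -> L2 (fun z => b z.1 * m z.2).
Proof. exact: tensor_L2. Qed.

Local Notation gtriple := (pfield R d * vfield R d * sfield R d)%type.
Variable cL : R.
Hypotheses (cL0 : 0 < cL)
  (hcoer : forall v : pfield R d, inU0 Q v ->
      cL * normL2p Q v ^+ 2 <=
        normL2p Q (opA Q v) ^+ 2 + normL2 mx Om (gamma0 T Om v) ^+ 2).

Local Notation nice := (nice T Om).
Local Notation ipgraph := (@ipgraph R d T Om).
Local Notation ingraph0 := (ingraph0 T Om).
Let SG := ingraph0_space T oO bO.

Definition slab_ind (s t : R) : R -> R := \1_(`]s, t[%classic : set (measurableTypeR R)).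

Let wst s t : weight T (slab_ind s t).
Proof. by apply: weight_indic; exact: measurable_itv. Qed.

Lemma cutoff_lim s t (F g : sfield R d) : L2 F -> L2 g ->
  (fun k => ip F (fun z => cutoff s t k z.1 * g z)) @ \oo -->
  ip F (fun z => slab_ind s t z.1 * g z).
Proof.
move=> FL gL; have gL' : L2 (fun z => `|g z|).
  apply: (inL2_dominated mQ _ gL); last by move=> z _; rewrite normr_id.
  by apply: measurableT_comp => //; exact: (inL2_measurable mQ gL).
apply: (ipL2_dominated mQ FL gL').
- by move=> k; exact: (inL2_measurable mQ (wL2 (weight_elem T (elementary_cutoff s t k)) gL)).
- by move=> k z _; rewrite normrM ler_piMl// ger0_norm ?cutoff_ge0// cutoff_le1.
- exact: (inL2_measurable mQ (wL2 (wst s t) gL)).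
- by move=> z _; apply: cvgMl; exact: cutoff_cvg.
Qed.

(** A smooth time cutoff of $v$ still vanishes laterally, so duality applies to it; the indicator of
    $]s,t[$ is then reached in the limit. *)
Lemma interval_duality s t v g chi q : grad0 T Om v g -> inL2v Q chi -> L2 q ->
  is_weak_divx T Om chi q ->
  ip q (fun z => slab_ind s t z.1 * v z) + ipL2v Q chi (weightv (slab_ind s t) g) = 0.
Proof.
move=> G chL qL H; have [vL gL _] := G.
have l1 := cutoff_lim (s := s) (t := t) qL vL.
have l2 : (fun k => ipL2v Q chi (weightv (cutoff s t k) g)) @ \oo -->
    ipL2v Q chi (weightv (slab_ind s t) g).
  apply: (@cvg_big _ _ _ _ _ (@add_continuous R)) => i _.
  rewrite vcomp_weightv (_ : (fun k => _) =
    (fun k => ip (vcomp chi i) (fun z => cutoff s t k z.1 * vcomp g i z))).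
    by apply: cutoff_lim; [exact: chL|exact: gL].
  by apply/funext => k; rewrite vcomp_weightv.
have l3 : (fun k => ip q (fun z => cutoff s t k z.1 * v z) +
    ipL2v Q chi (weightv (cutoff s t k) g)) @ \oo -->
    ip q (fun z => slab_ind s t z.1 * v z) + ipL2v Q chi (weightv (slab_ind s t) g).
  exact: cvgD l1 l2.
rewrite -(cvg_lim (@Rhausdorff R) l3) (_ : (fun k => _) = fun=> 0); first exact: lim_cst.
apply/funext => k.
have := grad0_duality T0 oO bO cL0 hcoer (grad0_weight oO (elementary_cutoff s t k) G) chL qL H.
by move=> ->; rewrite subrr.
Qed.

(** $\int\beta(t)\,(\langle\mathrm{div}\,z,v'\rangle+\langle\tau,\nabla_xv'\rangle)\,dt$ for
    $z=(v,\tau)$ and $z'=(v',\tau')$: one half of the polarized energy identity. *)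
Definition flux_pairing (be : R -> R) (z z' : gtriple) : R :=
  ip z.2 (fun y => be y.1 * z'.1.1.1 y) + ipL2v Q z.1.1.2 (weightv be z'.1.2).

Lemma weightv_L2 be g : weight T be -> inL2v Q g -> inL2v Q (weightv be g).
Proof. by move=> wb gL i; rewrite vcomp_weightv; exact: wL2. Qed.

Lemma flux_pairingPl be (c : R) z1 z2 z' : weight T be -> ingraph0 z1 -> ingraph0 z2 ->
  ingraph0 z' -> flux_pairing be (c *: z1 + z2) z' =
  c * flux_pairing be z1 z' + flux_pairing be z2 z'.
Proof.
move=> wb [[[_ a1] _ _ a2 _] _] [[[_ b1] _ _ b2 _] _] [[[c1 _] c2 _ _ _] _].
rewrite /flux_pairing /= (sipL S _ a2 b2 (wL2 wb c1)) (sipL Sv _ a1 b1 (weightv_L2 wb c2)).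
ring.
Qed.

Lemma flux_pairingPr be (c : R) z1 z2 z' : weight T be -> ingraph0 z1 -> ingraph0 z2 ->
  ingraph0 z' -> flux_pairing be z' (c *: z1 + z2) =
  c * flux_pairing be z' z1 + flux_pairing be z' z2.
Proof.
move=> wb [[[a1 _] a2 _ _ _] _] [[[b1 _] b2 _ _ _] _] [[[_ c1] _ _ c2 _] _].
rewrite /flux_pairing /=.
have -> : (fun y => be y.1 * (c *: z1 + z2).1.1.1 y) =
    c *: (fun y => be y.1 * z1.1.1.1 y) + (fun y => be y.1 * z2.1.1.1 y).
  apply/funext => y; rewrite -[LHS]/(be y.1 * (c * z1.1.1.1 y + z2.1.1.1 y)).
  by rewrite -[RHS]/(c * (be y.1 * z1.1.1.1 y) + be y.1 * z2.1.1.1 y); ring.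
have -> : weightv be (c *: z1.1.2 + z2.1.2) = c *: weightv be z1.1.2 + weightv be z2.1.2.
  by apply/funext => y; apply/rowP => i; rewrite !mxE; ring.
have x1 := wL2 wb a1; have x2 := wL2 wb b1.
have y1 := weightv_L2 wb a2; have y2 := weightv_L2 wb b2.
rewrite (ipDr S (sipZ S _ x1) x2 c2) (ipZr S _ x1 c2).
by rewrite (ipDr Sv (sipZ Sv _ y1) y2 c1) (ipZr Sv _ y1 c1); ring.
Qed.

Lemma nice_L2x z V r : nice z V -> L2x (V r).
Proof.
elim=> {z V} [a a' m p _ _ _ sm|chi q _ _ _|c z V z' V' _ Hz _ Hz'].
- by have := sipZ Sx (a r) (spatial_L2 sm).
- exact: (sip0 Sx).
- exact: (sipP Sx).
Qed.

Lemma nice_slice z V r x : nice z V -> z.1.1.1 (r, x) = V r x.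
Proof. by elim=> {z V} // c z V z' V' _ Hz _ Hz'; rewrite /= -[LHS]/(c * _ + _) Hz Hz'. Qed.

Lemma weight_integrable b : weight T b -> lam.-integrable I (EFin \o b).
Proof.
move=> [mb [M bM]]; apply: (measurable_bounded_integrable mI (time_interval_lty T0)).
  exact: (measurable_funS measurableT (@subsetT _ I) mb).
by exists M; split; [exact: num_real|move=> y My r Ir; apply: le_trans (ltW My); exact: bM].
Qed.

Lemma interval_product a a' b b' s t : elementary a -> elementary a' ->
  elementary b -> elementary b' -> (forall y : R, is_derive y 1 a (a' y)) ->
  (forall y : R, is_derive y 1 b (b' y)) -> 0 <= s -> s < t -> t <= T ->
  \int[lam]_(r in I) (a' r * (slab_ind s t r * b r)) +
  \int[lam]_(r in I) (b' r * (slab_ind s t r * a r)) = a t * b t - a s * b s.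
Proof.
move=> ea ea' eb eb' da db s0 st tT.
have W f : elementary f -> weight T f by move=> ef; exact: weight_elem.
rewrite -RintegralD//; last 2 first.
- by apply: weight_integrable; apply: weightM; [exact: W|apply: weightM => //; exact: W].
- by apply: weight_integrable; apply: weightM; [exact: W|apply: weightM => //; exact: W].
have dF (y : R) : is_derive y 1 (fun y => a y * b y) (a y * b' y + b y * a' y).
  exact: (is_deriveM (da y) (db y)).
have eF : elementary (fun y => a y * b' y + b y * a' y).
  by apply: elem_add; exact: elem_mul.
rewrite -(interval_FTC st dF (elementary_continuous eF)).
rewrite [LHS]Rintegral_mkcond [RHS]Rintegral_mkcond; apply: eq_Rintegral => r _.
rewrite !patchE.
have -> : slab_ind s t r = (s < r < t)%R%:R.
  rewrite /slab_ind indicE; congr (nat_of_bool _)%:R.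
  by apply/idP/idP; rewrite inE/= in_itv.
have -> : (r \in [set r : measurableTypeR R | s < r < t]) = (s < r < t).
  by apply/idP/idP; rewrite inE.
case: (boolP (s < r < t)) => [/andP[sr rt]|_]; last first.
  by case: ifP => _ //; rewrite !mul0r !mulr0 addr0.
rewrite mem_set; first by rewrite !mul1r; ring.
by rewrite /time_interval/= (le_lt_trans s0 sr) (lt_le_trans rt tT).
Qed.

(** By bilinearity it suffices to treat generators. Fluxes contribute nothing by duality, and two
    tensor fields reduce to the product rule in time. *)
Lemma nice_energy z V z' V' s t : nice z V -> nice z' V' ->
  0 <= s -> s < t -> t <= T ->
  flux_pairing (slab_ind s t) z z' + flux_pairing (slab_ind s t) z' z =
  ipx (V t) (V' t) - ipx (V s) (V' s).
Proof.
move=> nz nz' s0 st tT; have NG := @nice_ingraph0 _ _ _ _ T0 oO bO.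
have flux0 chi q y : inL2v Q chi -> L2 q -> is_weak_divx T Om chi q -> ingraph0 y ->
    flux_pairing (slab_ind s t) ((0, chi), 0, q) y +
    flux_pairing (slab_ind s t) y ((0, chi), 0, q) = 0.
  move=> chL qL H [[[y1 y2] yg _ yf _] G].
  rewrite /flux_pairing /= (interval_duality _ _ G chL qL H) add0r.
  rewrite (_ : (fun _ => _ * _) = 0); last by apply/funext => x; rewrite mulr0.
  rewrite (_ : weightv _ _ = 0); last by apply/funext => x; rewrite /weightv scaler0.
  rewrite (sipC S yf (sip0 S)) (sipC Sv y2 (sip0 Sv)).
  by rewrite (ip0l S yf) (ip0l Sv y2) addr0.
elim: nz z' V' nz' => {z V} [a a' m p ea ea' da sm|chi q chL qL H|c z1 V1 z2 V2 n1 IH1 n2 IH2] z' V' nz'.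
- elim: nz' => {z' V'} [b b' m' p' eb eb' db sm'|chi q chL qL H|c z1 V1 z2 V2 n1 IH1 n2 IH2].
  + have [mL mL'] := (spatial_L2 sm, spatial_L2 sm').
    have st0 := wst s t.
    have W f : elementary f -> weight T f by move=> ef; exact: weight_elem.
    rewrite /flux_pairing /= (ip0l Sv) ?(ip0l Sv) ?addr0; last 2 first.
    * apply: weightv_L2 => // i; rewrite vcomp_tensorv.
      exact: (tL2 (W _ ea) (spatial_L2v sm i)).
    * apply: weightv_L2 => // i; rewrite vcomp_tensorv.
      exact: (tL2 (W _ eb) (spatial_L2v sm' i)).
    have E1 (c' c : R -> R) (k' k : 'rV[R]_d -> R) : elementary c' -> elementary c ->
        L2x k' -> L2x k ->
        ip (fun y => c' y.1 * k' y.2) (fun y => slab_ind s t y.1 * (c y.1 * k y.2)) =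
        (\int[lam]_(r in I) (c' r * (slab_ind s t r * c r))) * ipx k' k.
      move=> ec' ec kL' kL.
      rewrite -(tensor_tensor T0 oO (W _ ec') (weightM st0 (W _ ec)) kL' kL).
      by congr (ip _ _); apply/funext => y; exact: mulrA.
    rewrite (E1 _ _ _ _ ea' eb mL mL') (E1 _ _ _ _ eb' ea mL' mL).
    rewrite (sipC Sx mL' mL) -mulrDl (interval_product ea ea' eb eb' da db s0 st tT).
    have E2 r : ipx (fun x => a r * m x) (fun x => b r * m' x) = a r * b r * ipx m m'.
      have := ipZl Sx (a r) mL (sipZ Sx (b r) mL'); rewrite (ipZr Sx (b r) mL' mL).
      by rewrite mulrA.
    by rewrite !E2 mulrBl.
  + have mL r : L2x (fun x => a r * m x) by exact: (sipZ Sx (a r) (spatial_L2 sm)).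
    have G := NG _ _ (nice_tensor ea ea' da sm).
    rewrite addrC flux0// (sipC Sx (mL t) (sip0 Sx)) (sipC Sx (mL s) (sip0 Sx)).
    by rewrite (ip0l Sx (mL t)) (ip0l Sx (mL s)) subrr.
  + have G := NG _ _ (nice_tensor ea ea' da sm); have st0 := wst s t.
    have mL r : L2x (fun x => a r * m x) by exact: (sipZ Sx (a r) (spatial_L2 sm)).
    rewrite (flux_pairingPl _ st0 (NG _ _ n1) (NG _ _ n2) G).
    rewrite (flux_pairingPr _ st0 (NG _ _ n1) (NG _ _ n2) G).
    have C r : ipx (fun x => a r * m x) ((c *: V1 + V2) r) =
        c * ipx (fun x => a r * m x) (V1 r) + ipx (fun x => a r * m x) (V2 r).
      have x1 := nice_L2x r n1; have x2 := nice_L2x r n2.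
      rewrite -[(c *: V1 + V2) r]/(c *: V1 r + V2 r).
      by rewrite (ipDr Sx (sipZ Sx c x1) x2 (mL r)) (ipZr Sx c x1 (mL r)).
    by rewrite !C addrACA -mulrDr IH1 IH2; ring.
- rewrite flux0//; last exact: NG nz'.
  by rewrite (ip0l Sx (nice_L2x t nz')) (ip0l Sx (nice_L2x s nz')) subrr.
- have st0 := wst s t.
  rewrite (flux_pairingPl _ st0 (NG _ _ n1) (NG _ _ n2) (NG _ _ nz')).
  rewrite (flux_pairingPr _ st0 (NG _ _ n1) (NG _ _ n2) (NG _ _ nz')).
  have C r : ipx ((c *: V1 + V2) r) (V' r) = c * ipx (V1 r) (V' r) + ipx (V2 r) (V' r).
    exact: (sipL Sx c (nice_L2x r n1) (nice_L2x r n2) (nice_L2x r nz')).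
  by rewrite !C addrACA -mulrDr (IH1 _ _ nz') (IH2 _ _ nz'); ring.
Qed.

Lemma slice_integral u : L2 u ->
  lam.-integrable I (EFin \o (fun r : R => ipx (fun x => u (r, x)) (fun x => u (r, x)))) /\
  ip u u = \int[lam]_(r in I) ipx (fun x => u (r, x)) (fun x => u (r, x)).
Proof.
move=> uL.
exact: (@rect_fubini1 _ _ _ _ R lam (lebesgue_rV d) I Om mI mO (fun z => u z * u z) (inL2M mQ uL uL)).
Qed.

Lemma ip_slab_le s t f : L2 f ->
  ip (fun y => slab_ind s t y.1 * f y) (fun y => slab_ind s t y.1 * f y) <= ip f f.
Proof.
move=> fL; have gL := wL2 (wst s t) fL.
apply: le_Rintegral => //; [exact: (inL2M mQ gL gL)|exact: (inL2M mQ fL fL)|].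
move=> y _; rewrite -!expr2 exprMn ler_piMl ?sqr_ge0//.
by rewrite /slab_ind indicE; case: (_ \in _); rewrite ?expr1n ?expr0n.
Qed.

Lemma flux_pairing_young s t z : ingraph0 z ->
  2 * `|flux_pairing (slab_ind s t) z z| <= ipgraph z z.
Proof.
case: z => -[[v tau] g] f [[[vL tL] gL _ fL _] _]; rewrite /= in vL tL gL fL.
rewrite /flux_pairing /ipgraph /ipL2p /=.
have bv := wL2 (wst s t) vL; have bg := weightv_L2 (wst s t) gL.
apply: le_trans (ler_wpM2l (ler0n R 2) (ler_normD _ _)) _; rewrite mulrDr.
apply: le_trans (lerD (sip_young S fL bv) (sip_young Sv tL bg)) _.
have h1 := ip_slab_le s t vL.
have h2 : ipL2v Q (weightv (slab_ind s t) g) (weightv (slab_ind s t) g) <= ipL2v Q g g.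
  by apply: ler_sum => i _; rewrite vcomp_weightv; exact: ip_slab_le.
lra.
Qed.

Lemma nice_increment z V s t : nice z V -> 0 <= s <= T -> 0 <= t <= T ->
  ipx (V t) (V t) <= ipx (V s) (V s) + ipgraph z z.
Proof.
move=> nz /andP[s0 sT] /andP[t0 tT].
have NG := nice_ingraph0 T0 oO bO nz; have zz := sip_ge0 SG NG.
have aux (p x y g : R) : 2 * `|p| <= g -> p + p = x - y -> x <= y + g /\ y <= x + g.
  by case: (ger0P p) => h0 h1 h2; split; lra.
have [st|ts|<-] := ltgtP s t; last by rewrite lerDl.
- exact: (aux _ _ _ _ (flux_pairing_young s t NG) (nice_energy nz nz s0 st tT)).1.
- exact: (aux _ _ _ _ (flux_pairing_young t s NG) (nice_energy nz nz t0 ts sT)).2.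
Qed.

(** Average the increment bound $\lVert V(t)\rVert^2\le\lVert V(s)\rVert^2+\lVert z\rVert^2$ over
    $s\in(0,T)$. *)
Lemma nice_sup z V t : nice z V -> 0 <= t <= T ->
  ipx (V t) (V t) <= (T^-1 + 1) * ipgraph z z.
Proof.
move=> nz tT; have NG := nice_ingraph0 T0 oO bO nz; have [[[vL _] _ _ _ _] _] := NG.
have [i1 e1] := slice_integral vL.
have slE r : (fun x => z.1.1.1 (r, x)) = V r by apply/funext => x; exact: nice_slice nz.
have wc (c : R) := weight_integrable (weight_elem T (elem_cst c)).
have h : T * ipx (V t) (V t) <= ip z.1.1.1 z.1.1.1 + T * ipgraph z z.
  have cI (c : R) : T * c = \int[lam]_(r in I) c.
    by rewrite Rintegral_cst//= (time_interval_lebesgue T0) mulrC.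
  rewrite e1 !cI -RintegralD//.
  apply: le_Rintegral => //; first exact: (integrableD mI i1 (wc _)).
  by move=> r /andP[r0 rT]; rewrite slE; apply: (nice_increment nz) => //; rewrite !ltW.
have vz : ip z.1.1.1 z.1.1.1 <= ipgraph z z.
  case: NG => -[wL gL _ fL _] _; apply: le_trans (ipL2p_fst_le mQ wL) _.
  by rewrite /ipgraph -addrA lerDl addr_ge0 ?(sip_ge0 Sv gL) ?(sip_ge0 S fL).
rewrite -(ler_pM2l T0) mulrA [T * (_ + _)]mulrDr mulr1 mulfV ?gt_eqF// mulrDl mul1r.
lra.
Qed.

Lemma nice_continuous z V t : nice z V ->
  (fun s : R => ipx (V s - V t) (V s - V t)) @ t --> (0 : R).
Proof.
elim=> {z V} [a a' m p ea _ _ sm|chi q _ _ _|c z V z' V' nz Hz nz' Hz'].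
- have mL := spatial_L2 sm.
  have E1 s : ipx ((fun x => a s * m x) - (fun x => a t * m x)) ((fun x => a s * m x) - (fun x => a t * m x))
      = (a s - a t) ^+ 2 * ipx m m.
    rewrite -(ip_sqrZ Sx (a s - a t) mL); congr ipx; apply/funext => x;
    by rewrite -[RHS]/((a s - a t) * m x) mulrBl.
  under eq_fun do rewrite E1.
  have H : (fun s => (a s - a t) * (a s - a t) * ipx m m) @ t --> (a t - a t) * (a t - a t) * ipx m m.
    have ca : (fun s => a s - a t) @ t --> a t - a t.
      by apply: cvgB; [exact: elementary_continuous|exact: cvg_cst].
    by apply: cvgMl; exact: cvgM.
  by under eq_fun do rewrite expr2; move: H; rewrite subrr !mul0r.
- under eq_fun do rewrite subrr (ip0l Sx (sip0 Sx)).
  exact: cvg_cst.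
- pose B s := 2 * (c ^+ 2 * ipx (V s - V t) (V s - V t)) + 2 * ipx (V' s - V' t) (V' s - V' t).
  have B0 : B @ t --> (0 : R).
    have h1 (k : R) (f : R -> R) : f @ t --> (0 : R) -> (fun s => k * f s) @ t --> (0 : R).
      by move=> f0; rewrite -[X in _ --> X](mulr0 k); apply: cvgM => //; exact: cvg_cst.
    rewrite -[X in _ --> X]addr0; apply: cvgD; apply: (h1 2) => //.
    exact: (h1 (c ^+ 2)).
  apply: (@squeeze_cvgr _ _ _ _ (cst 0) B) => //; last exact: cvg_cst.
  apply: nearW => s /=.
  have x1 := sipB Sx (nice_L2x s nz) (nice_L2x t nz).
  have x2 := sipB Sx (nice_L2x s nz') (nice_L2x t nz').
  have -> : (c *: V + V') s - (c *: V + V') t = c *: (V s - V t) + (V' s - V' t).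
    by rewrite -[LHS]/(c *: V s + V' s - (c *: V t + V' t)) scalerBr opprD addrACA.
  rewrite (sip_ge0 Sx (sipP Sx c x1 x2))/= /B -(ip_sqrZ Sx c x1).
  exact: (sip_sqrD_le Sx (sipZ Sx c x1) x2).
Qed.

(** The infimum over $n$ of the slice quantities has zero integral, hence vanishes at almost every
    time; no subsequence is extracted. The added $1/(n+1)$ ensures that the slice is small for an
    index that is itself large. *)
Lemma slices_cvg (u : nat -> sfield R d) : (forall n, L2 (u n)) ->
  (forall n, ip (u n) (u n) <= n.+1%:R^-1) ->
  {ae lam, forall r : R, I r -> forall e, 0 < e ->
    exists n, ipx (fun x => u n (r, x)) (fun x => u n (r, x)) + n.+1%:R^-1 <= e}.
Proof.
move=> uL ue.
pose eta n (r : R) := ipx (fun x => u n (r, x)) (fun x => u n (r, x)) + n.+1%:R^-1.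
have eta0 n r : 0 <= eta n r.
  by rewrite addr_ge0// /ipL2 Rintegral_ge0// => x _; rewrite -expr2 sqr_ge0.
have ieta n : lam.-integrable I (EFin \o eta n).
  have [i1 _] := slice_integral (uL n).
  exact: (integrableD mI i1 (weight_integrable (weight_elem T (elem_cst _)))).
have Ieta n : \int[lam]_(r in I) eta n r <= (1 + T) * n.+1%:R^-1.
  have [i1 e1] := slice_integral (uL n).
  have ic := weight_integrable (weight_elem T (elem_cst (n.+1%:R^-1 : R))).
  rewrite (RintegralD mI i1 ic) -e1 Rintegral_cst//= (time_interval_lebesgue T0) mulrDl mul1r.
  by rewrite lerD// mulrC.
pose th (r : R) := einfs (fun n => (eta n r)%:E) 0%N.
have th0 r : (0 <= th r)%E by apply: le_ereal_inf_tmp => _ [n _ <-]; rewrite lee_fin.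
have th_le n r : (th r <= (eta n r)%:E)%E by apply: ereal_inf_lbound; exists n.
have mth : measurable_fun I th.
  apply: (@measurable_fun_einfs _ _ _ I (fun n r => (eta n r)%:E)) => n.
  exact: (measurable_int _ (ieta n)).
have Ith n : (\int[lam]_(r in I) th r <= ((1 + T) * n.+1%:R^-1)%:E)%E.
  apply: (@le_trans _ _ (\int[lam]_(r in I) (eta n r)%:E)%E).
    apply: ge0_le_integral => //; exact: (measurable_int _ (ieta n)).
  by rewrite -(fineK (integrable_fin_num mI (ieta n))) lee_fin; exact: Ieta.
have Ith0 : (\int[lam]_(r in I) `|th r| = 0)%E.
  transitivity (\int[lam]_(r in I) th r)%E.
    by apply: eq_integral => r _; rewrite gee0_abs.
  apply/eqP; rewrite eq_le; apply/andP; split; last exact: integral_ge0.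
  apply/lee_addgt0Pr => e e0; rewrite add0e.
  have T1 : 0 < 1 + T by rewrite addr_gt0.
  have : \forall n \near \oo, n.+1%:R^-1 <= e / (1 + T).
    have /cvgrPdist_le := @cvg_harmonic R; move=> /(_ _ (divr_gt0 e0 T1)).
    by apply: filterS => n; rewrite sub0r normrN ger0_norm ?invr_ge0.
  move=> [n _ /(_ n (leqnn n)) hn]; apply: le_trans (Ith n) _.
  by rewrite lee_fin mulrC -ler_pdivlMr.
have := (ae_eq_integral_abs lam mI mth).1 Ith0.
apply: filterS => r h Ir e e0; apply: contrapT => /forallNP H.
have : (e%:E <= th r)%E.
  apply: le_ereal_inf_tmp => _ [n _ <-]; rewrite lee_fin ltW// ltNge.
  by apply/negP; exact: H.
by rewrite (h Ir) lee_fin leNgt e0.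
Qed.

(** One approximating sequence serves both the graph norm and, uniformly in time, the slices. The
    constant is $T^{-1}+1$ from [nice_sup], with a factor $4$ from two uses of $\lVert
    a+b\rVert^2\le2\lVert a\rVert^2+2\lVert b\rVert^2$. *)
Definition time_limit (zn : nat -> gtriple) (Vn : nat -> R -> 'rV[R]_d -> R) z V :=
  [/\ forall n, nice (zn n) (Vn n),
      forall n, ipgraph (z - zn n) (z - zn n) <= n.+1%:R^-1,
      forall t, L2x (V t) &
      forall n t, 0 <= t <= T ->
        ipx (Vn n t - V t) (Vn n t - V t) <= 4 * (T^-1 + 1) * n.+1%:R^-1].

(** Differences of nice elements are nice, so [nice_sup] makes their slices a Cauchy sequence
    uniformly in time. *)
Lemma time_limit_exists z : ingraph0 z -> exists zn Vn V, time_limit zn Vn z V.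
Proof.
move=> zG.
have en (n : nat) : 0 < n.+1%:R^-1 :> R by rewrite invr_gt0.
have /choice[zn /choice[Vn Hn]] : forall n : nat, exists z' V', nice z' V' /\
    ipgraph (z - z') (z - z') <= n.+1%:R^-1.
  by move=> n; exact: (nice_dense T0 oO bO cL0 hcoer zG (en n)).
have nz n : nice (zn n) (Vn n) by case: (Hn n).
have hz n : ipgraph (z - zn n) (z - zn n) <= n.+1%:R^-1 by case: (Hn n).
have NG n : ingraph0 (zn n) := nice_ingraph0 T0 oO bO (nz n).
pose K : R := T^-1 + 1; have K0 : 0 < K by rewrite addr_gt0// invr_gt0.
have VL n t : L2x (Vn n t) := nice_L2x t (nz n).
have diff n m t : 0 <= t <= T ->
    ipx (Vn n t - Vn m t) (Vn n t - Vn m t) <= K * (2 * n.+1%:R^-1 + 2 * m.+1%:R^-1).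
  move=> tT; have nm := nice_comb (-1) (nz m) (nz n).
  have := nice_sup nm tT; rewrite !scaleN1r ![- _ + _]addrC => h; apply: le_trans h _.
  rewrite ler_pM2l//; have x1 := sipB SG zG (NG n); have x2 := sipB SG zG (NG m).
  have -> : zn n - zn m = - (z - zn n) + (z - zn m) by rewrite opprB addrA subrK.
  apply: le_trans (sip_sqrD_le SG (sipN SG x1) x2) _.
  rewrite (ipNl SG x1 (sipN SG x1)) (ipNr SG x1 x1) opprK.
  by apply: lerD; rewrite ler_pM2l.
have small (e : R) : 0 < e -> \forall n \near \oo, n.+1%:R^-1 <= e.
  move=> e0; have /cvgrPdist_le := @cvg_harmonic R; move=> /(_ _ e0).
  by apply: filterS => n; rewrite sub0r normrN ger0_norm ?invr_ge0.
have /choice[V HV] : forall t, exists v, L2x v /\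
    (0 <= t <= T -> sip_cvg ipx (Vn ^~ t) v).
  move=> t; have [tT|] := pselect (0 <= t <= T); last first.
    by move=> nt; exists 0; split => //; exact: (sip0 Sx).
  have [//||v vL cv] := @inL2_complete _ _ R mx Om mO (Vn ^~ t).
    move=> e e0; have e4 : 0 < e / (4 * K) by rewrite divr_gt0// mulr_gt0.
    have [M _ HM] := small _ e4; exists M => m n Mm Mn.
    apply: le_trans (diff m n t tT) _; rewrite mulrC -ler_pdivlMr//.
    have := HM m Mm; have := HM n Mn => /= h1 h2.
    have -> : e / K = 4 * (e / (4 * K)) by rewrite invfM; field; rewrite gt_eqF.
    move: h1 h2; move: (m.+1%:R^-1) (n.+1%:R^-1) (e / (4 * K)) => a b k h1 h2.
    by lra.
  by exists v.
exists zn, Vn, V; split => //; first by move=> t; case: (HV t).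
move=> n t tT; have [vL /(_ tT) cv] := HV t; apply/ler_addgt0Pl => e e0.
have e4 : 0 < e / 4 by rewrite divr_gt0.
have e5 : 0 < e / 8 / K by rewrite !divr_gt0.
move/cvgrPdist_le : cv => /(_ _ e4) cv.
have [m [h1 h2]] : exists m, ipx (Vn m t - V t) (Vn m t - V t) <= e / 4 /\ m.+1%:R^-1 <= e / 8 / K.
  have [m _ /(_ m (leqnn m))] := filterI cv (small _ e5).
  move=> [h1 h2]; exists m; split => //; move: h1.
  by rewrite sub0r normrN ger0_norm// (sip_ge0 Sx (sipB Sx (VL m t) vL)).
have -> : Vn n t - V t = (Vn n t - Vn m t) + (Vn m t - V t) by rewrite addrA subrK.
apply: le_trans (sip_sqrD_le Sx (sipB Sx (VL n t) (VL m t)) (sipB Sx (VL m t) vL)) _.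
have := diff n m t tT; move: h2; rewrite ler_pdivlMr// -/K.
move: h1; move: (ipx _ _) (ipx _ _) (m.+1%:R^-1) (n.+1%:R^-1) => x y a b.
move=> h1 h2; rewrite mulrDr => h3.
have -> : 4 * K * b = 2 * (K * (2 * b)) by ring.
have -> : x = 2 * x / 2 by field.
lra.
Qed.

(** Continuity is inherited from the uniform limit. At almost every time [slices_cvg] supplies
    indices for which the slice of the approximation is close both to the slice of $v$ and to
    $V(t)$. *)
Lemma time_limit_rep zn Vn z V : ingraph0 z -> time_limit zn Vn z V ->
  continuous_rep T Om z.1.1.1 V.
Proof.
move=> zG [nz hz VL hV].
have NG n : ingraph0 (zn n) := nice_ingraph0 T0 oO bO (nz n).
pose K : R := 4 * (T^-1 + 1); have K0 : 0 < K by rewrite mulr_gt0// addr_gt0// invr_gt0.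
have VnL n t : L2x (Vn n t) := nice_L2x t (nz n).
split; first by move=> t _; exact: VL.
- move=> t; rewrite /= in_itv/= => tT; apply/cvgrPdist_le => e e0.
  have small (c : R) : 0 < c -> exists n, K * n.+1%:R^-1 <= c.
    move=> c0; have /cvgrPdist_le := @cvg_harmonic R; move=> /(_ _ (divr_gt0 c0 K0)).
    move=> [n _ /(_ n (leqnn n))]; rewrite sub0r normrN ger0_norm ?invr_ge0// => h.
    by exists n; rewrite mulrC -ler_pdivlMr.
  have e20 : 0 < e ^+ 2 / 16 by rewrite divr_gt0// exprn_gt0.
  have [n hn] := small _ e20.
  have := nice_continuous t (nz n) => /cvgrPdist_le /(_ _ e20).
  rewrite near_withinE; apply: filterS => s hs; rewrite /= in_itv/= => sT.
  rewrite sub0r normrN ger0_norm ?sqrtr_ge0//.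
  rewrite -[leRHS]ger0_norm ?(ltW e0)// -sqrtr_sqr ler_wsqrtr//.
  have -> : (fun x => V s x - V t x) =
      - (Vn n s - V s) + ((Vn n s - Vn n t) + (Vn n t - V t)).
    apply/funext => x.
    rewrite -[RHS]/(- (Vn n s x - V s x) + ((Vn n s x - Vn n t x) + (Vn n t x - V t x))).
    by ring.
  have x1 := sipB Sx (VnL n s) (VL s); have x2 := sipB Sx (VnL n s) (VnL n t).
  have x3 := sipB Sx (VnL n t) (VL t).
  apply: le_trans (sip_sqrD_le Sx (sipN Sx x1) (sipD Sx x2 x3)) _.
  have := sip_sqrD_le Sx x2 x3.
  rewrite (ipNl Sx x1 (sipN Sx x1)) (ipNr Sx x1 x1) opprK.
  have h1 := le_trans (hV n s sT) hn; have h3 := le_trans (hV n t tT) hn.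
  move: hs; rewrite sub0r normrN ger0_norm ?(sip_ge0 Sx x2)//.
  have := sqr_ge0 e; move: h1 h3; move: (ipx _ _) (ipx _ _) (ipx _ _) (ipx _ _) (e ^+ 2) => a b c f g.
  move=> h1 h2 h0 h3 h4; lra.
- have [[[zL _] _ _ _ _] _] := zG.
  have uL n : L2 (z.1.1.1 - (zn n).1.1.1).
    by have [[[h _] _ _ _ _] _] := NG n; exact: (sipB S zL h).
  have ue n : ip (z.1.1.1 - (zn n).1.1.1) (z.1.1.1 - (zn n).1.1.1) <= n.+1%:R^-1.
    apply: le_trans (hz n); have [[wL gL _ fL _] _] := sipB SG zG (NG n).
    apply: le_trans (ipL2p_fst_le mQ wL) _.
    by rewrite /ipgraph -addrA lerDl addr_ge0 ?(sip_ge0 Sv gL) ?(sip_ge0 S fL).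
  have sl := ae_slice_L2 mI mO zL.
  have := slices_cvg uL ue; apply: filterS2 sl => t zt Ht It.
  have vL := zt It; have tT : 0 <= t <= T by case/andP: It => /ltW -> /ltW ->.
  apply: (ip0_eqL2 mO vL (VL t)); set v := (fun x => z.1.1.1 (t, x)) in vL *.
  have dL := sipB Sx vL (VL t); apply/eqP; rewrite eq_le (sip_ge0 Sx dL) andbT.
  apply/ler_addgt0Pl => e e0; rewrite addr0.
  have K1 : 0 < 2 * (1 + K) by rewrite mulr_gt0// addr_gt0.
  have [n hn] := Ht It _ (divr_gt0 e0 K1).
  have x1 := sipB Sx vL (VnL n t); have x2 := sipB Sx (VnL n t) (VL t).
  have -> : v - V t = (v - Vn n t) + (Vn n t - V t) by rewrite addrA subrK.
  apply: le_trans (sip_sqrD_le Sx x1 x2) _.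
  have uE : (fun x => (z.1.1.1 - (zn n).1.1.1) (t, x)) = v - Vn n t.
    by apply/funext => x; rewrite -[RHS]/(v x - Vn n t x) -(nice_slice t x (nz n)).
  move: hn (hV n t tT) (sip_ge0 Sx x1); rewrite uE -/K ler_pdivlMr//.
  have : 0 <= n.+1%:R^-1 :> R by rewrite invr_ge0.
  move: (ipx _ _) (ipx _ _) (n.+1%:R^-1) => a b c c0 h1 h2 h3.
  nra.
Qed.

End energy.

(** * The initial trace and the inner product of (A, gamma0) *)

Section trace.
Context {R : realType} {d : nat}.
Local Notation E := (R * 'rV[R]_d)%type.
Local Notation ME := (measurableTypeR R * 'rV[R]_d)%type.
Local Notation mu := (@leb_tx R d).
Local Notation mx := (@leb_x R d).
Local Notation lam := (@lebesgue_measure R).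
Variables (T : R) (Om : set 'rV[R]_d).
Hypotheses (T0 : 0 < T) (oO : open Om) (bO : bounded_set Om).
Local Notation Q := (cylinder T Om).
Local Notation L2 := (inL2 mu (Q : set ME)).
Local Notation ip := (ipL2 mu (Q : set ME)).
Local Notation L2x := (inL2 mx Om).
Local Notation ipx := (ipL2 mx Om).
Local Notation I := (time_interval T).

Let mO := open_measurable_x oO.
Let Sx := @inL2_sip _ _ R mx Om mO.
Let oQ : open (Q : set E) := @cylinder_open R d T Om oO.
Let mQ : measurable (Q : set ME) := @measurable_Q R d T Om oO.
Let S := @inL2_sip _ _ R mu (Q : set ME) mQ.
Let Sv := @inL2v_sip R d Q mQ.
Let Sp := @inL2p_sip R d Q mQ.
Let mI := measurable_time_interval T.
Let wL2 b f : weight T b -> L2 f -> L2 (fun z => b z.1 * f z).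
Proof. exact: weight_L2. Qed.
Let tL2 b m : weight T b -> L2x m -> L2 (fun z => b z.1 * m z.2).
Proof. exact: tensor_L2. Qed.
Let sL2 (f : sfield R d) : smooth f -> L2 f.
Proof. by have [N QN] := cylinder_cube T bO; exact: (smooth_L2 oQ QN). Qed.

Local Notation gtriple := (pfield R d * vfield R d * sfield R d)%type.
Variable cL : R.
Hypotheses (cL0 : 0 < cL)
  (hcoer : forall v : pfield R d, inU0 Q v ->
      cL * normL2p Q v ^+ 2 <=
        normL2p Q (opA Q v) ^+ 2 + normL2 mx Om (gamma0 T Om v) ^+ 2).

Local Notation nice := (nice T Om).
Local Notation ipgraph := (@ipgraph R d T Om).
Local Notation L2graph := (L2graph T Om).
Local Notation ingraph0 := (ingraph0 T Om).
Local Notation time_limit := (time_limit T Om).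
Let SG := ingraph0_space T oO bO.
Let SL := L2graph_space T oO.
Let wst s t : weight T (@slab_ind R s t).
Proof. by apply: weight_indic; exact: measurable_itv. Qed.

Lemma ingraph0_L2 z : ingraph0 z -> L2graph z.
Proof. by move=> [[wL gL _ fL _] _]. Qed.

(** The representative, in the graph inner product, of the symmetrized flux pairing with [y]; it
    makes the energy identity continuous in the other argument. *)
Definition graph_dual (be : R -> R) (y : gtriple) : gtriple :=
  (((fun x => be x.1 * y.2 x), weightv be y.1.2), weightv be y.1.1.2,
    (fun x => be x.1 * y.1.1.1 x)).

Lemma graph_dual_L2 be y : weight T be -> ingraph0 y -> L2graph (graph_dual be y).
Proof.
move=> wb [[[y1 y2] yg _ yf _] _]; split; [split|] => /=.
- by split; [exact: wL2|exact: weightv_L2].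
- exact: weightv_L2.
- exact: wL2.
Qed.

Lemma flux_pairing_dual be z y : weight T be -> ingraph0 z -> ingraph0 y ->
  flux_pairing T Om be z y + flux_pairing T Om be y z = ipgraph z (graph_dual be y).
Proof.
move=> wb [[[z1 z2] zg _ zf _] _] [[[y1 y2] yg _ yf _] _].
rewrite /flux_pairing /ipgraph /ipL2p /=.
have -> : ip y.2 (fun x => be x.1 * z.1.1.1 x) = ip z.1.1.1 (fun x => be x.1 * y.2 x).
  by apply: eq_Rintegral => x _; ring.
have -> : ipL2v Q y.1.1.2 (weightv be z.1.2) = ipL2v Q z.1.2 (weightv be y.1.1.2).
  by apply: eq_bigr => i _; rewrite !vcomp_weightv; apply: eq_Rintegral => x _; ring.
by ring.
Qed.

Lemma time_limit_ingraph0 zn Vn z V n : time_limit zn Vn z V -> ingraph0 (zn n).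
Proof. by move=> [nz _ _ _]; exact: (nice_ingraph0 T0 oO bO (nz n)). Qed.

Lemma le_inv_cvg0 (u : nat -> R) (K : R) : 0 < K -> (forall n, 0 <= u n <= K * n.+1%:R^-1) ->
  u @ \oo --> (0 : R).
Proof.
move=> K0 uK; apply: cvg_le0 uK _.
by rewrite -[X in _ --> X](mulr0 K); apply: cvgM; [exact: cvg_cst|exact: cvg_harmonic].
Qed.

Lemma time_limit_cvg zn Vn z V : ingraph0 z -> time_limit zn Vn z V ->
  sip_cvg ipgraph zn z.
Proof.
move=> zG H; have [nz hz _ _] := H; apply: (@le_inv_cvg0 _ 1) => // n.
have zn0 := time_limit_ingraph0 n H; have x := sipB SG zn0 zG.
rewrite (sip_ge0 SG x)/= mul1r -opprB (ipNl SG _ (sipN SG _)) ?(ipNr SG) ?opprK//;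
  exact: (sipB SG).
Qed.

Lemma time_limit_cvg_at zn Vn z V t : time_limit zn Vn z V -> 0 <= t <= T ->
  sip_cvg ipx (Vn ^~ t) (V t).
Proof.
move=> [nz _ VL hV] tT; apply: (@le_inv_cvg0 _ (4 * (T^-1 + 1))).
  by rewrite mulr_gt0// addr_gt0// invr_gt0.
move=> n; rewrite hV// andbT; apply: (sip_ge0 Sx).
exact: (sipB Sx (nice_L2x oO t (nz n)) (VL t)).
Qed.

Lemma energy_limit zn Vn z V y Y s t : ingraph0 z -> time_limit zn Vn z V ->
  ingraph0 y -> (forall r, L2x (Y r)) -> 0 <= s <= T -> 0 <= t <= T ->
  (forall n, ipgraph (zn n) (graph_dual (slab_ind s t) y) =
    ipx (Vn n t) (Y t) - ipx (Vn n s) (Y s)) ->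
  ipgraph z (graph_dual (slab_ind s t) y) = ipx (V t) (Y t) - ipx (V s) (Y s).
Proof.
move=> zG H yG YL sT tT E; have [nz _ VL _] := H.
have znL n := ingraph0_L2 (time_limit_ingraph0 n H).
have VnL n r : L2x (Vn n r) := nice_L2x oO r (nz n).
have l1 := sip_cvg_ip SL znL (ingraph0_L2 zG) (graph_dual_L2 (wst s t) yG) (time_limit_cvg zG H).
have lt r : 0 <= r <= T -> (fun n => ipx (Vn n r) (Y r)) @ \oo --> ipx (V r) (Y r).
  move=> rT; exact: (sip_cvg_ip Sx (fun n => VnL n r) (VL r) (YL r) (time_limit_cvg_at H rT)).
have l2 : (fun n => ipx (Vn n t) (Y t) - ipx (Vn n s) (Y s)) @ \oo -->
    ipx (V t) (Y t) - ipx (V s) (Y s) by apply: cvgB; exact: lt.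
move: l1; rewrite (funext E) => l1.
by rewrite -(cvg_lim (@Rhausdorff R) l1) (cvg_lim (@Rhausdorff R) l2).
Qed.

Lemma energy_nice zn Vn z V y Y s t : ingraph0 z -> time_limit zn Vn z V ->
  nice y Y -> 0 <= s -> s < t -> t <= T ->
  ipgraph z (graph_dual (slab_ind s t) y) = ipx (V t) (Y t) - ipx (V s) (Y s).
Proof.
move=> zG H ny s0 st tT; have [nz _ _ _] := H.
have yG := nice_ingraph0 T0 oO bO ny.
apply: (energy_limit zG H yG (fun r => nice_L2x oO r ny)).
- by rewrite s0 (le_trans (ltW st)).
- by rewrite tT (le_trans s0 (ltW st)).
move=> n; rewrite -(flux_pairing_dual (wst s t) (time_limit_ingraph0 n H) yG).
exact: (nice_energy T0 oO bO cL0 hcoer (nz n) ny s0 st tT).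
Qed.

(** The polarized identity passes to the limit in one argument at a time: first against nice
    elements, then with [z] in both places. *)
Lemma energy zn Vn z V s t : ingraph0 z -> time_limit zn Vn z V ->
  0 <= s -> s < t -> t <= T ->
  2 * flux_pairing T Om (slab_ind s t) z z = ipx (V t) (V t) - ipx (V s) (V s).
Proof.
move=> zG H s0 st tT; have [nz _ VL _] := H; have wb := wst s t.
have -> : 2 * flux_pairing T Om (slab_ind s t) z z =
    ipgraph z (graph_dual (slab_ind s t) z).
  by rewrite -(flux_pairing_dual wb zG zG); ring.
apply: (energy_limit zG H zG VL).
- by rewrite s0 (le_trans (ltW st)).
- by rewrite tT (le_trans s0 (ltW st)).
move=> n; have NG := time_limit_ingraph0 n H.
rewrite -(flux_pairing_dual wb NG zG) addrC (flux_pairing_dual wb zG NG).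
rewrite (energy_nice zG H (nz n) s0 st tT).
by rewrite !(sipC Sx (VL _) (nice_L2x oO _ (nz n))).
Qed.

(** Integration by parts on the cylinder for functions that are constant in time, divided by $T$. *)
Lemma spatial_lateral phi r : lateral Om phi -> I r ->
  spatial T Om (fun x => phi (r, x)) (fun i x => 'D_(dir_x i) phi (r, x)).
Proof.
move=> lp Ir; have [sp _] := lp; split.
- exact: (smooth_slice_L2 oO bO sp Ir).
- by move=> i; exact: (smooth_slice_L2 oO bO (smooth_derive (dir_x i) sp) Ir).
move=> i psi r' spsi Ir'; have lf := lateral_frozen r lp; have sf := smooth_frozen r' spsi.
have := ipL2_derive_lateral T i mO bO sf lf.
have e1 f f' : L2x f -> L2x f' ->
    ip (fun z : E => f z.2) (fun z : E => f' z.2) = T * ipx f f'.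
  move=> fL fL'; rewrite -(ip_tensor_one T0 oO fL fL').
  by congr (ip _ _); apply/funext => z; rewrite mul1r.
have pL := smooth_slice_L2 oO bO sp Ir; have psL := smooth_slice_L2 oO bO spsi Ir'.
have dpL := smooth_slice_L2 oO bO (smooth_derive (dir_x i) sp) Ir.
have dpsL := smooth_slice_L2 oO bO (smooth_derive (dir_x i) spsi) Ir'.
have -> : 'D_(dir_x i) (fun z : E => phi (r, z.2)) = fun z => 'D_(dir_x i) phi (r, z.2).
  by apply/funext => z; exact: derive_frozen_x.
have -> : 'D_(dir_x i) (fun z : E => psi (r', z.2)) = fun z => 'D_(dir_x i) psi (r', z.2).
  by apply/funext => z; exact: derive_frozen_x.
rewrite (e1 _ _ psL dpL) (e1 _ _ dpsL pL) -mulrN => h.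
have Tn0 : T != 0 by rewrite gt_eqF.
move: h => /(mulfI Tn0); rewrite (sipC Sx psL dpL) (sipC Sx dpsL pL) => h.
by apply: oppr_inj; rewrite opprK h.
Qed.

Lemma lateral_total D : L2x D ->
  (forall phi r, lateral Om phi -> I r -> ipx D (fun x => phi (r, x)) = 0) ->
  ipx D D = 0.
Proof.
move=> DL H; have [N QN] := cylinder_cube T bO.
have e1 := elem_cst (1 : R); have w1 := weight_elem T e1.
have DL1 := tL2 w1 DL.
have D0 : eqL2 mu Q (fun z => 1 * D z.2) (fun=> 0).
  apply: (test_orthogonal oQ QN DL1) => phi tp.
  rewrite (tensor_smooth T0 oO bO w1 DL tp.1) (@eq_Rintegral _ _ _ lam I (fun=> 0)).
    by rewrite Rintegral_cst// mul0r.
  by move=> r; rewrite inE => Ir; rewrite (H _ _ (test_lateral tp) Ir) mulr0.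
have := eqL2_ip mQ DL1 D0 DL1; rewrite (ip_tensor_one T0 oO DL DL) => /eqP.
by rewrite mulf_eq0 gt_eqF//= => /eqP.
Qed.

Lemma spatial_total D : L2x D -> (forall m p, spatial T Om m p -> ipx D m = 0) ->
  ipx D D = 0.
Proof.
move=> DL H; apply: lateral_total => // phi r lp Ir.
exact: (H _ _ (spatial_lateral lp Ir)).
Qed.

Definition trace0 (z : gtriple) := gamma0 T Om z.1.1.

Lemma trace0_time_limit z : ingraph0 z -> exists zn Vn V,
  [/\ time_limit zn Vn z V, L2x (trace0 z) & eqL2 mx Om (trace0 z) (V 0)].
Proof.
move=> zG; have [zn [Vn [V H]]] := time_limit_exists T0 oO bO cL0 hcoer zG.
have [h1 h2] := gamma0_rep T0 oO (w := z.1.1) (time_limit_rep T0 oO bO zG H).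
by exists zn, Vn, V.
Qed.

Lemma trace0_L2 z : ingraph0 z -> L2x (trace0 z).
Proof. by move=> /trace0_time_limit[zn [Vn [V []]]]. Qed.

Lemma slab_one f g : L2 f -> L2 g ->
  ip f (fun z => slab_ind 0 T z.1 * g z) = ip f g.
Proof.
move=> fL gL; apply: eq_Rintegral => z; rewrite inE => -[Iz _].
by rewrite /slab_ind indicE mem_set ?mul1r//= in_itv.
Qed.

Lemma slab_onev f g : inL2v Q f -> inL2v Q g ->
  ipL2v Q f (weightv (slab_ind 0 T) g) = ipL2v Q f g.
Proof.
move=> fL gL; apply: eq_bigr => i _; rewrite vcomp_weightv.
exact: (slab_one (fL i) (gL i)).
Qed.

Lemma flux_pairing_one z z' : ingraph0 z -> ingraph0 z' ->
  flux_pairing T Om (slab_ind 0 T) z z' = ip z.2 z'.1.1.1 + ipL2v Q z.1.1.2 z'.1.2.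
Proof.
move=> [[[z1 z2] zg _ zf _] _] [[[y1 y2] yg _ yf _] _].
by rewrite /flux_pairing slab_one// slab_onev.
Qed.

(** The weight $1-t/T$ is $1$ at the initial time and vanishes at the final one: the energy identity
    against [decay] times a function of $x$ isolates the initial value. *)
Definition decay (t : R) : R := - T^-1 * t + 1.

Lemma elementary_decay : elementary decay.
Proof.
apply: elem_add; last exact: elem_cst.
by apply: elem_mul; [exact: elem_cst|exact: elem_id].
Qed.

Lemma affine_derive (a b y : R) : is_derive y 1 (fun t : R => a * t + b) a.
Proof. by have := is_derive_affine (is_derive_id (a * y + b) (1 : R)); rewrite mulr1. Qed.

Lemma trace0_green z m p : ingraph0 z -> spatial T Om m p ->
  ipx (trace0 z) m = - (ip z.2 (fun x => decay x.1 * m x.2) +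
    ipL2v Q z.1.1.2 (tensorv decay p) + ip (fun x => - T^-1 * m x.2) z.1.1.1).
Proof.
move=> zG sm; have [zn [Vn [V [H tL te]]]] := trace0_time_limit zG.
have [_ _ VL _] := H; have mL := spatial_L2 sm.
have ny := nice_tensor elementary_decay (elem_cst (- T^-1)) (affine_derive (- T^-1) 1) sm.
have yG := nice_ingraph0 T0 oO bO ny.
rewrite (eqL2_ipl mO tL (VL 0) te mL).
have := energy_nice zG H ny (lexx 0) T0 (lexx T).
have [[[z1 z2] zg _ _ _] _] := zG.
rewrite -(flux_pairing_dual (wst 0 T) zG yG) !flux_pairing_one//= (ip0l Sv zg) addr0.
have -> : (fun x => decay T * m x) = 0.
  by apply/funext => x; rewrite /decay mulNr mulVf ?gt_eqF// addNr mul0r.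
have -> : (fun x => decay 0 * m x) = m.
  by apply/funext => x; rewrite /decay mulr0 add0r mul1r.
by rewrite (sipC Sx (VL T) (sip0 Sx)) (ip0l Sx (VL T)) sub0r => ->; rewrite opprK.
Qed.

(** [gamma0] is a choice, so linearity is not automatic. It is read off [trace0_green], whose
    right-hand side is linear in [z]. *)
Lemma trace0P c z z' : ingraph0 z -> ingraph0 z' ->
  eqL2 mx Om (trace0 (c *: z + z')) (c *: trace0 z + trace0 z').
Proof.
move=> zG zG'; have sG := sipP SG c zG zG'.
have tL := trace0_L2 zG; have tL' := trace0_L2 zG'; have tL'' := trace0_L2 sG.
have rL := sipP Sx c tL tL'.
apply: (ip0_eqL2 mO tL'' rL); apply: spatial_total; first exact: (sipB Sx).
move=> m p sm; have mL := spatial_L2 sm.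
rewrite (ipBl Sx tL'' rL mL) (sipL Sx c tL tL' mL) !(trace0_green _ sm)//.
have [[[z1 z2] zg zf _ _] _] := zG; have [[[y1 y2] yg yf _ _] _] := zG'.
have ed := elementary_decay; have wd := weight_elem T ed.
have L1 := tL2 wd mL.
have L2 : inL2v Q (tensorv decay p).
  by move=> i; rewrite vcomp_tensorv; exact: (tL2 wd (spatial_L2v sm i)).
have L3 := tL2 (weight_elem T (elem_cst (- T^-1))) mL.
have [[_ _ _ zfL _] _] := zG; have [[_ _ _ yfL _] _] := zG'.
rewrite /= (sipL S c zfL yfL L1) (sipL Sv c z2 y2 L2).
rewrite (ipDr S (sipZ S c z1) y1 L3) (ipZr S c z1 L3).
by ring.
Qed.

Lemma trace0_bound z : ingraph0 z ->
  ipx (trace0 z) (trace0 z) <= (T^-1 + 1) * ipgraph z z.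
Proof.
move=> zG; have [zn [Vn [V [H tL te]]]] := trace0_time_limit zG.
have [nz _ VL _] := H.
rewrite (eqL2_ipl mO tL (VL 0) te tL) (sipC Sx (VL 0) tL) (eqL2_ipl mO tL (VL 0) te (VL 0)).
have T0' : 0 <= (0 : R) <= T by rewrite lexx ltW.
have l1 := sip_cvg_sqr Sx (fun n => nice_L2x oO 0 (nz n)) (VL 0) (time_limit_cvg_at H T0').
have l2 := sip_cvg_sqr SG (fun n => time_limit_ingraph0 n H) zG (time_limit_cvg zG H).
have l3 : (fun n => (T^-1 + 1) * ipgraph (zn n) (zn n)) @ \oo --> (T^-1 + 1) * ipgraph z z.
  by apply: cvgM => //; exact: cvg_cst.
apply: (ler_cvg_to l1 l3); apply: nearW => n.
by apply: (nice_sup T0 oO bO cL0 hcoer (nz n)); rewrite lexx ltW.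
Qed.

Definition Agraph (z : gtriple) : pfield R d := Apair z.1.1 z.1.2 z.2.

Lemma AgraphP c z z' : Agraph (c *: z + z') = c *: Agraph z + Agraph z'.
Proof.
by rewrite /Agraph /Apair; congr pair; rewrite /= scalerDr addrACA.
Qed.

Lemma Agraph_L2 z : ingraph0 z -> inL2p Q (Agraph z).
Proof. by move=> [wg _]; exact: (Apair_L2 oQ wg). Qed.

(** The product pulled back by $(A,\gamma_0)$. By coercivity and the boundedness of the trace it is
    equivalent to the graph product, so $U_0$ is complete for it and Riesz's theorem can produce
    preimages. *)
Definition ipA (z z' : gtriple) : R :=
  ipL2p Q (Agraph z) (Agraph z') + ipx (trace0 z) (trace0 z').

Lemma ipA_space : sip_space ingraph0 ipA.
Proof.
split.
- exact: (sip0 SG).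
- exact: (sipP SG).
- move=> z z' zG zG'; congr (_ + _).
    by rewrite (sipC Sp (Agraph_L2 zG) (Agraph_L2 zG')).
  by rewrite (sipC Sx (trace0_L2 zG) (trace0_L2 zG')).
- move=> c z z' y zG zG' yG; have sG := sipP SG c zG zG'.
  have tL := trace0_L2 zG; have tL' := trace0_L2 zG'; have yL := trace0_L2 yG.
  rewrite /ipA AgraphP (sipL Sp c (Agraph_L2 zG) (Agraph_L2 zG') (Agraph_L2 yG)).
  rewrite (eqL2_ipl mO (trace0_L2 sG) (sipP Sx c tL tL') (trace0P c zG zG') yL).
  by rewrite (sipL Sx c tL tL' yL); ring.
- move=> z zG; rewrite addr_ge0 ?(sip_ge0 Sp (Agraph_L2 zG))//.
  exact: (sip_ge0 Sx (trace0_L2 zG)).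
Qed.

Lemma ipA_coercive z : ingraph0 z -> cL * ipL2p Q z.1.1 z.1.1 <= ipA z z.
Proof.
move=> zG; have [zn [Vn [V [H tL te]]]] := trace0_time_limit zG.
have [_ _ VL _] := H.
have := graph0_coercive T0 oO bO hcoer zG (time_limit_rep T0 oO bO zG H).
rewrite /ipA (eqL2_ipl mO tL (VL 0) te tL) (sipC Sx (VL 0) tL).
by rewrite (eqL2_ipl mO tL (VL 0) te (VL 0)).
Qed.

(** Coercivity bounds the field, the divergence is a component of $A$, and the gradient is the
    difference of $\nabla_xv+\tau$ and $\tau$. *)
Lemma ipgraph_le_ipA z : ingraph0 z -> ipgraph z z <= (3 + 3 / cL) * ipA z z.
Proof.
move=> zG; have [[[z1 z2] zg _ zf _] _] := zG.
have h1 := ipA_coercive zG; have wL : inL2p Q z.1.1 by split.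
have tt := sip_ge0 Sx (trace0_L2 zG).
have sL := sipD Sv zg z2.
have h2 : ip z.2 z.2 + ipL2v Q (z.1.2 + z.1.1.2) (z.1.2 + z.1.1.2) <= ipA z z.
  by rewrite /ipA /Agraph /Apair /ipL2p /= lerDl.
have h3 := sip_sqrD_le Sv sL (sipN Sv z2).
rewrite addrK (ipNl Sv z2 (sipN Sv z2)) (ipNr Sv z2 z2) opprK in h3.
have h4 := ipL2p_snd_le mQ wL; have h5 := sip_ge0 S zf; have h6 := sip_ge0 Sv sL.
have {}h1 : ipL2p Q z.1.1 z.1.1 <= ipA z z / cL by rewrite ler_pdivlMr// mulrC.
have A0 := sip_ge0 ipA_space zG.
rewrite /ipgraph mulrDl mulrAC -[3 * ipA z z / cL]mulrA.
move: h1 h2 h3 h4 h5 h6; move: (ipA z z / cL) => r.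
move: (ipA z z) (ipL2p _ _ _) (ipL2v Q z.1.2 z.1.2) (ip z.2 z.2) (ipL2v _ _ _) (ipL2v _ _ _) A0.
by move=> a b c e f g h0 h1 h2 h3 h4 h5 h6; lra.
Qed.

Lemma ipA_le_ipgraph z : ingraph0 z -> ipA z z <= (3 + T^-1) * ipgraph z z.
Proof.
move=> zG; have [[[z1 z2] zg _ zf _] _] := zG.
have h1 := trace0_bound zG; have h2 := sip_sqrD_le Sv zg z2.
have h3 := sip_ge0 S z1; have h4 := sip_ge0 S zf.
move: h1; rewrite /ipA /Agraph /Apair /ipgraph /ipL2p /= => h1.
rewrite (_ : 3 + T^-1 = 2 + (T^-1 + 1)); last by ring.
by rewrite [leRHS]mulrDl; apply: lerD => //; lra.
Qed.

Lemma ipA_complete : sip_complete ingraph0 ipA.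
Proof.
move=> u uG cu.
have K0 : 0 < 3 + 3 / cL by rewrite addr_gt0// divr_gt0.
have K1 : 0 < 3 + T^-1 by rewrite addr_gt0// invr_gt0.
have [|l lG ul] := ingraph0_complete oO bO uG.
  move=> e e0; have [M HM] := cu _ (divr_gt0 e0 K0); exists M => m n Mm Mn.
  apply: le_trans (ipgraph_le_ipA (sipB SG (uG m) (uG n))) _.
  by rewrite mulrC -ler_pdivlMr//; exact: HM.
exists l => //.
apply: (@cvg_le0 _ _ (fun n => (3 + T^-1) * ipgraph (u n - l) (u n - l))).
  move=> n; have x := sipB SG (uG n) lG.
  by rewrite (sip_ge0 ipA_space x) ipA_le_ipgraph.
by rewrite -[X in _ --> X](mulr0 (3 + T^-1)); apply: cvgM => //; exact: cvg_cst.
Qed.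

Lemma trace0_nice z V : nice z V -> eqL2 mx Om (trace0 z) (V 0).
Proof.
move=> nz; have zG := nice_ingraph0 T0 oO bO nz.
have tL := trace0_L2 zG; have VL := nice_L2x oO 0 nz.
apply: (ip0_eqL2 mO tL VL); apply: spatial_total; first exact: (sipB Sx).
move=> m p sm; have mL := spatial_L2 sm.
have ny := nice_tensor elementary_decay (elem_cst (- T^-1)) (affine_derive (- T^-1) 1) sm.
have yG := nice_ingraph0 T0 oO bO ny.
have [[[z1 z2] zg _ _ _] _] := zG.
have := nice_energy T0 oO bO cL0 hcoer nz ny (lexx 0) T0 (lexx T).
rewrite !flux_pairing_one//= (ip0l Sv zg) addr0.
have -> : (fun x => decay T * m x) = 0.
  by apply/funext => x; rewrite /decay mulNr mulVf ?gt_eqF// addNr mul0r.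
have -> : (fun x => decay 0 * m x) = m.
  by apply/funext => x; rewrite /decay mulr0 add0r mul1r.
have VTL := nice_L2x oO T nz.
rewrite (sipC Sx VTL (sip0 Sx)) (ip0l Sx VTL) sub0r => h.
by rewrite (ipBl Sx tL VL mL) (trace0_green zG sm) h opprK subrr.
Qed.

(** Orthogonality is exploited on four families: fluxes give $w_1$ zero lateral values and gradient
    $w_2$, test functions give $\mathrm{div}(w_1,w_2)=0$, tensor fields with weight $t$ give the
    final value $0$, and tensor fields constant in time give $\xi$. *)
Lemma range_orthogonal w xi : inL2p Q w -> L2x xi ->
  (forall u, ingraph0 u -> ipL2p Q (Agraph u) w + ipx (trace0 u) xi = 0) ->
  ipL2p Q w w = 0 /\ ipx xi xi = 0.
Proof.
case: w => w1 w2 [w1L w2L] xiL H; rewrite /= in w1L w2L.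
have ip0r h : L2 h -> ip h 0 = 0.
  by move=> hL; rewrite (sipC S hL (sip0 S)); exact: (ip0l S hL).
have [N QN] := cylinder_cube T bO.
have G : grad0 T Om w1 w2.
  split => // i phi sp; have uL := unitv_L2 oO i (sL2 sp).
  have dL := sL2 (smooth_derive (dir_x i) sp).
  have du : is_weak_divx T Om (unitv i phi) ('D_(dir_x i) phi).
    move=> psi tp; rewrite -ip_gradv (sipC Sv uL (gradv_L2 T oO bO tp.1)) ip_unitv//; last exact: (gradv_L2 T oO bO tp.1).
    rewrite vcomp_gradv (sipC S (sL2 (smooth_derive _ tp.1)) (sL2 sp)).
    exact: (ipL2_derive_test _ mQ QN sp tp).
  have nf := nice_flux uL dL du; have fG := nice_ingraph0 T0 oO bO nf.
  have := H _ fG; rewrite (eqL2_ipl mO (trace0_L2 fG) (sip0 Sx) (trace0_nice nf) xiL).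
  rewrite (ip0l Sx xiL) addr0 /ipL2p /= add0r.
  rewrite (sipC S dL w1L) (sipC Sv uL w2L) ip_unitv// => /eqP.
  by rewrite addr_eq0 => /eqP.
have tens a a' m p : elementary a -> elementary a' ->
    (forall y : R, is_derive y 1 a (a' y)) -> spatial T Om m p ->
    ip (fun z => a' z.1 * m z.2) w1 + ipL2v Q (tensorv a p) w2 + a 0 * ipx m xi = 0.
  move=> ea ea' da sm; have nt := nice_tensor ea ea' da sm.
  have tG := nice_ingraph0 T0 oO bO nt; have mL := spatial_L2 sm.
  have := H _ tG.
  have aL : L2x (fun x => a 0 * m x) by exact: (sipZ Sx (a 0) mL).
  rewrite (eqL2_ipl mO (trace0_L2 tG) aL (trace0_nice nt) xiL) /ipL2p /= addr0.
  by rewrite [ipx _ xi](_ : _ = a 0 * ipx m xi)//; exact: (ipZl Sx (a 0) mL xiL).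
(* For $\varphi$ of compact support in the cylinder, $(\varphi,0)$ lies in $U_0$ with zero initial
   trace, and $A(\varphi,0)=(\partial_t\varphi,\nabla_x\varphi)$. *)
have Hdiv : is_weak_div Q (w1, w2) 0.
  move=> phi tp; have sp := tp.1; have pL := sL2 sp.
  have dL := sL2 (smooth_derive dir_t sp); have gL := gradv_L2 T oO bO sp.
  pose u : gtriple := ((phi, 0), gradv phi, 'D_dir_t phi).
  have uG : ingraph0 u.
    apply/(@ingraph0P R d T Om oO u); split; first by split => //; split => //; split => //; exact: (sip0 Sv).
    move=> th [[i [psi [spsi ->]]]|[psi [tpsi ->]]]; rewrite /ipgraph /ipL2p /= (ip0l Sv).
    - rewrite addr0 ip0r// addr0 ip_unitv// vcomp_gradv (sipC S pL (sL2 (smooth_derive _ spsi))).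
      rewrite -[X in X + _]opprK -(ipL2_derive_test _ mQ QN spsi tp).
      by rewrite (sipC S (sL2 spsi) (sL2 (smooth_derive _ sp))) addNr.
    - exact: (sip0 Sv).
    - rewrite addr0 (sipC Sv gL (sip0 Sv)) (ip0l Sv gL) addr0.
      by rewrite (ipL2_derive_test _ mQ QN sp tpsi) addNr.
    - exact: (gradv_L2 T oO bO tpsi.1).
  have u0 : ipx (trace0 u) (trace0 u) = 0.
    apply: spatial_total; first exact: trace0_L2.
    move=> m p sm; rewrite (trace0_green uG sm) /= (ip0l Sv) ?addr0.
      have mL := spatial_L2 sm; have ed := elementary_decay.
      rewrite (sipC S dL (tL2 (weight_elem T ed) mL)).
      rewrite (tensor_derive_t T0 oO bO ed (elem_cst (- T^-1)) (affine_derive (- T^-1) 1) mL tp).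
      by rewrite addNr oppr0.
    by move=> i; rewrite vcomp_tensorv; exact: (tL2 (weight_elem T elementary_decay) (spatial_L2v sm i)).
  have := H _ uG; rewrite (sip_null Sx (trace0_L2 uG) xiL u0) addr0 /ipL2p /Agraph /Apair /= addr0.
  rewrite (sipC S dL w1L) (sipC Sv gL w2L) ip_gradv => ->.
  by rewrite (ip0l S pL) oppr0.
pose W : gtriple := ((w1, w2), w2, 0).
have WG : ingraph0 W.
  by split => //; split => //=; [exact: grad0_weak G|exact: (sip0 S)].
have [zn [Vn [V [HV tL te]]]] := trace0_time_limit WG; have [_ _ VL _] := HV.
(* The weight $t$ cancels the initial term and leaves the final value. *)
have VT : ipx (V T) (V T) = 0.
  apply: spatial_total => // m p sm; have mL := spatial_L2 sm.
  have nt := nice_tensor elem_id (elem_cst 1) (fun y => is_derive_id y (1 : R)) sm.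
  have tG := nice_ingraph0 T0 oO bO nt.
  have := energy_nice WG HV nt (lexx 0) T0 (lexx T).
  rewrite -(flux_pairing_dual (wst 0 T) WG tG) !flux_pairing_one//= (ip0l Sv w2L) addr0.
  rewrite (ip0l S (tL2 (weight_elem T elem_id) mL)) add0r.
  have := tens _ _ _ _ elem_id (elem_cst 1) (fun y => is_derive_id y (1 : R)) sm.
  rewrite mul0r addr0.
  have pL : inL2v Q (tensorv id p).
    by move=> i; rewrite vcomp_tensorv; exact: (tL2 (weight_elem T elem_id) (spatial_L2v sm i)).
  rewrite (sipC Sv w2L pL) addrC => -> /esym/eqP.
  have -> : (fun x => 0 * m x) = 0 by apply/funext => x; rewrite mul0r.
  rewrite (sipC Sx (VL 0) (sip0 Sx)) (ip0l Sx (VL 0)) subr0.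
  rewrite [ipx _ _](_ : _ = T * ipx (V T) m); last exact: (ipZr Sx T mL (VL T)).
  by rewrite mulf_eq0 gt_eqF//= => /eqP.
(* With zero divergence and zero final value this reads $2\lVert w_2\rVert^2=-\lVert V(0)\rVert^2$,
   so both vanish. *)
have := energy WG HV (lexx 0) T0 (lexx T).
rewrite flux_pairing_one//= (ip0l S w1L) add0r VT sub0r => hE.
have g0 := sip_ge0 Sv w2L; have V00 := sip_ge0 Sx (VL 0).
have w20 : ipL2v Q w2 w2 = 0 by apply/eqP; rewrite eq_le g0 andbT; lra.
have V0 : ipx (V 0) (V 0) = 0 by rewrite w20 in hE; lra.
(* Now $AW=(0,2w_2)$ and the initial value are null, so coercivity applies. *)
have w0 : ipL2p Q (w1, w2) (w1, w2) = 0.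
  have := ipA_coercive WG; rewrite /ipA (eqL2_ipl mO tL (VL 0) te tL).
  rewrite (sip_null Sx (VL 0) tL V0) addr0 /Agraph /Apair {2}/ipL2p /=.
  have w22 := sipD Sv w2L w2L.
  rewrite (ip0l S (sip0 S)) add0r (ipDl Sv w2L w2L w22) (ipDr Sv w2L w2L w2L) w20 !addr0.
  have wp := sip_ge0 Sp (conj w1L w2L : inL2p Q (w1, w2)).
  move=> h; apply/eqP; rewrite eq_le wp andbT.
  by rewrite -(ler_pM2l cL0) mulr0.
split => //; apply: spatial_total => // m p sm; have mL := spatial_L2 sm.
have w1L0 : ip w1 w1 = 0.
  apply/eqP; rewrite eq_le (sip_ge0 S w1L) andbT -w0.
  exact: (ipL2p_fst_le mQ (conj w1L w2L : inL2p Q (w1, w2))).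
have e0 : elementary (fun _ : R => 0) := elem_cst 0.
have e1 : elementary (fun _ : R => 1) := elem_cst 1.
have := tens (fun=> 1) (fun=> 0) m p e1 e0 (fun y => is_derive_cst _ _ _) sm.
have L1 := tL2 (weight_elem T e0) mL.
have L2 : inL2v Q (tensorv (fun=> 1) p).
  by move=> i; rewrite vcomp_tensorv; exact: (tL2 (weight_elem T e1) (spatial_L2v sm i)).
rewrite (sipC S L1 w1L) (sip_null S w1L L1 w1L0) (sipC Sv L2 w2L) (sip_null Sv w2L L2 w20).
by rewrite !add0r mul1r (sipC Sx mL xiL).
Qed.

End trace.

(** * Surjectivity of (A, gamma0) *)

Section solution.
Context {R : realType} {d : nat}.
Local Notation E := (R * 'rV[R]_d)%type.
Local Notation ME := (measurableTypeR R * 'rV[R]_d)%type.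
Local Notation mx := (@leb_x R d).
Variables (T : R) (Om : set 'rV[R]_d).
Hypotheses (T0 : 0 < T) (oO : open Om) (bO : bounded_set Om).
Local Notation Q := (cylinder T Om).
Local Notation L2x := (inL2 mx Om).
Local Notation ipx := (ipL2 mx Om).

Let mO := open_measurable_x oO.
Let Sx := @inL2_sip _ _ R mx Om mO.
Let oQ : open (Q : set E) := @cylinder_open R d T Om oO.
Let mQ : measurable (Q : set ME) := @measurable_Q R d T Om oO.
Let Sp := @inL2p_sip R d Q mQ.
Let mI := measurable_time_interval T.

Variable cL : R.
Hypotheses (cL0 : 0 < cL)
  (hcoer : forall v : pfield R d, inU0 Q v ->
      cL * normL2p Q v ^+ 2 <=
        normL2p Q (opA Q v) ^+ 2 + normL2 mx Om (gamma0 T Om v) ^+ 2).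

Local Notation ingraph0 := (ingraph0 T Om).
Local Notation trace0 := (trace0 T Om).
Local Notation ipA := (ipA T Om).
Let SA : sip_space ingraph0 ipA := ipA_space T0 oO bO cL0 hcoer.
Let AL z : ingraph0 z -> inL2p Q (Agraph z).
Proof. exact: Agraph_L2. Qed.
Let tL z : ingraph0 z -> L2x (trace0 z).
Proof. exact: (trace0_L2 T0 oO bO cL0 hcoer). Qed.

(** The Riesz representative for [ipA] of the pairing with $(w,\xi)$ leaves a remainder orthogonal
    to the range, hence null. *)
Lemma range_full w xi : inL2p Q w -> L2x xi -> exists z,
  [/\ ingraph0 z, eqL2p Q (Agraph z) w & eqL2 mx Om (trace0 z) xi].
Proof.
move=> wL xL; pose F z := ipL2p Q (Agraph z) w + ipx (trace0 z) xi.
have w0 := sip_ge0 Sp wL; have x0 := sip_ge0 Sx xL.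
have FL a u v : ingraph0 u -> ingraph0 v -> F (a *: u + v) = a * F u + F v.
  move=> uG vG; have sG := sipP SA a uG vG.
  rewrite /F AgraphP (sipL Sp a (AL uG) (AL vG) wL).
  rewrite (eqL2_ipl mO (tL sG) (sipP Sx a (tL uG) (tL vG)) (trace0P T0 oO bO cL0 hcoer a uG vG) xL).
  by rewrite (sipL Sx a (tL uG) (tL vG) xL); ring.
have FC u : ingraph0 u -> F u ^+ 2 <= 2 * (ipL2p Q w w + ipx xi xi) * ipA u u.
  move=> uG; have h1 := sip_CS Sp (AL uG) wL; have h2 := sip_CS Sx (tL uG) xL.
  have a0 := sip_ge0 Sp (AL uG); have b0 := sip_ge0 Sx (tL uG).
  move: h1 h2; rewrite /F /ipA.
  move: (ipL2p Q (Agraph u) w) (ipx (trace0 u) xi) w0 x0 a0 b0.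
  move: (ipL2p Q w w) (ipx xi xi) (ipL2p Q _ _) (ipx _ _) => p q a b x y p0 q0 a0 b0 h1 h2.
  have h3 : (x + y) ^+ 2 <= 2 * x ^+ 2 + 2 * y ^+ 2 by have := sqr_ge0 (x - y); nra.
  have h4 := mulr_ge0 a0 q0; have h5 := mulr_ge0 b0 p0; nra.
have [z zG zF] := sip_riesz SA FL FC (ipA_complete T0 oO bO cL0 hcoer).
exists z; have dwL := sipB Sp wL (AL zG); have dxL := sipB Sx xL (tL zG).
have [|h1 h2] := range_orthogonal T0 oO bO cL0 hcoer dwL dxL.
  move=> u uG; rewrite (ipBr Sp wL (AL zG) (AL uG)) (ipBr Sx xL (tL zG) (tL uG)).
  have := zF u uG; rewrite /F /ipA (sipC Sp (AL zG) (AL uG)) (sipC Sx (tL zG) (tL uG)).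
  by move=> h; rewrite addrACA -opprD h subrr.
split => //.
  have [e1 e2] := eqL2p_ip0 mQ wL (AL zG) h1; split; last move=> i.
    by apply: filterS e1 => x /[apply].
  by apply: filterS (e2 i) => x /[apply].
by have := ip0_eqL2 mO xL (tL zG) h2; apply: filterS => x /[apply].
Qed.

End solution.

(** * The broken test space *)

Section broken_space.
Context {R : realType} {d : nat}.
Local Notation E := (R * 'rV[R]_d)%type.
Local Notation ME := (measurableTypeR R * 'rV[R]_d)%type.
Local Notation mu := (@leb_tx R d).
Local Notation mx := (@leb_x R d).
Variables (T : R) (Om : set 'rV[R]_d).
Local Notation Q := (cylinder T Om).
Variables (N : R) (n : nat) (K : 'I_n -> set E).
Hypotheses (mO : measurable (Om : set 'rV[R]_d)) (mQ : measurable (Q : set ME))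
  (QN : Q `<=` cube N) (hK : is_mesh Q K).
Local Notation L2 := (inL2 mu (Q : set ME)).
Local Notation ip := (ipL2 mu (Q : set ME)).
Local Notation L2x := (inL2 mx Om).
Local Notation ipx := (ipL2 mx Om).
Let Sx := @inL2_sip _ _ R mx Om mO.
Let S := @inL2_sip _ _ R mu (Q : set ME) mQ.
Let Sp := @inL2p_sip R d Q mQ.

Let oK i : open (K i). Proof. by have [h _ _ _] := hK; exact: h. Qed.
Let KQ i : K i `<=` Q. Proof. by have [_ h _ _] := hK; exact: h. Qed.
Let KN i : K i `<=` cube N. Proof. by move=> z /KQ /QN. Qed.
Let mK i : measurable (K i : set ME). Proof. exact: open_measurable_E. Qed.
Let Spi i := @inL2p_sip R d (K i) (mK i).

Lemma inL2_subset (D D' : set ME) (f : sfield R d) : measurable D -> measurable D' ->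
  D `<=` D' -> inL2 mu D' f -> inL2 mu D f.
Proof.
move=> mD mD' DD /(inL2P _ mD')[mf if2]; apply/(inL2P _ mD); split.
  exact: measurable_funS mf.
exact: integrableS if2.
Qed.

Lemma inL2p_subset i w : inL2p Q w -> inL2p (K i) w.
Proof. by move=> [w1 w2]; split => [|j]; apply: (inL2_subset (mK i) mQ (@KQ i)). Qed.

Lemma indic_restrict i (f : sfield R d) :
  (fun z => \1_(K i) z * f z) \_ Q = f \_ (K i).
Proof.
apply/funext => z; rewrite !patchE indicE; have [zK|zK] := boolP (z \in K i).
  rewrite mem_set; first by rewrite mul1r.
  exact: (KQ (set_mem zK)).
by rewrite mul0r; case: ifP.
Qed.

Lemma inL2_indic i f : inL2 mu (K i) f -> L2 (fun z => \1_(K i) z * f z).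
Proof. by rewrite /inL2 indic_restrict. Qed.

Definition glue (f : 'I_n -> sfield R d) : sfield R d :=
  fun z => \sum_(i < n) \1_(K i) z * f i z.

Lemma glue_in f i z : K i z -> glue f z = f i z.
Proof.
move=> zK; rewrite /glue (bigD1 i)//= big1 ?addr0.
  by rewrite indicE mem_set// mul1r.
move=> j ji; rewrite indicE memNset ?mul0r// => zKj.
have [_ _ /trivIsetP/(_ j i I I ji) h _] := hK.
by have : (K j `&` K i) z by []; rewrite h.
Qed.

Lemma glue_L2 f : (forall i, inL2 mu (K i) (f i)) -> L2 (glue f).
Proof.
move=> fL; rewrite (_ : glue f = \sum_(i < n) (fun z => \1_(K i) z * f i z)).
  by elim/big_ind : _ => [|u v|i _]; [exact: (sip0 S)|exact: (sipD S)|exact: inL2_indic].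
by apply/funext => z; rewrite /glue fct_sumE.
Qed.

Lemma mesh_ae (P : E -> Prop) :
  (forall i, {ae mu, forall z, K i z -> P z}) -> {ae mu, forall z, Q z -> P z}.
Proof.
move=> H; have [_ _ _ N0] := hK.
have N1 : {ae mu, forall z, ~ (Q `\` \bigcup_i K i) z}.
  by move: N0; congr (mu.-negligible _); apply/seteqP; split => z /=; [move=> h /(_ h)|apply: contrapT].
have H' : {ae mu, forall z, forall i, K i z -> P z}.
  exact: (@filter_forall _ _ _ _ (ae_filter_ringOfSetsType mu) H).
apply: (@filterS2 _ _ (ae_filter_ringOfSetsType mu) _ _ _ _ N1 H') => z nz h Qz.
have [[i _ Kz]|nK] := pselect ((\bigcup_i K i) z); first exact: (h i Kz).
by exfalso; apply: nz.
Qed.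

Lemma eqL2_glue f (g : sfield R d) : (forall i, eqL2 mu (K i) (f i) g) -> eqL2 mu Q (glue f) g.
Proof.
move=> H; apply: mesh_ae => i; have := H i; apply: filterS => z Hz zK.
by rewrite (glue_in _ zK) Hz.
Qed.

Lemma opAstar_h_fst w : (opAstar_h K w).1 = glue (fun i => (opAstar (K i) w).1).
Proof. by []. Qed.

Lemma opAstar_h_snd w j :
  vcomp (opAstar_h K w).2 j = glue (fun i => vcomp (opAstar (K i) w).2 j).
Proof.
apply/funext => z; rewrite /vcomp /= summxE; apply: eq_bigr => i _.
by rewrite mxE.
Qed.

Lemma opAstar_h_L2 w : (forall i, inU (K i) w) -> inL2p Q (opAstar_h K w).
Proof.
move=> wU; split; first by apply: glue_L2 => i; case: (opAstar_L2 (@oK i) (wU i)).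
move=> j; rewrite opAstar_h_snd; apply: glue_L2 => i.
by case: (opAstar_L2 (@oK i) (wU i)).
Qed.

(** Computes the broken operator from any cellwise witnesses: the cells are disjoint and cover the
    cylinder up to a null set. *)
Lemma opAstar_h_graph w (P : pfield R d) g f :
  (forall i, wgraph (K i) w (g i) (f i)) ->
  (forall i, eqL2p (K i) (Astarpair w (g i) (f i)) P) ->
  eqL2p Q (opAstar_h K w) P.
Proof.
move=> wg wP; split.
  apply: eqL2_glue => i; have [e1 _] := opAstar_wgraph (@oK i) (@KN i) (wg i).
  have [e2 _] := wP i; apply: filterS2 e1 e2 => z h1 h2 zK.
  by rewrite h1// h2.
move=> j; rewrite opAstar_h_snd; apply: eqL2_glue => i.
have [_ e1] := opAstar_wgraph (@oK i) (@KN i) (wg i).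
have [_ e2] := wP i; apply: filterS2 (e1 j) (e2 j) => z h1 h2 zK.
by rewrite h1// h2.
Qed.

Lemma opAstar_hP a w w' : (forall i, inU (K i) w) -> (forall i, inU (K i) w') ->
  eqL2p Q (opAstar_h K (a *: w + w')) (a *: opAstar_h K w + opAstar_h K w').
Proof.
move=> wU wU'; have wg i := inU_wgraph (wU i); have wg' i := inU_wgraph (wU' i).
apply: (opAstar_h_graph (fun i => wgraphL (@oK i) (@KN i) a (wg i) (wg' i))) => i.
split; last move=> j; apply: aeW => z zK.
  rewrite -[RHS]/(a * (opAstar_h K w).1 z + (opAstar_h K w').1 z) !opAstar_h_fst !(glue_in _ zK).
  by rewrite -[LHS]/(- (a * wdiv (K i) w z + wdiv (K i) w' z)) /=; ring.
rewrite vcompL -[RHS]/(a * vcomp (opAstar_h K w).2 j z + vcomp (opAstar_h K w').2 j z).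
rewrite !opAstar_h_snd !(glue_in _ zK) /vcomp /= !mxE.
by ring.
Qed.

Lemma inY0 : inY T Om K 0.
Proof.
split; last exact: (sip0 Sx).
by split; [exact: (sip0 Sp)|move=> i; exact: (wgraph_inU (wgraph0 (@oK i) (@KN i)))].
Qed.

Lemma inYP a y y' : inY T Om K y -> inY T Om K y' -> inY T Om K (a *: y + y').
Proof.
move=> [[yL yU] y2] [[yL' yU'] y2']; split; last exact: (sipP Sx).
split; first exact: (sipP Sp).
by move=> i; exact: (wgraph_inU (wgraphL (@oK i) (@KN i) a (inU_wgraph (yU i)) (inU_wgraph (yU' i)))).
Qed.

Lemma ipY_space : sip_space (inY T Om K) (ipY T Om K).
Proof.
have AL y : inY T Om K y -> inL2p Q (opAstar_h K y.1).
  by move=> [[_ yU] _]; exact: opAstar_h_L2.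
split; [exact: inY0|exact: inYP| | |].
- move=> y y' yY yY'; have := AL _ yY; have := AL _ yY'; case: yY => -[yL _] y2; case: yY' => -[yL' _] y2'.
  by move=> a1 a2; rewrite /ipY (sipC Sp yL yL') (sipC Sp a2 a1) (sipC Sx y2 y2').
- move=> a y y' y'' yY yY' yY''; have a1 := AL _ yY; have a2 := AL _ yY'; have a3 := AL _ yY''.
  have a4 := AL _ (inYP a yY yY').
  case: yY => -[yL yU] y2; case: yY' => -[yL' yU'] y2'; case: yY'' => -[yL'' _] y2''.
  rewrite /ipY (sipL Sp a yL yL' yL'') (sipL Sx a y2 y2' y2'').
  rewrite (eqL2p_ipl mQ a4 (sipP Sp a a1 a2) a3 (opAstar_hP a yU yU')) (sipL Sp a a1 a2 a3).
  by ring.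
- move=> y yY; have a1 := AL _ yY; case: yY => -[yL _] y2.
  apply: addr_ge0; last exact: (sip_ge0 Sx y2).
  by apply: addr_ge0; [exact: (sip_ge0 Sp yL)|exact: (sip_ge0 Sp a1)].
Qed.

Lemma ip_subset_le i f : L2 f -> ipL2 mu (K i) f f <= ip f f.
Proof.
move=> fL; have fL' := inL2_subset (mK i) mQ (@KQ i) fL.
rewrite -lee_fin -(ipL2_EFin (mK i) fL' fL') -(ipL2_EFin mQ fL fL).
apply: ge0_subset_integral => //; last by move=> z _; rewrite lee_fin -expr2 sqr_ge0.
exact: (measurable_int _ (inL2M mQ fL fL)).
Qed.

Lemma ipL2p_subset_le i w : inL2p Q w -> ipL2p (K i) w w <= ipL2p Q w w.
Proof.
move=> [w1 w2]; apply: lerD; first exact: ip_subset_le.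
by apply: ler_sum => j _; exact: ip_subset_le.
Qed.

Lemma opAstar_hB w w' : (forall i, inU (K i) w) -> (forall i, inU (K i) w') ->
  eqL2p Q (opAstar_h K (w - w')) (opAstar_h K w - opAstar_h K w').
Proof.
move=> wU wU'; have := opAstar_hP (-1) wU' wU.
by rewrite !scaleN1r ![- _ + _]addrC.
Qed.

Lemma opAstar_h_in w i z : K i z ->
  (opAstar_h K w).1 z = - wdiv (K i) w z /\
  forall j, vcomp (opAstar_h K w).2 j z = vcomp w.2 j z - vcomp (gradx (K i) w.1) j z.
Proof.
move=> zK; split; first by rewrite opAstar_h_fst (glue_in _ zK).
by move=> j; rewrite opAstar_h_snd (glue_in _ zK) /vcomp /= !mxE addrC.
Qed.

(** Closedness of the broken operator, hence completeness of $Y$, follows from closedness of the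
    weak derivatives on each cell. *)
Lemma opAstar_closed (w_ : nat -> pfield R d) w P : (forall k, inHAstarT T Om K (w_ k)) ->
  inL2p Q w -> inL2p Q P -> sip_cvg (ipL2p Q) w_ w ->
  sip_cvg (ipL2p Q) (fun k => opAstar_h K (w_ k)) P ->
  (forall i, inU (K i) w) /\ eqL2p Q (opAstar_h K w) P.
Proof.
move=> wH wL PL cw cP; have [w1L w2L] := wL; have [P1L P2L] := PL.
have w_L k : inL2p Q (w_ k) by case: (wH k).
have P_L k : inL2p Q (opAstar_h K (w_ k)) by apply: opAstar_h_L2; case: (wH k).
have [cw1 cw2] := (L2p_cvgP mQ w_L wL).1 cw.
have [cP1 cP2] := (L2p_cvgP mQ P_L PL).1 cP.
(* On a cell, $A^*w=P$ means $\mathrm{div}\,w=-P_1$ and $\nabla_xw_1=w_2-P_2$; the same relations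
   express the derivatives of [w_ k] through convergent quantities. *)
have graph i : wgraph (K i) w (w.2 - P.2) (- P.1).
  have Si := @inL2_sip _ _ R mu (K i : set ME) (mK i).
  have sub f : L2 f -> inL2 mu (K i) f by exact: inL2_subset (mK i) mQ (@KQ i).
  have wg k : wgraph (K i) (w_ k) (gradx (K i) (w_ k).1) (wdiv (K i) (w_ k)).
    by apply: inU_wgraph; case: (wH k).
  apply: (wgraph_cvg (@oK i) (@KN i) wg).
  - exact: inL2p_subset.
  - by move=> j; rewrite vcompB; apply: sub; exact: (sipB S (w2L j) (P2L j)).
  - by apply: sub; exact: (sipN S P1L).
  - apply: cvg_le0 cw => k; have dL := sipB Sp (w_L k) wL.
    rewrite ipL2p_subset_le// andbT; apply: (sip_ge0 (Spi i)).
    exact: inL2p_subset.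
  - move=> j.
    pose A k := vcomp (w_ k).2 j - vcomp w.2 j.
    pose B k := vcomp (opAstar_h K (w_ k)).2 j - vcomp P.2 j.
    have AL k : L2 (A k) by apply: (sipB S) => //; case: (w_L k).
    have BL k : L2 (B k) by apply: (sipB S) => //; case: (P_L k).
    apply: (@cvg_le0 _ _ (fun k => 2 * ip (A k) (A k) + 2 * ip (B k) (B k))).
      move=> k; rewrite [ipL2 _ _ _ _](_ : _ = ipL2 mu (K i) (A k - B k) (A k - B k)).
        have Ai := sub _ (AL k); have Bi := sub _ (BL k).
        rewrite (sip_ge0 Si (sipB Si Ai Bi))/=.
        apply: le_trans (sip_sqrD_le Si Ai (sipN Si Bi)) _.
        rewrite (ipNl Si Bi (sipN Si Bi)) (ipNr Si Bi Bi) opprK.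
        by rewrite lerD// ler_pM2l// ip_subset_le.
      apply: eq_Rintegral => z; rewrite inE => zK.
      have [_ /(_ j) h] := opAstar_h_in (w_ k) zK.
      rewrite vcompB; set G := vcomp (gradx _ _) j in h *.
      rewrite -[LHS]/((G z - (vcomp w.2 j z - vcomp P.2 j z)) * (G z - (vcomp w.2 j z - vcomp P.2 j z))).
      rewrite -[RHS]/((vcomp (w_ k).2 j z - vcomp w.2 j z - (vcomp (opAstar_h K (w_ k)).2 j z - vcomp P.2 j z))
        * (vcomp (w_ k).2 j z - vcomp w.2 j z - (vcomp (opAstar_h K (w_ k)).2 j z - vcomp P.2 j z))).
      by rewrite h; ring.
    rewrite -[X in _ --> X](_ : 2 * 0 + 2 * 0 = 0); last by rewrite mulr0 addr0.
    by apply: cvgD; (apply: cvgM; [exact: cvg_cst|]); [exact: cw2|exact: cP2].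
  - pose B k := (opAstar_h K (w_ k)).1 - P.1.
    have BL k : L2 (B k) by apply: (sipB S) => //; case: (P_L k).
    apply: cvg_le0 cP1 => k; rewrite [ipL2 _ _ _ _](_ : _ = ipL2 mu (K i) (B k) (B k)).
      by rewrite (sip_ge0 Si (sub _ (BL k)))/= ip_subset_le.
    apply: eq_Rintegral => z; rewrite inE => zK; have [h _] := opAstar_h_in (w_ k) zK.
    rewrite -[LHS]/((wdiv (K i) (w_ k) z - - P.1 z) * (wdiv (K i) (w_ k) z - - P.1 z)).
    rewrite -[RHS]/(((opAstar_h K (w_ k)).1 z - P.1 z) * ((opAstar_h K (w_ k)).1 z - P.1 z)).
    by rewrite h; ring.
split; first by move=> i; exact: wgraph_inU (graph i).
apply: (opAstar_h_graph graph) => i; split; last move=> j; apply: aeW => z _.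
  by rewrite /= -[LHS]/(- - P.1 z) opprK.
by rewrite /vcomp /= !mxE; ring.
Qed.

Lemma ipY_complete : sip_complete (inY T Om K) (ipY T Om K).
Proof.
move=> u uY cu.
have uL k : inL2p Q (u k).1 by case: (uY k) => -[].
have uU k i : inU (K i) (u k).1 by case: (uY k) => -[].
have ux k : L2x (u k).2 by case: (uY k).
have uA k : inL2p Q (opAstar_h K (u k).1) by exact: opAstar_h_L2.
have dE m k : ipY T Om K (u m - u k) (u m - u k) =
    ipL2p Q ((u m).1 - (u k).1) ((u m).1 - (u k).1) +
    ipL2p Q (opAstar_h K (u m).1 - opAstar_h K (u k).1) (opAstar_h K (u m).1 - opAstar_h K (u k).1) +
    ipx ((u m).2 - (u k).2) ((u m).2 - (u k).2).
  have dU i : inU (K i) ((u m).1 - (u k).1).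
    have [[_ h] _] := inYP (-1) (uY k) (uY m).
    by have := h i; rewrite /= scaleN1r addrC.
  have L1 := opAstar_h_L2 dU; have L2 := sipB Sp (uA m) (uA k).
  have E1 := opAstar_hB (uU m) (uU k).
  by rewrite /ipY /= (eqL2p_ipl mQ L1 L2 L1 E1) (eqL2p_ipr mQ L2 L1 L2 E1).
have g1 m k := sip_ge0 Sp (sipB Sp (uL m) (uL k)).
have g2 m k := sip_ge0 Sp (sipB Sp (uA m) (uA k)).
have g3 m k := sip_ge0 Sx (sipB Sx (ux m) (ux k)).
have [|w wL cw] := @inL2p_complete R d Q mQ (fun k => (u k).1) uL.
  move=> e e0; have [M HM] := cu e e0; exists M => m k Mm Mk; apply: le_trans (HM m k Mm Mk).
  by rewrite dE -addrA lerDl addr_ge0.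
have [|P PL cP] := @inL2p_complete R d Q mQ (fun k => opAstar_h K (u k).1) uA.
  move=> e e0; have [M HM] := cu e e0; exists M => m k Mm Mk; apply: le_trans (HM m k Mm Mk).
  by rewrite dE [X in _ <= X + _]addrC -addrA lerDl addr_ge0.
have [|x xL cx] := inL2_complete (D := Om) mO ux.
  move=> e e0; have [M HM] := cu e e0; exists M => m k Mm Mk; apply: le_trans (HM m k Mm Mk).
  by rewrite dE lerDr addr_ge0.
have [wU wP] := opAstar_closed (fun k => (uY k).1) wL PL cw cP.
have wY : inY T Om K (w, x) by [].
exists (w, x) => //.
have dE' k : ipY T Om K (u k - (w, x)) (u k - (w, x)) =
    ipL2p Q ((u k).1 - w) ((u k).1 - w) +
    ipL2p Q (opAstar_h K (u k).1 - P) (opAstar_h K (u k).1 - P) +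
    ipx ((u k).2 - x) ((u k).2 - x).
  have dU i : inU (K i) ((u k).1 - w).
    have [[_ h] _] := inYP (-1) wY (uY k).
    by have := h i; rewrite /= scaleN1r addrC.
  have L1 := opAstar_h_L2 dU; have L2 := sipB Sp (uA k) PL.
  have E1 : eqL2p Q (opAstar_h K ((u k).1 - w)) (opAstar_h K (u k).1 - P).
    have [e1 e2] := opAstar_hB (uU k) wU; have [e3 e4] := wP; split.
      by apply: filterS2 e1 e3 => z h1 h2 Qz; rewrite h1//= -[LHS]/(_ - (opAstar_h K w).1 z) h2.
    move=> j; apply: filterS2 (e2 j) (e4 j) => z h1 h2 Qz.
    rewrite h1// vcompB -[LHS]/(_ - vcomp (opAstar_h K w).2 j z) h2//.
    by rewrite vcompB.
  by rewrite /ipY /= (eqL2p_ipl mQ L1 L2 L1 E1) (eqL2p_ipr mQ L2 L1 L2 E1).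
rewrite /sip_cvg (funext dE') -[X in _ --> X](_ : 0 + 0 + 0 = 0); last by rewrite !addr0.
by apply: cvgD => //; exact: cvgD.
Qed.

End broken_space.

(** * Well-posedness *)

(** $s=(1+\sqrt{1+4c})/(2c)$ is the positive root of $cs^2=s+1$; the last identity is the
    rationalization of $1/\beta$. *)
Lemma beta_inverse {R : realType} (c : R) : 0 < c -> exists s : R,
  [/\ 0 < s, c * s ^+ 2 = s + 1 &
      ((1 + 2 * c - Num.sqrt ((1 + 2 * c) ^+ 2 - 4 * c ^+ 2)) / (2 * c))^-1 = 1 + s].
Proof.
move=> c0; set D := Num.sqrt _.
have D2 : D ^+ 2 = 1 + 4 * c by rewrite sqr_sqrtr; [ring|nra].
have D0 : 0 <= D by exact: sqrtr_ge0.
exists ((1 + D) / (2 * c)); split.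
- by rewrite divr_gt0//; lra.
- rewrite (_ : c * _ = (1 + 2 * D + D ^+ 2) / (4 * c)); last by field; rewrite gt_eqF.
  by rewrite D2; field; rewrite gt_eqF.
- have h : (1 + 2 * c - D) * (1 + 2 * c + D) = 4 * c ^+ 2.
    by rewrite (_ : _ * _ = (1 + 2 * c) ^+ 2 - D ^+ 2); [rewrite D2|]; ring.
  have nz : 1 + 2 * c - D != 0.
    by apply: contra_eq_neq h => ->; rewrite mul0r lt_eqF// mulr_gt0// exprn_gt0.
  apply: (mulfI (x := (1 + 2 * c - D) / (2 * c))).
    by rewrite mulf_neq0// invr_neq0// gt_eqF// mulr_gt0.
  rewrite divff; last by rewrite mulf_neq0// invr_neq0// gt_eqF// mulr_gt0.
  have -> : (1 + 2 * c - D) / (2 * c) * (1 + (1 + D) / (2 * c)) =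
    (1 + 2 * c - D) * (1 + 2 * c + D) / (4 * c ^+ 2) by field; rewrite gt_eqF.
  by rewrite h divff// gt_eqF// mulr_gt0// exprn_gt0.
Qed.

(** Here $A=\lVert v\rVert^2$, $B=\lVert A^*_hw_0\rVert^2$, $X=\langle v,A^*_hw_0\rangle$ and
    $C=\lVert w_0\rVert^2+\lVert\xi_0\rVert^2$. The left-hand side is the squared norm of the
    solution, and $B+C$ is the squared norm of the Riesz representative of the data. *)
Lemma beta_estimate {R : realType} (c s A B X C : R) : 0 < c -> 0 < s ->
  c * s ^+ 2 = s + 1 -> 0 <= A -> 0 <= B -> 2 * (s * X) <= A + s ^+ 2 * B ->
  c * A <= C -> (A + 2 * X + B) + A + C <= (1 + s) ^+ 2 * (B + C).
Proof.
move=> c0 s0 cs A0 B0 HX HC.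
have C0 : 0 <= C by apply: le_trans HC; rewrite mulr_ge0// ltW.
have sA : (s + 1) * A <= s ^+ 2 * C by rewrite -cs mulrAC mulrC ler_wpM2l// sqr_ge0.
(* The factor $s(s+1)$ clears the denominators $s$ of Young's inequality and $c=(s+1)/s^2$. *)
have s2 : 0 < s * (s + 1) by rewrite mulr_gt0//; lra.
rewrite -(ler_pM2l s2).
have h1 : (s + 1) * (2 * (s * X)) <= (s + 1) * (A + s ^+ 2 * B).
  by rewrite ler_pM2l//; lra.
have h2 : (2 * s + 1) * ((s + 1) * A) <= (2 * s + 1) * (s ^+ 2 * C).
  by rewrite ler_pM2l//; lra.
have h3 : 0 <= s ^+ 2 * C by rewrite mulr_ge0// sqr_ge0.
have h4 : 0 <= s ^+ 2 * B by rewrite mulr_ge0// sqr_ge0.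
have h5 : 0 <= s * (s ^+ 2 * C) by rewrite mulr_ge0// ltW.
have h6 : 0 <= s * (s ^+ 2 * B) by rewrite mulr_ge0// ltW.
have h7 : 0 <= s * (s * (s ^+ 2 * C)) by rewrite mulr_ge0// ltW.
have h8 : 0 <= s * (s * (s ^+ 2 * B)) by rewrite mulr_ge0// ltW.
nra.
Qed.

Section well_posedness.
Context {R : realType} {d : nat}.
Local Notation E := (R * 'rV[R]_d)%type.
Local Notation ME := (measurableTypeR R * 'rV[R]_d)%type.
Local Notation mu := (@leb_tx R d).
Local Notation mx := (@leb_x R d).
Variables (T : R) (Om : set 'rV[R]_d).
Hypotheses (T0 : 0 < T) (oO : open Om) (bO : bounded_set Om).
Local Notation Q := (cylinder T Om).
Local Notation L2 := (inL2 mu (Q : set ME)).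
Local Notation ip := (ipL2 mu (Q : set ME)).
Local Notation L2x := (inL2 mx Om).
Local Notation ipx := (ipL2 mx Om).

Let mO := open_measurable_x oO.
Let Sx := @inL2_sip _ _ R mx Om mO.
Let oQ : open (Q : set E) := @cylinder_open R d T Om oO.
Let mQ : measurable (Q : set ME) := @measurable_Q R d T Om oO.
Let S := @inL2_sip _ _ R mu (Q : set ME) mQ.
Let Sv := @inL2v_sip R d Q mQ.
Let Sp := @inL2p_sip R d Q mQ.
Let mI := measurable_time_interval T.
Let sL2 (f : sfield R d) : smooth f -> L2 f.
Proof. by have [N QN] := cylinder_cube T bO; exact: (smooth_L2 oQ QN). Qed.

Local Notation gtriple := (pfield R d * vfield R d * sfield R d)%type.
Variable cL : R.
Hypotheses (cL0 : 0 < cL)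
  (hcoer : forall v : pfield R d, inU0 Q v ->
      cL * normL2p Q v ^+ 2 <=
        normL2p Q (opA Q v) ^+ 2 + normL2 mx Om (gamma0 T Om v) ^+ 2).

Local Notation ingraph0 := (ingraph0 T Om).
Local Notation trace0 := (trace0 T Om).
Local Notation ipA := (ipA T Om).
Local Notation ipgraph := (@ipgraph R d T Om).
Variables (n : nat) (K : 'I_n -> set E).
Hypothesis hK : is_mesh Q K.
Let SG := ingraph0_space T oO bO.
Let SA : sip_space ingraph0 ipA := ipA_space T0 oO bO cL0 hcoer.
Let AL z : ingraph0 z -> inL2p Q (Agraph z).
Proof. exact: Agraph_L2. Qed.
Let tL z : ingraph0 z -> L2x (trace0 z).
Proof. exact: (trace0_L2 T0 oO bO cL0 hcoer). Qed.
Let hcube := cylinder_cube T bO.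

(** On globally smooth fields the broken operator is the classical one almost everywhere, so the
    mesh disappears from tests with them. *)
Lemma smooth_inY (phi : sfield R d) (chi : vfield R d) : smooth phi -> smooth_vec chi ->
  inHAstarT T Om K (phi, chi) /\
  eqL2p Q (opAstar_h K (phi, chi))
    (- (fun z => 'D_dir_t phi z + smooth_divx chi z), - gradv phi + chi).
Proof.
move=> sp sc; have [N QN] := hcube; have [oK KQ _ _] := hK.
have KN i : K i `<=` cube N by move=> z /KQ /QN.
have wg i := smooth_wgraph (oK i) (KN i) sp sc.
split; last first.
  by apply: (opAstar_h_graph QN hK wg) => i; split; last move=> j; apply: aeW.
split; last by move=> i; exact: wgraph_inU (wg i).
by split; [exact: sL2|move=> i; exact: sL2 (sc i)].
Qed.

Lemma opAstar_h0 : eqL2p Q (opAstar_h K 0) 0.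
Proof.
have [N QN] := hcube; have [oK KQ _ _] := hK.
have KN i : K i `<=` cube N by move=> z /KQ /QN.
apply: (opAstar_h_graph QN hK (fun i => wgraph0 (oK i) (KN i))) => i.
split; [apply: aeW => z _; exact: oppr0|move=> j; apply: aeW => z _].
by rewrite /vcomp /= !mxE oppr0 addr0.
Qed.

(* Smooth functions belong to Y, and testing with them shows that ka carries
   the weak derivatives making (ka + ze) an element of the kernel of (A, gamma0). *)
Lemma ultraweak_unique ka ze : inL2p Q ka -> ingraph0 ze ->
  (forall y, inY T Om K y -> ipL2p Q ka (opAstar_h K y.1) +
    ipL2p Q (Agraph ze) y.1 + ipx (trace0 ze) y.2 = 0) ->
  ipL2p Q (ka + ze.1.1) (ka + ze.1.1) = 0.
Proof.
move=> kL zG H; have [k1 k2] := kL; have AzL := AL zG; have [A1 A2] := AzL.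
have [N QN] := hcube; have [oK KQ _ _] := hK.
have AhL y : inY T Om K y -> inL2p Q (opAstar_h K y.1).
  by move=> [[_ yU] _]; exact: (opAstar_h_L2 mQ hK yU).
have tz0 : ipx (trace0 ze) (trace0 ze) = 0.
  (* Testing with the trace itself in the last component gives its square. *)
  have yY : inY T Om K (0, trace0 ze).
    by split; [case: (inY0 mO mQ QN hK)|exact: tL].
  have := H _ yY; rewrite /= (sipC Sp AzL (sip0 Sp)) (ip0l Sp AzL) addr0.
  rewrite (eqL2p_ipr mQ kL (AhL _ yY) (sip0 Sp) opAstar_h0).
  by rewrite (sipC Sp kL (sip0 Sp)) (ip0l Sp kL) add0r.
have key phi chi : smooth phi -> smooth_vec chi ->
    - ip ka.1 (fun z => 'D_dir_t phi z + smooth_divx chi z) +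
    (ipL2v Q ka.2 chi - ipL2v Q ka.2 (gradv phi)) +
    (ip (Agraph ze).1 phi + ipL2v Q (Agraph ze).2 chi) = 0.
  move=> sp sc; have [[pcL pcU] e] := smooth_inY sp sc.
  have yY : inY T Om K ((phi, chi), 0) by split => //; exact: (sip0 Sx).
  have [pL cL'] := pcL; have gL := gradv_L2 T oO bO sp.
  have fL : L2 (fun z => 'D_dir_t phi z + smooth_divx chi z).
    exact: (sipD S (sL2 (smooth_derive dir_t sp)) (sL2 (smooth_divx_smooth sc))).
  have PL : inL2p Q (- (fun z => 'D_dir_t phi z + smooth_divx chi z), - gradv phi + chi).
    by split => /=; [exact: (sipN S fL)|exact: (sipD Sv (sipN Sv gL) cL')].
  have := H _ yY; rewrite (sipC Sx (tL zG) (sip0 Sx)) (ip0l Sx (tL zG)) addr0.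
  rewrite (eqL2p_ipr mQ kL (AhL _ yY) PL e) /ipL2p /= (ipNr S fL k1).
  by rewrite (ipDr Sv (sipN Sv gL) cL' k2) (ipNr Sv gL k2) [- ipL2v _ _ _ + _]addrC.
have sv0 : smooth_vec (0 : vfield R d).
  by move=> i; rewrite vcomp0; exact: smooth_cst 0.
have dv0 : smooth_divx (0 : vfield R d) = fun=> 0.
  apply/funext => z; rewrite /smooth_divx big1// => i _; rewrite vcomp0.
  exact: derive_cst.
have g0 : gradv (fun=> 0 : R) = 0 :> vfield R d.
  by apply/funext => z; apply/rowP => i; rewrite !mxE; exact: derive_cst.
have keyt phi : smooth phi -> ip ka.1 ('D_dir_t phi) + ipL2v Q ka.2 (gradv phi) =
    ip (Agraph ze).1 phi.
  move=> sp; have := key phi 0 sp sv0; rewrite dv0.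
  rewrite (_ : (fun z => _ + 0) = 'D_dir_t phi); last by apply/funext => z; rewrite addr0.
  rewrite (sipC Sv k2 (sip0 Sv)) (ip0l Sv k2) (sipC Sv A2 (sip0 Sv)) (ip0l Sv A2).
  by move=> h; lra.
have keyx chi : smooth_vec chi -> ip ka.1 (smooth_divx chi) =
    ipL2v Q ka.2 chi + ipL2v Q (Agraph ze).2 chi.
  move=> sc; have := key (fun=> 0) chi (smooth_cst 0) sc; rewrite g0.
  rewrite (_ : (fun z => _ + _) = smooth_divx chi); last first.
    by apply/funext => z; rewrite derive_cst add0r.
  rewrite (sipC Sv k2 (sip0 Sv)) (ip0l Sv k2) (sipC S A1 (sip0 S)) (ip0l S A1).
  by move=> h; lra.
pose gk := - (ka.2 + (Agraph ze).2); pose fk := - (Agraph ze).1.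
have gkL : inL2v Q gk by exact: (sipN Sv (sipD Sv k2 A2)).
have fkL : L2 fk by exact: (sipN S A1).
have Gk : grad0 T Om ka.1 gk.
  split => // i phi sp; have uL := unitv_L2 oO i (sL2 sp).
  have su : smooth_vec (unitv i phi).
    by move=> j; rewrite vcomp_unitv; case: ifP => _; [exact: sp|exact: (smooth_cst 0)].
  have du : smooth_divx (unitv i phi) = 'D_(dir_x i) phi.
    apply/funext => z; rewrite /smooth_divx (bigD1 i)//= vcomp_unitv eqxx big1 ?addr0// => j ji.
    by rewrite vcomp_unitv (negbTE ji); exact: derive_cst.
  have := keyx _ su; rewrite du => ->.
  rewrite -(ipDl Sv k2 A2 uL) -(ip_unitv oO i phi gkL).
  by rewrite (ipNl Sv (sipD Sv k2 A2) uL) opprK.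
have Dk : is_weak_div Q ka fk.
  move=> phi tp; rewrite -ip_gradv (keyt _ tp.1) /fk (ipNl S A1 (sL2 tp.1)).
  by rewrite opprK.
pose k : gtriple := (ka, gk, fk).
have kG : ingraph0 k by split => //; split => //; exact: grad0_weak.
have tk0 : ipx (trace0 k) (trace0 k) = 0.
  apply: (lateral_total T0 oO bO (tL kG)) => phi r lp Ir.
  have sm := spatial_lateral T0 oO bO lp Ir; have mL := spatial_L2 sm.
  rewrite (trace0_green T0 oO bO cL0 hcoer kG sm) /=.
  (* A smooth function that does not vanish at the initial time: [keyt] for it says that the initial
     trace has zero product with the slice of [phi]. *)
  pose m (z : E) := phi (r, z.2); pose dm (z : E) := decay T z.1 * m z.
  have sm' : smooth m := smooth_frozen r lp.1.
  have ed := elementary_decay T.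
  have sd : smooth (fun z : E => decay T z.1) by exact: smooth_fst.
  have sdm : smooth dm by exact: smoothM.
  have Dt : 'D_dir_t dm = fun z => - T^-1 * phi (r, z.2).
    apply/funext => z; rewrite derive_mulE; [|exact: (smooth_derivable sd)|exact: (smooth_derivable sm')].
    rewrite (derive_frozen_t _ _ lp.1) mulr0 add0r mulrC.
    by rewrite (derive_fst_t _ (affine_derive (- T^-1) 1)).
  have Gd : gradv dm = tensorv (decay T) (fun i x => 'D_(dir_x i) phi (r, x)).
    apply/funext => z; apply/rowP => i; rewrite !mxE.
    rewrite derive_mulE; [|exact: (smooth_derivable sd)|exact: (smooth_derivable sm')].
    by rewrite derive_fst_x mulr0 addr0 (derive_frozen_x _ _ _ lp.1).
  have := keyt _ sdm; rewrite Dt Gd => h.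
  have fL : L2 (fun z => - T^-1 * phi (r, z.2)) by exact: (sL2 (smoothZ (- T^-1) sm')).
  rewrite (sipC S fL k1) /fk (ipNl S A1 (sL2 sdm)) -h.
  by ring.
have sG := sipD SG kG zG.
have Ak : Agraph k = - Agraph ze.
  rewrite /Agraph /Apair /=; congr pair.
  by rewrite /gk /Agraph /Apair /= opprD addrAC addNr add0r.
have A0 : ipA (k + ze) (k + ze) = 0.
  have kk : ipA k k + 2 * ipA k ze + ipA ze ze = 0.
    rewrite /ipA Ak tk0 tz0 (sip_null Sx (tL kG) (tL zG) tk0).
    rewrite (ipNl Sp AzL (sipN Sp AzL)) (ipNr Sp AzL AzL) (ipNl Sp AzL AzL).
    by ring.
  by rewrite (ip_sqrD SA kG zG).
have := ipA_coercive T0 oO bO cL0 hcoer sG; rewrite A0 /= => h.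
have sL : inL2p Q (ka + ze.1.1).
  by apply: (sipD Sp kL); case: zG => -[].
apply/eqP; rewrite eq_le (sip_ge0 Sp sL) andbT.
by rewrite -(ler_pM2l cL0) mulr0.
Qed.

(** $A$ and $\gamma_0$ depend on the class only. This is required because [opE] recovers the field
    of the solution only almost everywhere. *)
Lemma opA_ingraph0 z v : ingraph0 z -> inL2p Q v -> eqL2p Q z.1.1 v ->
  [/\ inU0 Q v, eqL2p Q (opA Q v) (Agraph z), L2x (gamma0 T Om v) &
      eqL2 mx Om (gamma0 T Om v) (trace0 z)].
Proof.
move=> zG vL e; have [N QN] := hcube; have [wg G] := zG.
have [[z1L z2L] gL _ fL _] := wg; have [e1 e2] := e; have [v1L v2L] := vL.
pose o : gtriple := ((v, z.1.2), z.2).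
have Go : grad0 T Om v.1 z.1.2.
  split => // i phi sp; rewrite -(grad0_ibp G i sp).
  exact/esym/(eqL2_ipl mQ z1L v1L e1 (sL2 (smooth_derive _ sp))).
have wo : wgraph Q v z.1.2 z.2 := wgraph_ae oQ QN wg vL e.
have oG : ingraph0 o by [].
have [a1 a2] := opA_wgraph oQ QN wo.
split; [exact: (graph0_inU0 oO bO (conj wo Go))| |exact: (tL oG)|].
  split; first exact: a1.
  move=> i; apply: filterS2 (a2 i) (e2 i) => p h1 h2 Qp.
  by rewrite h1// /vcomp /= !mxE; congr (_ + _); have := h2 Qp; rewrite /vcomp => ->.
have dG := sipB SG oG zG.
(* The difference is null in the graph norm, so its trace is null by boundedness. *)
have d0 : ipgraph (o - z) (o - z) = 0.
  have uL : inL2p Q (v - z.1.1) by exact: (sipB Sp vL).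
  have zu : eqL2p Q (v - z.1.1) 0.
    split; [apply: filterS e1|move=> i; apply: filterS (e2 i)] => p h Qp.
      by rewrite -[LHS]/(v.1 p - z.1.1.1 p) h// subrr.
    by rewrite vcompB -[LHS]/(vcomp v.2 i p - vcomp z.1.1.2 i p) h// subrr vcomp0.
  rewrite /ipgraph /= !subrr (ip0l Sv (sip0 Sv)) (ip0l S (sip0 S)) !addr0.
  by rewrite (eqL2p_ipl mQ uL (sip0 Sp) uL zu) (ip0l Sp uL).
have t0 : ipx (trace0 (o - z)) (trace0 (o - z)) = 0.
  apply/eqP; rewrite eq_le (sip_ge0 Sx (tL dG)) andbT.
  by have := trace0_bound T0 oO bO cL0 hcoer dG; rewrite d0 mulr0.
apply: (ip0_eqL2 mO (tL oG) (tL zG)).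
have tP := trace0P T0 oO bO cL0 hcoer (-1) zG oG.
have ee : eqL2 mx Om (trace0 (o - z)) (trace0 o - trace0 z).
  by move: tP; rewrite !scaleN1r ![- _ + _]addrC.
have bL := sipB Sx (tL oG) (tL zG).
rewrite -(eqL2_ipl mO (tL dG) bL ee bL) (sipC Sx (tL dG) bL).
by rewrite -(eqL2_ipl mO (tL dG) bL ee (tL dG)).
Qed.

Lemma gammaA_ingraph0 z v y : ingraph0 z -> inL2p Q v -> eqL2p Q z.1.1 v ->
  inY T Om K y ->
  gammaA T Om K v y = ipL2p Q (Agraph z) y.1 - ipL2p Q v (opAstar_h K y.1)
    + ipx (trace0 z) y.2.
Proof.
move=> zG vL e [[y1 yU] y2]; have [vU a gL g] := opA_ingraph0 zG vL e.
have AL' : inL2p Q (opA Q v) by case: vU => vU _; exact: (opA_L2 oQ vU).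
rewrite /gammaA (eqL2p_ipl mQ AL' (AL zG) y1 a).
by rewrite (eqL2_ipl mO gL (tL zG) g y2).
Qed.

(** The normalized representative attains the value $\lVert y\rVert_Y$ in the supremum; a null
    representative is handled apart. *)
Lemma riesz_norm (F : ycarrier R d -> R) y : in_dualY T Om K F -> inY T Om K y ->
  (forall y', inY T Om K y' -> ipY T Om K y y' = F y') ->
  normY T Om K y <= norm_dualY T Om K F.
Proof.
move=> [FL [C HC]] yY yF; have [N QN] := hcube.
have SY := ipY_space mO mQ QN hK.
have ub : has_ubound [set `|F y| | y in [set y | inY T Om K y /\ normY T Om K y <= 1]].
  exists `|C| => _ [u [uY u1] <-]; apply: le_trans (HC u uY) _.
  apply: le_trans (ler_norm _) _; rewrite normrM -[leRHS]mulr1 ler_wpM2l//.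
  by rewrite ger0_norm ?sqrtr_ge0.
have y0 : 0 <= normY T Om K y by exact: sqrtr_ge0.
have [n0|n0] := eqVneq (normY T Om K y) 0.
  apply: (@le_trans _ _ `|F 0|); first by rewrite n0.
  apply: ub_le_sup => //; exists 0 => //; split; first exact: (sip0 SY).
  by rewrite /normY (ip0l SY (sip0 SY)) sqrtr0.
have {}n0 : 0 < normY T Om K y by rewrite lt_neqAle eq_sym n0.
have n2 : ipY T Om K y y = normY T Om K y ^+ 2 by rewrite sqr_sqrtr// (sip_ge0 SY yY).
pose u := (normY T Om K y)^-1 *: y; have uY : inY T Om K u by exact: (sipZ SY).
apply: ub_le_sup => //; exists u; first split => //.
  by rewrite /normY (ip_sqrZ SY _ yY) n2 -exprMn mulVf ?gt_eqF// expr1n sqrtr1.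
rewrite -yF// (ipZr SY _ yY yY) n2 expr2 mulKf ?gt_eqF//.
by rewrite ger0_norm.
Qed.

Lemma riesz_range (F : ycarrier R d -> R) : in_dualY T Om K F -> exists y z, [/\ inY T Om K y, ingraph0 z,
  forall y', inY T Om K y' -> ipY T Om K y y' = F y',
  eqL2p Q (Agraph z) y.1 & eqL2 mx Om (trace0 z) y.2].
Proof.
move=> [FL [C HC]]; have [N QN] := hcube; have SY := ipY_space mO mQ QN hK.
have [u uY|y yY Hy] := sip_riesz SY FL (C := C ^+ 2) _ (ipY_complete mO mQ QN hK).
  rewrite -(sqr_sqrtr (sip_ge0 SY uY)) -exprMn -real_normK ?num_real//.
  have h := HC u uY; rewrite ler_pXn2r ?nnegrE//.
  exact: le_trans (normr_ge0 _) h.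
have [[y1 _] y2] := yY.
have [z [zG az tz]] := range_full T0 oO bO cL0 hcoer y1 y2.
by exists y, z.
Qed.

Section solution.
Variables (y : ycarrier R d) (z : gtriple) (F : ycarrier R d -> R).
Hypotheses (yY : inY T Om K y) (zG : ingraph0 z)
  (yF : forall y', inY T Om K y' -> ipY T Om K y y' = F y')
  (az : eqL2p Q (Agraph z) y.1) (tz : eqL2 mx Om (trace0 z) y.2).
Let v := z.1.1.
Let p := opAstar_h K y.1.
Definition solution : xcarrier R d := (v + p, gammaA T Om K v).

Let SY : sip_space (inY T Om K) (ipY T Om K).
Proof. by have [N QN] := hcube; exact: (ipY_space mO mQ QN hK). Qed.
Let AhL y' : inY T Om K y' -> inL2p Q (opAstar_h K y'.1).
Proof. by move=> [[_ yU] _]; exact: (opAstar_h_L2 mQ hK yU). Qed.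
Let pL : inL2p Q p := AhL yY.
Let vL : inL2p Q v. Proof. by case: zG => -[]. Qed.
Let eqv : eqL2p Q z.1.1 v. Proof. by split => [|i]; apply: aeW. Qed.
Let y1L : inL2p Q y.1. Proof. by case: yY => -[]. Qed.
Let y2L : L2x y.2. Proof. by case: yY. Qed.

Lemma solution_inX : inX T Om K solution.
Proof.
split; first exact: (sipD Sp vL pL).
by exists v => //; have [] := opA_ingraph0 zG vL eqv.
Qed.

(** The terms $\langle v,A^*_hw\rangle$ of the volume part and of the trace functional cancel,
    leaving the three terms of the inner product of $Y$. *)
Lemma solution_bE y' : inY T Om K y' -> form_b T Om K solution y' = ipY T Om K y y'.
Proof.
move=> yY'; have aL := AhL yY'; have [[y1 _] y2] := yY'.
rewrite /form_b /solution /= (gammaA_ingraph0 zG vL eqv yY') (ipDl Sp vL pL aL).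
rewrite (eqL2p_ipl mQ (AL zG) y1L y1 az) (eqL2_ipl mO (tL zG) y2L tz y2).
by rewrite /ipY -/p; ring.
Qed.

Lemma solution_unique us' : inX T Om K us' ->
  (forall y', inY T Om K y' -> form_b T Om K us' y' = F y') -> eqX T Om K us' solution.
Proof.
move=> [uL [v' vU' tE]] H; pose k : gtriple := (v', gradx Q v'.1, wdiv Q v').
have kG : ingraph0 k := inU0_graph0 oO vU'.
have vL' : inL2p Q v' by case: vU' => -[].
have eqv' : eqL2p Q k.1.1 v' by split => [|i]; apply: aeW.
have [sL _] := solution_inX; have zeG := sipB SG kG zG.
(* The trace functionals contribute $-\langle\mathtt{ze},A^*_hw\rangle$; absorbing it in [ka] gives
   exactly the hypothesis of [ultraweak_unique], whose conclusion concerns [ka] plus the field of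
   [ze], that is [e]. *)
pose ze := k - z; pose e := us'.1 - solution.1; pose ka := e - ze.1.1.
have zeL : inL2p Q ze.1.1 := sipB Sp vL' vL.
have eL : inL2p Q e := sipB Sp uL sL.
have kaL : inL2p Q ka := sipB Sp eL zeL.
have A0 : ipL2p Q e e = 0.
  rewrite -[e](subrK ze.1.1); apply: ultraweak_unique => // y' yY'.
  have aL := AhL yY'; have [[y1 _] y2] := yY'.
  have := H y' yY'; rewrite -yF// -solution_bE// /form_b tE//.
  rewrite [solution.2 y']/= (gammaA_ingraph0 kG vL' eqv' yY') (gammaA_ingraph0 zG vL eqv yY').
  have zE : ze = (-1) *: z + k by rewrite scaleN1r addrC.
  have tP := trace0P T0 oO bO cL0 hcoer (-1) zG kG.
  rewrite [Agraph ze](_ : _ = (-1) *: Agraph z + Agraph k); last by rewrite zE AgraphP.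
  rewrite [trace0 ze](_ : _ = trace0 ((-1) *: z + k)); last by rewrite zE.
  rewrite (eqL2_ipl mO (tL (sipP SG (-1) zG kG)) (sipP Sx (-1) (tL zG) (tL kG)) tP y2).
  rewrite (sipL Sx (-1) (tL zG) (tL kG) y2) (sipL Sp (-1) (AL zG) (AL kG) y1).
  rewrite /ka (ipBl Sp eL zeL aL) /e (ipBl Sp uL sL aL).
  rewrite -[ze.1.1]/(v' - v) (ipBl Sp vL' vL aL).
  by move=> h; lra.
have e0 : eqL2p Q us'.1 solution.1 by exact: (eqL2p_ip0 mQ uL sL A0).
split => // y' yY'; have aL := AhL yY'.
have := H y' yY'; rewrite -yF// -solution_bE// /form_b.
by rewrite (eqL2p_ipl mQ uL sL aL e0) => /addrI.
Qed.

(** For the solution $\mathcal E$ returns $v$, so the four squares of the norm are those of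
    $v+A^*_hw_0$, $v$, $w_0$ and $\xi_0$, and coercivity bounds the second by the last two. *)
Lemma solution_bound s : 0 < s -> cL * s ^+ 2 = s + 1 ->
  normX T Om K solution <= (1 + s) * normY T Om K y.
Proof.
move=> s0 cs; set us := solution.
have [yT tT] : inY T Om K (opT T Om K us) /\
    forall y', inY T Om K y' -> ipY T Om K (opT T Om K us) y' = form_b T Om K us y'.
  apply: (xgetPex (((fun=> 0), (fun=> 0)), (fun=> 0))
    (P := [set y0 | inY T Om K y0 /\ forall y', inY T Om K y' -> ipY T Om K y0 y' = form_b T Om K us y'])).
  by exists y; split => // y' yY'; rewrite solution_bE.
set q := opAstar_h K (opT T Om K us).1; have qL : inL2p Q q := AhL yT.
have [[t1 tU] t2] := yT; have [[_ yU] _] := yY.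
(* [opT] is a chosen representative. Its difference from [y] is orthogonal to all of $Y$, hence
   null, so the broken operators agree almost everywhere. *)
have qp : eqL2p Q q p.
  apply: (eqL2p_ip0 mQ qL pL); have dY := sipB SY yT yY.
  have [N QN] := hcube; have dL := AhL dY; have bL := sipB Sp qL pL.
  have bE : eqL2p Q (opAstar_h K (opT T Om K us - y).1) (q - p) := opAstar_hB QN hK tU yU.
  have : ipY T Om K (opT T Om K us - y) (opT T Om K us - y) = 0.
    by rewrite (ipBl SY yT yY dY) tT// solution_bE// subrr.
  have [[d1 _] d2] := dY; rewrite /ipY.
  rewrite (eqL2p_ipl mQ dL bL dL bE) (eqL2p_ipr mQ bL dL bL bE).
  have := sip_ge0 Sp d1; have := sip_ge0 Sp bL; have := sip_ge0 Sx d2.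
  by move: (ipL2p _ _ _) (ipL2p _ (q - p) _) (ipx _ _) => x1 x2 x3; lra.
have vE : eqL2p Q z.1.1 (opE T Om K us).
  have [e1 e2] := qp; split; [apply: filterS e1|move=> i; apply: filterS (e2 i)] => x h Qx.
    by rewrite -[RHS]/(v.1 x + p.1 x - q.1 x) h// addrK.
  rewrite -[RHS]/(vcomp ((v + p) - q).2 i x) vcompB.
  rewrite -[RHS]/(vcomp (v + p).2 i x - vcomp q.2 i x) h//.
  by rewrite /vcomp /= !mxE addrK.
have EL : inL2p Q (opE T Om K us) by exact: (sipB Sp (sipD Sp vL pL) qL).
have [EU aE gL gE] := opA_ingraph0 zG EL vE.
have aL : inL2p Q (opA Q (opE T Om K us)) by case: EU => EU _; exact: (opA_L2 oQ EU).
have nE : ipL2p Q (opE T Om K us) (opE T Om K us) = ipL2p Q v v.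
  by rewrite -(eqL2p_ipl mQ vL EL EL vE) -(eqL2p_ipr mQ vL vL EL vE).
have nA : ipL2p Q (opA Q (opE T Om K us)) (opA Q (opE T Om K us)) = ipL2p Q y.1 y.1.
  rewrite (eqL2p_ipl mQ aL (AL zG) aL aE) (eqL2p_ipr mQ (AL zG) aL (AL zG) aE).
  by rewrite (eqL2p_ipl mQ (AL zG) y1L (AL zG) az) (eqL2p_ipr mQ y1L (AL zG) y1L az).
have tT2 : ipx (trace0 z) (trace0 z) = ipx y.2 y.2.
  rewrite (eqL2_ipl mO (tL zG) y2L tz (tL zG)) (sipC Sx y2L (tL zG)).
  by rewrite (eqL2_ipl mO (tL zG) y2L tz y2L).
have nG : ipx (gamma0 T Om (opE T Om K us)) (gamma0 T Om (opE T Om K us)) = ipx y.2 y.2.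
  rewrite (eqL2_ipl mO gL (tL zG) gE gL) (sipC Sx (tL zG) gL).
  by rewrite (eqL2_ipl mO gL (tL zG) gE (tL zG)).
have coer : cL * ipL2p Q v v <= ipL2p Q y.1 y.1 + ipx y.2 y.2.
  have := ipA_coercive T0 oO bO cL0 hcoer zG; rewrite /ipA tT2.
  by rewrite (eqL2p_ipl mQ (AL zG) y1L (AL zG) az) (eqL2p_ipr mQ y1L (AL zG) y1L az).
have v0 := sip_ge0 Sp vL; have p0 := sip_ge0 Sp pL; have s1 : 0 <= 1 + s by lra.
have young : 2 * (s * ipL2p Q v p) <= ipL2p Q v v + s ^+ 2 * ipL2p Q p p.
  have := sip_ge0 Sp (sipB Sp vL (sipZ Sp s pL)).
  rewrite (ip_sqrB Sp vL (sipZ Sp s pL)) (ip_sqrZ Sp s pL) (ipZr Sp s pL vL).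
  by move: (s * _) (s ^+ 2 * _) => x1 x2; lra.
have r0 : 0 <= (1 + s) * normY T Om K y by rewrite mulr_ge0// sqrtr_ge0.
rewrite -[leRHS](ger0_norm r0) -sqrtr_sqr ler_wsqrtr//.
rewrite exprMn /normY (sqr_sqrtr (sip_ge0 SY yY)) /normL2p /normL2.
rewrite !sqr_sqrtr ?(sip_ge0 Sp EL) ?(sip_ge0 Sp aL) ?(sip_ge0 Sx gL)//; last first.
  exact: (sip_ge0 Sp (sipD Sp vL pL)).
rewrite nE nA nG [ipL2p Q us.1 us.1](ip_sqrD Sp vL pL) -addrA.
rewrite (_ : ipY T Om K y y = ipL2p Q p p + (ipL2p Q y.1 y.1 + ipx y.2 y.2)).
  exact: (beta_estimate cL0 s0 cs v0 p0 young coer).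
by rewrite /ipY -/p addrAC addrC.
Qed.

End solution.

End well_posedness.

Theorem theorem4p6 (R : realType) (d : nat) (hd : (0 < d)%N)
    (Omega : set 'rV[R]_d) (hOmega : bounded_lipschitz_domain Omega)
    (Tend : R) (hTend : 0 < Tend)
    (n : nat) (K : 'I_n -> set (R * 'rV[R]_d))
    (hK : is_mesh (cylinder Tend Omega) K)
    (cL : R) (hcL : 0 < cL)
    (hcoer : forall v : pfield R d, inU0 (cylinder Tend Omega) v ->
      cL * normL2p (cylinder Tend Omega) v ^+ 2 <=
        normL2p (cylinder Tend Omega) (opA (cylinder Tend Omega) v) ^+ 2
        + normL2 leb_x Omega (gamma0 Tend Omega v) ^+ 2)
    (F : ycarrier R d -> R) (hF : in_dualY Tend Omega K F) :
  let beta : R :=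
    (1 + 2 * cL - Num.sqrt ((1 + 2 * cL) ^+ 2 - 4 * cL ^+ 2)) / (2 * cL) in
  exists us : xcarrier R d,
    [/\ inX Tend Omega K us,
        forall y, inY Tend Omega K y -> form_b Tend Omega K us y = F y,
        forall us' : xcarrier R d, inX Tend Omega K us' ->
          (forall y, inY Tend Omega K y -> form_b Tend Omega K us' y = F y) ->
          eqX Tend Omega K us' us &
        normX Tend Omega K us <= beta^-1 * norm_dualY Tend Omega K F].
Proof.
have [oO _ _ bO _] := hOmega; move=> beta.
have [y [z [yY zG yF az tz]]] := riesz_range hTend oO bO hcL hcoer hK hF.
have [s [s0 cs bs]] := beta_inverse hcL.
exists (solution Tend Omega K y z); split.
- exact: (solution_inX hTend oO bO hcL hcoer hK yY zG).
- by move=> y' yY'; rewrite (solution_bE hTend oO bO hcL hcoer hK yY zG az tz yY') yF.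
- move=> us'; exact: (solution_unique hTend oO bO hcL hcoer hK yY zG yF az tz).
- apply: le_trans (solution_bound hTend oO bO hcL hcoer hK yY zG az tz s0 cs) _.
  rewrite /beta bs ler_wpM2l//; first by lra.
  exact: (riesz_norm oO bO hK hF yY yF).
Qed.
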